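(* Let $d\in\{2,3\}$, $\gamma>1$, $\gamma\ge\frac d2$. Let $\varrho_0>0$, $\varrho_0\in L^\gamma(\Omega)\cap L^2(\Omega)$, $\mathbf u_0\in W^{1,2}(\Omega;\mathbb R^d)$, and let $\{(\varrho_h^n,\mathbf u_h^n)\}_{n=1}^{N_t}$ be a family of solutions of the MAC scheme (defined in the context) with $\Delta t\approx h$. Let $(r,\mathbf U)$ be a strong solution on $[0,T]\times\Omega$ (space-periodic) of $$\partial_t r+\mathrm{div}_x(r\mathbf U)=0,\qquad \partial_t(r\mathbf U)+\mathrm{div}_x(r\mathbf U\otimes\mathbf U)+\nabla_xp(r)=\mathrm{div}_x\mathbb S(\nabla_x\mathbf U)$$ in the class $$r\in C^2([0,T]\times\Omega),\quad 0<\underline r\le r(t,x)\le\overline r,\quad \mathbf U\in C^2([0,T]\times\Omega;\mathbb R^d).$$ Put $r_h^n=\Pi_{\mathcal T}r(t^n)$, $\mathbf U_h^n=\Pi_{\mathcal E}\mathbf U(t^n)$. Then there exists a positive number $$c=c\big(M_0,E_0,\underline r,\overline r,|p'|_{C^1([\underline r,\overline r])},\|(\nabla_xr,\partial_tr,\partial_t\nabla_xr,\partial_t^2r,\mathbf U,\nabla_x\mathbf U,\nabla_x^2\mathbf U,\partial_t\mathbf U,\partial_t\nabla_x\mathbf U)\|_{L^\infty((0,T)\times\Omega)}\big),$$ depending tacitly also on $T,\gamma,\mathrm{diam}(\Omega),|\Omega|$ (and not on $h,\Delta t$), such that $$\sup_{0\le n\le N_t}\mathfrak E(\varrho_h^n,\mathbf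 u_h^n|r_h^n,\mathbf U_h^n)+\Delta t\sum_{n=1}^{N_t}\frac\mu2\int_\Omega|\nabla_\epsilon(\mathbf u_h^n-\mathbf U_h^n)|^2dx+\Delta t\sum_{n=1}^{N_t}(\mu+\lambda)\int_\Omega|\mathrm{div}_{\mathcal T}(\mathbf u_h^n-\mathbf U_h^n)|^2dx$$ $$\le c\Big(h^A+\sqrt{\Delta t}+\mathfrak E(\varrho_h^0,\mathbf u_h^0|r(0),\mathbf U(0))\Big),\qquad A=\min\Big\{\frac{2\gamma-d}{\gamma},\frac12\Big\}.$$
   Context: **System.** $\Omega=([0,1]|_{\{0,1\}})^d$ is the flat torus, $d\in\{2,3\}$, $T>0$. $\mathbb S(\nabla_x\mathbf u)=\mu(\nabla_x\mathbf u+\nabla_x^T\mathbf u)+\lambda\,\mathrm{div}_x\mathbf u\,\mathbb I$, $\mu>0$, $\mu+\lambda\ge0$; $p(\varrho)=a\varrho^\gamma$, $a>0$, $\gamma>1$; $\mathcal H(\varrho)=\varrho\int_1^\varrho p(z)z^{-2}\,dz$. The parameters $a,\mu,\lambda,d$, the scheme exponent $\alpha$, and the constants in $\Delta t\approx h$ are fixed. **Relative energy.** $\mathbb E(\varrho|r)=\mathcal H(\varrho)-\mathcal H'(r)(\varrho-r)-\mathcal H(r)$. For discrete arguments, $\mathfrak E(\varrho_h^n,\mathbf u_h^n|r_h^n,\mathbf U_h^n)=\int_\Omega\big(\frac12\varrho_h^n|\overline{\mathbf u}_h^n-\overline{\mathbf U}_h^n|^2+\mathbb E(\varrho_h^n|r_h^n)\big)dx$,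 and $\mathfrak E(\varrho_h^0,\mathbf u_h^0|r(0),\mathbf U(0))=\int_\Omega\big(\frac12\varrho_h^0|\overline{\mathbf u}_h^0-\mathbf U(0)|^2+\mathbb E(\varrho_h^0|r(0))\big)dx$. $M_0=\int_\Omega\varrho_h^0\,dx$, $E_0=\int_\Omega\big(\frac12\varrho_h^0|\overline{\mathbf u}_h^0|^2+\mathcal H(\varrho_h^0)\big)dx$. **Grid.** $\mathcal T$ is a uniform grid of $\Omega$ by closed cubes $K$ of side $h$ (centers $\mathbf x_K$); $\mathcal E$ its set of faces (centers $\mathbf x_\sigma$), $\mathcal E(K)$ the faces of $K$, $\mathcal E_i$ the faces orthogonal to the $i$-th unit vector $\mathbf e_i$; $\sigma_{K,i\pm}$ is the face of $K$ with center $\mathbf x_K\pm\frac h2\mathbf e_i$; $\mathcal N(K)$ is the set of cells sharing a face with $K$. $\sigma=K|L$ is the face between $K$ and $L$, written $\overrightarrow{K|L}$ if $\mathbf x_L-\mathbf x_K=h\mathbf e_i$. The dual cell $D_\sigma$ of $\sigma=K|L$ is the union of the halves of $K$ and $L$ adjacent to $\sigma$; for fixed $i$, $\{D_\sigma\}_{\sigma\in\mathcal E_i}$ is a uniform grid of $\Omega$. $X_{\mathcal T}$: functions constant on each $K$. $Y_{i,\mathcal E}$: functions constant on each $D_\sigma$, $\sigma\in\mathcal E_i$; $\mathbf Y_{\mathcal E}=Y_{1,\mathcal E}\times\dots\times Y_{d,\mathcal E}$. **Operators.** For $r\in X_{\mathcal T}$, $\mathbf v=(v_1,\dots,v_d)\in\mathbf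 Y_{\mathcal E}$: $\{\{r\}\}^{(i)}\in Y_{i,\mathcal E}$ has value $\frac{r_K+r_L}2$ on $D_\sigma$, $\sigma=K|L\in\mathcal E_i$; $\overline{v_i}\in X_{\mathcal T}$ has value $\frac12(v_{i,\sigma_{K,i+}}+v_{i,\sigma_{K,i-}})$ on $K$, $\overline{\mathbf v}=(\overline{v_1},\dots,\overline{v_d})$; $\eth^{(i)}_{\mathcal E}r\in Y_{i,\mathcal E}$ has value $\frac{r_L-r_K}h$ on $D_\sigma$, $\sigma=\overrightarrow{K|L}\in\mathcal E_i$; for $w\in Y_{i,\mathcal E}$, $\partial^{(i)}_{\mathcal T}w\in X_{\mathcal T}$ has value $\frac{w_{\sigma_{K,i+}}-w_{\sigma_{K,i-}}}h$ on $K$; $\mathrm{div}_{\mathcal T}\mathbf v=\sum_i\partial^{(i)}_{\mathcal T}v_i$; $(\Delta_{\mathcal T}r)_K=h^{-2}\sum_{L\in\mathcal N(K)}(r_L-r_K)$; $(\Delta_{\mathcal E}v_i)_\sigma=h^{-2}\sum_{\sigma'}(v_{i,\sigma'}-v_{i,\sigma})$ over $\sigma'\in\mathcal E_i$ whose dual cells are neighbours of $D_\sigma$. Velocity gradient: $\nabla_\epsilon\mathbf v=(\eth_jv_i)_{i,j}$, where for neighbouring dual cells $D_\sigma,D_{\sigma'}$ ($\sigma,\sigma'\in\mathcal E_i$, $\mathbf x_{\sigma'}-\mathbf x_\sigma=h\mathbf e_j$) with common face $\epsilon$, $\eth_jv_i=\frac{v_{i,\sigma'}-v_{i,\sigma}}h$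 on the bidual cell $D_\epsilon$, the union of the halves of $D_\sigma$ and $D_{\sigma'}$ adjacent to $\epsilon$. Upwind flux: $\mathrm{Up}^{(i)}[r,\mathbf v]_\sigma=r_K(v_{i,\sigma})^++r_L(v_{i,\sigma})^-$ for $\sigma=\overrightarrow{K|L}\in\mathcal E_i$, with $s^+=\max\{0,s\}$, $s^-=\min\{0,s\}$; $\mathrm{div}_{\mathrm{Up}}[r,\mathbf v]=\sum_i\partial_{\mathcal T}^{(i)}\mathrm{Up}^{(i)}[r,\mathbf v]$. $\Pi_{\mathcal T}$ is the cell-average projection onto $X_{\mathcal T}$; $\Pi_{\mathcal E}\boldsymbol\phi\in\mathbf Y_{\mathcal E}$ has $i$-th component equal to $\frac1{|\sigma|}\int_\sigma\phi_i$ on $D_\sigma$, $\sigma\in\mathcal E_i$. $\Delta t=T/N_t$, $t^n=n\Delta t$, $D_tf^n=(f^n-f^{n-1})/\Delta t$. $\Delta t\approx h$ means $c_1h\le\Delta t\le c_2h$ with $c_1,c_2>0$ independent of $h,\Delta t$. **MAC scheme.** Given $\varrho_h^0=\Pi_{\mathcal T}\varrho_0$, $\overline{\mathbf u}_h^0=\Pi_{\mathcal T}\mathbf u_0$, find $(\varrho_h^n,\mathbf u_h^n)\in X_{\mathcal T}\times\mathbf Y_{\mathcal E}$ such that for $n=1,\dots,N_t$, $i=1,\dots,d$, $$D_t\varrho_h^n+\mathrm{div}_{\mathrm{Up}}[\varrho_h^n,\mathbf u_h^n]-h^\alpha\Delta_{\mathcal T}\varrho_h^n=0,$$ $$D_t\{\{\varrho_h^n\overline{u_{i,h}^n}\}\}^{(i)}+\{\{\mathrm{div}_{\mathrm{Up}}[\varrho_h^n\overline{u_{i,h}^n},\mathbf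 u_h^n]\}\}^{(i)}+\eth^{(i)}_{\mathcal E}p(\varrho_h^n)-\mu\Delta_{\mathcal E}u_{i,h}^n-(\mu+\lambda)\eth_{\mathcal E}^{(i)}\mathrm{div}_{\mathcal T}\mathbf u_h^n=h^\alpha\sum_{j=1}^d\Big\{\Big\{\partial^{(j)}_{\mathcal T}\big(\{\{\overline{u_{i,h}^n}\}\}^{(j)}\eth^{(j)}_{\mathcal E}\varrho_h^n\big)\Big\}\Big\}^{(i)},$$ where $\alpha\in(1,2\gamma-d/3)$ if $\gamma\in(1,2)$ and $\alpha>1$ if $\gamma\ge2$. Only $\overline{\mathbf u}_h^0$ (not $\mathbf u_h^0$) enters at level $0$. It is known that for positive initial density solutions exist and every solution has $\varrho_h^n>0$ and $\int_\Omega\varrho_h^n=\int_\Omega\varrho_h^0$. *)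

(* Defs.v *)
From HB Require Import structures.
From mathcomp Require Import all_boot all_order all_algebra.
From mathcomp Require Import all_classical all_reals all_analysis.
Set Implicit Arguments.
Unset Strict Implicit.
Unset Printing Implicit Defensive.
Import Order.TTheory GRing.Theory Num.Theory.
Import numFieldNormedType.Exports.
Local Open Scope classical_set_scope.
Local Open Scope ring_scope.

(* Lebesgue measure on R^n.  The library provides the product sigma-algebra on
   n-tuples but no measure on it: R^(n+1) carries the image of the binary product
   of the measures on R and R^n.  R^0 is a point of mass 1. *)

Section lebesgue_tuple.
Context {R : realType}.
Local Notation tup n := (n.-tuple (measurableTypeR R)).

Definition tcons n (x : measurableTypeR R * tup n) : tup n.+1 :=
  [the n.+1.-tuple _ of x.1 :: x.2].

Definition tuncons n (t : tup n.+1) : measurableTypeR R * tup n :=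
  (tnth t ord0, [tuple of behead t]).

Lemma measurable_tcons n : measurable_fun [set: _] (@tcons n).
Proof. exact: measurable_cons. Qed.

Lemma measurable_tuncons n : measurable_fun [set: _] (@tuncons n).
Proof.
apply/measurable_fun_pairP; split; first exact: measurable_tnth.
exact: measurable_behead.
Qed.

Lemma tconsK n : cancel (@tcons n) (@tuncons n).
Proof. by move=> [x s]; rewrite /tuncons /tcons /=; congr pair; exact: val_inj. Qed.

Section step.
Variables (n : nat) (m : {sigma_finite_measure set (tup n) -> \bar R}).
Local Open Scope ereal_scope.

Definition tuple_measure_step : set (tup n.+1) -> \bar R :=
  pushforward (@lebesgue_measure R \x m) (@tcons n).

Let preim_tcons A : measurable A -> measurable (@tcons n @^-1` A).
Proof. by move=> mA; rewrite -[X in measurable X]setTI; exact: measurable_tcons. Qed.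

Let step0 : tuple_measure_step set0 = 0.
Proof. by rewrite /tuple_measure_step /pushforward preimage_set0 measure0. Qed.

Let step_ge0 A : 0 <= tuple_measure_step A.
Proof. exact: (measure_ge0 (@lebesgue_measure R \x m)%E). Qed.

Let step_additive : semi_sigma_additive tuple_measure_step.
Proof.
move=> F mF tF mUF; rewrite /tuple_measure_step /pushforward preimage_bigcup.
apply: measure_semi_sigma_additive.
- by move=> k; exact: preim_tcons.
- apply/trivIsetP => i j _ _ ij; rewrite -preimage_setI.
  by move/trivIsetP : tF => /(_ _ _ _ _ ij) ->//; rewrite preimage_set0.
- by rewrite -preimage_bigcup; exact: preim_tcons.
Qed.

HB.instance Definition _ := isMeasure.Build _ _ _ tuple_measure_step
  step0 step_ge0 step_additive.

Let step_sigma_finite : sigma_finite [set: _] tuple_measure_step.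
Proof.
pose l : {sigma_finite_measure set (measurableTypeR R) -> \bar R} :=
  @lebesgue_measure R.
have /sigma_finiteP[F [FT ndF Foo]] := sigma_finiteT l.
have /sigma_finiteP[G [GT ndG Goo]] := sigma_finiteT m.
exists (fun k => @tuncons n @^-1` (F k `*` G k)) => [|k].
  rewrite -preimage_bigcup (_ : \bigcup_k _ = setT) ?preimage_setT//.
  rewrite -setXTT FT GT predeqE => -[x y]; split.
    by move=> [k _ []/= ? ?]; split; exists k.
  move=> [/= [i _ Fx] [k _ Gy]]; exists (maxn i k) => //; split.
  - by move: x Fx; exact/subsetPset/ndF/leq_maxl.
  - by move: y Gy; exact/subsetPset/ndG/leq_maxr.
have [mF Fk] := Foo k; have [mG Gk] := Goo k; split.
  rewrite -[X in measurable X]setTI.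
  by apply: measurable_tuncons => //; exact: measurableX.
rewrite /tuple_measure_step /pushforward -comp_preimage.
rewrite (_ : _ \o _ = id); last by rewrite funeqE => x /=; rewrite tconsK.
rewrite preimage_id -/l product_measure1E//.
by rewrite lte_mul_pinfty// ge0_fin_numE.
Qed.

HB.instance Definition _ := Measure_isSigmaFinite.Build _ _ _
  tuple_measure_step step_sigma_finite.

End step.

Fixpoint leb n : {sigma_finite_measure set (tup n) -> \bar R} :=
  if n is n'.+1 return {sigma_finite_measure set (tup n) -> \bar R}
  then tuple_measure_step (leb n') else \d_([tuple] : tup 0).

End lebesgue_tuple.

(* Functions on the flat torus of dimension d are functions on R^d = 'rV[R]_d that
   are 1-periodic in each coordinate; the unit cube is a fundamental domain. *)

Section torus.
Context {R : realType} {d : nat}.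
Local Notation pt := ('rV[R]_d).
Local Notation tup n := (n.-tuple (measurableTypeR R)).

Definition unit_vec (i : 'I_d) : pt := delta_mx 0 i.

Definition torus_periodic V (f : pt -> V) : Prop :=
  forall x i, f (x + unit_vec i) = f x.

Definition pt_of (t : tup d) : pt := \row_i tnth t i.

Definition Omega : set (tup d) := [set t | forall i, tnth t i \in `[0, 1]].

Definition inLp (p : R) (f : pt -> R) : Prop :=
  (f \o pt_of) \_ Omega \in Lfun (leb d) p%:E.

Fixpoint iter_partial (s : seq 'I_d) (f : pt -> R) : pt -> R :=
  if s is i :: s' then iter_partial s' ('D_(unit_vec i) f) else f.

Definition smooth (f : pt -> R) : Prop :=
  forall s, continuous (iter_partial s f) /\
    forall i x, derivable (iter_partial s f) x (unit_vec i).

Definition weak_partial (i : 'I_d) (f g : pt -> R) : Prop :=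
  forall phi, smooth phi -> torus_periodic phi ->
    \int[leb d]_(t in Omega) (f (pt_of t) * 'D_(unit_vec i) phi (pt_of t)) =
    - \int[leb d]_(t in Omega) (g (pt_of t) * phi (pt_of t)).

Definition inW12 (f : pt -> R) : Prop :=
  inLp 2 f /\ forall i, exists2 g, inLp 2 g & weak_partial i f g.

End torus.

(* Space-time functions; only their values on [0,T] x R^d matter. *)

Section space_time.
Context {R : realType} {d : nat}.
Local Notation st := (R * 'rV[R]_d)%type.
Implicit Types (f : st -> R) (T : R).

Definition dt f : st -> R := 'D_(1, 0) f.
Definition dx (i : 'I_d) f : st -> R := 'D_(0, unit_vec i) f.

Definition dir : Type := option 'I_d.
Definition dpart (j : dir) : (st -> R) -> st -> R := if j is Some i then dx i else dt.
Definition dir_vec (j : dir) : st := if j is Some i then (0, unit_vec i) else (1, 0).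

Definition open_slab T : set st := [set z | 0 < z.1 < T].
Definition closed_slab T : set st := [set z | 0 <= z.1 <= T].

Definition extends_continuously T f : Prop :=
  exists2 g : st -> R, {within closed_slab T, continuous g} &
    {in open_slab T, g =1 f}.

(* C^2([0,T] x R^d): f is continuous on the closed slab and its partial derivatives
   of order at most 2 exist in the open slab and extend continuously to the closed
   one. *)
Definition C2 T f : Prop :=
  [/\ {within closed_slab T, continuous f},
      forall j, (forall z, open_slab T z -> derivable f z (dir_vec j)) /\
        extends_continuously T (dpart j f)
    & forall j k,
        (forall z, open_slab T z -> derivable (dpart j f) z (dir_vec k)) /\
        extends_continuously T (dpart k (dpart j f))].

Definition time_periodic V T (f : st -> V) : Prop :=
  forall t, 0 <= t <= T -> torus_periodic (fun x => f (t, x)).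

Definition component (U : st -> 'rV[R]_d) (i : 'I_d) : st -> R := fun z => U z 0 i.

Definition pressure (a gamma : R) (z : R) : R := a * z `^ gamma.

Definition stress (mu lambda : R) (U : st -> 'rV[R]_d) (i j : 'I_d) : st -> R :=
  fun z => mu * (dx j (component U i) z + dx i (component U j) z)
    + lambda * (\sum_k dx k (component U k) z) * (i == j)%:R.

Definition strong_solution (T a gamma mu lambda : R)
    (r : st -> R) (U : st -> 'rV[R]_d) : Prop :=
  [/\ C2 T r /\ (forall i, C2 T (component U i)),
      time_periodic T r /\ time_periodic T U,
      (forall z, open_slab T z ->
        dt r z + \sum_j dx j (fun y => r y * component U j y) z = 0)
    & (forall z i, open_slab T z ->
        dt (fun y => r y * component U i y) z
        + \sum_j dx j (fun y => r y * component U i y * component U j y) z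
        + dx i (fun y => pressure a gamma (r y)) z
        = \sum_j dx j (stress mu lambda U i j) z)].

Definition Linfty_norm T (f : st -> R) : R :=
  fine ('N[(@lebesgue_measure R \x leb d)%E]_+oo
    [ EFin \o ((fun s => f (s.1, pt_of s.2)) \_ (`]0, T[ `*` Omega)) ]).

(* Pointwise Euclidean length of
   (grad r, d_t r, d_t grad r, d_t^2 r, U, grad U, grad^2 U, d_t U, d_t grad U). *)
Definition solution_length (r : st -> R) (U : st -> 'rV[R]_d) : st -> R :=
  fun z => Num.sqrt (
    \sum_i (dx i r z) ^+ 2 + (dt r z) ^+ 2 + \sum_i (dt (dx i r) z) ^+ 2
    + (dt (dt r) z) ^+ 2
    + \sum_i (component U i z) ^+ 2 + \sum_i \sum_j (dx j (component U i) z) ^+ 2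
    + \sum_i \sum_j \sum_k (dx k (dx j (component U i)) z) ^+ 2
    + \sum_i (dt (component U i) z) ^+ 2
    + \sum_i \sum_j (dt (dx j (component U i)) z) ^+ 2).

Definition solution_norm T (r : st -> R) (U : st -> 'rV[R]_d) : R :=
  Linfty_norm T (solution_length r U).

End space_time.

Section thermodynamics.
Context {R : realType} (a gamma : R).
Local Notation p := (pressure a gamma).

Definition Helmholtz (rho : R) : R :=
  rho * (if 1 <= rho then \int[lebesgue_measure]_(z in `[1, rho]) (p z / z ^+ 2)
         else - \int[lebesgue_measure]_(z in `[rho, 1]) (p z / z ^+ 2)).

Definition rel_energy_density (rho r : R) : R :=
  Helmholtz rho - derive1 Helmholtz r * (rho - r) - Helmholtz r.

Definition C1_norm (f : R -> R) (x y : R) : R :=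
  sup [set `|f z| | z in `[x, y]] + sup [set `|derive1 f z| | z in `[x, y]].

End thermodynamics.

(* The uniform grid with N cells per direction, h = 1/N.  The cell with index k is
   prod_i [k_i h, (k_i + 1) h]; index arithmetic is cyclic.  A face orthogonal to
   e_i is indexed by the cell K of which it is the right face sigma_{K,i+}, so the
   face k lies between the cells k and up i k.  Cell functions (X_T) and i-th face
   functions (Y_{i,E}) are thus both represented by their values on cell indices. *)

Section grid.
Context {R : realType} {d N : nat}.
Local Notation tup n := (n.-tuple (measurableTypeR R)).

Definition cell : Type := {ffun 'I_d -> 'I_N}.
Definition up (i : 'I_d) (k : cell) : cell :=
  [ffun j => if j == i then ordS (k j) else k j].
Definition dn (i : 'I_d) (k : cell) : cell :=
  [ffun j => if j == i then ord_pred (k j) else k j].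

Implicit Types (k : cell) (i j : 'I_d) (f r w : cell -> R) (v : 'I_d -> cell -> R).

Definition mesh : R := N%:R^-1.

(* Cells, dual cells D_sigma and bidual cells D_epsilon all have volume h^d, so this
   is the integral over the torus of any of the piecewise constant functions. *)
Definition integral_pc f : R := mesh ^+ d * \sum_(k : cell) f k.

Definition cell_set k : set (tup d) :=
  [set t | forall i, (k i)%:R * mesh <= tnth t i <= (k i).+1%:R * mesh].

Definition proj_cell (phi : 'rV[R]_d -> R) : cell -> R := fun k =>
  (mesh ^+ d)^-1 * \int[leb d]_(t in cell_set k) phi (pt_of t).

(* The right face of cell k orthogonal to e_i, parametrized by its d - 1 free
   coordinates; it has area h^(d-1). *)
Definition face_set i k : set (tup d.-1) :=
  [set t | forall m, (k (lift i m))%:R * mesh <= tnth t m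
                     <= (k (lift i m)).+1%:R * mesh].

Definition face_point i k (t : tup d.-1) : 'rV[R]_d :=
  \row_j if unlift i j is Some m then tnth t m else (k i).+1%:R * mesh.

Definition proj_face (phi : 'rV[R]_d -> 'rV[R]_d) : 'I_d -> cell -> R := fun i k =>
  (mesh ^+ d.-1)^-1 * \int[leb d.-1]_(t in face_set i k) phi (face_point i k t) 0 i.

Definition avg_face i r : cell -> R := fun k => (r k + r (up i k)) / 2.
Definition avg_cell i w : cell -> R := fun k => (w k + w (dn i k)) / 2.
Definition mean v : 'I_d -> cell -> R := fun i => avg_cell i (v i).
Definition diff_face i r : cell -> R := fun k => (r (up i k) - r k) / mesh.
Definition diff_cell i w : cell -> R := fun k => (w k - w (dn i k)) / mesh.
Definition div_cell v : cell -> R := fun k => \sum_i diff_cell i (v i) k.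

(* Both Delta_T on cell functions and Delta_E on face functions: the neighbours of
   a (dual) cell are its translates by +h and -h along each axis. *)
Definition laplace f : cell -> R := fun k =>
  mesh ^- 2 * \sum_j ((f (up j k) - f k) + (f (dn j k) - f k)).

Definition upwind r v i : cell -> R := fun k =>
  r k * Num.max 0 (v i k) + r (up i k) * Num.min 0 (v i k).
Definition div_up r v : cell -> R := fun k => \sum_i diff_cell i (upwind r v i) k.

(* eth_j v_i on the bidual cell between the dual cells of the faces k and up j k;
   the same difference quotient as diff_face. *)
Definition grad_norm2 v : R :=
  \sum_i \sum_j integral_pc (fun k => diff_face j (v i) k ^+ 2).

Definition mass (rho : cell -> R) : R := integral_pc rho.

Section scheme.
Variables (a gamma mu lambda alpha : R).

(* The discrete fields are (rho n, u n).  At level 0 only the cell velocity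
   Pi_T u0 exists: it need not be the cell mean of any face field. *)
Definition cell_velocity (u0 : 'rV[R]_d -> 'rV[R]_d) (u : nat -> 'I_d -> cell -> R)
    (n : nat) : 'I_d -> cell -> R :=
  if n is 0%N then fun i => proj_cell (fun x => u0 x 0 i) else mean (u n).

Definition continuity_eq (tau : R) (rho_prev rho : cell -> R) v : Prop :=
  forall k, (rho k - rho_prev k) / tau + div_up rho v k
            - mesh `^ alpha * laplace rho k = 0.

Definition momentum_eq (tau : R) (rho_prev : cell -> R) (ubar_prev : 'I_d -> cell -> R)
    (rho : cell -> R) v : Prop :=
  let ubar := mean v in
  forall i k,
    (avg_face i (fun l => rho l * ubar i l) k
     - avg_face i (fun l => rho_prev l * ubar_prev i l) k) / tau
    + avg_face i (div_up (fun l => rho l * ubar i l) v) k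
    + diff_face i (fun l => pressure a gamma (rho l)) k
    - mu * laplace (v i) k
    - (mu + lambda) * diff_face i (div_cell v) k
    = mesh `^ alpha * \sum_j avg_face i
        (diff_cell j (fun l => avg_face j (ubar i) l * diff_face j rho l)) k.

Definition MAC_solution (T : R) (Nt : nat) (rho0 : 'rV[R]_d -> R)
    (u0 : 'rV[R]_d -> 'rV[R]_d) (rho : nat -> cell -> R)
    (u : nat -> 'I_d -> cell -> R) : Prop :=
  let tau := T / Nt%:R in
  rho 0%N = proj_cell rho0 /\
  forall n, (n < Nt)%N ->
    continuity_eq tau (rho n) (rho n.+1) (u n.+1) /\
    momentum_eq tau (rho n) (cell_velocity u0 u n) (rho n.+1) (u n.+1).

Definition rel_energy (rho : cell -> R) (ubar : 'I_d -> cell -> R)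
    (r : cell -> R) (Ubar : 'I_d -> cell -> R) : R :=
  integral_pc (fun k => 2^-1 * rho k * (\sum_i (ubar i k - Ubar i k) ^+ 2)
                        + rel_energy_density a gamma (rho k) (r k)).

(* The relative energy of piecewise constant (rho, ubar) with respect to functions
   (r, U) on the torus. *)
Definition rel_energy_init (rho : cell -> R) (ubar : 'I_d -> cell -> R)
    (r : 'rV[R]_d -> R) (U : 'rV[R]_d -> 'rV[R]_d) : R :=
  \sum_(k : cell) \int[leb d]_(t in cell_set k)
    (2^-1 * rho k * (\sum_i (ubar i k - U (pt_of t) 0 i) ^+ 2)
     + rel_energy_density a gamma (rho k) (r (pt_of t))).

Definition energy (rho : cell -> R) (ubar : 'I_d -> cell -> R) : R :=
  integral_pc (fun k => 2^-1 * rho k * (\sum_i ubar i k ^+ 2)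
                        + Helmholtz a gamma (rho k)).

End scheme.
End grid.

Arguments cell : clear implicits.

(* Main.v *)
(* Relative energy method.  Testing the discrete momentum equation with the velocity error and
   the continuity equation with [|U|^2/2] and [H'(rho) - H'(r)] gives a discrete relative energy
   inequality, in which the numerical dissipation (upwinding, implicit Euler and the [h^alpha]
   diffusion) has a favourable sign.  The sampled strong solution solves the scheme up to [O(h)],
   so the right-hand side is bounded by [C (relative energy + h^A)] plus a small multiple of the
   viscous and numerical dissipation; for [gamma > 2] the latter is completed by a renormalized
   entropy, weighted by [sqrt h], which controls the density jumps.  The discrete Gronwall lemma
   concludes if [C tau <= 1/2]; otherwise [h] is bounded below and the energy bound suffices.
   All constants depend on the data only through the listed norms; monotonicity in the energy is
   obtained by summing the constants for the integer energy levels up to [E_0 + 1]. *)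
Require Import Defs.
From mathcomp Require Import all_boot all_order all_algebra.
From mathcomp Require Import all_classical all_reals all_analysis.
From mathcomp Require Import ring lra.
Import Order.TTheory GRing.Theory Num.Theory.
Import numFieldNormedType.Exports.
Local Open Scope classical_set_scope.
Local Open Scope ring_scope.
Set Implicit Arguments.
Unset Strict Implicit.
Unset Printing Implicit Defensive.
From mathcomp Require Import measurable_realfun ess_sup_inf.

(** In the class C^2 the second derivatives are merely continuous, so sampling the equations
    pointwise would leave residuals governed by a modulus of continuity: neither O(h) nor controlled
    by the listed norms. The equations are therefore averaged over space-time cells, where the mean
    of a derivative is a difference quotient of face means. The means are midpoint sums whose number
    of nodes is chosen after the grid, so that moduli of continuity influence this number but no
    constant. A second obstacle is that the relative energy sees the velocity error only with the
    weight [rho]; the Poincare inequality restores the unweighted error from mass, internal energy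
    and discrete gradient. The two exponents in the rate have separate origins. A cell has volume
    [h^d], hence [rho <= B h^(-d/gamma)] and [h^2 rho <= B h^((2 gamma - d)/gamma)]. Density jumps
    are balanced by Young's inequality against the dissipation with weight [sqrt h], which leaves
    terms of order [sqrt h]. For uniformity, all data of a time step form one record, and each
    constant is chosen before the record. *)

(** * Summation by parts on the periodic grid *)

Section discrete_calculus.
Context {R : realType} {d N : nat}.
Hypothesis N_gt0 : (0 < N)%N.
Local Notation cell := (cell d N).
Local Notation h := (@mesh R N).
Local Notation I := (@integral_pc R d N).
Implicit Types (f g w : cell -> R) (i j : 'I_d) (k : cell).

Lemma mesh_gt0 : 0 < h.
Proof. by rewrite invr_gt0 ltr0n. Qed.

Lemma mesh_le1 : h <= 1.
Proof. by rewrite invf_le1 ?ltr0n// ler1n. Qed.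

Lemma upK i : cancel (@up d N i) (dn i).
Proof.
by move=> k; apply/ffunP => j; rewrite !ffunE; case: eqP => // _; rewrite ordSK.
Qed.

Lemma dnK i : cancel (@dn d N i) (up i).
Proof.
by move=> k; apply/ffunP => j; rewrite !ffunE; case: eqP => // _; rewrite ord_predK.
Qed.

Lemma upC i j k : up i (up j k) = up j (up i k).
Proof.
apply/ffunP => l; rewrite !ffunE; case: eqP => [->|//].
by case: eqP.
Qed.

Lemma up_dnC i j k : up i (dn j k) = dn j (up i k).
Proof. by apply: (can_inj (upK j)); rewrite dnK upC dnK. Qed.

Lemma Ipc_eq f g : f =1 g -> I f = I g.
Proof. by move=> fg; rewrite /integral_pc; under eq_bigr do rewrite fg. Qed.

Lemma Ipc_up i f : I (fun k => f (up i k)) = I f.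
Proof.
rewrite /integral_pc [in RHS](reindex_inj (can_inj (upK i))).
by [].
Qed.

Lemma Ipc_dn i f : I (fun k => f (dn i k)) = I f.
Proof. by rewrite -(Ipc_up i); apply: Ipc_eq => k; rewrite upK. Qed.

Lemma IpcD f g : I (fun k => f k + g k) = I f + I g.
Proof. by rewrite /integral_pc big_split mulrDr. Qed.

Lemma IpcZ (c : R) f : I (fun k => c * f k) = c * I f.
Proof. by rewrite /integral_pc -mulr_sumr mulrCA. Qed.

Lemma IpcZr (c : R) f : I (fun k => f k * c) = I f * c.
Proof. by rewrite /integral_pc -mulr_suml mulrA. Qed.

Lemma IpcN f : I (fun k => - f k) = - I f.
Proof. by rewrite /integral_pc sumrN mulrN. Qed.

Lemma IpcB f g : I (fun k => f k - g k) = I f - I g.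
Proof. by rewrite IpcD IpcN. Qed.

Lemma Ipc_sum (J : finType) (F : J -> cell -> R) :
  I (fun k => \sum_j F j k) = \sum_j I (F j).
Proof. by rewrite /integral_pc exchange_big mulr_sumr. Qed.

Lemma Ipc_le f g : (forall k, f k <= g k) -> I f <= I g.
Proof.
move=> fg; apply: ler_wpM2l; first by rewrite exprn_ge0// ltW// mesh_gt0.
exact: ler_sum.
Qed.

Lemma Ipc_ge0 f : (forall k, 0 <= f k) -> 0 <= I f.
Proof.
move=> f0; apply: mulr_ge0; last exact: sumr_ge0.
by rewrite exprn_ge0// ltW// mesh_gt0.
Qed.

Lemma Ipc_norm f : `|I f| <= I (fun k => `|f k|).
Proof.
rewrite /integral_pc normrM ger0_norm; last by rewrite exprn_ge0// ltW// mesh_gt0.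
apply: ler_wpM2l; first by rewrite exprn_ge0// ltW// mesh_gt0.
exact: ler_norm_sum.
Qed.

Lemma Ipc_cst (c : R) : I (fun=> c) = c.
Proof.
rewrite /integral_pc sumr_const card_ffun !card_ord -[c *+ _]mulr_natr mulrCA.
by rewrite natrX -exprMn mulVf ?expr1n ?mulr1// pnatr_eq0 -lt0n.
Qed.

Lemma Ipc_le_sum_cell f k : (forall l, 0 <= f l) -> h ^+ d * f k <= I f.
Proof.
move=> f0; apply: ler_wpM2l; first by rewrite exprn_ge0// ltW// mesh_gt0.
by rewrite (bigD1 k)//= lerDl sumr_ge0.
Qed.

(** Periodicity leaves no boundary term: [up i] permutes the cells, so one half of the difference
    quotient can be translated. *)
Lemma Ipc_diff_cell i w f :
  I (fun k => diff_cell i w k * f k) = - I (fun k => w k * diff_face i f k).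
Proof.
transitivity (I (fun k => w k * f k / h) - I (fun k => w (dn i k) * f k / h)).
  by rewrite -IpcB; apply: Ipc_eq => k; rewrite /diff_cell; ring.
rewrite -[X in _ - X](Ipc_up i) -IpcB -IpcN; apply: Ipc_eq => k.
by rewrite upK /diff_face; ring.
Qed.

Lemma Ipc_diff_face i w f :
  I (fun k => diff_face i w k * f k) = - I (fun k => w k * diff_cell i f k).
Proof.
have := Ipc_diff_cell i f w.
under eq_fun do rewrite mulrC; move=> ->; rewrite opprK.
by apply: Ipc_eq => k; rewrite mulrC.
Qed.

(** Adjointness of the two averages. The inertial terms of the momentum equation are face averages
    of cell quantities; this turns them into cell integrals against [mean w]. *)
Lemma Ipc_avg_face i g w :
  I (fun k => avg_face i g k * w k) = I (fun k => g k * avg_cell i w k).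
Proof.
transitivity (I (fun k => g k * w k / 2) + I (fun k => g (up i k) * w k / 2)).
  by rewrite -IpcD; apply: Ipc_eq => k; rewrite /avg_face; ring.
rewrite -[X in _ + X](Ipc_dn i) -IpcD; apply: Ipc_eq => k.
by rewrite dnK /avg_cell; ring.
Qed.

Lemma laplaceE f k : laplace f k = \sum_j diff_cell j (diff_face j f) k :> R.
Proof.
rewrite /laplace mulr_sumr; apply: eq_bigr => j _.
rewrite /diff_cell /diff_face dnK expr2 invfM.
ring.
Qed.

Lemma Ipc_laplace f w :
  I (fun k => laplace f k * w k) =
  - \sum_j I (fun k => diff_face j f k * diff_face j w k).
Proof.
under eq_fun do rewrite laplaceE mulr_suml.
rewrite Ipc_sum -sumrN; apply: eq_bigr => j _.
by rewrite Ipc_diff_cell.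
Qed.

Lemma avg_cell_dn i w k : avg_cell i w k - w k = - (h / 2) * diff_cell i w k.
Proof. rewrite /avg_cell /diff_cell; field. by rewrite gt_eqF// mesh_gt0. Qed.

Lemma avg_cell_up i w k :
  avg_cell i w (up i k) - w k = h / 2 * diff_cell i w (up i k).
Proof. rewrite /avg_cell /diff_cell upK; field. by rewrite gt_eqF// mesh_gt0. Qed.

End discrete_calculus.

(** [b'] is a separate argument rather than the derivative of [b]: discrete renormalization is an
    algebraic identity valid for any pair of functions. *)
Definition bregman {R : realType} (b b' : R -> R) (x y : R) : R :=
  b x - b y - b' y * (x - y).

(** * Weak forms of the scheme and renormalization *)

Section scheme_identities.
Context {R : realType} {d N : nat}.
Hypothesis N_gt0 : (0 < N)%N.
Local Notation cell := (cell d N).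
Local Notation h := (@mesh R N).
Local Notation I := (@integral_pc R d N).
Variables (a gamma mu lambda alpha tau : R).
Hypothesis tau_gt0 : 0 < tau.
Variables (rho0 rho : cell -> R) (ubar0 u : 'I_d -> cell -> R).
Local Notation hal := (h `^ alpha).
Local Notation p := (pressure a gamma).
Let h_neq0 : h != 0. Proof. by rewrite gt_eqF// mesh_gt0. Qed.
Let tau_neq0 : tau != 0. Proof. by rewrite gt_eqF. Qed.

(** With the artificial diffusion included in the flux, the continuity equation is a single discrete
    conservation law. *)
Definition mass_flux (j : 'I_d) (k : cell) : R :=
  upwind rho u j k - hal * diff_face j rho k.

Definition momentum_flux (i j : 'I_d) (k : cell) : R :=
  upwind (fun l => rho l * mean u i l) u j k
  - hal * (avg_face j (mean u i) k * diff_face j rho k).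

Lemma continuity_weak (phi : cell -> R) :
  continuity_eq alpha tau rho0 rho u ->
  I (fun k => (rho k - rho0 k) * phi k) =
  tau * \sum_j I (fun k => mass_flux j k * diff_face j phi k).
Proof.
move=> ceq.
have eqk k : rho k - rho0 k = - tau * \sum_j diff_cell j (mass_flux j) k.
  have /eqP := ceq k; rewrite laplaceE /div_up mulr_sumr -addrA -sumrB.
  rewrite addr_eq0 => /eqP E.
  rewrite -[LHS](divfK tau_neq0) E mulNr mulrC mulNr; congr (- (_ * _)).
  apply: eq_bigr => j _; rewrite /mass_flux /diff_cell; ring.
under Ipc_eq do rewrite eqk -mulrA mulr_suml.
rewrite IpcZ Ipc_sum mulNr -mulrN -sumrN; congr (_ * _); apply: eq_bigr => j _.
by rewrite Ipc_diff_cell// opprK.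
Qed.

(** Only the inertial terms are face averages and see the test field through [mean w]; pressure and
    viscosity act on the face field [w] itself. *)
Lemma momentum_weak (w : 'I_d -> cell -> R) :
  momentum_eq a gamma mu lambda alpha tau rho0 ubar0 rho u ->
  \sum_i I (fun k => (rho k * mean u i k - rho0 k * ubar0 i k) * mean w i k) =
  tau * (\sum_i \sum_j I (fun k => momentum_flux i j k * diff_face j (mean w i) k)
         + I (fun k => p (rho k) * div_cell w k)
         - mu * \sum_i \sum_j I (fun k => diff_face j (u i) k * diff_face j (w i) k)
         - (mu + lambda) * I (fun k => div_cell u k * div_cell w k)).
Proof.
move=> meq.
have eqk i k : avg_face i (fun l => rho l * mean u i l - rho0 l * ubar0 i l
      + tau * \sum_j diff_cell j (momentum_flux i j) l) k =
    tau * (- diff_face i (fun l => p (rho l)) k + mu * laplace (u i) k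
           + (mu + lambda) * diff_face i (div_cell u) k).
  have E := meq i k; rewrite /= in E.
  have {E} -> : - diff_face i (fun l => p (rho l)) k + mu * laplace (u i) k
           + (mu + lambda) * diff_face i (div_cell u) k =
      (avg_face i (fun l => rho l * mean u i l) k
     - avg_face i (fun l => rho0 l * ubar0 i l) k) / tau
    + avg_face i (div_up (fun l => rho l * mean u i l) u) k
    - hal * \sum_j avg_face i
        (diff_cell j (fun l => avg_face j (mean u i) l * diff_face j rho l)) k.
    by rewrite -E; ring.
  have avgS (F : 'I_d -> cell -> R) : avg_face i (fun l => \sum_j F j l) k =
      \sum_j avg_face i (F j) k.
    by rewrite /avg_face -big_split/= mulr_suml.
  have -> : avg_face i (fun l => rho l * mean u i l - rho0 l * ubar0 i l
      + tau * \sum_j diff_cell j (momentum_flux i j) l) k =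
     avg_face i (fun l => rho l * mean u i l) k -
     avg_face i (fun l => rho0 l * ubar0 i l) k +
     tau * \sum_j avg_face i (diff_cell j (momentum_flux i j)) k.
    by rewrite -avgS /avg_face; ring.
  rewrite /div_up avgS [hal * _]mulr_sumr -[_ / tau + _ - _]addrA -sumrB mulrDr [tau * (_ / _)]mulrC divfK//.
  congr (_ + tau * _); apply: eq_bigr => j _.
  by rewrite /avg_face /diff_cell /momentum_flux /avg_face /=; ring.
have S : \sum_i I (fun k => avg_face i (fun l => rho l * mean u i l -
       rho0 l * ubar0 i l
      + tau * \sum_j diff_cell j (momentum_flux i j) l) k * w i k) =
   \sum_i I (fun k => tau * (- diff_face i (fun l => p (rho l)) k +
       mu * laplace (u i) k
           + (mu + lambda) * diff_face i (div_cell u) k) * w i k).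
  by apply: eq_bigr => i _; apply: Ipc_eq => k; rewrite eqk.
have L i : I (fun k => avg_face i (fun l => rho l * mean u i l -
       rho0 l * ubar0 i l
      + tau * \sum_j diff_cell j (momentum_flux i j) l) k * w i k) =
   I (fun k => (rho k * mean u i k - rho0 k * ubar0 i k) * mean w i k) -
   tau * \sum_j I (fun k => momentum_flux i j k * diff_face j (mean w i) k).
  rewrite Ipc_avg_face//.
  transitivity (I (fun k => (rho k * mean u i k - rho0 k * ubar0 i k) * mean w i k
     + tau * \sum_j (diff_cell j (momentum_flux i j) k * mean w i k))).
    by apply: Ipc_eq => k; rewrite -mulr_suml mulrA -mulrDl.
  rewrite IpcD IpcZ Ipc_sum -mulrN -sumrN; congr (_ + _ * _).
  by apply: eq_bigr => j _; rewrite Ipc_diff_cell.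
have Rr i : I (fun k => tau * (- diff_face i (fun l => p (rho l)) k +
       mu * laplace (u i) k
           + (mu + lambda) * diff_face i (div_cell u) k) * w i k) =
    tau * (I (fun k => p (rho k) * diff_cell i (w i) k)
     - mu * \sum_j I (fun k => diff_face j (u i) k * diff_face j (w i) k)
     - (mu + lambda) * I (fun k => div_cell u k * diff_cell i (w i) k)).
  transitivity (I (fun k => - tau * (diff_face i (fun l => p (rho l)) k * w i k)
     + tau * mu * (laplace (u i) k * w i k)
     + tau * (mu + lambda) * (diff_face i (div_cell u) k * w i k))).
    by apply: Ipc_eq => k; ring.
  rewrite !IpcD !IpcZ !Ipc_diff_face// Ipc_laplace//; ring.
move: S; under eq_bigr do rewrite L; under [RHS]eq_bigr do rewrite Rr.
rewrite sumrB -!mulr_sumr => /(canRL (subrK _)) ->.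
rewrite -mulrDr; congr (_ * _).
rewrite !sumrB -[X in _ - X - _ + _]mulr_sumr -[X in _ - _ - X + _]mulr_sumr.
have -> : \sum_i I (fun k => p (rho k) * diff_cell i (w i) k) =
   I (fun k => p (rho k) * div_cell w k).
  by rewrite -Ipc_sum; apply: Ipc_eq => k; rewrite /div_cell mulr_sumr.
have -> : \sum_i I (fun k => div_cell u k * diff_cell i (w i) k) =
   I (fun k => div_cell u k * div_cell w k).
  by rewrite -Ipc_sum; apply: Ipc_eq => k; rewrite {3}/div_cell mulr_sumr.
ring.
Qed.

(** In the upwind part the distance is taken from the upstream value to the downstream base point;
    the diffusive part is symmetric. The sum is nonnegative as soon as the Bregman distance is. *)
Definition dissipation (b b' : R -> R) : R :=
  \sum_j I (fun k =>
    (Num.max 0 (u j k) * bregman b b' (rho k) (rho (up j k))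
     - Num.min 0 (u j k) * bregman b b' (rho (up j k)) (rho k)) / h
    + hal / h ^+ 2 * (bregman b b' (rho k) (rho (up j k))
                      + bregman b b' (rho (up j k)) (rho k))).

Lemma maxDmin0 (x : R) : Num.max 0 x + Num.min 0 x = x.
Proof. by rewrite addr_max_min add0r. Qed.

Lemma Ipc_div_cell (f : cell -> R) (w : 'I_d -> cell -> R) :
  I (fun k => f k * div_cell w k) = - \sum_j I (fun k => w j k * diff_face j f k).
Proof.
transitivity (I (fun k => \sum_j diff_cell j (w j) k * f k)).
  by apply: Ipc_eq => k; rewrite -mulr_suml mulrC.
by rewrite Ipc_sum -sumrN; apply: eq_bigr => j _; rewrite Ipc_diff_cell.
Qed.

(** Tested with [b'(rho)], the mass flux through each face splits exactly into the difference of
    [rho b'(rho) - b(rho)] carried by [u] and the Bregman terms, so the identity holds face by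
    face. *)
Lemma renormalized_continuity (b b' : R -> R) :
  continuity_eq alpha tau rho0 rho u ->
  I (fun k => (rho k - rho0 k) * b' (rho k))
  + tau * (I (fun k => (rho k * b' (rho k) - b (rho k)) * div_cell u k)
           + dissipation b b') = 0.
Proof.
move=> /continuity_weak ->.
rewrite Ipc_div_cell -mulrDr -sumrN -!big_split/= big1 ?mulr0// => j _.
rewrite -IpcN -!IpcD/=.
rewrite -[RHS](@Ipc_cst R d N N_gt0 0).
apply: Ipc_eq => k; rewrite /mass_flux /upwind /diff_face /bregman.
rewrite -{3}(maxDmin0 (u j k)).
by field.
Qed.

End scheme_identities.

(** * Relative energy inequality for arbitrary discrete test fields *)

Section relative_energy.
Context {R : realType} {d N : nat}.
Hypothesis N_gt0 : (0 < N)%N.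
Local Notation cell := (cell d N).
Local Notation h := (@mesh R N).
Local Notation I := (@integral_pc R d N).
Variables (a gamma mu lambda alpha tau : R).
Hypothesis tau_gt0 : 0 < tau.
Variables (rho0 rho : cell -> R) (ubar0 u : 'I_d -> cell -> R).
Local Notation hal := (h `^ alpha).
Local Notation p := (pressure a gamma).
Hypothesis rho0_gt0 : forall k, 0 < rho0 k.
Hypothesis rho_gt0 : forall k, 0 < rho k.
Let h_neq0 : h != 0. Proof. by rewrite gt_eqF// mesh_gt0. Qed.

(** The right side exceeds the left side by exactly [h/2] times the absolute upwind mass flux times
    the squared difference quotient of [mean u i]: the upwind dissipation of kinetic energy. The
    [h^alpha] term of the momentum equation is what makes the diffusive contributions to the kinetic
    energy cancel. *)
Lemma momentum_flux_convective (v : 'I_d -> cell -> R) i j k :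
  momentum_flux alpha rho u i j k * (diff_face j (mean u i) k - diff_face j (v i) k)
  + mass_flux alpha rho u j k * (2^-1 * diff_face j (fun l => v i l ^+ 2) k
                           - 2^-1 * diff_face j (fun l => mean u i l ^+ 2) k)
  <= - ((rho k * Num.max 0 (u j k) * (mean u i k - v i k)
         + rho (up j k) * Num.min 0 (u j k) * (mean u i (up j k) - v i (up j k)))
        * diff_face j (v i) k)
     + h / 2 * (rho k * Num.max 0 (u j k) - rho (up j k) * Num.min 0 (u j k))
       * diff_face j (v i) k ^+ 2
     + hal * (avg_face j (fun l => mean u i l - v i l) k * diff_face j rho k
              * diff_face j (v i) k).
Proof.
rewrite -subr_ge0.
have -> : - ((rho k * Num.max 0 (u j k) * (mean u i k - v i k)
         + rho (up j k) * Num.min 0 (u j k) * (mean u i (up j k) - v i (up j k)))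
        * diff_face j (v i) k)
     + h / 2 * (rho k * Num.max 0 (u j k) - rho (up j k) * Num.min 0 (u j k))
       * diff_face j (v i) k ^+ 2
     + hal * (avg_face j (fun l => mean u i l - v i l) k * diff_face j rho k
              * diff_face j (v i) k) - (
  momentum_flux alpha rho u i j k * (diff_face j (mean u i) k - diff_face j (v i) k)
  + mass_flux alpha rho u j k * (2^-1 * diff_face j (fun l => v i l ^+ 2) k
                           - 2^-1 * diff_face j (fun l => mean u i l ^+ 2) k)) =
    h / 2 * (rho k * Num.max 0 (u j k) - rho (up j k) * Num.min 0 (u j k))
       * diff_face j (mean u i) k ^+ 2.
  rewrite /momentum_flux /mass_flux /upwind /avg_face /diff_face.
  by field.
apply: mulr_ge0; last exact: sqr_ge0.
apply: mulr_ge0; first by rewrite divr_ge0// ltW// mesh_gt0.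
rewrite subr_ge0; apply: (@le_trans _ _ 0).
  by rewrite mulr_ge0_le0 ?ge_min ?lexx// ltW.
by rewrite mulr_ge0 ?le_max ?lexx// ltW.
Qed.

Variables (H H' : R -> R).
Hypothesis pE : forall x, 0 < x -> p x = x * H' x - H x.
Hypothesis bregman_ge0 : forall x y, 0 < x -> 0 < y -> 0 <= bregman H H' x y.
Variables (W0 W : 'I_d -> cell -> R) (phi0 phi : cell -> R).
Hypothesis ceq : continuity_eq alpha tau rho0 rho u.
Hypothesis meq : momentum_eq a gamma mu lambda alpha tau rho0 ubar0 rho u.

(** The equations are tested with the old fields [W0], [phi0], while each energy uses the fields of
    its own level; this leaves increments of [W] and [phi] multiplied by the new density. With
    [phi = H'(r)] the density [H(rho) - phi rho] is the Bregman distance up to [p(r)]. Zero fields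
    give the plain energy balance. *)
Lemma relative_energy_ineq :
  I (fun k => 2^-1 * rho k * (\sum_i (mean u i k - mean W i k) ^+ 2)
              + H (rho k) - phi k * rho k)
  - I (fun k => 2^-1 * rho0 k * (\sum_i (ubar0 i k - mean W0 i k) ^+ 2)
              + H (rho0 k) - phi0 k * rho0 k)
  + tau * (dissipation alpha rho u H H'
     + mu * (\sum_i \sum_j I (fun k => diff_face j (u i) k *
                  (diff_face j (u i) k - diff_face j (W0 i) k)))
     + (mu + lambda) * I (fun k => div_cell u k * (div_cell u k - div_cell W0 k)))
  <= - I (fun k => rho k * \sum_i (mean u i k - mean W i k) * (mean W i k - mean W0 i k))
     - I (fun k => rho k * (phi k - phi0 k))
     + tau * (\sum_i \sum_j I (fun k =>
        - ((rho k * Num.max 0 (u j k) * (mean u i k - mean W0 i k)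
         + rho (up j k) * Num.min 0 (u j k) * (mean u i (up j k) - mean W0 i (up j k)))
        * diff_face j (mean W0 i) k)
       + h / 2 * (rho k * Num.max 0 (u j k) - rho (up j k) * Num.min 0 (u j k))
         * diff_face j (mean W0 i) k ^+ 2
       + hal * (avg_face j (fun l => mean u i l - mean W0 i l) k * diff_face j rho k
              * diff_face j (mean W0 i) k))
      - \sum_j I (fun k => mass_flux alpha rho u j k * diff_face j phi0 k)
      - I (fun k => p (rho k) * div_cell W0 k)).
Proof.
pose w i k := u i k - W0 i k.
(* Weight for the continuity equation: the kinetic energy of the test field minus that of the
   solution, and the linear part of the relative energy. *)
pose psi k := 2^-1 * (\sum_i mean W0 i k ^+ 2) - 2^-1 * (\sum_i mean u i k ^+ 2) - phi0 k.
have mw i k : mean w i k = mean u i k - mean W0 i k.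
  by rewrite /mean /avg_cell /w; ring.
have dfw i j k : diff_face j (w i) k = diff_face j (u i) k - diff_face j (W0 i) k.
  by rewrite /diff_face /w; ring.
have dmw i j k : diff_face j (mean w i) k =
    diff_face j (mean u i) k - diff_face j (mean W0 i) k.
  by rewrite /diff_face !mw; ring.
have dw k : div_cell w k = div_cell u k - div_cell W0 k.
  by rewrite /div_cell -sumrB; apply: eq_bigr => i _; rewrite /diff_cell /w; ring.
have M := momentum_weak tau_gt0 w meq.
have C := continuity_weak tau_gt0 psi ceq.
have Q := renormalized_continuity N_gt0 tau_gt0 H H' ceq.
have flux : \sum_i \sum_j I (fun k =>
      momentum_flux alpha rho u i j k * diff_face j (mean w i) k)
    + \sum_j I (fun k => mass_flux alpha rho u j k * diff_face j psi k) <=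
    \sum_i \sum_j I (fun k =>
        - ((rho k * Num.max 0 (u j k) * (mean u i k - mean W0 i k)
         + rho (up j k) * Num.min 0 (u j k) * (mean u i (up j k) - mean W0 i (up j k)))
        * diff_face j (mean W0 i) k)
       + h / 2 * (rho k * Num.max 0 (u j k) - rho (up j k) * Num.min 0 (u j k))
         * diff_face j (mean W0 i) k ^+ 2
       + hal * (avg_face j (fun l => mean u i l - mean W0 i l) k * diff_face j rho k
              * diff_face j (mean W0 i) k))
      - \sum_j I (fun k => mass_flux alpha rho u j k * diff_face j phi0 k).
  have psiE j k : diff_face j psi k =
     \sum_i (2^-1 * diff_face j (fun l => mean W0 i l ^+ 2) k
             - 2^-1 * diff_face j (fun l => mean u i l ^+ 2) k)
     - diff_face j phi0 k.
    rewrite sumrB -!mulr_sumr /diff_face -!mulr_suml !sumrB /psi; ring.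
  rewrite exchange_big/= [X in _ <= X - _]exchange_big/= -big_split -sumrB/=.
  apply: ler_sum => j _; rewrite -!Ipc_sum -IpcD -IpcB; apply: Ipc_le => // k.
  rewrite psiE mulrBr addrA lerB// mulr_sumr -big_split; apply: ler_sum => i _.
  by rewrite /= dmw momentum_flux_convective.
have time : I (fun k => 2^-1 * rho k * (\sum_i (mean u i k - mean W i k) ^+ 2)
              + H (rho k) - phi k * rho k)
  - I (fun k => 2^-1 * rho0 k * (\sum_i (ubar0 i k - mean W0 i k) ^+ 2)
              + H (rho0 k) - phi0 k * rho0 k)
  + I (fun k => rho k * \sum_i (mean u i k - mean W i k) * (mean W i k - mean W0 i k))
  + I (fun k => rho k * (phi k - phi0 k)) <=
   \sum_i I (fun k => (rho k * mean u i k - rho0 k * ubar0 i k) * mean w i k)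
   + I (fun k => (rho k - rho0 k) * psi k) + I (fun k => (rho k - rho0 k) * H' (rho k)).
  rewrite -IpcB -!Ipc_sum -!IpcD; apply: Ipc_le => // k; rewrite -subr_ge0.
  (* Implicit Euler dissipation: the gap between both sides is the Bregman distance of the two
     density levels plus squares of velocity increments. *)
  have bH := bregman_ge0 (rho0_gt0 k) (rho_gt0 k).
  have -> : \sum_i (rho k * mean u i k - rho0 k * ubar0 i k) * mean w i k +
   (rho k - rho0 k) * psi k + (rho k - rho0 k) * H' (rho k) -
    (2^-1 * rho k * (\sum_i (mean u i k - mean W i k) ^+ 2) + H (rho k) -
     phi k * rho k -
    (2^-1 * rho0 k * (\sum_i (ubar0 i k - mean W0 i k) ^+ 2) +
      H (rho0 k) - phi0 k * rho0 k) +
    rho k * (\sum_i (mean u i k - mean W i k) * (mean W i k - mean W0 i k)) +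
     rho k * (phi k - phi0 k)) = bregman H H' (rho0 k) (rho k) +
     \sum_i (2^-1 * rho0 k * (mean u i k - ubar0 i k) ^+ 2
             + 2^-1 * rho k * (mean W i k - mean W0 i k) ^+ 2).
    have -> : \sum_i (2^-1 * rho0 k * (mean u i k - ubar0 i k) ^+ 2
             + 2^-1 * rho k * (mean W i k - mean W0 i k) ^+ 2) =
       \sum_i (rho k * mean u i k - rho0 k * ubar0 i k) * mean w i k
       + (rho k - rho0 k) * (2^-1 * (\sum_i mean W0 i k ^+ 2)
                             - 2^-1 * (\sum_i mean u i k ^+ 2))
       - 2^-1 * rho k * (\sum_i (mean u i k - mean W i k) ^+ 2)
       + 2^-1 * rho0 k * (\sum_i (ubar0 i k - mean W0 i k) ^+ 2)
       - rho k * (\sum_i (mean u i k - mean W i k) * (mean W i k - mean W0 i k)).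
      rewrite !mulr_sumr -!sumrB mulr_sumr -big_split -sumrB -big_split -sumrB.
      by apply: eq_bigr => i _; rewrite /= mw; field.
    rewrite /psi /bregman; ring.
  rewrite addr_ge0// sumr_ge0// => i _.
  by rewrite addr_ge0// mulr_ge0 ?sqr_ge0// mulr_ge0 ?ltW// invr_ge0.
have P1 : I (fun k => p (rho k) * div_cell w k) =
   I (fun k => p (rho k) * div_cell u k) - I (fun k => p (rho k) * div_cell W0 k).
  by rewrite -IpcB; apply: Ipc_eq => k; rewrite dw mulrBr.
have P2 : I (fun k => (rho k * H' (rho k) - H (rho k)) * div_cell u k) =
   I (fun k => p (rho k) * div_cell u k).
  by apply: Ipc_eq => k; rewrite pE.
move: M; under [X in _ - _ * X - _]eq_bigr do under eq_bigr do
  under Ipc_eq do rewrite dfw.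
under [X in _ - _ - _ * X]Ipc_eq do rewrite dw.
move=> M; rewrite P1 in M; rewrite P2 in Q.
move: flux time; rewrite -(ler_pM2l tau_gt0) => flux time.
move: M C Q flux time; set A1 := I _; set A2 := I _; set A3 := I _; set A4 := I _.
move: (\sum_i I _) => S1; move: (\sum_i \sum_j I _) => S2.
rewrite !mulrDr !mulrN => M C Q flux time.
lra.
Qed.

End relative_energy.

(** * Convexity inequalities for powers *)

Section power_law.
Context {R : realType}.
Implicit Types x y t r : R.

(** Young's inequality with exponents [1/s] and [1/(1-s)], applied to [x^s] and 1: the tangent at 1
    of a concave power. *)
Lemma powR_le_affine (s x : R) : 0 < s <= 1 -> 0 < x -> x `^ s <= 1 + s * (x - 1).
Proof.
move=> /andP[s0]; rewrite le_eqVlt => /predU1P[->|s1] x0.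
  by rewrite powRr1 ?(ltW x0)//; lra.
have s1' : 0 < 1 - s by rewrite subr_gt0.
have := @conjugate_powR R (x `^ s) 1 s^-1 (1 - s)^-1 (powR_ge0 _ _) ler01.
rewrite !invr_gt0 !invrK => /(_ s0 s1'); rewrite mulr1 powR1 -powRrM divff ?gt_eqF//.
rewrite powRr1 ?(ltW x0)// => H; apply: (le_trans (H _)); lra.
Qed.

(** The concave bound with exponent [1/s] at the point [x^s], solved for [x^s]. *)
Lemma powR_ge_affine (s x : R) : 1 <= s -> 0 < x -> 1 + s * (x - 1) <= x `^ s.
Proof.
move=> s1 x0; have s0 : 0 < s by apply: lt_le_trans s1.
have := @powR_le_affine s^-1 (x `^ s).
rewrite invr_gt0 s0 invf_le1// s1 powR_gt0// -powRrM divff ?gt_eqF//.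
rewrite powRr1 ?(ltW x0)// => /(_ isT isT); rewrite -(ler_pM2l s0) mulrDr mulrA.
by rewrite divff ?gt_eqF// mul1r mulr1; lra.
Qed.

Lemma powR_predr x s : 0 < x -> x * x `^ (s - 1) = x `^ s.
Proof.
move=> x0; rewrite -[X in X * _]powRr1 ?ltW// -powRD; first by congr (_ `^ _); ring.
by rewrite (gt_eqF x0) implybT.
Qed.

Lemma powR_pred x s : 0 < x -> x `^ (s - 1) = x `^ s / x.
Proof. by move=> x0; rewrite -(powR_predr s x0) mulrAC divff ?mul1r ?gt_eqF. Qed.

Lemma powR_div x y s : 0 < x -> 0 < y -> (x / y) `^ s = x `^ s / y `^ s.
Proof.
move=> x0 y0; rewrite powRM ?invr_ge0 ?ltW// -powR_inv1 ?ltW// -powRrM mulN1r.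
by rewrite powRN.
Qed.

Definition power_excess (s x y : R) : R := x `^ s - y `^ s - s * y `^ (s - 1) * (x - y).

(** Homogeneity: two-point inequalities reduce to the base point 1. *)
Lemma power_excess_ratio s x y : 0 < x -> 0 < y ->
  power_excess s x y = y `^ s * ((x / y) `^ s - 1 - s * (x / y - 1)).
Proof.
move=> x0 y0; rewrite /power_excess powR_div// powR_pred//.
by field; rewrite !gt_eqF ?powR_gt0.
Qed.

Lemma power_excess_ge0 s x y : 1 <= s -> 0 < x -> 0 < y -> 0 <= power_excess s x y.
Proof.
move=> s1 x0 y0; rewrite power_excess_ratio// mulr_ge0 ?powR_ge0//.
by have := powR_ge_affine s1 (divr_gt0 x0 y0); lra.
Qed.

(** The tangent inequality with exponent [s/2 >= 1] is used at [t^2] instead of [t]; it then already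
    contains the quadratic term. *)
Lemma power_excess_ge_sq s x y : 2 <= s -> 0 < x -> 0 < y ->
  s / 2 * y `^ s * (x / y - 1) ^+ 2 <= power_excess s x y.
Proof.
move=> s2 x0 y0; rewrite power_excess_ratio// [s / 2 * _]mulrC -mulrA.
rewrite ler_wpM2l ?powR_ge0//; set t := x / y.
have t0 : 0 < t by rewrite divr_gt0.
have E : (t ^+ 2) `^ (s / 2) = t `^ s.
  by rewrite -powR_mulrn ?(ltW t0)// -powRrM mulrC divfK.
have := @powR_ge_affine (s / 2) (t ^+ 2) ltac:(lra) (exprn_gt0 _ t0).
rewrite E; lra.
Qed.

(** The concave bound at [1/t] with exponent [s - 1] reads [t^s >= t^2 / ((s-1) + (2-s) t)]; the
    rest is polynomial. *)
Lemma powR_excess1_ge s t : 1 < s <= 2 -> 0 < t ->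
  (s - 1) ^+ 2 * (t - 1) ^+ 2 / ((s - 1) + (2 - s) * t) <= t `^ s - 1 - s * (t - 1).
Proof.
move=> /andP[s1 s2] t0.
have D0 : 0 < (s - 1) + (2 - s) * t.
  by rewrite ltr_pwDl ?subr_gt0// mulr_ge0 ?subr_ge0// ltW.
have B : (t^-1) `^ (s - 1) <= 1 + (s - 1) * (t^-1 - 1).
  by apply: powR_le_affine; rewrite ?invr_gt0//; lra.
have E : 1 + (s - 1) * (t^-1 - 1) = ((s - 1) + (2 - s) * t) / t.
  by field; rewrite gt_eqF.
have iE : (t^-1) `^ (s - 1) = t / t `^ s.
  by rewrite -powR_inv1 ?(ltW t0)// -powRrM mulN1r powRN powR_pred// invf_div.
rewrite E iE in B.
have ts0 : 0 < t `^ s by rewrite powR_gt0.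
rewrite ler_pdivlMr// mulrAC ler_pdivrMr// in B.
rewrite ler_pdivrMr//.
apply: (@le_trans _ _ (t * t - (1 + s * (t - 1)) * (s - 1 + (2 - s) * t))); first nra.
move: B; move: (t `^ s) => z; lra.
Qed.

(** The excess of 1 over the base point [t]. It serves the case where the base point is the smaller
    argument; inverting the ratio keeps it in the unit interval. *)
Lemma powR_excess1_rev_ge s t : 1 < s <= 2 -> 0 < t <= 1 ->
  (s - 1) ^+ 2 * (1 - t) ^+ 2 <= 1 - t `^ s - s * t `^ (s - 1) * (1 - t).
Proof.
move=> /andP[s1 s2] /andP[t0 t1].
have B : t `^ (s - 1) <= 1 + (s - 1) * (t - 1) by apply: powR_le_affine => //; lra.
rewrite -(powR_predr s t0); move: B (powR_ge0 t (s - 1)).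
move: (t `^ (s - 1)) => z B z0.
have C : 0 <= 1 + (s - 1) * (1 - t) by rewrite addr_ge0// mulr_ge0//; lra.
by have := ler_wpM2r C B; lra.
Qed.

(* [z^(s-2)] is smallest at the larger of the two points, and [max^(2-s) <= 1 + max]. *)
Lemma power_excess_ge s x y : 1 < s <= 2 -> 0 < x -> 0 < y ->
  (s - 1) ^+ 2 * (x - y) ^+ 2 / (1 + x + y) <= power_excess s x y.
Proof.
move=> s12 x0 y0; have /andP[s1 s2] := s12.
have max2 z : 0 < z -> z ^+ 2 <= (1 + z) * z `^ s.
  move=> z0; have := @powR_le_affine (2 - s) z.
  have [->|s2'] := eqVneq s 2.
    by move=> _; rewrite powR_mulrn ?(ltW z0)//; have := exprn_gt0 2 z0; nra.
  have s2'' : s < 2 by rewrite lt_neqAle s2'.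
  move=> /(_ _ z0) B; have {}B := B ltac:(lra).
  have -> : z ^+ 2 = z `^ (2 - s) * z `^ s.
    rewrite -powRD ?subrK ?powR_mulrn ?(ltW z0)//.
    by rewrite (gt_eqF z0) implybT.
  by rewrite ler_wpM2r ?powR_ge0// (le_trans B)//; nra.
have D0 : 0 < 1 + x + y by lra.
have [xy|yx] := leP x y.
  rewrite power_excess_ratio//.
  have t0 : 0 < x / y by rewrite divr_gt0.
  apply: le_trans (ler_wpM2l (powR_ge0 _ _) (powR_excess1_ge s12 t0)).
  have -> : (x / y - 1) ^+ 2 = (x - y) ^+ 2 / y ^+ 2 by field; rewrite gt_eqF.
  have t1 : x / y <= 1 by rewrite ler_pdivrMr ?mul1r.
  have F0 : 0 < s - 1 + (2 - s) * (x / y).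
    by rewrite ltr_pwDl ?subr_gt0// mulr_ge0 ?subr_ge0// ltW.
  have F1 : s - 1 + (2 - s) * (x / y) <= 1 by nra.
  apply: (@le_trans _ _ (y `^ s * ((s - 1) ^+ 2 * ((x - y) ^+ 2 / y ^+ 2)))).
    have -> : y `^ s * ((s - 1) ^+ 2 * ((x - y) ^+ 2 / y ^+ 2)) =
       (s - 1) ^+ 2 * (x - y) ^+ 2 * (y `^ s / y ^+ 2).
      by field; rewrite gt_eqF.
    apply: ler_wpM2l; first by rewrite mulr_ge0 ?sqr_ge0.
    rewrite ler_pdivlMr ?exprn_gt0// mulrC ler_pdivrMr// mulrC.
    rewrite (le_trans (max2 _ y0))// ler_wpM2r ?powR_ge0//; lra.
  rewrite ler_wpM2l ?powR_ge0// ler_pdivlMr// ler_piMr//.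
  by rewrite mulr_ge0 ?sqr_ge0// divr_ge0 ?sqr_ge0.
have t01 : 0 < y / x <= 1 by rewrite divr_gt0//= ler_pdivrMr// mul1r ltW.
have -> : power_excess s x y =
    x `^ s * (1 - (y / x) `^ s - s * (y / x) `^ (s - 1) * (1 - y / x)).
  rewrite /power_excess [(y / x) `^ (s - 1)]powR_pred ?divr_gt0// !powR_div//.
  by rewrite powR_pred//; field; rewrite !gt_eqF ?powR_gt0.
apply: le_trans (ler_wpM2l (powR_ge0 _ _) (powR_excess1_rev_ge s12 t01)).
have -> : x `^ s * ((s - 1) ^+ 2 * (1 - y / x) ^+ 2) =
   (s - 1) ^+ 2 * (x - y) ^+ 2 * (x `^ s / x ^+ 2).
  by field; rewrite gt_eqF.
apply: ler_wpM2l; first by rewrite mulr_ge0 ?sqr_ge0.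
rewrite ler_pdivlMr ?exprn_gt0// mulrC ler_pdivrMr// mulrC.
rewrite (le_trans (max2 _ x0))// ler_wpM2r ?powR_ge0//; lra.
Qed.

End power_law.

(** * The pressure potential in closed form *)

Section helmholtz_power.
Context {R : realType} (a gamma : R).
Hypotheses (a_gt0 : 0 < a) (gamma_gt1 : 1 < gamma).
Implicit Types x y r : R.
Local Notation p := (pressure a gamma).

(** Value for the power law of [x] times the integral from 1 to [x] of [p(z)/z^2]. The estimates use
    this form; its agreement with [Helmholtz] at positive densities is proved separately. *)
Definition hpot x : R := a / (gamma - 1) * (x `^ gamma - x).
Definition hpot' x : R := a / (gamma - 1) * (gamma * x `^ (gamma - 1) - 1).

Let g1 : 0 < gamma - 1. Proof. by rewrite subr_gt0. Qed.
Let g1' : gamma - 1 != 0. Proof. by rewrite gt_eqF. Qed.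
Let c0 : 0 < a / (gamma - 1). Proof. by rewrite divr_gt0. Qed.

Lemma pressure_hpot x : 0 < x -> p x = x * hpot' x - hpot x.
Proof.
move=> x0; rewrite /pressure /hpot /hpot' -(powR_predr gamma x0).
by field.
Qed.

Lemma bregman_hpot x y : bregman hpot hpot' x y = a / (gamma - 1) * power_excess gamma x y.
Proof. by rewrite /bregman /hpot /hpot' /power_excess; ring. Qed.

Lemma bregman_hpot_ge0 x y : 0 < x -> 0 < y -> 0 <= bregman hpot hpot' x y.
Proof.
by move=> x0 y0; rewrite bregman_hpot mulr_ge0 ?power_excess_ge0// ltW.
Qed.

(** The pressure is [gamma - 1] times the potential plus a linear function, so the part of the
    pressure quadratic in the density error is controlled by the relative energy. *)
Lemma pressure_excess x r :
  p x - p r - a * gamma * r `^ (gamma - 1) * (x - r) =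
  (gamma - 1) * bregman hpot hpot' x r.
Proof. by rewrite bregman_hpot /power_excess /pressure; field. Qed.

Lemma bregman_hpot_ge x y : gamma <= 2 -> 0 < x -> 0 < y ->
  a * (gamma - 1) * ((x - y) ^+ 2 / (1 + x + y)) <= bregman hpot hpot' x y.
Proof.
move=> g2 x0 y0; rewrite bregman_hpot.
have g12 : 1 < gamma <= 2 by apply/andP.
have := ler_wpM2l (ltW c0) (power_excess_ge g12 x0 y0).
apply: le_trans; rewrite le_eqVlt; apply/orP; left; apply/eqP; field.
by rewrite g1' andbT gt_eqF//; lra.
Qed.

(** The denominator [1 + x] gives one formula for every [gamma]: quadratic for bounded [x], and
    linear for large [x], which is all that can be used when [gamma] is close to 1. *)
Lemma bregman_hpot_coercive (rlow rup : R) : 0 < rlow ->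
  exists2 c, 0 < c & forall x r, 0 < x -> rlow <= r <= rup ->
    c * ((x - r) ^+ 2 / (1 + x)) <= bregman hpot hpot' x r.
Proof.
move=> rl0; have [g2|g2] := leP gamma 2.
  (* A negative [rup] makes the range of [r] empty; otherwise [1 + rup] is a legitimate
     denominator. *)
  have [ru0|ru0] := ltP rup 0.
    by exists 1 => // x r x0 /andP[? ?]; lra.
  exists (a * (gamma - 1) / (1 + rup)).
    by rewrite divr_gt0 ?mulr_gt0//; lra.
  move=> x r x0 /andP[r1 r2]; have r0 : 0 < r by lra.
  apply: le_trans (bregman_hpot_ge g2 x0 r0).
  rewrite -[X in X <= _]mulrA; apply: ler_wpM2l; first by rewrite mulr_ge0// ltW.
  rewrite mulrCA; apply: ler_wpM2l; first exact: sqr_ge0.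
  rewrite -invfM lef_pV2 ?posrE; [nra|nra|lra].
exists (a / (gamma - 1) * (gamma / 2 * (rlow `^ (gamma - 2)))).
  by rewrite !mulr_gt0 ?powR_gt0 ?invr_gt0//; lra.
move=> x r x0 /andP[r1 r2]; have r0 : 0 < r by lra.
rewrite bregman_hpot -[X in X <= _]mulrA; apply: ler_wpM2l; first exact: ltW.
apply: le_trans (power_excess_ge_sq (ltW g2) x0 r0).
have -> : (x / r - 1) ^+ 2 = (x - r) ^+ 2 / r ^+ 2 by field; rewrite gt_eqF.
have E : r `^ gamma = r `^ (gamma - 2) * r ^+ 2.
  rewrite -powR_mulrn ?(ltW r0)// -powRD ?subrK//.
  by rewrite (gt_eqF r0) implybT.
rewrite E.
have -> : gamma / 2 * (r `^ (gamma - 2) * r ^+ 2) * ((x - r) ^+ 2 / r ^+ 2) =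
   gamma / 2 * (r `^ (gamma - 2) * (x - r) ^+ 2).
  by field; rewrite gt_eqF.
rewrite -[X in X <= _]mulrA; apply: ler_wpM2l; first lra.
apply: ler_pM; rewrite ?powR_ge0//.
- by rewrite divr_ge0 ?sqr_ge0//; lra.
- by apply: ge0_ler_powR; rewrite ?nnegrE; lra.
- by rewrite ler_pdivrMr ?ler_peMr ?sqr_ge0//; lra.
Qed.

Lemma le_1D_powR x : 0 < x -> x <= 1 + x `^ gamma.
Proof.
move=> x0; have := powR_ge_affine (ltW gamma_gt1) x0.
have := powR_ge0 x gamma; move: (x `^ gamma) => z z0 H.
have [x1|] := leP x 1; first lra.
by rewrite -subr_gt0 => x1; have := mulr_gt0 g1 x1; lra.
Qed.

End helmholtz_power.

(** * The renormalized entropy *)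

Section entropy.
Context {R : realType}.
Implicit Types x y : R.

(** Chosen for its second derivative [1/(1+x)]. When [gamma > 2] the second derivative of [hpot]
    vanishes at vacuum and cannot control density jumps there; this function controls them with the
    same weight [1/(1+x+y)] that [hpot] provides for [gamma <= 2]. *)
Definition entropy x : R := (1 + x) * ln (1 + x) - x.
Definition entropy' x : R := ln (1 + x).

Lemma ln_le_sub1 (z : R) : 0 < z -> ln z <= z - 1.
Proof. by move=> z0; rewrite -{1}[z](subrKC 1); apply: le_ln1Dx; lra. Qed.

(* With [X = 1+x], [Y = 1+y]: [X ln(X/Y) = -2X ln(sqrt(Y/X)) >= 2X - 2 sqrt(XY)], so the
   Bregman distance is at least [(sqrt X - sqrt Y)^2]. *)
Lemma bregman_entropy_ge x y : 0 < x -> 0 < y ->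
  (x - y) ^+ 2 / (1 + x + y) / 4 <= bregman entropy entropy' x y.
Proof.
move=> x0 y0.
have root (z : R) : 0 < z -> exists2 s, 0 < s & 1 + z = s ^+ 2.
  move=> z0; exists (Num.sqrt (1 + z)); first by rewrite sqrtr_gt0; lra.
  by rewrite sqr_sqrtr//; lra.
have [s s0 sE] := root x x0; have [t t0 tE] := root y y0.
have L := ln_le_sub1 (divr_gt0 t0 s0).
have E : bregman entropy entropy' x y =
    - 2 * s ^+ 2 * ln (t / s) - (s ^+ 2 - t ^+ 2).
  rewrite /bregman /entropy /entropy' sE tE.
  have -> : x = s ^+ 2 - 1 by lra.
  have -> : y = t ^+ 2 - 1 by lra.
  rewrite ln_div ?posrE// ?exprn_gt0// !lnXn//.
  move: (ln s) (ln t) => p q; ring.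
rewrite E; apply: (@le_trans _ _ ((s - t) ^+ 2)); last first.
  have -> : (s - t) ^+ 2 = - 2 * s ^+ 2 * (t / s - 1) - (s ^+ 2 - t ^+ 2).
    by field; rewrite gt_eqF.
  rewrite lerD2r; apply: ler_wnM2l L.
  by rewrite mulNr oppr_le0 mulr_ge0// sqr_ge0.
rewrite -mulrA -invfM ler_pdivrMr; last by lra.
have -> : x - y = (s - t) * (s + t) by rewrite -subr_sqr; lra.
rewrite exprMn; apply: ler_wpM2l; first exact: sqr_ge0.
have := sqr_ge0 (s - t); have := sqr_ge0 (s + t); lra.
Qed.

(** The quantity equals [x - ln (1 + x)]: the source produced by compression stays linear in the
    density. *)
Lemma entropy_flux_bound x : 0 < x -> 0 <= x * entropy' x - entropy x <= x.
Proof.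
move=> x0; rewrite /entropy /entropy'.
have L := @le_ln1Dx R x ltac:(lra).
have : 0 <= ln (1 + x) by rewrite ln_ge0//; lra.
move: L; move: (ln _) => z L z0.
by apply/andP; split; [|rewrite mulrDl mul1r]; lra.
Qed.

Lemma entropy_bound x : 0 < x -> 0 <= entropy x <= x + x ^+ 2.
Proof.
move=> x0; have /andP[_ B] := entropy_flux_bound x0.
have L := @le_ln1Dx R x ltac:(lra).
have L0 : 0 <= ln (1 + x) by rewrite ln_ge0//; lra.
have := @ln_le_sub1 (1 + x)^-1; rewrite invr_gt0 lnV ?posrE; last lra.
move=> /(_ ltac:(lra)) M; rewrite /entropy.
have : (1 + x) * ((1 + x)^-1 - 1) = - x by field; rewrite gt_eqF//; lra.
move: L L0 M; move: (ln _) ((1 + x)^-1) => z w L L0 M E.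
by apply/andP; split; nra.
Qed.

End entropy.

(** * Positivity of the density *)

Section positivity.
Context {R : realType} {d N : nat}.
Hypothesis N_gt0 : (0 < N)%N.
Local Notation cell := (cell d N).
Local Notation h := (@mesh R N).
Local Notation I := (@integral_pc R d N).

(* The mass flux out of the set [rho <= 0] is nonpositive. *)
Lemma density_gt0 (alpha tau : R) (rho0 rho : cell -> R) (u : 'I_d -> cell -> R) :
  0 < tau -> continuity_eq alpha tau rho0 rho u -> (forall k, 0 < rho0 k) ->
  forall k, 0 < rho k.
Proof.
move=> tau0 ceq r0 k; rewrite ltNge; apply/negP => rk.
pose phi (l : cell) : R := if rho l <= 0 then 1 else 0.
have h0 := @mesh_gt0 R N N_gt0.
have C := continuity_weak tau0 phi ceq.
have F j l : 0 <= mass_flux alpha rho u j l * diff_face j phi l.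
  rewrite /mass_flux /upwind /diff_face /phi.
  have hl : 0 <= h `^ alpha / h by rewrite divr_ge0 ?powR_ge0// ltW.
  have mx : 0 <= Num.max 0 (u j l) by rewrite le_max lexx.
  have mn : Num.min 0 (u j l) <= 0 by rewrite ge_min lexx.
  move: mx mn; move: (Num.max _ _) (Num.min _ _) => x y x0 y0.
  set A := (X in _ * ((X - _) / _)); set B := (X in _ * ((_ - X) / _)).
  have -> : (rho l * x + rho (up j l) * y
      - h `^ alpha * ((rho (up j l) - rho l) / h)) * ((A - B) / h) =
    h^-1 * ((rho l * x + rho (up j l) * y - (rho (up j l) - rho l) * (h `^ alpha / h))
            * (A - B)) by ring.
  apply: mulr_ge0; first by rewrite invr_ge0 ltW.
  move: hl; move: (h `^ alpha / h) => c c0; rewrite {}/A {}/B.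
  have [a|a] := leP (rho (up j l)) 0; have [b|b] := leP (rho l) 0;
    rewrite ?subrr ?mulr0// ?subr0 ?sub0r ?mulr1 ?mulrN1 ?oppr_ge0.
    have := mulr_ge0 (ltW b) x0; have := mulr_le0 a y0.
    have : (rho (up j l) - rho l) * c <= 0 by rewrite mulr_le0_ge0//; lra.
    lra.
  have := mulr_le0_ge0 b x0; have := mulr_ge0_le0 (ltW a) y0.
  have : 0 <= (rho (up j l) - rho l) * c by rewrite mulr_ge0//; lra.
  lra.
have P : 0 <= I (fun l => (rho l - rho0 l) * phi l).
  rewrite C; apply: mulr_ge0; first exact: ltW.
  by apply: sumr_ge0 => j _; apply: Ipc_ge0.
have P' l : 0 <= (rho0 l - rho l) * phi l.
  rewrite /phi; have [b|b] := leP (rho l) 0; rewrite ?mulr0// mulr1.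
  by have := r0 l; lra.
(* Cell [k] alone contributes a positive amount to an integral of nonnegative terms that the flux
   balance makes nonpositive. *)
have := Ipc_le_sum_cell N_gt0 k P'.
have -> : I (fun l => (rho0 l - rho l) * phi l) = - I (fun l => (rho l - rho0 l) * phi l).
  by rewrite -IpcN; apply: Ipc_eq => l; ring.
rewrite /phi rk mulr1; apply/negP; rewrite -ltNge; apply: (@le_lt_trans _ _ 0).
  by rewrite oppr_le0.
by rewrite mulr_gt0 ?exprn_gt0//; have := r0 k; lra.
Qed.

End positivity.

(** * Poincare inequality weighted by the density *)

Section poincare.
Context {R : realType} {d N : nat}.
Hypothesis N_gt0 : (0 < N)%N.
Local Notation cell := (cell d N).
Local Notation h := (@mesh R N).
Local Notation I := (@integral_pc R d N).
Implicit Types (f : cell -> R) (j : 'I_d) (s k : cell).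

Lemma Ipc_iter_up n j f : I (fun k => f (iter n (up j) k)) = I f.
Proof.
elim: n f => [|n IH] f //; rewrite -[RHS](IH f).
by rewrite -[RHS](Ipc_up j); apply: Ipc_eq => k; rewrite iterSr.
Qed.

Lemma sqr_sum_le n (F : 'I_n -> R) : (\sum_i F i) ^+ 2 <= n%:R * \sum_i F i ^+ 2.
Proof.
elim: n F => [|n IH] F; first by rewrite !big_ord0 expr0n/= mulr0.
rewrite !big_ord_recl; have := IH (fun i => F (lift ord0 i)).
have : 0 <= \sum_i F (lift ord0 i) ^+ 2 by apply: sumr_ge0 => i _; apply: sqr_ge0.
move: (\sum_i F (lift _ _)) (\sum_i F (lift _ _) ^+ 2) (F ord0) => S Q x {F IH} Q0 H.
case: (eqVneq n 0%N) H => [->|n0] H.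
  have /eqP : S ^+ 2 = 0.
    by apply/eqP; rewrite eq_le sqr_ge0 andbT; move: H; rewrite mul0r.
  by rewrite sqrf_eq0 => /eqP S0; move: H; rewrite S0 expr0n/= => H; nra.
have n1 : (0 : R) < n%:R by rewrite ltr0n lt0n.
rewrite -natr1; move: n1 H; move: (n%:R : R) => m m0 H.
have m0' : 0 < m^-1 by rewrite invr_gt0.
have := mulr_ge0 (ltW m0') (sqr_ge0 (m * x - S)).
have -> : m^-1 * (m * x - S) ^+ 2 = m * x ^+ 2 - 2 * x * S + m^-1 * S ^+ 2.
  by field; rewrite gt_eqF.
have : m^-1 * S ^+ 2 <= Q by rewrite mulrC ler_pdivrMr// mulrC.
lra.
Qed.

(** Telescoping over [n] cells and Cauchy-Schwarz produce the factor [(n h)^2], at most 1 because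
    the path is not longer than the torus. *)
Lemma Ipc_iter_up_sub n j f : (n <= N)%N ->
  I (fun k => (f (iter n (up j) k) - f k) ^+ 2) <= I (fun k => diff_face j f k ^+ 2).
Proof.
move=> nN; have h0 := @mesh_gt0 R N N_gt0.
have tel k : f (iter n (up j) k) - f k =
    \sum_(m < n) (h * diff_face j f (iter m (up j) k)).
  elim: n {nN} => [|n IH]; first by rewrite big_ord0 subrr.
  rewrite big_ord_recr/= -IH /diff_face; field; by rewrite gt_eqF.
apply: (@le_trans _ _ (I (fun k => n%:R * \sum_(m < n)
    (h * diff_face j f (iter m (up j) k)) ^+ 2))).
  by apply: Ipc_le => // k; rewrite tel sqr_sum_le.
rewrite IpcZ Ipc_sum.
under eq_bigr => m _ do
  rewrite (Ipc_iter_up m j (fun k => (h * diff_face j f k) ^+ 2)).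
rewrite sumr_const card_ord -[X in _ * X <= _]mulr_natl.
have -> : I (fun k => (h * diff_face j f k) ^+ 2) =
    h ^+ 2 * I (fun k => diff_face j f k ^+ 2).
  by rewrite -IpcZ; apply: Ipc_eq => k; rewrite exprMn.
have nh : (n%:R : R) * h <= 1.
  by rewrite ler_pdivrMr ?mul1r ?ler_nat// ltr0n.
have n0 : 0 <= (n%:R : R) * h by rewrite mulr_ge0// ltW.
have X0 : 0 <= I (fun k => diff_face j f k ^+ 2).
  by apply: Ipc_ge0 => // k; apply: sqr_ge0.
move: X0 n0 nh; move: (I _) (n%:R : R) => X m X0 m0 m1.
have -> : m * (m * (h ^+ 2 * X)) = (m * h) ^+ 2 * X by ring.
by rewrite ler_piMl// expr_le1.
Qed.

(** Translation of the cyclic grid, [s] being read as a vector of step counts. The path visits one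
    direction after the other, so each leg costs one directional difference. *)
Definition shift (s k : cell) : cell :=
  foldr (fun j l => iter (s j) (up j) l) k (enum 'I_d).

Lemma Ipc_shift_seq (js : seq 'I_d) s f :
  I (fun k => f (foldr (fun j l => iter (s j) (up j) l) k js)) = I f.
Proof.
elim: js f => [|j js IH] f //=.
by rewrite (IH (fun k => f (iter (s j) (up j) k))) Ipc_iter_up.
Qed.

Lemma Ipc_shift_sub_seq (js : seq 'I_d) s f :
  I (fun k => (f (foldr (fun j l => iter (s j) (up j) l) k js) - f k) ^+ 2) <=
  2 ^+ (size js) * \sum_(j <- js) I (fun k => diff_face j f k ^+ 2).
Proof.
elim: js => [|j js IH] /=.
  rewrite big_nil mulr0 (@Ipc_eq _ _ _ _ (fun=> 0)) ?Ipc_cst// => k.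
  by rewrite subrr expr0n.
pose T k := foldr (fun j l => iter (s j) (up j) l) k js.
apply: (@le_trans _ _ (I (fun k => 2 * (f (iter (s j) (up j) (T k)) - f (T k)) ^+ 2
    + 2 * (f (T k) - f k) ^+ 2))).
  apply: Ipc_le => // k; rewrite -/(T k).
  have := sqr_ge0 (f (iter (s j) (up j) (T k)) - f (T k) - (f (T k) - f k)).
  by move: (f _) (f (T k)) (f k) => x y z; lra.
rewrite IpcD !IpcZ big_cons exprS -mulrA mulrDr mulrDr lerD//; last first.
  by rewrite ler_wpM2l.
rewrite (Ipc_shift_seq js s (fun l => (f (iter (s j) (up j) l) - f l) ^+ 2)).
rewrite ler_wpM2l// (le_trans (Ipc_iter_up_sub _ _ _))//; first exact: ltnW.
rewrite ler_peMl ?Ipc_ge0// => [k|]; first exact: sqr_ge0.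
by rewrite exprn_ege1// ler1n.
Qed.

Lemma val_iter_ordS n (x : 'I_N) : val (iter n (@ordS N) x) = ((x + n) %% N)%N.
Proof.
elim: n => [|n IH]; first by rewrite addn0 modn_small.
by rewrite iterS/= IH -addn1 modnDml addn1 addnS.
Qed.

Lemma iter_upE n j k l : iter n (up j) k l = if l == j then iter n (@ordS N) (k l) else k l.
Proof.
elim: n => [|n IH]; first by case: eqP.
by rewrite iterS ffunE IH; case: eqP.
Qed.

Lemma shift_val s k j : val (shift s k j) = ((k j + s j) %% N)%N.
Proof.
have aux (js : seq 'I_d) : uniq js ->
   val (foldr (fun j l => iter (s j) (up j) l) k js j) =
   if j \in js then ((k j + s j) %% N)%N else k j.
  elim: js => [|i js IH]//= /andP[ijs /IH{}IH]; rewrite iter_upE inE.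
  case: eqVneq IH => [->|_]//=; rewrite (negPf ijs) => E.
  by rewrite val_iter_ordS E.
by rewrite aux ?enum_uniq// mem_enum.
Qed.

(** For fixed [k] the translation vectors parametrize the cells, so that an average over [s] is an
    average over the whole grid. *)
Lemma shift_inj k : injective (shift^~ k).
Proof.
move=> s t st; apply/ffunP => j; apply: val_inj.
have := congr1 (fun c : cell => val (c j)) st; rewrite !shift_val => /eqP.
by rewrite eqn_modDl !modn_small// => /eqP.
Qed.

Lemma Ipc_shiftl k f : I (fun s => f (shift s k)) = I f.
Proof.
rewrite /integral_pc [in RHS](reindex_inj (@shift_inj k)).
by [].
Qed.

(** The value [f(k)] is compared with [f] at each translate of [k], with the weight found there, and
    the result is averaged over all translations. The weighted integral of [f^2] on the right
    replaces the subtraction of a mean value. *)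
Lemma weighted_poincare (w f : cell -> R) : (forall k, 0 <= w k <= 1) ->
  I w * I (fun k => f k ^+ 2) <=
  2 * I (fun k => w k * f k ^+ 2)
  + 2 ^+ d.+1 * \sum_j I (fun k => diff_face j f k ^+ 2).
Proof.
move=> w01.
have -> : I w * I (fun k => f k ^+ 2) = I (fun s => I (fun k => w (shift s k) * f k ^+ 2)).
  transitivity (I (fun k => I (fun s => w (shift s k) * f k ^+ 2))).
    under [RHS]Ipc_eq do rewrite IpcZr Ipc_shiftl.
    by rewrite IpcZ.
  by rewrite /integral_pc -!mulr_sumr exchange_big.
have -> : 2 * I (fun k => w k * f k ^+ 2)
  + 2 ^+ d.+1 * \sum_j I (fun k => diff_face j f k ^+ 2) =
  I (fun s => 2 * I (fun k => w k * f k ^+ 2)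
  + 2 ^+ d.+1 * \sum_j I (fun k => diff_face j f k ^+ 2)) by rewrite Ipc_cst.
apply: Ipc_le => // s.
apply: (@le_trans _ _ (I (fun k => 2 * (w (shift s k) * f (shift s k) ^+ 2)
   + 2 * (f (shift s k) - f k) ^+ 2))).
  apply: Ipc_le => // k; have /andP[w0 w1] := w01 (shift s k).
  move: (w _) w0 w1 => v v0 v1; move: (f _) (f k) => x y.
  have := mulr_ge0 v0 (sqr_ge0 (x - y - x)); have := mulr_ge0 v0 (sqr_ge0 (2 * x - y)).
  have : 0 <= (1 - v) * (x - y) ^+ 2 by rewrite mulr_ge0 ?sqr_ge0//; lra.
  lra.
rewrite IpcD !IpcZ (Ipc_shift_seq _ s (fun k => w k * f k ^+ 2)) lerD2l exprS -mulrA.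
rewrite ler_wpM2l//.
have := Ipc_shift_sub_seq (enum 'I_d) s f.
by rewrite size_enum_ord big_enum.
Qed.

End poincare.

(* The density bounds force [rho >= M/2] on a set of measure bounded below; the weight in
   the Poincare inequality is the indicator of that set. *)
Lemma density_poincare (R : realType) (d : nat) (gamma M B : R) :
  1 < gamma -> 0 < M -> 0 < B ->
  exists2 C : R, 0 < C & forall (N : nat) (rho f : cell d N -> R), (0 < N)%N ->
    (forall k, 0 < rho k) -> integral_pc rho = M ->
    integral_pc (fun k => rho k `^ gamma) <= B ->
    integral_pc (fun k => f k ^+ 2) <=
    C * (integral_pc (fun k => rho k * f k ^+ 2)
         + \sum_j integral_pc (fun k => diff_face j f k ^+ 2)).
Proof.
move=> g1 M0 B0.
(* Above [T] one has [rho <= M/(4B) rho^gamma], so those cells carry at most a quarter of the mass;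
   cells with [rho < M/2] carry at most half. The remaining quarter has density at most [T], so the
   set [rho >= M/2] has measure at least [M/(4T)]. *)
pose T := (4 * B / M) `^ (gamma - 1)^-1.
have q0 : 0 < 4 * B / M by rewrite divr_gt0 ?mulr_gt0.
have T0 : 0 < T by rewrite powR_gt0.
have TE : T `^ (gamma - 1) = 4 * B / M.
  rewrite -powRrM mulVf ?powRr1// ?ltW//; by rewrite gt_eqF// subr_gt0.
exists (4 * T / M * (4 / M + 2 ^+ d.+1)).
  by rewrite mulr_gt0 ?divr_gt0 ?mulr_gt0// addr_gt0 ?divr_gt0// exprn_gt0.
move=> N rho f N0 r0 rM rB.
pose w k : R := if M / 2 <= rho k then 1 else 0.
have w01 k : 0 <= w k <= 1 by rewrite /w; case: ifP; rewrite ?lexx ?ler01.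
have W : M / 4 <= T * integral_pc w.
  have : integral_pc rho <= integral_pc (fun k => M / 2 + (M / (4 * B) * rho k `^ gamma
     + T * w k)).
    apply: Ipc_le => // k; rewrite /w; have [Hk|Hk] := leP (M / 2) (rho k); last first.
      by rewrite mulr0 addr0; apply: (le_trans (ltW Hk)); rewrite lerDl mulr_ge0 ?powR_ge0//
        divr_ge0 ?mulr_ge0// ltW.
    rewrite mulr1; have [rT|Tr] := leP (rho k) T.
      have : 0 <= M / (4 * B) * rho k `^ gamma.
        by rewrite mulr_ge0 ?powR_ge0// divr_ge0 ?mulr_ge0// ltW.
      lra.
    have : rho k <= M / (4 * B) * rho k `^ gamma.
      rewrite -(powR_predr gamma (r0 k)) mulrCA ler_peMr ?(ltW (r0 k))//.
      rewrite -invf_div mulrC ler_pdivlMr// mul1r.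
      by rewrite -TE; apply: ge0_ler_powR; rewrite ?nnegrE ?ltW// subr_gt0.
    lra.
  rewrite !IpcD !IpcZ Ipc_cst// rM.
  have : M / (4 * B) * integral_pc (fun k => rho k `^ gamma) <= M / 4.
    apply: (@le_trans _ _ (M / (4 * B) * B)).
      by apply: ler_wpM2l rB; rewrite divr_ge0 ?mulr_ge0// ltW.
    by rewrite le_eqVlt; apply/orP; left; apply/eqP; field; rewrite gt_eqF.
  lra.
have P := weighted_poincare N0 f w01.
have Q : integral_pc (fun k => w k * f k ^+ 2) <=
    2 / M * integral_pc (fun k => rho k * f k ^+ 2).
  rewrite -IpcZ; apply: Ipc_le => // k; rewrite mulrA ler_wpM2r ?sqr_ge0// /w.
  have [H|H] := leP (M / 2) (rho k).
    have m2 : 0 <= 2 / M by rewrite divr_ge0// ltW.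
    have := ler_wpM2l m2 H; have -> : 2 / M * (M / 2) = 1 by field; rewrite gt_eqF.
    by [].
  by rewrite mulr_ge0 ?divr_ge0// ltW.
have F0 : 0 <= integral_pc (fun k => f k ^+ 2) by apply: Ipc_ge0 => // k; apply: sqr_ge0.
have G0 : 0 <= integral_pc (fun k => rho k * f k ^+ 2).
  by apply: Ipc_ge0 => // k; rewrite mulr_ge0 ?sqr_ge0// ltW.
have D0 : 0 <= \sum_j integral_pc (fun k => diff_face j f k ^+ 2).
  by apply: sumr_ge0 => j _; apply: Ipc_ge0 => // k; apply: sqr_ge0.
have K0 : 0 < (2 : R) ^+ d.+1 by rewrite exprn_gt0.
have M4 : 0 < 4 / M by rewrite divr_gt0.
have : M / 4 * integral_pc (fun k => f k ^+ 2) <=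
   T * ((4 / M + 2 ^+ d.+1) * (integral_pc (fun k => rho k * f k ^+ 2)
         + \sum_j integral_pc (fun k => diff_face j f k ^+ 2))).
  apply: (le_trans (ler_wpM2r F0 W)); rewrite -mulrA; apply: ler_wpM2l; first exact: ltW.
  apply: (le_trans P).
  have : 2 * integral_pc (fun k => w k * f k ^+ 2) <=
     4 / M * integral_pc (fun k => rho k * f k ^+ 2) by lra.
  have := mulr_ge0 (ltW K0) G0; have := mulr_ge0 (ltW M4) D0; lra.
rewrite -ler_pdivlMl ?divr_gt0// => /le_trans; apply.
by rewrite le_eqVlt; apply/orP; left; apply/eqP; field; rewrite gt_eqF.
Qed.

(** * One time step: terms that can be absorbed *)

Section one_step.
Context {R : realType} (d : nat).
Variables (a gamma mu lambda alpha M B rlow rup : R).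
Hypotheses (a_gt0 : 0 < a) (gamma_gt1 : 1 < gamma) (gammad : d%:R / 2 <= gamma)
  (mu_gt0 : 0 < mu) (mulambda_ge0 : 0 <= mu + lambda) (alpha_gt1 : 1 < alpha)
  (M_gt0 : 0 < M) (B_ge1 : 1 <= B) (rlow_gt0 : 0 < rlow).
Local Notation p := (pressure a gamma).
Local Notation H := (hpot a gamma).
Local Notation H' := (hpot' a gamma).
Let A : R := Num.min ((2 * gamma - d%:R) / gamma) 2^-1.

(* One time step of the scheme with discrete test fields [s_r], [s_W].  The arrays [s_psi],
   [s_G], [s_D], [s_Z] express that the test fields solve the Navier-Stokes system up to
   [O(h)]: they stand for averages of [H'(r)], of the velocity gradient and of the
   divergence on faces, and of [div S / r] on cells. *)
Record step : Type := Step {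
  s_N : nat; s_tau : R;
  s_rho0 : cell d s_N -> R; s_rho : cell d s_N -> R;
  s_ubar0 : 'I_d -> cell d s_N -> R; s_u : 'I_d -> cell d s_N -> R;
  s_r0 : cell d s_N -> R; s_r : cell d s_N -> R;
  s_W0 : 'I_d -> cell d s_N -> R; s_W : 'I_d -> cell d s_N -> R;
  s_psi : 'I_d -> cell d s_N -> R;
  s_G : 'I_d -> 'I_d -> cell d s_N -> R;
  s_D : 'I_d -> cell d s_N -> R;
  s_Z : 'I_d -> cell d s_N -> R;
  s_N_gt0 : (0 < s_N)%N;
  s_tau_gt0 : 0 < s_tau;
  s_tau_le : s_tau <= B * @mesh R s_N;
  s_rho0_gt0 : forall k, 0 < s_rho0 k;
  s_rho_gt0 : forall k, 0 < s_rho k;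
  s_mass : integral_pc s_rho = M;
  s_kinetic : integral_pc (fun k => s_rho k * \sum_i mean s_u i k ^+ 2) <= B;
  s_internal : integral_pc (fun k => s_rho k `^ gamma) <= B;
  s_continuity : continuity_eq alpha s_tau s_rho0 s_rho s_u;
  s_momentum : momentum_eq a gamma mu lambda alpha s_tau s_rho0 s_ubar0 s_rho s_u;
  s_r0_itv : forall k, rlow <= s_r0 k <= rup;
  s_r_itv : forall k, rlow <= s_r k <= rup;
  s_W0_le : forall i k, `|s_W0 i k| <= B;
  s_W_le : forall i k, `|s_W i k| <= B;
  s_WB : forall i k, `|s_W i k - s_W0 i k| <= B * s_tau;
  s_dW0_le : forall i j k, `|diff_face j (s_W0 i) k| <= B;
  s_dW_le : forall i j k, `|diff_face j (s_W i) k| <= B;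
  s_dWB : forall i j k,
    `|diff_face j (s_W i) k - diff_face j (s_W0 i) k| <= B * s_tau;
  s_ddW0_le : forall i j l k, `|diff_face l (diff_face j (s_W0 i)) k| <= B;
  s_ddW_le : forall i j l k, `|diff_face l (diff_face j (s_W i)) k| <= B;
  s_phiB : forall k, `|H' (s_r k) - H' (s_r0 k)| <= B * s_tau;
  s_dphi_le : forall j k, `|diff_face j (fun l => H' (s_r0 l)) k| <= B;
  s_pB : forall k, `|p (s_r k) - p (s_r0 k)| <= B * s_tau;
  s_Z_le : forall i k, `|s_Z i k| <= B;
  s_velocity : forall i k,
    `|(mean s_W i k - mean s_W0 i k) / s_tau
      + \sum_j mean s_W0 j k * diff_face j (mean s_W0 i) k
      + diff_cell i (s_psi i) k - s_Z i k| <= B * @mesh R s_N;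
  s_stress : forall i k,
    `|s_r k * s_Z i k - mu * \sum_j diff_cell j (s_G i j) k
      - (mu + lambda) * diff_cell i (s_D i) k| <= B * @mesh R s_N;
  s_psi_le : forall i k,
    `|s_psi i k - avg_face i (fun l => H' (s_r0 l)) k| <= B * @mesh R s_N;
  s_G_le : forall i j k, `|s_G i j k - diff_face j (s_W0 i) k| <= B * @mesh R s_N;
  s_D_le : forall i k, `|s_D i k - div_cell s_W0 k| <= B * @mesh R s_N;
  s_transport : forall k,
    `|(H' (s_r k) - H' (s_r0 k)) / s_tau
      + \sum_i mean s_W0 i k * diff_cell i (s_psi i) k
      + a * gamma * s_r0 k `^ (gamma - 1) * div_cell s_W0 k| <= B * @mesh R s_N;
  s_pressure :
    `|integral_pc (fun k => (p (s_r k) - p (s_r0 k)) / s_tau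
      + (a * gamma * s_r0 k `^ (gamma - 1) * s_r0 k - p (s_r0 k)) * div_cell s_W0 k)|
     <= B * @mesh R s_N
}.

Arguments s_rho0 : clear implicits.
Arguments s_rho : clear implicits.
Arguments s_ubar0 : clear implicits.
Arguments s_u : clear implicits.
Arguments s_r0 : clear implicits.
Arguments s_r : clear implicits.
Arguments s_W0 : clear implicits.
Arguments s_W : clear implicits.
Arguments s_psi : clear implicits.
Arguments s_G : clear implicits.
Arguments s_D : clear implicits.
Arguments s_Z : clear implicits.

Implicit Types s : step.
Local Notation h s := (@mesh R (s_N s)).
Local Notation I := (@integral_pc R d _).
Local Notation ub s := (mean (s_u s)).

Definition err s (i : 'I_d) (k : cell d (s_N s)) : R := s_u s i k - s_W s i k.

Definition gradE s : R := grad_norm2 (@err s).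

(** The part of the numerical dissipation used in the estimates, upwind and diffusive. The weight is
    chosen so that this quantity is dominated by the dissipation of [hpot] for [gamma <= 2] and by
    that of [entropy] for [gamma > 2]. *)
Definition jumps s : R :=
  \sum_j I (fun k => `|s_u s j k| * (s_rho s (up j k) - s_rho s k) ^+ 2
                     / (1 + s_rho s k + s_rho s (up j k)) / h s)
  + \sum_j I (fun k => h s `^ alpha * diff_face j (s_rho s) k ^+ 2
                     / (1 + s_rho s k + s_rho s (up j k))).

Definition relE s : R :=
  I (fun k => 2^-1 * s_rho s k * (\sum_i (ub s i k - mean (s_W s) i k) ^+ 2)
              + bregman H H' (s_rho s k) (s_r s k)).

(* Quantities absorbed by viscosity, numerical dissipation, the relative energy and the
   convergence rate. *)
Definition negligible (T : step -> R) : Prop :=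
  forall delta : R, 0 < delta -> exists2 C : R, 0 < C & forall s,
    T s <= delta * (gradE s + Num.sqrt (h s) * jumps s) + C * (relE s + h s `^ A).

Let h_gt0 s : 0 < h s. Proof. exact: mesh_gt0 (s_N_gt0 s). Qed.
Let h_le1 s : h s <= 1. Proof. exact: mesh_le1 (s_N_gt0 s). Qed.
Let B_gt0 : 0 < B. Proof. exact: lt_le_trans B_ge1. Qed.

Lemma gradE_ge0 s : 0 <= gradE s.
Proof.
apply: sumr_ge0 => i _; apply: sumr_ge0 => j _.
by apply: Ipc_ge0 => [|k]; [exact: s_N_gt0|exact: sqr_ge0].
Qed.

Lemma jumps_ge0 s : 0 <= jumps s.
Proof.
have D k j : 0 <= (1 + s_rho s k + s_rho s (up j k))^-1.
  by rewrite invr_ge0; have := s_rho_gt0 k; have := s_rho_gt0 (up j k); lra.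
apply: addr_ge0; apply: sumr_ge0 => j _; apply: Ipc_ge0 => [|k]; try exact: s_N_gt0.
  by rewrite mulr_ge0 ?invr_ge0 ?(ltW (h_gt0 s))// mulr_ge0// mulr_ge0// sqr_ge0.
by rewrite mulr_ge0// mulr_ge0 ?powR_ge0// sqr_ge0.
Qed.

Let s_r_gt0 s k : 0 < s_r s k.
Proof. by have /andP[r1 _] := s_r_itv k; apply: lt_le_trans r1. Qed.

Lemma relE_ge0 s : 0 <= relE s.
Proof.
apply: Ipc_ge0 => [|k]; first exact: s_N_gt0.
apply: addr_ge0; last by rewrite bregman_hpot_ge0// s_rho_gt0.
apply: mulr_ge0; first by rewrite mulr_ge0// ltW// s_rho_gt0.
by apply: sumr_ge0 => i _; exact: sqr_ge0.
Qed.

Lemma rate_ge0 s : 0 <= h s `^ A. Proof. exact: powR_ge0. Qed.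

Lemma neg_le (T T' : step -> R) : (forall s, T s <= T' s) -> negligible T' -> negligible T.
Proof.
move=> TT' nT' del del0; have [C C0 HC] := nT' del del0.
by exists C => // s; apply: le_trans (HC s).
Qed.

Lemma negD (T T' : step -> R) : negligible T -> negligible T' ->
  negligible (fun s => T s + T' s).
Proof.
move=> nT nT' del del0; have d2 : 0 < del / 2 by rewrite divr_gt0.
have [C C0 HC] := nT _ d2; have [C' C'0 HC'] := nT' _ d2.
exists (C + C') => [|s]; first exact: addr_gt0.
have := HC s; have := HC' s; lra.
Qed.

Lemma negZ (c : R) (T : step -> R) : 0 <= c -> negligible T ->
  negligible (fun s => c * T s).
Proof.
move=> c0 nT del del0.
have c1 : 0 < c + 1 by lra.
have [C C0 HC] := nT (del / (c + 1)) (divr_gt0 del0 c1).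
exists ((c + 1) * C) => [|s]; first exact: mulr_gt0.
have G0 : 0 <= gradE s + Num.sqrt (h s) * jumps s.
  by rewrite addr_ge0 ?gradE_ge0// mulr_ge0 ?sqrtr_ge0 ?jumps_ge0.
have E0 : 0 <= relE s + h s `^ A by rewrite addr_ge0 ?relE_ge0 ?rate_ge0.
apply: (le_trans (ler_wpM2l c0 (HC s))); rewrite mulrDr lerD//.
  rewrite mulrA; apply: ler_wpM2r => //.
  by rewrite mulrCA ler_piMr ?(ltW del0)// ler_pdivrMr// mul1r; lra.
by rewrite mulrA; apply: ler_wpM2r => //; apply: ler_wpM2r; lra.
Qed.

Lemma neg_sum (J : finType) (T : J -> step -> R) : (forall j, negligible (T j)) ->
  negligible (fun s => \sum_j T j s).
Proof.
move=> nT; elim: (index_enum J) => [|j js IH].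
  move=> del del0; exists 1 => // s; rewrite big_nil.
  have G0 : 0 <= del * (gradE s + Num.sqrt (h s) * jumps s).
    by rewrite mulr_ge0 ?(ltW del0)// addr_ge0 ?gradE_ge0// mulr_ge0 ?sqrtr_ge0 ?jumps_ge0.
  by have := rate_ge0 s; have := relE_ge0 s; lra.
by apply: neg_le (negD (nT j) IH) => s; rewrite big_cons.
Qed.

Lemma neg_rate (c : R) : 0 <= c -> negligible (fun s => c * h s `^ A).
Proof.
move=> c0 del del0; exists (c + 1) => [|s]; first lra.
have G0 : 0 <= del * (gradE s + Num.sqrt (h s) * jumps s).
  by rewrite mulr_ge0 ?(ltW del0)// addr_ge0 ?gradE_ge0// mulr_ge0 ?sqrtr_ge0 ?jumps_ge0.
have := mulr_ge0 c0 (relE_ge0 s); have := relE_ge0 s; have := rate_ge0 s.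
move: (relE s) (h s `^ A) => x y; lra.
Qed.

Lemma neg_relE : negligible relE.
Proof.
move=> del del0; exists 1 => // s.
have G0 : 0 <= del * (gradE s + Num.sqrt (h s) * jumps s).
  by rewrite mulr_ge0 ?(ltW del0)// addr_ge0 ?gradE_ge0// mulr_ge0 ?sqrtr_ge0 ?jumps_ge0.
have := rate_ge0 s; lra.
Qed.

Lemma neg_gradE (T : step -> R) : (forall eps : R, 0 < eps -> exists2 C : R, 0 < C &
    forall s, T s <= eps * (gradE s + relE s) + C * (relE s + h s `^ A)) -> negligible T.
Proof.
move=> HT del del0; have [C C0 HC] := HT del del0.
exists (del + C) => [|s]; first exact: addr_gt0.
have := HC s; have : 0 <= del * (Num.sqrt (h s) * jumps s).
  by rewrite !mulr_ge0 ?sqrtr_ge0 ?jumps_ge0// ltW.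
have := mulr_ge0 (ltW del0) (rate_ge0 s); lra.
Qed.

Lemma A_le_half : A <= 2^-1. Proof. by rewrite /A ge_min lexx orbT. Qed.

Let g0 : 0 < gamma. Proof. exact: lt_trans gamma_gt1. Qed.

Lemma A_ge0 : 0 <= A.
Proof.
rewrite /A le_min invr_ge0 ler0n andbT divr_ge0 ?(ltW g0)//.
by move: gammad; lra.
Qed.

Lemma sqrt_mesh_le s : Num.sqrt (h s) <= h s `^ A.
Proof.
rewrite -powR12_sqrt ?(ltW (h_gt0 s))//.
by apply: ger_powR; rewrite ?h_gt0 ?h_le1// A_le_half.
Qed.

Lemma mesh_le_sqrt s : h s <= Num.sqrt (h s).
Proof.
rewrite -{1}[h s](@sqr_sqrtr _ (h s)) ?(ltW (h_gt0 s))// expr2 ler_piMl ?sqrtr_ge0//.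
by rewrite -[X in _ <= X]sqrtr1 ler_sqrt.
Qed.

Lemma mesh_le_rate s : h s <= h s `^ A.
Proof. exact: le_trans (mesh_le_sqrt s) (sqrt_mesh_le s). Qed.

Lemma neg_mesh (c : R) (T : step -> R) : 0 <= c -> (forall s, T s <= c * h s) ->
  negligible T.
Proof.
move=> c0 HT; apply: neg_le (neg_rate c0) => s; apply: le_trans (HT s) _.
by apply: ler_wpM2l => //; apply: mesh_le_rate.
Qed.

Lemma neg_sqrt (c : R) (T : step -> R) : 0 <= c ->
  (forall s, T s <= c * Num.sqrt (h s)) -> negligible T.
Proof.
move=> c0 HT; apply: neg_le (neg_rate c0) => s; apply: le_trans (HT s) _.
by apply: ler_wpM2l => //; apply: sqrt_mesh_le.
Qed.

(** Inverse estimate: a single cell of volume [h^d] satisfies [h^d rho^gamma <= B], and [B >= 1]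
    gives [B^(1/gamma) <= B]. *)
Lemma rho_max s k : s_rho s k <= B * h s `^ (- (d%:R / gamma)).
Proof.
have hd : 0 < h s ^+ d by rewrite exprn_gt0.
have le1 : h s ^+ d * s_rho s k `^ gamma <= B.
  apply: le_trans (s_internal s); apply: (Ipc_le_sum_cell (s_N_gt0 s) k) => l.
  exact: powR_ge0.
have -> : s_rho s k = (s_rho s k `^ gamma) `^ gamma^-1.
  by rewrite -powRrM divff ?gt_eqF// powRr1 ?ltW ?s_rho_gt0.
have -> : h s `^ (- (d%:R / gamma)) = ((h s ^+ d)^-1) `^ gamma^-1.
  rewrite -mulNr powRrM; congr (_ `^ _).
  by rewrite powRN powR_mulrn// ltW.
have BB : B `^ gamma^-1 <= B.
  by apply: ler1_powR => //; rewrite invf_le1 ?ltW.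
apply: (@le_trans _ _ ((B * (h s ^+ d)^-1) `^ gamma^-1)).
  apply: ge0_ler_powR; rewrite ?nnegrE ?invr_ge0 ?powR_ge0 ?(ltW g0)//.
    by rewrite mulr_ge0 ?invr_ge0 ?(ltW hd)// ltW.
  by rewrite ler_pdivlMr// mulrC.
rewrite powRM ?invr_ge0 ?(ltW hd) ?(ltW B_gt0)//.
by apply: ler_wpM2r BB; apply: powR_ge0.
Qed.

(** The exponent [(2 gamma - d)/gamma = 2 - d/gamma] enters the rate here. *)
Lemma mesh2_rho_max s k : h s ^+ 2 * s_rho s k <= B * h s `^ A.
Proof.
apply: (@le_trans _ _ (h s ^+ 2 * (B * h s `^ (- (d%:R / gamma))))).
  by apply: ler_wpM2l; [exact: sqr_ge0|exact: rho_max].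
rewrite mulrCA; apply: ler_wpM2l; first exact: ltW.
rewrite -powR_mulrn ?(ltW (h_gt0 s))// -powRD ?(gt_eqF (h_gt0 s)) ?implybT//.
apply: ger_powR; rewrite ?h_gt0 ?h_le1//.
rewrite /A ge_min; apply/orP; left.
by rewrite le_eqVlt; apply/orP; left; apply/eqP; field; rewrite gt_eqF.
Qed.

(** The assumption [d/2 <= gamma] acts here, through [A >= 0]. *)
Lemma mesh2_rho_le s k : h s ^+ 2 * s_rho s k <= B.
Proof.
apply: le_trans (mesh2_rho_max k) _; rewrite ler_piMr ?(ltW B_gt0)//.
rewrite -[X in _ <= X](powRr0 (h s)); apply: ger_powR; rewrite ?h_gt0 ?h_le1//.
exact: A_ge0.
Qed.

Section elementary.
Variables (c : R).
Hypothesis c_ge0 : 0 <= c.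
(* [g] stands for a difference quotient of the velocity error. *)
Variable g : forall s, cell d (s_N s) -> R.
Arguments g : clear implicits.
Hypothesis g_le : forall s, I (fun k => g s k ^+ 2) <= c * (gradE s + relE s) :> R.

Let young (s : step) (eps : R) (f : cell d (s_N s) -> R) :
  0 < eps -> (forall k, 0 <= f k) ->
  I (fun k => f k * `|g s k|) <= eps * I (fun k => g s k ^+ 2)
      + eps^-1 * I (fun k => f k ^+ 2).
Proof.
move=> eps0 f0; rewrite -!IpcZ -IpcD; apply: Ipc_le => [|k]; first exact: s_N_gt0.
rewrite -[g s k ^+ 2]real_normK ?num_real//.
move: (f k) `|g s k| => x y.
have e0 : 0 < eps^-1 by rewrite invr_gt0.
have := mulr_ge0 (ltW e0) (sqr_ge0 (eps * y - x / 2)).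
have -> : eps^-1 * (eps * y - x / 2) ^+ 2 = eps * y ^+ 2 - y * x + eps^-1 * x ^+ 2 / 4.
  by field; rewrite gt_eqF.
by have := mulr_ge0 (ltW e0) (sqr_ge0 x); lra.
Qed.

(** Young's inequality: [g^2] goes to the viscosity with a small factor, while [f^2] must be covered
    by the relative energy and the rate. *)
Lemma neg_young (f : forall s, cell d (s_N s) -> R) (K : R) : 0 <= K ->
  (forall s k, 0 <= f s k) ->
  (forall s, I (fun k => f s k ^+ 2) <= K * (relE s + h s `^ A)) ->
  negligible (fun s => I (fun k => f s k * `|g s k|)).
Proof.
move=> K0 f0 fK; apply: neg_gradE => eps eps0.
have c1 : 0 < c + 1 by rewrite ltr_wpDl.
pose eps' := eps / (c + 1); have e0 : 0 < eps' by rewrite divr_gt0.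
exists (eps'^-1 * (K + 1)) => [|s].
  by rewrite mulr_gt0 ?invr_gt0//; lra.
apply: le_trans (young e0 (f0 s)) _.
have G0 : 0 <= gradE s + relE s by rewrite addr_ge0 ?gradE_ge0 ?relE_ge0.
have E0 : 0 <= relE s + h s `^ A by rewrite addr_ge0 ?relE_ge0 ?rate_ge0.
apply: lerD.
  apply: (@le_trans _ _ (eps' * (c * (gradE s + relE s)))).
    by apply: ler_wpM2l; [exact: ltW|].
  rewrite mulrA; apply: ler_wpM2r => //.
  by rewrite /eps' mulrAC -mulrA ler_piMr ?(ltW eps0)// ler_pdivrMr// mul1r; lra.
rewrite -[X in _ <= X]mulrA; apply: ler_wpM2l; first by rewrite invr_ge0 ltW.
by apply: le_trans (fK s) _; apply: ler_wpM2r => //; lra.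
Qed.

Lemma neg_mesh_g : negligible (fun s => I (fun k => Num.sqrt (h s) * `|g s k|)).
Proof.
apply: (@neg_young (fun s _ => Num.sqrt (h s)) 1) => [//|s k|s]; first exact: sqrtr_ge0.
rewrite Ipc_cst ?s_N_gt0// sqr_sqrtr ?(ltW (h_gt0 s))// mul1r.
by have := mesh_le_rate s; have := relE_ge0 s; lra.
Qed.

(** Since [(h rho)^2 = (h^2 rho) rho], one density is spent on the inverse estimate and the other on
    the mass. *)
Lemma neg_rho_g : negligible (fun s => I (fun k => h s * s_rho s k * `|g s k|)).
Proof.
apply: (@neg_young (fun s k => h s * s_rho s k) (B * M)) => [|s k|s].
- by rewrite mulr_ge0 ?(ltW B_gt0)// ltW.
- by rewrite mulr_ge0 ?(ltW (h_gt0 s))// ltW// s_rho_gt0.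
apply: (@le_trans _ _ (I (fun k => B * h s `^ A * s_rho s k))).
  apply: Ipc_le => [|k]; first exact: s_N_gt0.
  rewrite exprMn [s_rho s k ^+ 2]expr2 mulrA; apply: ler_wpM2r; last exact: mesh2_rho_max.
  by rewrite ltW// s_rho_gt0.
rewrite IpcZ s_mass mulrAC; apply: ler_wpM2l; last by have := relE_ge0 s; lra.
by rewrite mulr_ge0 ?(ltW B_gt0)// ltW.
Qed.

(** The factor [rho e^2] that remains is kinetic relative energy, so boundedness of [h^2 rho],
    without a rate, suffices. *)
Lemma neg_rho_e_g i : negligible (fun s =>
  I (fun k => h s * s_rho s k * `|ub s i k - mean (s_W s) i k| * `|g s k|)).
Proof.
apply: (@neg_young (fun s k => h s * s_rho s k * `|ub s i k - mean (s_W s) i k|) (2 * B))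
  => [|s k|s].
- by rewrite mulr_ge0// ltW.
- by rewrite mulr_ge0// mulr_ge0 ?(ltW (h_gt0 s))// ltW// s_rho_gt0.
apply: (@le_trans _ _ (2 * B * relE s)); last first.
  by apply: ler_wpM2l; [rewrite mulr_ge0// ltW|have := rate_ge0 s; lra].
rewrite -IpcZ; apply: Ipc_le => [|k]; first exact: s_N_gt0.
have r0 := s_rho_gt0 k.
have b0 := bregman_hpot_ge0 a_gt0 gamma_gt1 r0 (s_r_gt0 k).
rewrite exprMn real_normK ?num_real//.
apply: (@le_trans _ _ (B * s_rho s k * (ub s i k - mean (s_W s) i k) ^+ 2)).
  apply: ler_wpM2r; first exact: sqr_ge0.
  rewrite exprMn [s_rho s k ^+ 2]expr2 mulrA; apply: ler_wpM2r; last exact: mesh2_rho_le.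
  exact: ltW.
apply: (@le_trans _ _ (B * s_rho s k * (\sum_i (ub s i k - mean (s_W s) i k) ^+ 2))).
  apply: ler_wpM2l; first by rewrite mulr_ge0// ltW.
  by rewrite (bigD1 i)//= lerDl; apply: sumr_ge0 => j _; exact: sqr_ge0.
have := mulr_ge0 (ltW B_gt0) b0; move: (\sum_i _) (bregman _ _ _ _) => x y; lra.
Qed.

End elementary.

Definition ebar s (i : 'I_d) (k : cell d (s_N s)) : R := ub s i k - mean (s_W s) i k.

(** The equations are tested with the old-level field, whereas the relative energy and the viscous
    error use the new one. The two errors differ by [O(h)]. *)
Definition ebar0 s (i : 'I_d) (k : cell d (s_N s)) : R := ub s i k - mean (s_W0 s) i k.

Lemma ebarE s i k : ebar i k = avg_cell i (@err s i) k.
Proof. by rewrite /ebar /mean /avg_cell /err; ring. Qed.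

Lemma diff_ebarE s i j k :
  diff_face j (@ebar s i) k = avg_cell i (diff_face j (@err s i)) k.
Proof. by rewrite /diff_face !ebarE /avg_cell up_dnC; ring. Qed.

Lemma grad_err_le s i j : I (fun k => diff_face j (@err s i) k ^+ 2) <= gradE s.
Proof.
have P i' j' : 0 <= I (fun k => diff_face j' (@err s i') k ^+ 2).
  by apply: Ipc_ge0 => [|k]; [exact: s_N_gt0|exact: sqr_ge0].
rewrite /gradE /grad_norm2 (bigD1 i)//= (bigD1 j)//= -addrA lerDl.
by apply: addr_ge0; apply: sumr_ge0 => i' _ //; apply: sumr_ge0 => j' _.
Qed.

Lemma grad_ebar_le s i j : I (fun k => diff_face j (@ebar s i) k ^+ 2) <= gradE s.
Proof.
apply: le_trans (grad_err_le s i j).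
set f := diff_face j (@err s i).
apply: (@le_trans _ _ (I (fun k => 2^-1 * (f k ^+ 2 + f (dn i k) ^+ 2)))).
  apply: Ipc_le => [|k]; first exact: s_N_gt0.
  rewrite diff_ebarE -/f /avg_cell; have := sqr_ge0 (f k - f (dn i k)).
  by move: (f k) (f _) => x y; lra.
by rewrite IpcZ IpcD (Ipc_dn i (fun k => f k ^+ 2)); lra.
Qed.

Lemma diff_cell_err_le s i : I (fun k => diff_cell i (@err s i) k ^+ 2) <= gradE s.
Proof.
apply: le_trans (grad_err_le s i i).
rewrite -(Ipc_dn i (fun k => diff_face i (@err s i) k ^+ 2)).
apply: Ipc_le => [|k]; first exact: s_N_gt0.
by rewrite /diff_face /diff_cell dnK.
Qed.

Lemma le_1gradE s (x : R) : x <= gradE s -> x <= 1 * (gradE s + relE s).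
Proof. by have := relE_ge0 s; lra. Qed.

Lemma relE_kinetic s : I (fun k => s_rho s k * \sum_i ebar i k ^+ 2) <= 2 * relE s.
Proof.
rewrite -IpcZ; apply: Ipc_le => [|k]; first exact: s_N_gt0.
have := bregman_hpot_ge0 a_gt0 gamma_gt1 (s_rho_gt0 k) (s_r_gt0 k).
rewrite /ebar; move: (\sum_i _) (bregman _ _ _ _) => x y; lra.
Qed.

Lemma ebar_le_relE s i : I (fun k => s_rho s k * ebar i k ^+ 2) <= 2 * relE s.
Proof.
apply: le_trans (relE_kinetic s); apply: Ipc_le => [|k]; first exact: s_N_gt0.
apply: ler_wpM2l; first by rewrite ltW// s_rho_gt0.
by rewrite (bigD1 i)//= lerDl; apply: sumr_ge0 => j _; exact: sqr_ge0.
Qed.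

(** Unweighted control, needed for the residuals that do not carry a factor [rho]. *)
Lemma ebar_poincare : exists2 c : R, 0 < c & forall s i,
  I (fun k => @ebar s i k ^+ 2) <= c * (gradE s + relE s).
Proof.
have [C C0 HC] := density_poincare d gamma_gt1 M_gt0 B_gt0.
exists (C * (2 + d%:R)) => [|s i].
  by rewrite mulr_gt0// ltr_pwDl.
apply: (le_trans (HC _ _ _ (s_N_gt0 s) (@s_rho_gt0 s) (s_mass s) (s_internal s))).
rewrite -mulrA; apply: ler_wpM2l; first exact: ltW.
have D : \sum_j I (fun k => diff_face j (@ebar s i) k ^+ 2) <= d%:R * gradE s.
  apply: (@le_trans _ _ (\sum_(j < d) gradE s)).
    by apply: ler_sum => j _; exact: grad_ebar_le.
  by rewrite sumr_const card_ord mulr_natl.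
have := ebar_le_relE s i; have := relE_ge0 s; have := gradE_ge0 s.
have := mulr_ge0 (ler0n R d) (relE_ge0 s).
move: D; move: (\sum_j _) (I _) (gradE s) (relE s) => x y z w; lra.
Qed.

(** For terms that require the density jumps: half of [delta] pays for the jumps, the other half for
    the remainder, whose constant may depend on [theta]. *)
Lemma neg_absorb (T : step -> R) (T' : R -> step -> R) :
  (forall theta s, 0 < theta -> T s <= theta * (Num.sqrt (h s) * jumps s) + T' theta s) ->
  (forall theta, 0 < theta -> negligible (T' theta)) -> negligible T.
Proof.
move=> TT' nT' del del0; have d2 : 0 < del / 2 by rewrite divr_gt0.
have [C C0 HC] := nT' _ d2 _ d2.
exists C => // s; have := TT' _ s d2; have := HC s.
have := mulr_ge0 (ltW d2) (gradE_ge0 s); lra.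
Qed.

Lemma neg_mass (c : R) : 0 <= c -> negligible (fun s => I (fun k => c * h s * s_rho s k)).
Proof.
move=> c0; apply: (@neg_mesh (c * M)) => [|s]; first by rewrite mulr_ge0// ltW.
by rewrite IpcZ s_mass; lra.
Qed.

Lemma rho_ubar_sqr_le s j : I (fun k => s_rho s k * ub s j k ^+ 2) <= B.
Proof.
apply: le_trans (s_kinetic s); apply: Ipc_le => [|k]; first exact: s_N_gt0.
apply: ler_wpM2l; first by rewrite ltW// s_rho_gt0.
by rewrite (bigD1 j)//= lerDl; apply: sumr_ge0 => l _; exact: sqr_ge0.
Qed.

Lemma norm_le_sqr (x : R) : `|x| <= 1 + x ^+ 2.
Proof.
rewrite -[x ^+ 2]real_normK ?num_real//; have := sqr_ge0 (`|x| - 1).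
by have := normr_ge0 x; move: `|x| => y; lra.
Qed.

Lemma norm_mul_le (x y : R) : `|x| * `|y| <= x ^+ 2 + y ^+ 2.
Proof.
rewrite -[x ^+ 2]real_normK ?num_real// -[y ^+ 2]real_normK ?num_real//.
have := sqr_ge0 (`|x| - `|y|); have := sqr_ge0 `|x|; have := sqr_ge0 `|y|.
by move: `|x| `|y| => u v; lra.
Qed.

Lemma rho_ubar_le s j : I (fun k => s_rho s k * `|ub s j k|) <= M + B.
Proof.
apply: (@le_trans _ _ (I (fun k => s_rho s k + s_rho s k * ub s j k ^+ 2))).
  apply: Ipc_le => [|k]; first exact: s_N_gt0.
  have := ler_wpM2l (ltW (s_rho_gt0 k)) (norm_le_sqr (ub s j k)); lra.
by rewrite IpcD s_mass lerD2l rho_ubar_sqr_le.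
Qed.

Lemma neg_rho_ubar j : negligible (fun s => Num.sqrt (h s) * I (fun k => s_rho s k * `|ub s j k|)).
Proof.
apply: (@neg_sqrt (M + B)) => [|s]; first by rewrite addr_ge0 ?ltW.
by rewrite mulrC; apply: ler_wpM2r; rewrite ?sqrtr_ge0// rho_ubar_le.
Qed.

Lemma neg_ebar2 i j :
  negligible (fun s => I (fun k => s_rho s k * (`|@ebar s i k| * `|ebar j k|))).
Proof.
apply: neg_le (negZ (ler0n R 4) neg_relE) => s.
apply: (@le_trans _ _ (I (fun k => s_rho s k * ebar i k ^+ 2 + s_rho s k * ebar j k ^+ 2))).
  apply: Ipc_le => [|k]; first exact: s_N_gt0.
  by rewrite -mulrDr; apply: ler_wpM2l; rewrite ?norm_mul_le// ltW// s_rho_gt0.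
by rewrite IpcD; have := ebar_le_relE s i; have := ebar_le_relE s j; lra.
Qed.

Lemma neg_ubar_ebar i j :
  negligible (fun s => I (fun k => h s * s_rho s k * (`|@ebar s i k| * `|ub s j k|))).
Proof.
have n1 := negZ (ler0n R 2) neg_relE.
have n2 : negligible (fun s => h s * B).
  by apply: (@neg_mesh B) => [|s]; [exact: ltW|rewrite mulrC].
apply: neg_le (negD n1 n2) => s.
apply: (@le_trans _ _ (I (fun k => s_rho s k * ebar i k ^+ 2
    + h s * (s_rho s k * ub s j k ^+ 2)))).
  apply: Ipc_le => [|k]; first exact: s_N_gt0.
  have r0 := s_rho_gt0 k; have := norm_mul_le (ebar i k) (ub s j k) => N.
  have := ler_wpM2l (mulr_ge0 (ltW (h_gt0 s)) (ltW r0)) N.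
  have : h s * (s_rho s k * ebar i k ^+ 2) <= s_rho s k * ebar i k ^+ 2.
    by rewrite ler_piMl// mulr_ge0 ?sqr_ge0// ltW.
  lra.
rewrite IpcD IpcZ; apply: lerD; first exact: ebar_le_relE.
by apply: ler_wpM2l; [exact: ltW|exact: rho_ubar_sqr_le].
Qed.

Lemma neg_rho_grad i j :
  negligible (fun s => I (fun k => h s * s_rho s k * `|diff_face j (@err s i) k|)).
Proof.
by apply: (@neg_rho_g 1) => // s; apply: le_1gradE; exact: grad_err_le.
Qed.

Lemma neg_rho_grad_ebar i j :
  negligible (fun s => I (fun k => h s * s_rho s k * `|diff_face j (@ebar s i) k|)).
Proof.
by apply: (@neg_rho_g 1) => // s; apply: le_1gradE; exact: grad_ebar_le.
Qed.

Lemma neg_rho_diff_cell j :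
  negligible (fun s => I (fun k => h s * s_rho s k * `|diff_cell j (@err s j) k|)).
Proof.
by apply: (@neg_rho_g 1) => // s; apply: le_1gradE; exact: diff_cell_err_le.
Qed.

Lemma neg_rho_ebar_diff_cell i j : negligible (fun s =>
  I (fun k => h s * s_rho s k * `|@ebar s i k| * `|diff_cell j (@err s j) k|)).
Proof.
by apply: (@neg_rho_e_g 1) => // s; apply: le_1gradE; exact: diff_cell_err_le.
Qed.

Lemma neg_grad i j :
  negligible (fun s => I (fun k => Num.sqrt (h s) * `|diff_face j (@err s i) k|)).
Proof.
by apply: (@neg_mesh_g 1) => // s; apply: le_1gradE; exact: grad_err_le.
Qed.

Lemma neg_diff_cell j :
  negligible (fun s => I (fun k => Num.sqrt (h s) * `|diff_cell j (@err s j) k|)).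
Proof.
by apply: (@neg_mesh_g 1) => // s; apply: le_1gradE; exact: diff_cell_err_le.
Qed.

Lemma neg_ebar i : negligible (fun s => I (fun k => Num.sqrt (h s) * `|@ebar s i k|)).
Proof.
have [c c0 Hc] := ebar_poincare.
by apply: (@neg_mesh_g c) => [|s]; [exact: ltW|exact: Hc].
Qed.

Lemma neg_rho_ebar i : negligible (fun s => I (fun k => h s * s_rho s k * `|@ebar s i k|)).
Proof.
have n1 := negZ (ler0n R 2) neg_relE.
apply: neg_le (negD (neg_mass ler01) n1) => s.
apply: (@le_trans _ _ (I (fun k => 1 * h s * s_rho s k + s_rho s k * ebar i k ^+ 2))).
  apply: Ipc_le => [|k]; first exact: s_N_gt0.
  have r0 := s_rho_gt0 k; have := norm_le_sqr (ebar i k) => N.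
  have := ler_wpM2l (mulr_ge0 (ltW (h_gt0 s)) (ltW r0)) N.
  have : h s * (s_rho s k * ebar i k ^+ 2) <= s_rho s k * ebar i k ^+ 2.
    by rewrite ler_piMl// mulr_ge0 ?sqr_ge0// ltW.
  lra.
by rewrite IpcD lerD2l ebar_le_relE.
Qed.

(** Young's inequality with weight [1 + rho]: [(rho - r)^2/(1 + rho)] belongs to the relative energy
    by coercivity, and [(1 + rho)] times the squared velocity error is covered by the Poincare
    inequality and the kinetic part. *)
Lemma neg_density_ebar i :
  negligible (fun s => I (fun k => `|s_rho s k - s_r s k| * `|@ebar s i k|)).
Proof.
have [c c0 Hc] := ebar_poincare.
have [m m0 Hm] := bregman_hpot_coercive a_gt0 gamma_gt1 rup rlow_gt0.
apply: neg_gradE => eps eps0.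
have c1 : 0 < c + 2 by lra.
pose e := eps / (c + 2); have e0 : 0 < e by rewrite divr_gt0.
exists (e^-1 * m^-1) => [|s]; first by rewrite mulr_gt0 ?invr_gt0.
apply: (@le_trans _ _ (I (fun k => e * (ebar i k ^+ 2 + s_rho s k * ebar i k ^+ 2)
   + e^-1 * m^-1 * bregman H H' (s_rho s k) (s_r s k)))).
  apply: Ipc_le => [|k]; first exact: s_N_gt0.
  have r0 := s_rho_gt0 k.
  have K : (s_rho s k - s_r s k) ^+ 2 / (1 + s_rho s k) <=
      m^-1 * bregman H H' (s_rho s k) (s_r s k).
    by rewrite ler_pdivlMl//; apply: Hm => //; exact: s_r_itv.
  have D0 : 0 < 1 + s_rho s k by lra.
  apply: (@le_trans _ _ (e * (ebar i k ^+ 2 + s_rho s k * ebar i k ^+ 2) +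
      e^-1 * ((s_rho s k - s_r s k) ^+ 2 / (1 + s_rho s k)))); last first.
    rewrite lerD2l -[X in _ <= X]mulrA; apply: ler_wpM2l => //.
    by rewrite invr_ge0 ltW.
  rewrite -[ebar i k ^+ 2]real_normK ?num_real//.
  rewrite -[(s_rho s k - s_r s k) ^+ 2]real_normK ?num_real//.
  move: `|ebar i k| `|_ - _| => x y; set z := _ + s_rho s k in D0 *.
  have -> : e * (x ^+ 2 + s_rho s k * x ^+ 2) = e * z * x ^+ 2 by rewrite /z; ring.
  have ez : 0 < e * z by rewrite mulr_gt0.
  have ez' : 0 < (e * z)^-1 by rewrite invr_gt0.
  have -> : e^-1 * (y ^+ 2 / z) = (e * z)^-1 * y ^+ 2.
    by field; rewrite !gt_eqF.
  have := mulr_ge0 (ltW ez') (sqr_ge0 (e * z * x - y / 2)).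
  have := mulr_ge0 (ltW ez') (sqr_ge0 y).
  have -> : (e * z)^-1 * (e * z * x - y / 2) ^+ 2 =
     e * z * x ^+ 2 - x * y + (e * z)^-1 * y ^+ 2 / 4.
    by field; rewrite !gt_eqF.
  lra.
rewrite IpcD !IpcZ IpcD.
have e1 : e * c + 2 * e <= eps.
  by rewrite /e; have -> : eps / (c + 2) * c + 2 * (eps / (c + 2)) = eps
    by field; rewrite gt_eqF.
have br : I (fun k => bregman H H' (s_rho s k) (s_r s k)) <= relE s.
  apply: Ipc_le => [|k]; first exact: s_N_gt0.
  rewrite lerDr mulr_ge0 ?mulr_ge0 ?(ltW (s_rho_gt0 _))//.
  by apply: sumr_ge0 => j _; exact: sqr_ge0.
apply: lerD.
  apply: (@le_trans _ _ (e * (c * (gradE s + relE s) + 2 * relE s))).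
    by apply: ler_wpM2l; [exact: ltW|apply: lerD; [exact: Hc|exact: ebar_le_relE]].
  have := gradE_ge0 s; have := relE_ge0 s => E0 G0.
  apply: (@le_trans _ _ ((e * c + 2 * e) * (gradE s + relE s))).
    by have := mulr_ge0 (ltW e0) G0; lra.
  by apply: ler_wpM2r => //; rewrite addr_ge0.
apply: ler_wpM2l; first by rewrite mulr_ge0 ?invr_ge0 ?ltW.
by have := rate_ge0 s; lra.
Qed.

(** Upwinding is driven by face velocities, the energy by cell velocities; they differ by half a
    cell times the normal derivative, which viscosity controls. *)
Lemma u_le_ubar s j k : `|s_u s j k| <= `|ub s j k| + h s * `|diff_cell j (s_u s j) k|.
Proof.
have -> : s_u s j k = ub s j k + h s / 2 * diff_cell j (s_u s j) k.
  by have := avg_cell_dn (s_N_gt0 s) j (s_u s j) k; rewrite /mean; lra.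
apply: le_trans (ler_normD _ _) _; rewrite lerD2l normrM.
rewrite [`|h s / 2|]ger0_norm ?divr_ge0// ?(ltW (h_gt0 s))//.
by have := mulr_ge0 (ltW (h_gt0 s)) (normr_ge0 (diff_cell j (s_u s j) k)); lra.
Qed.

Lemma u_le_ubar_up s j k :
  `|s_u s j k| <= `|ub s j (up j k)| + h s * `|diff_cell j (s_u s j) (up j k)|.
Proof.
have -> : s_u s j k = ub s j (up j k) - h s / 2 * diff_cell j (s_u s j) (up j k).
  by have := avg_cell_up (s_N_gt0 s) j (s_u s j) k; rewrite /mean; lra.
apply: le_trans (ler_normB _ _) _; rewrite lerD2l normrM.
rewrite [`|h s / 2|]ger0_norm ?divr_ge0// ?(ltW (h_gt0 s))//.
by have := mulr_ge0 (ltW (h_gt0 s)) (normr_ge0 (diff_cell j (s_u s j) (up j k))); lra.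
Qed.

Lemma diff_cell_W_le s j k : `|diff_cell j (s_W s j) k| <= B.
Proof. by have := s_dW_le j j (dn j k); rewrite /diff_face /diff_cell dnK. Qed.

Lemma diff_cell_u_le s j k :
  `|diff_cell j (s_u s j) k| <= `|diff_cell j (@err s j) k| + B.
Proof.
have -> : diff_cell j (s_u s j) k = diff_cell j (@err s j) k + diff_cell j (s_W s j) k.
  by rewrite /diff_cell /err; ring.
apply: le_trans (ler_normD _ _) _; rewrite lerD2l; exact: diff_cell_W_le.
Qed.

Lemma neg_rho_diff_cell_u j :
  negligible (fun s => I (fun k => h s * s_rho s k * `|diff_cell j (s_u s j) k|)).
Proof.
apply: neg_le (negD (neg_rho_diff_cell j) (neg_mass (ltW B_gt0))) => s.
rewrite -IpcD; apply: Ipc_le => [|k]; first exact: s_N_gt0.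
have := ler_wpM2l (mulr_ge0 (ltW (h_gt0 s)) (ltW (s_rho_gt0 k))) (diff_cell_u_le j k).
lra.
Qed.

Lemma neg_rho_u j : negligible (fun s => Num.sqrt (h s) * I (fun k => s_rho s k * `|s_u s j k|)).
Proof.
apply: neg_le (negD (neg_rho_ubar j) (neg_rho_diff_cell_u j)) => s.
rewrite -!IpcZ -IpcD; apply: Ipc_le => [|k]; first exact: s_N_gt0.
have q0 := sqrtr_ge0 (h s); have q1 : Num.sqrt (h s) <= 1.
  by rewrite -sqrtr1 ler_sqrt.
have r0 := ltW (s_rho_gt0 k).
have := ler_wpM2l (mulr_ge0 q0 r0) (u_le_ubar j k).
have X0 : 0 <= h s * s_rho s k * `|diff_cell j (s_u s j) k|.
  by rewrite mulr_ge0// mulr_ge0// ltW.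
have := ler_wpM2r X0 q1; lra.
Qed.

Lemma neg_rho_up_u j :
  negligible (fun s => Num.sqrt (h s) * I (fun k => s_rho s (up j k) * `|s_u s j k|)).
Proof.
apply: neg_le (negD (neg_rho_ubar j) (neg_rho_diff_cell_u j)) => s.
apply: (@le_trans _ _ (Num.sqrt (h s) * I (fun k => s_rho s (up j k) *
   (`|ub s j (up j k)| + h s * `|diff_cell j (s_u s j) (up j k)|)))).
  apply: ler_wpM2l; first exact: sqrtr_ge0.
  apply: Ipc_le => [|k]; first exact: s_N_gt0.
  by apply: ler_wpM2l; [rewrite ltW// s_rho_gt0|exact: u_le_ubar_up].
rewrite (Ipc_up j (fun k => s_rho s k *
   (`|ub s j k| + h s * `|diff_cell j (s_u s j) k|))).
rewrite -!IpcZ -IpcD; apply: Ipc_le => [|k]; first exact: s_N_gt0.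
have q0 := sqrtr_ge0 (h s); have q1 : Num.sqrt (h s) <= 1.
  by rewrite -sqrtr1 ler_sqrt.
have r0 := ltW (s_rho_gt0 k).
have X0 : 0 <= h s * s_rho s k * `|diff_cell j (s_u s j) k|.
  by rewrite mulr_ge0// mulr_ge0// ltW.
have := ler_wpM2r X0 q1; lra.
Qed.

Lemma W_mean_le s i k : `|mean (s_W s) i k| <= B.
Proof.
rewrite /mean /avg_cell normrM [`|2^-1|]ger0_norm ?invr_ge0// ler_pdivrMr//.
apply: le_trans (ler_normD _ _) _.
by have := s_W_le i k; have := s_W_le i (dn i k); lra.
Qed.

Lemma neg_u j : negligible (fun s => Num.sqrt (h s) * I (fun k => `|s_u s j k|)).
Proof.
have n1 : negligible (fun s => 3 * B * Num.sqrt (h s)).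
  by apply: (@neg_sqrt (3 * B)) => // ; rewrite mulr_ge0// ltW.
apply: neg_le (negD n1 (negD (neg_ebar j) (neg_diff_cell j))) => s.
rewrite -[X in _ <= X + _](Ipc_cst (d := d) (s_N_gt0 s)) -!IpcD -IpcZ.
apply: Ipc_le => [|k]; first exact: s_N_gt0.
have q0 := sqrtr_ge0 (h s).
have E : `|s_u s j k| <= 3 * B + (`|ebar j k| + `|diff_cell j (@err s j) k|).
  have : `|ub s j k| <= `|ebar j k| + B.
    have -> : ub s j k = ebar j k + mean (s_W s) j k by rewrite /ebar subrK.
    by apply: le_trans (ler_normD _ _) _; rewrite lerD2l W_mean_le.
  have := u_le_ubar j k; have := diff_cell_u_le j k.
  have : h s * `|diff_cell j (s_u s j) k| <= `|diff_cell j (s_u s j) k|.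
    by rewrite ler_piMl.
  have := B_gt0; lra.
by have := ler_wpM2l q0 E; lra.
Qed.

(** Young's inequality on each face with weight [1 + rho_K + rho_L]: the square is the upwind part
    of [jumps] with factor [theta sqrt h], and what remains is [sqrt h / theta] times integrals of
    [|u|] and [rho |u|]. This balance is a source of the exponent 1/2 in the rate. *)
Lemma neg_jump_u j :
  negligible (fun s => I (fun k => `|s_u s j k| * `|s_rho s (up j k) - s_rho s k|)).
Proof.
apply: (@neg_absorb _ (fun theta s => theta^-1 *
   (Num.sqrt (h s) * I (fun k => `|s_u s j k|)
    + Num.sqrt (h s) * I (fun k => s_rho s k * `|s_u s j k|)
    + Num.sqrt (h s) * I (fun k => s_rho s (up j k) * `|s_u s j k|)))); last first.
  move=> theta t0; apply: negZ; first by rewrite invr_ge0 ltW.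
  by apply: negD; [apply: negD; [exact: neg_u|exact: neg_rho_u]|exact: neg_rho_up_u].
move=> theta s t0; have q0 : 0 < Num.sqrt (h s) by rewrite sqrtr_gt0.
have q2 : Num.sqrt (h s) ^+ 2 = h s by rewrite sqr_sqrtr// ltW.
set q := Num.sqrt (h s) in q0 q2 *.
have J : I (fun k => `|s_u s j k| * (s_rho s (up j k) - s_rho s k) ^+ 2
                     / (1 + s_rho s k + s_rho s (up j k)) / h s) <= jumps s.
  have D k i : 0 <= (1 + s_rho s k + s_rho s (up i k))^-1.
    by rewrite invr_ge0; have := s_rho_gt0 k; have := s_rho_gt0 (up i k); lra.
  rewrite /jumps (bigD1 j)//= -addrA lerDl; apply: addr_ge0; apply: sumr_ge0 => i _;
    apply: Ipc_ge0 => [|k]; try exact: s_N_gt0.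
    by rewrite mulr_ge0 ?invr_ge0 ?(ltW (h_gt0 s))// mulr_ge0// mulr_ge0// sqr_ge0.
  by rewrite mulr_ge0// mulr_ge0 ?powR_ge0// sqr_ge0.
have tq : 0 <= theta * q by rewrite mulr_ge0// ltW.
rewrite [theta * (q * _)]mulrA; apply: le_trans (lerD (ler_wpM2l tq J) (lexx _)).
rewrite -!IpcZ -!IpcD -IpcZ -IpcD; apply: Ipc_le => [|k]; first exact: s_N_gt0.
have r0 := s_rho_gt0 k; have r1 := s_rho_gt0 (up j k).
rewrite -[(s_rho s (up j k) - s_rho s k) ^+ 2]real_normK ?num_real//.
rewrite -q2; move: `|s_u s j k| (normr_ge0 (s_u s j k)) => w w0.
move: `|_ - _| => y; set z := 1 + s_rho s k + s_rho s (up j k).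
have z0 : 0 < z by rewrite /z; lra.
have z'0 : z != 0 by rewrite gt_eqF.
have q'0 : q != 0 by rewrite gt_eqF.
have t'0 : theta != 0 by rewrite gt_eqF.
have -> : theta^-1 * (q * w + q * (s_rho s k * w) + q * (s_rho s (up j k) * w)) =
   w * (q * z / theta) by rewrite /z; ring.
rewrite -subr_ge0.
have -> : theta * q * (w * y ^+ 2 / z / q ^+ 2) + w * (q * z / theta) - w * y
   = w * (theta / (q * z) * (y - q * z / theta / 2) ^+ 2 + 3 / 4 * (q * z / theta)).
  by field; rewrite ?z'0 ?q'0 ?t'0.
rewrite mulr_ge0// addr_ge0//; first by rewrite mulr_ge0 ?sqr_ge0// divr_ge0 ?mulr_ge0 ?ltW.
by rewrite mulr_ge0// divr_ge0 ?mulr_ge0 ?ltW.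
Qed.

(** The same balance against the diffusive part of [jumps]; [alpha > 1] enters through
    [h^alpha <= h], and the leftover weight integrates to [1 + 2 M]. *)
Lemma neg_diffusion j :
  negligible (fun s => h s `^ alpha * I (fun k => `|diff_face j (s_rho s) k|)).
Proof.
apply: (@neg_absorb _ (fun theta s => theta^-1 * ((1 + 2 * M) * Num.sqrt (h s))));
  last first.
  move=> theta t0; apply: negZ; first by rewrite invr_ge0 ltW.
  by apply: (@neg_sqrt (1 + 2 * M)) => //; have := M_gt0; lra.
move=> theta s t0; have q0 : 0 < Num.sqrt (h s) by rewrite sqrtr_gt0.
have q2 : Num.sqrt (h s) ^+ 2 = h s by rewrite sqr_sqrtr// ltW.
set q := Num.sqrt (h s) in q0 q2 *.
have J : I (fun k => h s `^ alpha * diff_face j (s_rho s) k ^+ 2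
                     / (1 + s_rho s k + s_rho s (up j k))) <= jumps s.
  have D k i : 0 <= (1 + s_rho s k + s_rho s (up i k))^-1.
    by rewrite invr_ge0; have := s_rho_gt0 k; have := s_rho_gt0 (up i k); lra.
  rewrite /jumps addrC (bigD1 j)//= -addrA lerDl; apply: addr_ge0; apply: sumr_ge0 => i _;
    apply: Ipc_ge0 => [|k]; try exact: s_N_gt0.
    by rewrite mulr_ge0// mulr_ge0 ?powR_ge0// sqr_ge0.
  by rewrite mulr_ge0 ?invr_ge0 ?(ltW (h_gt0 s))// mulr_ge0// mulr_ge0// sqr_ge0.
have tq : 0 <= theta * q by rewrite mulr_ge0// ltW.
rewrite [theta * (q * _)]mulrA; apply: le_trans (lerD (ler_wpM2l tq J) (lexx _)).
have E : 1 + 2 * M = I (fun k => 1 + s_rho s k + s_rho s (up j k)).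
  by rewrite !IpcD (Ipc_up j (s_rho s)) s_mass Ipc_cst ?s_N_gt0//; lra.
rewrite E [I _ * q]mulrC [theta^-1 * _]mulrA -!IpcZ -IpcD; apply: Ipc_le => [|k]; first exact: s_N_gt0.
have r0 := s_rho_gt0 k; have r1 := s_rho_gt0 (up j k).
rewrite -[diff_face j (s_rho s) k ^+ 2]real_normK ?num_real//.
move: `|_| => y; set z := 1 + s_rho s k + s_rho s (up j k).
have z0 : 0 < z by rewrite /z; lra.
have w0 : 0 <= h s `^ alpha by exact: powR_ge0.
have wq : h s `^ alpha <= q ^+ 2.
  rewrite q2 -[X in _ <= X](powRr1 (ltW (h_gt0 s))); apply: ger_powR.
    by rewrite h_gt0 h_le1.
  exact: ltW.
move: (h s `^ alpha) w0 wq => w w0 wq.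
have z'0 : z != 0 by rewrite gt_eqF.
have q'0 : q != 0 by rewrite gt_eqF.
have t'0 : theta != 0 by rewrite gt_eqF.
have W : w * (z / (theta * q)) <= theta^-1 * q * z.
  have -> : theta^-1 * q * z = q ^+ 2 * (z / (theta * q)) by field; rewrite ?z'0 ?q'0 ?t'0.
  by apply: ler_wpM2r wq; rewrite divr_ge0 ?mulr_ge0// ltW.
apply: le_trans (lerD (lexx _) W).
rewrite -subr_ge0.
have -> : theta * q * (w * y ^+ 2 / z) + w * (z / (theta * q)) - w * y =
  w * ((theta * q) / z * (y - z / (theta * q) / 2) ^+ 2 + 3 / 4 * (z / (theta * q))).
  by field; rewrite ?z'0 ?q'0 ?t'0.
rewrite mulr_ge0// addr_ge0//; first by rewrite mulr_ge0 ?sqr_ge0// divr_ge0 ?mulr_ge0 ?ltW.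
by rewrite mulr_ge0// divr_ge0 ?mulr_ge0 ?ltW.
Qed.

(** * Remainders of the relative energy balance *)

Local Notation V s := (mean (s_W s)).
Local Notation V0 s := (mean (s_W0 s)).
Local Notation phi0 s := (fun l => H' (s_r0 s l)).

Lemma tau_B_le s : B * s_tau s <= B ^+ 2 * h s.
Proof. by rewrite expr2 -mulrA; apply: ler_wpM2l; [exact: ltW|exact: s_tau_le]. Qed.

Lemma norm_half_le (x y K : R) : `|x| <= K -> `|y| <= K -> `|(x + y) / 2| <= K.
Proof.
move=> xK yK; rewrite normrM [`|2^-1|]ger0_norm ?invr_ge0// ler_pdivrMr//.
by apply: le_trans (ler_normD _ _) _; lra.
Qed.

Lemma V0_le s i k : `|V0 s i k| <= B.
Proof. by apply: norm_half_le; exact: s_W0_le. Qed.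

Lemma VB_le s i k : `|V s i k - V0 s i k| <= B ^+ 2 * h s.
Proof.
apply: le_trans (tau_B_le s).
have -> : V s i k - V0 s i k = ((s_W s i k - s_W0 s i k) +
   (s_W s i (dn i k) - s_W0 s i (dn i k))) / 2 by rewrite /mean /avg_cell; field.
by apply: norm_half_le; exact: s_WB.
Qed.

Lemma diff_VE s i j k : diff_face j (V0 s i) k =
  (diff_face j (s_W0 s i) k + diff_face j (s_W0 s i) (dn i k)) / 2.
Proof. by rewrite /mean /diff_face /avg_cell up_dnC; ring. Qed.

Lemma dV0_le s i j k : `|diff_face j (V0 s i) k| <= B.
Proof. by rewrite diff_VE; apply: norm_half_le; exact: s_dW0_le. Qed.

Lemma mesh_diff_face s j (f : cell d (s_N s) -> R) k :
  h s * diff_face j f k = f (up j k) - f k.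
Proof. by rewrite /diff_face mulrC divfK// gt_eqF. Qed.

Lemma ddV0_le s i j k :
  `|diff_face j (V0 s i) (dn j k) - diff_face j (V0 s i) k| <= B * h s.
Proof.
have E l : diff_face j (s_W0 s i) (dn j l) - diff_face j (s_W0 s i) l =
   - (h s * diff_face j (diff_face j (s_W0 s i)) (dn j l)).
  by rewrite mesh_diff_face dnK opprB.
have -> : diff_face j (V0 s i) (dn j k) - diff_face j (V0 s i) k =
   (- (h s * diff_face j (diff_face j (s_W0 s i)) (dn j k))
    - (h s * diff_face j (diff_face j (s_W0 s i)) (dn j (dn i k)))) / 2.
  rewrite -!E !diff_VE.
  have -> : dn i (dn j k) = dn j (dn i k).
    by apply: (can_inj (upK i)); rewrite dnK up_dnC dnK.
  ring.
apply: norm_half_le; rewrite normrN normrM (ger0_norm (ltW (h_gt0 s))) mulrC;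
  by apply: ler_wpM2r; [exact: ltW|exact: s_ddW0_le].
Qed.

Lemma dVB_le s i j k :
  `|diff_face j (V s i) k - diff_face j (V0 s i) k| <= B ^+ 2 * h s.
Proof.
apply: le_trans (tau_B_le s).
have -> : diff_face j (V s i) k - diff_face j (V0 s i) k =
  ((diff_face j (s_W s i) k - diff_face j (s_W0 s i) k) +
   (diff_face j (s_W s i) (dn i k) - diff_face j (s_W0 s i) (dn i k))) / 2.
  by rewrite /mean /diff_face /avg_cell up_dnC; field; rewrite gt_eqF.
by apply: norm_half_le; exact: s_dWB.
Qed.

Lemma ebar0_le s i k : `|@ebar0 s i k| <= `|ebar i k| + B ^+ 2 * h s.
Proof.
have -> : ebar0 i k = ebar i k + (V s i k - V0 s i k) by rewrite /ebar /ebar0; ring.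
by apply: le_trans (ler_normD _ _) _; rewrite lerD2l VB_le.
Qed.

Lemma div_W_le s k : `|div_cell (s_W s) k| <= d%:R * B.
Proof.
apply: le_trans (ler_norm_sum _ _ _) _.
apply: (@le_trans _ _ (\sum_(i < d) B)); last by rewrite sumr_const card_ord mulr_natl.
by apply: ler_sum => i _; exact: diff_cell_W_le.
Qed.

Lemma div_W0_le s k : `|div_cell (s_W0 s) k| <= d%:R * B.
Proof.
apply: le_trans (ler_norm_sum _ _ _) _.
apply: (@le_trans _ _ (\sum_(i < d) B)); last by rewrite sumr_const card_ord mulr_natl.
apply: ler_sum => i _; have := s_dW0_le i i (dn i k).
by rewrite /diff_face /diff_cell dnK.
Qed.

Lemma div_WB_le s k :
  `|div_cell (s_W s) k - div_cell (s_W0 s) k| <= d%:R * (B ^+ 2 * h s).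
Proof.
rewrite /div_cell -sumrB; apply: le_trans (ler_norm_sum _ _ _) _.
apply: (@le_trans _ _ (\sum_(i < d) B ^+ 2 * h s));
  last by rewrite sumr_const card_ord mulr_natl.
apply: ler_sum => i _; apply: le_trans (tau_B_le s).
by have := s_dWB i i (dn i k); rewrite /diff_face /diff_cell dnK.
Qed.

Lemma div_W0_dn_le s i k :
  `|div_cell (s_W0 s) (dn i k) - div_cell (s_W0 s) k| <= d%:R * (B * h s).
Proof.
rewrite /div_cell -sumrB; apply: le_trans (ler_norm_sum _ _ _) _.
apply: (@le_trans _ _ (\sum_(l < d) B * h s));
  last by rewrite sumr_const card_ord mulr_natl.
apply: ler_sum => l _.
have -> : diff_cell l (s_W0 s l) (dn i k) - diff_cell l (s_W0 s l) k =
   - (h s * diff_face i (diff_face l (s_W0 s l)) (dn l (dn i k))).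
  by rewrite mesh_diff_face up_dnC dnK /diff_cell /diff_face !dnK; ring.
rewrite normrN normrM (ger0_norm (ltW (h_gt0 s))) mulrC.
by apply: ler_wpM2r; [exact: ltW|exact: s_ddW0_le].
Qed.

(** Centred convection of the test field against its upwind transport. The contribution of negative
    face velocities has been translated to the same cell, hence the index [dn j k]. *)
Definition X1 s : R := \sum_i \sum_j I (fun k => s_rho s k *
  (ebar i k * V0 s j k * diff_face j (V0 s i) k
   - ebar0 i k * (Num.max 0 (s_u s j k) * diff_face j (V0 s i) k
       + Num.min 0 (s_u s j (dn j k)) * diff_face j (V0 s i) (dn j k)))).

(** The velocity and transport equations supply the pressure gradient against [ebar + V0], which
    differs from [ub] by the time increment of [V]. *)
Definition X2 s : R := - \sum_i I (fun k =>
  s_rho s k * (V s i k - V0 s i k) * diff_cell i (s_psi s i) k).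

(** [Z] is the viscous force per unit mass; passing from [rho Z] to the force [r Z] costs this
    term. *)
Definition X3 s : R := - \sum_i I (fun k =>
  (s_rho s k - s_r s k) * ebar i k * s_Z s i k).

Definition X4 s : R := - \sum_i I (fun k => ebar i k *
  (s_r s k * s_Z s i k - mu * \sum_j diff_cell j (s_G s i j) k
      - (mu + lambda) * diff_cell i (s_D s i) k)).

Definition X5 s : R :=
  - \sum_i I (fun k => s_rho s k * ebar i k *
      ((V s i k - V0 s i k) / s_tau s + \sum_j V0 s j k * diff_face j (V0 s i) k
       + diff_cell i (s_psi s i) k - s_Z s i k))
  - I (fun k => s_rho s k * ((H' (s_r s k) - H' (s_r0 s k)) / s_tau s
      + \sum_i V0 s i k * diff_cell i (s_psi s i) k
      + a * gamma * s_r0 s k `^ (gamma - 1) * div_cell (s_W0 s) k)).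

(** [X6], [X7] and [X8] collect the three ways in which the work of the averaged pressure gradient
    differs from the mass flux tested with [phi0]: [psi] is not the face average of [phi0], the flux
    is upwind instead of centred, and it contains diffusion. *)
Definition X6 s : R := - \sum_i I (fun k =>
  diff_face i (fun l => s_rho s l * ub s i l) k
  * (s_psi s i k - avg_face i (phi0 s) k)).

Definition X7 s : R := \sum_i I (fun k =>
  (avg_face i (fun l => s_rho s l * ub s i l) k - upwind (s_rho s) (s_u s) i k)
  * diff_face i (phi0 s) k).

Definition X8 s : R := h s `^ alpha * \sum_j I (fun k =>
  diff_face j (s_rho s) k * diff_face j (phi0 s) k).

(** The upwind dissipation that the test velocity itself would produce. *)
Definition X9 s : R := \sum_i \sum_j I (fun k =>
  h s / 2 * (s_rho s k * Num.max 0 (s_u s j k) - s_rho s (up j k) * Num.min 0 (s_u s j k))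
  * diff_face j (V0 s i) k ^+ 2).

Definition X10 s : R := h s `^ alpha * \sum_i \sum_j I (fun k =>
  avg_face j (@ebar0 s i) k * diff_face j (s_rho s) k * diff_face j (V0 s i) k).

(** The part of the pressure quadratic in the density error, and the residual of the integrated
    pressure equation. *)
Definition X11 s : R :=
  - (gamma - 1) * I (fun k => bregman H H' (s_rho s k) (s_r0 s k) * div_cell (s_W0 s) k)
  + I (fun k => (p (s_r s k) - p (s_r0 s k)) / s_tau s
      + (a * gamma * s_r0 s k `^ (gamma - 1) * s_r0 s k - p (s_r0 s k))
        * div_cell (s_W0 s) k).

(** Averaged gradients and divergences against differences of the test field, and the old test field
    against the new one. *)
Definition X12 s : R :=
  mu * \sum_i \sum_j I (fun k => diff_face j (@err s i) k *
    ((s_G s i j k + s_G s i j (up i k)) / 2 - diff_face j (s_W s i) k))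
  - mu * \sum_i \sum_j I (fun k => diff_face j (s_u s i) k *
     (diff_face j (s_W s i) k - diff_face j (s_W0 s i) k))
  + (mu + lambda) * \sum_i I (fun k => diff_cell i (@err s i) k *
     ((s_D s i (dn i k) + s_D s i k) / 2 - div_cell (s_W s) k))
  - (mu + lambda) * I (fun k => div_cell (s_u s) k *
     (div_cell (s_W s) k - div_cell (s_W0 s) k)).

Lemma max0_lipschitz (x y : R) : `|Num.max 0 x - Num.max 0 y| <= `|x - y|.
Proof.
have A1 := ler_norm (x - y); have A2 := ler_norm (y - x); rewrite distrC in A2.
have A3 := normr_ge0 (x - y); rewrite ler_norml.
by have [?|?] := leP 0 x; have [?|?] := leP 0 y; apply/andP; split; lra.
Qed.

Lemma min0_lipschitz (x y : R) : `|Num.min 0 x - Num.min 0 y| <= `|x - y|.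
Proof.
have A1 := ler_norm (x - y); have A2 := ler_norm (y - x); rewrite distrC in A2.
have A3 := normr_ge0 (x - y); rewrite ler_norml.
by have [?|?] := leP 0 x; have [?|?] := leP 0 y; apply/andP; split; lra.
Qed.

(** The splitting passes through the cell velocity [m = (w + w')/2]: the positive part of one face
    velocity and the negative part of the other are replaced by those of [m], which add up to
    [m]. *)
Lemma convection_le (b t v g g' w w' e e0 : R) : 1 <= b -> 0 <= t ->
  `|v| <= b -> `|g| <= b -> `|g'| <= b -> `|g' - g| <= b * t ->
  `|e - e0| <= b ^+ 2 * t ->
  `|e * v * g - e0 * (Num.max 0 w * g + Num.min 0 w' * g')| <=
  b ^+ 4 * t + b * (`|e0| * `|(w + w') / 2 - v|) + b * (`|e0| * `|w - w'|)
  + b * t * (`|e0| * `|(w + w') / 2|).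
Proof.
move=> b1 t0 vb gb g'b gg ee; set m := (w + w') / 2.
have b0 : 0 <= b by lra.
have mx : `|Num.max 0 w - Num.max 0 m| <= `|w - w'| / 2.
  have -> : `|w - w'| / 2 = `|w - m|.
    rewrite -[2^-1 in LHS]ger0_norm ?invr_ge0// -normrM; congr `|_|.
    by rewrite /m; field.
  exact: max0_lipschitz.
have mn : `|Num.min 0 w' - Num.min 0 m| <= `|w - w'| / 2.
  have -> : `|w - w'| / 2 = `|w' - m|.
    rewrite -[2^-1 in LHS]ger0_norm ?invr_ge0// -normrM -normrN; congr `|_|.
    by rewrite /m; field.
  exact: min0_lipschitz.
have mm : `|Num.min 0 m| <= `|m|.
  by case: (leP 0 m) => ?; rewrite ?normr0.
have -> : e * v * g - e0 * (Num.max 0 w * g + Num.min 0 w' * g') =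
  (e - e0) * (v * g) - e0 * (m - v) * g
  - e0 * ((Num.max 0 w - Num.max 0 m) * g)
  - e0 * ((Num.min 0 w' - Num.min 0 m) * g')
  - e0 * (Num.min 0 m * (g' - g)).
  have := maxDmin0 m; move: (Num.max 0 m) (Num.min 0 m) (Num.max _ _) (Num.min _ _).
  by move=> x y z q <-; ring.
have mul_le (x y X Y : R) : `|x| <= X -> `|y| <= Y -> `|x * y| <= X * Y.
  by move=> xX yY; rewrite normrM; apply: ler_pM.
have tri (x y z q r : R) :
    `|x - y - z - q - r| <= `|x| + `|y| + `|z| + `|q| + `|r|.
  have E1 := ler_normB (x - y - z - q) r; have E2 := ler_normB (x - y - z) q.
  have E3 := ler_normB (x - y) z; have E4 := ler_normB x y; lra.
apply: le_trans (tri _ _ _ _ _) _.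
have B1 : `|(e - e0) * (v * g)| <= b ^+ 2 * t * (b * b) by do 2 apply: (mul_le) => //.
have B2 : `|e0 * (m - v) * g| <= `|e0| * `|m - v| * b by do 2 apply: (mul_le) => //.
have B3 : `|e0 * ((Num.max 0 w - Num.max 0 m) * g)| <= `|e0| * (`|w - w'| / 2 * b).
  by do 2 apply: (mul_le) => //.
have B4 : `|e0 * ((Num.min 0 w' - Num.min 0 m) * g')| <= `|e0| * (`|w - w'| / 2 * b).
  by do 2 apply: (mul_le) => //.
have B5 : `|e0 * (Num.min 0 m * (g' - g))| <= `|e0| * (`|m| * (b * t)).
  by do 2 apply: (mul_le) => //.
lra.
Qed.

Lemma neg_rho_h_ubar j : negligible (fun s => I (fun k => h s * s_rho s k * `|ub s j k|)).
Proof.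
apply: neg_le (neg_rho_ubar j) => s; rewrite -IpcZ.
apply: Ipc_le => [|k]; first exact: s_N_gt0.
rewrite -mulrA; apply: ler_wpM2r; last exact: mesh_le_sqrt.
by rewrite mulr_ge0// ltW// s_rho_gt0.
Qed.

Lemma neg_X1 : negligible X1.
Proof.
apply: neg_sum => i; apply: neg_sum => j.
have B0 : 0 <= B by exact: ltW.
have n (c : R) (T : step -> R) (nT : negligible T) (c0 : 0 <= c) := negZ c0 nT.
have N1 := neg_mass (ler01 : 0 <= 1 :> R).
have N2 := neg_ebar2 i j.
have N3 := neg_rho_ebar i. have N4 := neg_rho_ebar j.
have N5 := neg_rho_ebar_diff_cell i j.
have N6 := neg_rho_diff_cell_u j.
have N7 := neg_ubar_ebar i j.
have N8 := neg_rho_h_ubar j.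
have B4 : 0 <= B ^+ 4 by rewrite exprn_ge0.
have B5 : 0 <= B ^+ 5 by rewrite exprn_ge0.
have B3 : 0 <= B ^+ 3 by rewrite exprn_ge0.
have B2 : 0 <= B ^+ 2 by rewrite exprn_ge0.
apply: neg_le (negD (negD (negD (n _ _ N1 (addr_ge0 B4 B5)) (n _ _ N2 B0))
  (negD (n _ _ N3 (addr_ge0 B3 B2)) (n _ _ N4 B3)))
  (negD (negD (n _ _ N5 B0) (n _ _ N6 B3)) (negD (n _ _ N7 B0) (n _ _ N8 B3)))) => s.
rewrite -!IpcZ -!IpcD; apply: Ipc_le => [|k]; first exact: s_N_gt0.
have r0 := s_rho_gt0 k; have h0 := h_gt0 s.
have C := @convection_le B (h s) (V0 s j k) (diff_face j (V0 s i) k)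
  (diff_face j (V0 s i) (dn j k)) (s_u s j k) (s_u s j (dn j k)) (ebar i k) (ebar0 i k)
  B_ge1 (ltW h0) (V0_le j k) (dV0_le i j k) (dV0_le i j (dn j k)) (ddV0_le i j k) _.
have ee : `|ebar i k - ebar0 i k| <= B ^+ 2 * h s.
  rewrite distrC; have -> : ebar0 i k - ebar i k = V s i k - V0 s i k.
    by rewrite /ebar /ebar0; ring.
  exact: VB_le.
have {C} := C ee.
have -> : (s_u s j k + s_u s j (dn j k)) / 2 = ub s j k by [].
have -> : ub s j k - V0 s j k = ebar0 j k by [].
have -> : s_u s j k - s_u s j (dn j k) = h s * diff_cell j (s_u s j) k.
  by rewrite /diff_cell mulrC divfK// gt_eqF.
rewrite [`|h s * _|]normrM (ger0_norm (ltW h0)) => C.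
have Ei := ebar0_le i k; have Ej := ebar0_le j k; have Du := diff_cell_u_le j k.
apply: le_trans (ler_norm _) _; rewrite normrM (ger0_norm (ltW r0)).
apply: (@le_trans _ _ (s_rho s k * ((B ^+ 4 + B ^+ 5) * h s + B * (`|ebar i k| * `|ebar j k|)
  + (B ^+ 3 + B ^+ 2) * (h s * `|ebar i k|) + B ^+ 3 * (h s * `|ebar j k|)
  + B * (h s * (`|ebar i k| * `|diff_cell j (@err s j) k|))
  + B ^+ 3 * (h s * `|diff_cell j (s_u s j) k|) + B * (h s * (`|ebar i k| * `|ub s j k|))
  + B ^+ 3 * (h s * `|ub s j k|)))); last first.
  by rewrite le_eqVlt; apply/orP; left; apply/eqP; ring.
apply: ler_wpM2l; first exact: ltW.
apply: (le_trans C).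
move: Ei Ej Du (normr_ge0 (ebar i k)) (normr_ge0 (ebar j k))
  (normr_ge0 (ebar0 i k)) (normr_ge0 (ebar0 j k))
  (normr_ge0 (diff_cell j (@err s j) k)) (normr_ge0 (diff_cell j (s_u s j) k))
  (normr_ge0 (ub s j k)) (h_le1 s) h0.
move: `|ebar i k| `|ebar j k| `|ebar0 i k| `|ebar0 j k| `|diff_cell j (@err s j) k|
  `|diff_cell j (s_u s j) k| `|ub s j k| (h s) => x y x0 y0 z w v t.
move=> Ex Ey Ez x_ge0 y_ge0 x0_ge0 y0_ge0 z_ge0 w_ge0 v_ge0 t1 t0.
have P1 : x0 * y0 <= x * y + B ^+ 2 * t * x + B ^+ 2 * t * y + B ^+ 4 * t.
  apply: (@le_trans _ _ ((x + B ^+ 2 * t) * (y + B ^+ 2 * t))); first exact: ler_pM.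
  have : B ^+ 4 * (t * t) <= B ^+ 4 * t.
    by apply: ler_wpM2l => //; rewrite ler_piMr// ltW.
  lra.
have P2 : x0 * (t * w) <= t * (x * z) + B * (t * x) + B ^+ 2 * (t * w).
  have tw : 0 <= t * w by rewrite mulr_ge0// ltW.
  apply: (le_trans (ler_wpM2r tw Ex)).
  have := ler_wpM2l (mulr_ge0 (ltW t0) x_ge0) Ez.
  have : B ^+ 2 * t * (t * w) <= B ^+ 2 * (t * w).
    by apply: ler_wpM2r => //; rewrite ler_piMr.
  lra.
have P3 : t * (x0 * v) <= t * (x * v) + B ^+ 2 * (t * v).
  have tv : 0 <= t * v by rewrite mulr_ge0// ltW.
  have := ler_wpM2r tv Ex.
  have : B ^+ 2 * t * (t * v) <= B ^+ 2 * (t * v).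
    by apply: ler_wpM2r => //; rewrite ler_piMr.
  lra.
have := ler_wpM2l B0 P1; have := ler_wpM2l B0 P2; have := ler_wpM2l B0 P3.
lra.
Qed.
(** The record contains no bound on the differences of [psi]; the discrete velocity equation
    expresses them through bounded quantities. *)
Lemma dpsi_le s i k : `|diff_cell i (s_psi s i) k| <= (3 + d%:R) * B ^+ 2.
Proof.
have E1 := s_velocity i k; have h1 := h_le1 s.
have Bh : B * h s <= B by rewrite ler_piMr// ltW.
have B2 : B <= B ^+ 2 by rewrite expr2 ler_peMr// ltW.
have E2 : `|(V s i k - V0 s i k) / s_tau s| <= B.
  have t0 := s_tau_gt0 s.
  rewrite normrM normfV (gtr0_norm t0) ler_pdivrMr//.
  have -> : V s i k - V0 s i k = ((s_W s i k - s_W0 s i k) +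
     (s_W s i (dn i k) - s_W0 s i (dn i k))) / 2 by rewrite /mean /avg_cell; field.
  by apply: norm_half_le; exact: s_WB.
have E3 : `|\sum_j V0 s j k * diff_face j (V0 s i) k| <= d%:R * B ^+ 2.
  apply: le_trans (ler_norm_sum _ _ _) _.
  apply: (@le_trans _ _ (\sum_(j < d) B ^+ 2));
    last by rewrite sumr_const card_ord mulr_natl.
  apply: ler_sum => j _; rewrite normrM expr2.
  by apply: ler_pM => //; [exact: V0_le|exact: dV0_le].
have E4 := s_Z_le i k.
have -> : diff_cell i (s_psi s i) k =
  ((V s i k - V0 s i k) / s_tau s + \sum_j V0 s j k * diff_face j (V0 s i) k
       + diff_cell i (s_psi s i) k - s_Z s i k) - (V s i k - V0 s i k) / s_tau s
  - (\sum_j V0 s j k * diff_face j (V0 s i) k) + s_Z s i k by ring.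
have tri (x y z q : R) : `|x - y - z + q| <= `|x| + `|y| + `|z| + `|q|.
  have := ler_normD (x - y - z) q; have := ler_normB (x - y) z; have := ler_normB x y.
  lra.
apply: le_trans (tri _ _ _ _) _; lra.
Qed.

Lemma Ipc_le_norm s (f g : cell d (s_N s) -> R) : (forall k, `|f k| <= g k) ->
  - I f <= I g /\ I f <= I g.
Proof.
move=> fg; split; rewrite -?IpcN; apply: Ipc_le => [|k]; try exact: s_N_gt0.
  by apply: le_trans (fg k); rewrite -normrN ler_norm.
by apply: le_trans (fg k); exact: ler_norm.
Qed.

Lemma neg_norm (F G : forall s, cell d (s_N s) -> R) :
  (forall s k, `|F s k| <= G s k) -> negligible (fun s => I (G s)) ->
  negligible (fun s => I (F s)).
Proof. by move=> FG; apply: neg_le => s; have [] := Ipc_le_norm (FG s). Qed.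

Lemma neg_normN (F G : forall s, cell d (s_N s) -> R) :
  (forall s k, `|F s k| <= G s k) -> negligible (fun s => I (G s)) ->
  negligible (fun s => - I (F s)).
Proof. by move=> FG; apply: neg_le => s; have [] := Ipc_le_norm (FG s). Qed.

Lemma neg_sumN (J : finType) (T : J -> step -> R) : (forall j, negligible (fun s => - T j s)) ->
  negligible (fun s => - \sum_j T j s).
Proof. by move=> nT; apply: neg_le (neg_sum nT) => s; rewrite sumrN. Qed.

Lemma neg_IZ (c : R) (F : forall s, cell d (s_N s) -> R) : 0 <= c ->
  negligible (fun s => I (F s)) -> negligible (fun s => I (fun k => c * F s k)).
Proof. by move=> c0 nF; apply: neg_le (negZ c0 nF) => s; rewrite IpcZ. Qed.

Lemma neg_ID (F G : forall s, cell d (s_N s) -> R) :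
  negligible (fun s => I (F s)) -> negligible (fun s => I (G s)) ->
  negligible (fun s => I (fun k => F s k + G s k)).
Proof. by move=> nF nG; apply: neg_le (negD nF nG) => s; rewrite IpcD. Qed.

Let B0 : 0 <= B. Proof. exact: ltW. Qed.

Lemma neg_X2 : negligible X2.
Proof.
apply: neg_sumN => i.
apply: (@neg_normN _ (fun s k => B ^+ 2 * ((3 + d%:R) * B ^+ 2) * h s * s_rho s k)).
  move=> s k; rewrite normrM [`|s_rho s k * _|]normrM (gtr0_norm (s_rho_gt0 k)).
  have -> : B ^+ 2 * ((3 + d%:R) * B ^+ 2) * h s * s_rho s k =
    s_rho s k * (B ^+ 2 * h s) * ((3 + d%:R) * B ^+ 2) by ring.
  have r0 := ltW (s_rho_gt0 k).
  apply: ler_pM => //; [exact: mulr_ge0| |exact: dpsi_le].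
  by apply: ler_wpM2l => //; exact: VB_le.
by apply: neg_mass; rewrite mulr_ge0 ?exprn_ge0// mulr_ge0 ?exprn_ge0// addr_ge0.
Qed.

Lemma neg_X3 : negligible X3.
Proof.
apply: neg_sumN => i.
apply: (@neg_normN _ (fun s k => B * (`|s_rho s k - s_r s k| * `|ebar i k|))).
  move=> s k; rewrite normrM [`|_ * ebar i k|]normrM [X in X <= _]mulrC; apply: ler_wpM2r; last exact: s_Z_le.
  exact: mulr_ge0.
by apply: neg_IZ => //; exact: neg_density_ebar.
Qed.

Lemma neg_X4 : negligible X4.
Proof.
apply: neg_sumN => i.
apply: (@neg_normN _ (fun s k => B * (Num.sqrt (h s) * `|ebar i k|))).
  move=> s k; rewrite normrM [X in X <= _]mulrC [X in _ <= X]mulrA; apply: ler_wpM2r => //.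
  apply: le_trans (s_stress i k) _; apply: ler_wpM2l => //; exact: mesh_le_sqrt.
by apply: neg_IZ => //; exact: neg_ebar.
Qed.

Lemma neg_X5 : negligible X5.
Proof.
apply: negD.
  apply: neg_sumN => i.
  apply: (@neg_normN _ (fun s k => B * (h s * s_rho s k * `|ebar i k|))).
    move=> s k; rewrite normrM [`|s_rho s k * _|]normrM (gtr0_norm (s_rho_gt0 k)).
    have := ler_wpM2l (mulr_ge0 (ltW (s_rho_gt0 k)) (normr_ge0 (ebar i k))) (s_velocity i k).
    by move/le_trans; apply; rewrite le_eqVlt; apply/orP; left; apply/eqP; ring.
  by apply: neg_IZ => //; exact: neg_rho_ebar.
apply: (@neg_normN _ (fun s k => B * h s * s_rho s k)).
  move=> s k; rewrite normrM (gtr0_norm (s_rho_gt0 k)) [X in X <= _]mulrC.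
  by apply: ler_wpM2r (s_transport k); rewrite ltW// s_rho_gt0.
exact: neg_mass.
Qed.

(** A common majorant for the jump of [rho ub] across a face and for the distance between centred
    and upwind mass flux. *)
Definition mass_jump s (i : 'I_d) (k : cell d (s_N s)) : R :=
  `|s_u s i k| * `|s_rho s (up i k) - s_rho s k|
  + h s * s_rho s k * `|diff_cell i (s_u s i) k|
  + h s * s_rho s (up i k) * `|diff_cell i (s_u s i) (up i k)|.

Lemma neg_mass_jump i : negligible (fun s => I (fun k => @mass_jump s i k)).
Proof.
apply: neg_ID; first by apply: neg_ID; [exact: neg_jump_u|exact: neg_rho_diff_cell_u].
apply: neg_le (neg_rho_diff_cell_u i) => s.
by rewrite (Ipc_up i (fun k => h s * s_rho s k * `|diff_cell i (s_u s i) k|)).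
Qed.

Lemma ubar_sub s i k :
  ub s i k - s_u s i k = - (h s / 2) * diff_cell i (s_u s i) k.
Proof. exact: avg_cell_dn (s_N_gt0 s) i (s_u s i) k. Qed.

Lemma ubar_up_sub s i k :
  ub s i (up i k) - s_u s i k = h s / 2 * diff_cell i (s_u s i) (up i k).
Proof. exact: avg_cell_up (s_N_gt0 s) i (s_u s i) k. Qed.

Lemma norm3_le (x y z : R) : `|x + y + z| <= `|x| + `|y| + `|z|.
Proof. have E1 := ler_normD (x + y) z; have E2 := ler_normD x y; lra. Qed.

Lemma normrM3 (x t y : R) : 0 <= x -> 0 <= t -> `|x * (t * y)| = x * (t * `|y|).
Proof. by move=> x0 t0; rewrite !normrM (ger0_norm x0) (ger0_norm t0). Qed.

Lemma momentum_jump_le s i k :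
  `|s_rho s (up i k) * ub s i (up i k) - s_rho s k * ub s i k| <= mass_jump i k.
Proof.
have r0 := s_rho_gt0 k; have r1 := s_rho_gt0 (up i k); have h0 := h_gt0 s.
have -> : s_rho s (up i k) * ub s i (up i k) - s_rho s k * ub s i k =
   s_u s i k * (s_rho s (up i k) - s_rho s k)
   - s_rho s k * (ub s i k - s_u s i k)
   + s_rho s (up i k) * (ub s i (up i k) - s_u s i k) by ring.
rewrite ubar_sub ubar_up_sub; apply: le_trans (norm3_le _ _ _) _.
have h2 : 0 <= h s / 2 by rewrite divr_ge0// ltW.
rewrite normrM mulNr mulrN opprK (normrM3 _ (ltW r0) h2) (normrM3 _ (ltW r1) h2) /mass_jump.
have := mulr_ge0 (mulr_ge0 (ltW h0) (ltW r0)) (normr_ge0 (diff_cell i (s_u s i) k)).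
have := mulr_ge0 (mulr_ge0 (ltW h0) (ltW r1))
   (normr_ge0 (diff_cell i (s_u s i) (up i k))).
lra.
Qed.

Lemma upwind_sub_le s i k :
  `|avg_face i (fun l => s_rho s l * ub s i l) k - upwind (s_rho s) (s_u s) i k|
  <= mass_jump i k.
Proof.
have r0 := s_rho_gt0 k; have r1 := s_rho_gt0 (up i k); have h0 := h_gt0 s.
have -> : avg_face i (fun l => s_rho s l * ub s i l) k - upwind (s_rho s) (s_u s) i k =
   2^-1 * ((Num.max 0 (s_u s i k) - Num.min 0 (s_u s i k))
           * (s_rho s (up i k) - s_rho s k))
   + 2^-1 * (s_rho s k * (ub s i k - s_u s i k))
   + 2^-1 * (s_rho s (up i k) * (ub s i (up i k) - s_u s i k)).
  rewrite /avg_face /upwind; have := maxDmin0 (s_u s i k).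
  move: (Num.max 0 (s_u s i k)) (Num.min 0 (s_u s i k)) => x y <-.
  by field.
have -> : Num.max 0 (s_u s i k) - Num.min 0 (s_u s i k) = `|s_u s i k|.
  have [?|?] := leP 0 (s_u s i k); first by rewrite subr0 ger0_norm.
  by rewrite sub0r ltr0_norm.
rewrite ubar_sub ubar_up_sub; apply: le_trans (norm3_le _ _ _) _.
have h2 : 0 <= h s / 2 by rewrite divr_ge0// ltW.
have i2 : 0 <= 2^-1 :> R by rewrite invr_ge0.
rewrite (normrM3 _ i2 (normr_ge0 _)) mulNr [s_rho s k * - _]mulrN [2^-1 * - _]mulrN normrN.
rewrite [`|2^-1 * (s_rho s k * _)|]normrM [`|2^-1 * (s_rho s (up i k) * _)|]normrM.
rewrite (normrM3 _ (ltW r0) h2) (normrM3 _ (ltW r1) h2) (ger0_norm i2) /mass_jump.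
have := mulr_ge0 (mulr_ge0 (ltW h0) (ltW r0)) (normr_ge0 (diff_cell i (s_u s i) k)).
have := mulr_ge0 (mulr_ge0 (ltW h0) (ltW r1))
   (normr_ge0 (diff_cell i (s_u s i) (up i k))).
have := mulr_ge0 (normr_ge0 (s_u s i k)) (normr_ge0 (s_rho s (up i k) - s_rho s k)).
lra.
Qed.

(** The difference quotient costs [1/h], which is compensated by the [O(h)] distance of [psi] from
    the face average of [phi0]. *)
Lemma neg_X6 : negligible X6.
Proof.
apply: neg_sumN => i.
apply: (@neg_normN _ (fun s k => B * mass_jump i k)); last first.
  by apply: neg_IZ => //; exact: neg_mass_jump.
move=> s k; have h0 := h_gt0 s.
apply: (@le_trans _ _ (mass_jump i k / h s * (B * h s))).
  rewrite normrM; apply: ler_pM => //; last exact: s_psi_le.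
  rewrite /diff_face normrM normfV (gtr0_norm h0).
  by apply: ler_wpM2r; [rewrite invr_ge0 ltW|exact: momentum_jump_le].
by rewrite le_eqVlt; apply/orP; left; apply/eqP; field; rewrite gt_eqF.
Qed.

Lemma neg_X7 : negligible X7.
Proof.
apply: neg_sum => i.
apply: (@neg_norm _ (fun s k => B * mass_jump i k)); last first.
  by apply: neg_IZ => //; exact: neg_mass_jump.
move=> s k; rewrite normrM [X in X <= _]mulrC.
by apply: ler_pM => //; [exact: s_dphi_le|exact: upwind_sub_le].
Qed.

Lemma neg_X8 : negligible X8.
Proof.
have n := neg_sum (fun j => negZ B0 (neg_diffusion j)).
apply: neg_le n => s; rewrite /X8 mulr_sumr; apply: ler_sum => j _.
rewrite -!IpcZ; apply: Ipc_le => [|k]; first exact: s_N_gt0.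
rewrite [B * _]mulrCA; apply: ler_wpM2l; first exact: powR_ge0.
apply: le_trans (ler_norm _) _; rewrite normrM mulrC.
by apply: ler_wpM2r => //; exact: s_dphi_le.
Qed.

Lemma neg_X9 : negligible X9.
Proof.
apply: neg_sum => i; apply: neg_sum => j.
have B2 : 0 <= B ^+ 2 by exact: sqr_ge0.
have n := negZ B2 (negD (neg_rho_u j) (neg_rho_up_u j)).
apply: neg_le n => s; rewrite -mulrDr -IpcD -!IpcZ.
apply: Ipc_le => [|k]; first exact: s_N_gt0.
have r0 := s_rho_gt0 k; have r1 := s_rho_gt0 (up j k); have h0 := h_gt0 s.
have mx : Num.max 0 (s_u s j k) <= `|s_u s j k|.
  by rewrite ge_max normr_ge0 ler_norm.
have mn : - Num.min 0 (s_u s j k) <= `|s_u s j k|.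
  by rewrite lerNl le_min oppr_le0 normr_ge0 lerNl -normrN ler_norm.
have U : s_rho s k * Num.max 0 (s_u s j k) - s_rho s (up j k) * Num.min 0 (s_u s j k) <=
   s_rho s k * `|s_u s j k| + s_rho s (up j k) * `|s_u s j k|.
  by have := ler_wpM2l (ltW r0) mx; have := ler_wpM2l (ltW r1) mn; lra.
have G : diff_face j (V0 s i) k ^+ 2 <= B ^+ 2.
  by rewrite -real_normK ?num_real//; apply: lerXn2r; rewrite ?nnegrE// dV0_le.
have X0 : 0 <= s_rho s k * `|s_u s j k| + s_rho s (up j k) * `|s_u s j k|.
  by rewrite addr_ge0// mulr_ge0// ltW.
have hs : h s / 2 <= Num.sqrt (h s) by have := mesh_le_sqrt s; lra.
have h2 : 0 <= h s / 2 by rewrite divr_ge0// ltW.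
apply: (@le_trans _ _ (h s / 2 *
   (s_rho s k * `|s_u s j k| + s_rho s (up j k) * `|s_u s j k|) * B ^+ 2)).
  apply: (@le_trans _ _ (h s / 2 *
   (s_rho s k * `|s_u s j k| + s_rho s (up j k) * `|s_u s j k|)
      * diff_face j (V0 s i) k ^+ 2)).
    by apply: ler_wpM2r; [exact: sqr_ge0|exact: ler_wpM2l].
  by apply: ler_wpM2l => //; exact: mulr_ge0.
by rewrite mulrC; apply: ler_wpM2l => //; apply: ler_wpM2r.
Qed.

Lemma neg_rho_grad_ebar_dn i j :
  negligible (fun s => I (fun k => h s * s_rho s k * `|diff_face j (@ebar s i) (dn j k)|)).
Proof.
apply: (@neg_rho_g 1 ler01 (fun s k => diff_face j (@ebar s i) (dn j k))) => // s.
rewrite (Ipc_dn j (fun k => diff_face j (@ebar s i) k ^+ 2)).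
by apply: le_1gradE; exact: grad_ebar_le.
Qed.

Lemma mesh_alpha_le s : h s `^ alpha <= h s.
Proof.
rewrite -[X in _ <= X](powRr1 (ltW (h_gt0 s))); apply: ger_powR; last exact: ltW.
by rewrite h_gt0 h_le1.
Qed.

(** Summation by parts moves the difference from the density to the velocity factors; with
    [h^alpha <= h] the terms are then absorbed without any control of density jumps. *)
Lemma neg_X10 : negligible X10.
Proof.
have n i j : negligible (fun s => h s `^ alpha * I (fun k =>
    avg_face j (@ebar0 s i) k * diff_face j (s_rho s) k * diff_face j (V0 s i) k)).
  have B2 : 0 <= B ^+ 2 by exact: sqr_ge0.
  have B3 : 0 <= B ^+ 3 by rewrite exprn_ge0.
  have n0 := neg_ID (neg_ID (neg_IZ B0 (neg_rho_grad_ebar i j))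
     (neg_IZ B0 (neg_rho_grad_ebar_dn i j)))
     (neg_ID (neg_IZ B0 (neg_rho_ebar i)) (neg_mass (mulr_ge0 (ler0n R 3) B3))).
  apply: neg_le n0 => s; have h0 := h_gt0 s.
  pose f (k : cell d (s_N s)) := avg_face j (@ebar0 s i) k * diff_face j (V0 s i) k.
  have -> : I (fun k => avg_face j (@ebar0 s i) k * diff_face j (s_rho s) k
      * diff_face j (V0 s i) k) = - I (fun k => s_rho s k * diff_cell j f k).
    by rewrite -Ipc_diff_face//; apply: Ipc_eq => k; rewrite /f; ring.
  rewrite -IpcN -IpcZ; apply: Ipc_le => [|k]; first exact: s_N_gt0.
  have r0 := s_rho_gt0 k.
  have E : diff_cell j f k =
    (diff_face j (@ebar0 s i) k + diff_face j (@ebar0 s i) (dn j k)) / 2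
      * diff_face j (V0 s i) k
    - (ebar0 i k - h s / 2 * diff_face j (@ebar0 s i) (dn j k))
      * ((diff_face j (V0 s i) (dn j k) - diff_face j (V0 s i) k) / h s).
    rewrite /diff_cell /f /avg_face !dnK.
    move: (diff_face j (V0 s i) k) (diff_face j (V0 s i) (dn j k)) => g g'.
    rewrite /diff_face dnK; field; by rewrite gt_eqF.
  have de l : `|diff_face j (@ebar0 s i) l| <= `|diff_face j (@ebar s i) l| + B ^+ 2.
    have -> : diff_face j (@ebar0 s i) l = diff_face j (@ebar s i) l
       + (diff_face j (V s i) l - diff_face j (V0 s i) l).
      by rewrite /diff_face /ebar /ebar0; ring.
    apply: le_trans (ler_normD _ _) _; rewrite lerD2l.
    by apply: le_trans (dVB_le i j l) _; rewrite ler_piMr.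
  have g1 := dV0_le i j k.
  have g2 : `|(diff_face j (V0 s i) (dn j k) - diff_face j (V0 s i) k) / h s| <= B.
    by rewrite normrM normfV (gtr0_norm h0) ler_pdivrMr// ddV0_le.
  have e0 : `|ebar0 i k| <= `|ebar i k| + B ^+ 2.
    apply: le_trans (ebar0_le i k) _; rewrite lerD2l ler_piMr//.
  have d1 := de k; have d2 := de (dn j k).
  have N : `|diff_cell j f k| <= B * `|diff_face j (@ebar s i) k|
     + B * `|diff_face j (@ebar s i) (dn j k)| + (B * `|ebar i k| + 3 * B ^+ 3).
    rewrite E; move: g1 g2 e0 d1 d2.
    move: (diff_face j (V0 s i) k) (_ / h s) (ebar0 i k) (diff_face j (@ebar0 s i) k)
      (diff_face j (@ebar0 s i) (dn j k)) => g w e p1 p2 g1 w1 e1 d1 d2.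
    have F1 : `|(p1 + p2) / 2 * g| <= (`|diff_face j (@ebar s i) k| + B ^+ 2 +
       (`|diff_face j (@ebar s i) (dn j k)| + B ^+ 2)) / 2 * B.
      rewrite normrM; apply: ler_pM => //.
      rewrite normrM [`|2^-1|]ger0_norm ?invr_ge0//; apply: ler_wpM2r => //.
      by apply: le_trans (ler_normD _ _) _; exact: lerD.
    have F2 : `|(e - h s / 2 * p2) * w| <= (`|ebar i k| + B ^+ 2 +
       2^-1 * (`|diff_face j (@ebar s i) (dn j k)| + B ^+ 2)) * B.
      rewrite normrM; apply: ler_pM => //; apply: le_trans (ler_normB _ _) _.
      apply: lerD => //; rewrite normrM [`|h s / 2|]ger0_norm ?divr_ge0// ?(ltW h0)//.
      apply: ler_pM => //; first by rewrite divr_ge0// ltW.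
      by have := h_le1 s; lra.
    have F := ler_normB ((p1 + p2) / 2 * g) ((e - h s / 2 * p2) * w).
    have := mulr_ge0 B0 (normr_ge0 (diff_face j (@ebar s i) k)); lra.
  have a0 := powR_ge0 (h s) alpha.
  apply: le_trans (ler_norm _) _; rewrite normrM normrN normrM (ger0_norm a0).
  rewrite (gtr0_norm r0).
  apply: (@le_trans _ _ (h s * (s_rho s k * `|diff_cell j f k|))).
    by apply: ler_wpM2r (mesh_alpha_le s); rewrite mulr_ge0// ltW.
  have := ler_wpM2l (mulr_ge0 (ltW h0) (ltW r0)) N.
  lra.
apply: neg_le (neg_sum (fun i => neg_sum (n i))) => s; rewrite /X10 mulr_sumr.
by apply: ler_sum => i _; rewrite mulr_sumr.
Qed.

(** The base point of the Bregman distance is changed from [r0] to [r]; this costs increments of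
    [H'(r)] and [p(r)], both [O(tau)]. *)
Lemma neg_X11 : negligible X11.
Proof.
have g1 : 0 < gamma - 1 by rewrite subr_gt0.
have dB : 0 <= d%:R * B by rewrite mulr_ge0.
have B2 : 0 <= B ^+ 2 by exact: sqr_ge0.
apply: negD; last first.
  apply: (@neg_mesh B) => // s; exact: le_trans (ler_norm _) (s_pressure s).
have n1 : negligible (fun s => I (fun k => bregman H H' (s_rho s k) (s_r0 s k))).
  have n2 : negligible (fun s => relE s + B ^+ 2 * h s).
    by apply: negD; [exact: neg_relE|exact: (@neg_mesh (B ^+ 2))].
  apply: neg_le (negD n2 (neg_mass B2)) => s.
  rewrite -[X in relE s + X](Ipc_cst (d := d) (s_N_gt0 s)) -!IpcD.
  apply: Ipc_le => [|k]; first exact: s_N_gt0.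
  have r00 : 0 < s_r0 s k by have /andP[r1 _] := s_r0_itv k; apply: lt_le_trans r1.
  have r10 := s_r_gt0 k.
  have r0 := s_rho_gt0 k.
  have E : bregman H H' (s_rho s k) (s_r0 s k) = bregman H H' (s_rho s k) (s_r s k)
     + (H' (s_r s k) - H' (s_r0 s k)) * s_rho s k - (p (s_r s k) - p (s_r0 s k)).
    rewrite !(pressure_hpot a gamma_gt1)// /bregman; ring.
  rewrite E.
  have tB := tau_B_le s.
  have F1 := ler_wpM2r (ltW r0) (le_trans (le_trans (ler_norm _) (s_phiB k)) tB).
  have F2 : - (p (s_r s k) - p (s_r0 s k)) <= B ^+ 2 * h s.
    by rewrite (le_trans (le_trans (ler_norm _) _) tB)// normrN s_pB.
  have F3 : 0 <= 2^-1 * s_rho s k * (\sum_i (ub s i k - V s i k) ^+ 2).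
    rewrite mulr_ge0 ?mulr_ge0 ?(ltW r0)//.
    by apply: sumr_ge0 => j _; exact: sqr_ge0.
  move: F1 F2 F3; move: (\sum_i _) (bregman _ _ _ _) (H' (s_r s k)) (p (s_r s k)) => x y z w.
  lra.
apply: neg_le (negZ (mulr_ge0 (ltW g1) dB) n1) => s.
rewrite mulNr -mulrN -mulrA; apply: ler_wpM2l; first exact: ltW.
rewrite -IpcN -IpcZ; apply: Ipc_le => [|k]; first exact: s_N_gt0.
have r00 : 0 < s_r0 s k by have /andP[r1 _] := s_r0_itv k; apply: lt_le_trans r1.
have b0 := bregman_hpot_ge0 a_gt0 gamma_gt1 (s_rho_gt0 k) r00.
rewrite -mulrN mulrC; apply: ler_wpM2r => //.
by apply: le_trans (ler_norm _) _; rewrite normrN div_W0_le.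
Qed.
Lemma neg_X12 : negligible X12.
Proof.
have B2 : 0 <= B ^+ 2 by exact: sqr_ge0.
have B3 : 0 <= B ^+ 3 by rewrite exprn_ge0.
have BB : B <= B ^+ 2 by rewrite expr2 ler_peMr.
have ncst (c : R) : 0 <= c -> negligible (fun s => I (fun _ : cell d (s_N s) => c * h s)).
  by move=> c0; apply: (@neg_mesh c) => // s; rewrite Ipc_cst; [exact: lexx|exact: s_N_gt0].
have dB2 : 0 <= d%:R * B ^+ 2 by exact: mulr_ge0.
apply: negD; [apply: negD; [apply: negD|]|].
- apply: negZ; first exact: ltW.
  apply: neg_sum => i; apply: neg_sum => j.
  apply: (@neg_norm _ (fun s k => 3 * B ^+ 2 * (Num.sqrt (h s) * `|diff_face j (@err s i) k|)));
    last by apply: neg_IZ; [exact: mulr_ge0|exact: neg_grad].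
  move=> s k; rewrite normrM [X in X <= _]mulrC [X in _ <= X]mulrA.
  apply: ler_wpM2r => //.
  apply: (@le_trans _ _ (3 * B ^+ 2 * h s)); last first.
    by apply: ler_wpM2l; [exact: mulr_ge0|exact: mesh_le_sqrt].
  have E1 := s_G_le i j k; have E2 := s_G_le i j (up i k).
  have E3 : `|diff_face j (s_W0 s i) (up i k) - diff_face j (s_W0 s i) k| <= B * h s.
    rewrite -mesh_diff_face normrM (gtr0_norm (h_gt0 s)) mulrC.
    by apply: ler_wpM2r; [exact: ltW|exact: s_ddW0_le].
  have E4 := le_trans (s_dWB i j k) (tau_B_le s).
  have Bh : B * h s <= B ^+ 2 * h s by apply: ler_wpM2r => //; exact: ltW.
  move: E1 E2 E3 E4.
  move: (s_G s i j k) (s_G s i j (up i k)) (diff_face j (s_W0 s i) (up i k))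
     (diff_face j (s_W0 s i) k) (diff_face j (s_W s i) k) => g g' w' w z.
  rewrite !ler_norml => /andP[? ?] /andP[? ?] /andP[? ?] /andP[? ?].
  by apply/andP; split; lra.
- apply: neg_le (negZ (ltW mu_gt0) (neg_sum (fun i => neg_sum (fun j =>
    neg_ID (neg_IZ B2 (neg_grad i j)) (ncst _ B3))))) => s.
  rewrite -mulrN; apply: ler_wpM2l; first exact: ltW.
  rewrite -sumrN; apply: ler_sum => i _; rewrite -sumrN; apply: ler_sum => j _.
  rewrite -IpcN; apply: Ipc_le => [|k]; first exact: s_N_gt0.
  apply: le_trans (ler_norm _) _; rewrite normrN normrM.
  have E4 := le_trans (s_dWB i j k) (tau_B_le s).
  have E1 : `|diff_face j (s_u s i) k| <= `|diff_face j (@err s i) k| + B.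
    have -> : diff_face j (s_u s i) k = diff_face j (@err s i) k + diff_face j (s_W s i) k.
      by rewrite /diff_face /err; ring.
    by apply: le_trans (ler_normD _ _) _; rewrite lerD2l s_dW_le.
  apply: (@le_trans _ _ ((`|diff_face j (@err s i) k| + B) * (B ^+ 2 * h s))).
    exact: ler_pM.
  have := ler_wpM2r (mulr_ge0 B2 (normr_ge0 (diff_face j (@err s i) k))) (mesh_le_sqrt s).
  lra.
- apply: negZ => //; apply: neg_sum => i.
  apply: (@neg_norm _ (fun s k => (1 + 2 * d%:R) * B ^+ 2 *
     (Num.sqrt (h s) * `|diff_cell i (@err s i) k|)));
    last by apply: neg_IZ; [rewrite mulr_ge0// addr_ge0// mulr_ge0|exact: neg_diff_cell].
  move=> s k; rewrite normrM [X in X <= _]mulrC [X in _ <= X]mulrA.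
  apply: ler_wpM2r => //.
  apply: (@le_trans _ _ ((1 + 2 * d%:R) * B ^+ 2 * h s)); last first.
    apply: ler_wpM2l; last exact: mesh_le_sqrt.
    by rewrite mulr_ge0// addr_ge0// mulr_ge0.
  have E1 := s_D_le i k; have E2 := s_D_le i (dn i k).
  have E3 := div_W0_dn_le i k; have E4 := div_WB_le k.
  have Bh : B * h s <= B ^+ 2 * h s by apply: ler_wpM2r => //; exact: ltW.
  have dBh : d%:R * (B * h s) <= d%:R * (B ^+ 2 * h s) by apply: ler_wpM2l.
  move: E1 E2 E3 E4.
  move: (s_D s i k) (s_D s i (dn i k)) (div_cell (s_W0 s) (dn i k)) (div_cell (s_W0 s) k)
    (div_cell (s_W s) k) => g g' w' w z.
  rewrite !ler_norml => /andP[? ?] /andP[? ?] /andP[? ?] /andP[? ?].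
  have : 0 <= d%:R * (B ^+ 2 * h s) by rewrite !mulr_ge0// ltW.
  by move=> ?; apply/andP; split; lra.
have n := neg_sum (fun i => neg_ID (neg_IZ dB2 (neg_diff_cell i)) (ncst _ (mulr_ge0 dB2 B0))).
apply: neg_le (negZ mulambda_ge0 n) => s.
rewrite -mulrN; apply: ler_wpM2l => //; rewrite -IpcN -Ipc_sum.
apply: Ipc_le => [|k]; first exact: s_N_gt0.
apply: le_trans (ler_norm _) _; rewrite normrN normrM.
apply: (@le_trans _ _ ((\sum_i (`|diff_cell i (@err s i) k| + B)) *
   (d%:R * (B ^+ 2 * h s)))).
  apply: ler_pM => //; last exact: div_WB_le.
  apply: le_trans (ler_norm_sum _ _ _) _.
  by apply: ler_sum => i _; exact: diff_cell_u_le.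
rewrite mulr_suml; apply: ler_sum => i _.
have := ler_wpM2r (mulr_ge0 dB2 (normr_ge0 (diff_cell i (@err s i) k))) (mesh_le_sqrt s).
lra.
Qed.

(** * Assembly of the one-step inequality *)

Definition relE0 s : R :=
  I (fun k => 2^-1 * s_rho0 s k * (\sum_i (s_ubar0 s i k - V0 s i k) ^+ 2)
              + bregman H H' (s_rho0 s k) (s_r0 s k)).

(** [S1] to [S4] are the leading terms: convection, pressure gradient, viscosity, compression. They
    arise once from the time increments of the test fields and once from the spatial terms, and
    cancel up to the remainders. *)
Let S1 s := \sum_i \sum_j I (fun k =>
  s_rho s k * (ebar i k * V0 s j k * diff_face j (V0 s i) k)).
Let S2 s := \sum_i I (fun k => s_rho s k * ub s i k * diff_cell i (s_psi s i) k).
Let S3 s := \sum_i I (fun k => ebar i k *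
  (mu * \sum_j diff_cell j (s_G s i j) k + (mu + lambda) * diff_cell i (s_D s i) k)).
Let S4 s := I (fun k =>
  s_rho s k * (a * gamma * s_r0 s k `^ (gamma - 1) * div_cell (s_W0 s) k)).

(** The consistency relations replace the time increments of the test fields: [s_velocity]
    multiplied by [rho ebar], [s_transport] multiplied by [rho], and [s_stress] multiplied by
    [ebar]. *)
Lemma time_difference s :
  - I (fun k => s_rho s k * \sum_i (ub s i k - V s i k) * (V s i k - V0 s i k))
  - I (fun k => s_rho s k * (H' (s_r s k) - H' (s_r0 s k)))
  = s_tau s * (S1 s + S2 s + X2 s + X3 s + X4 s + X5 s - S3 s + S4 s).
Proof.
have t0 : s_tau s != 0 by rewrite gt_eqF// s_tau_gt0.
pose e1 i k := (V s i k - V0 s i k) / s_tau s + \sum_j V0 s j k * diff_face j (V0 s i) k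
       + diff_cell i (s_psi s i) k - s_Z s i k.
pose e2 k := (H' (s_r s k) - H' (s_r0 s k)) / s_tau s
      + \sum_i V0 s i k * diff_cell i (s_psi s i) k
      + a * gamma * s_r0 s k `^ (gamma - 1) * div_cell (s_W0 s) k.
pose e3 i k := s_r s k * s_Z s i k - mu * \sum_j diff_cell j (s_G s i j) k
      - (mu + lambda) * diff_cell i (s_D s i) k.
pose e4 i k := mu * \sum_j diff_cell j (s_G s i j) k
   + (mu + lambda) * diff_cell i (s_D s i) k.
pose f i k := \sum_j s_rho s k * (ebar i k * V0 s j k * diff_face j (V0 s i) k)
  + s_rho s k * ub s i k * diff_cell i (s_psi s i) k
  - s_rho s k * (V s i k - V0 s i k) * diff_cell i (s_psi s i) k
  - (s_rho s k - s_r s k) * ebar i k * s_Z s i k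
  - ebar i k * e3 i k - s_rho s k * ebar i k * e1 i k - ebar i k * e4 i k.
(* In [f] everything cancels except the time increment and the work of the pressure gradient on
   [V0]; the latter is removed by [e2]. *)
have fE i k : f i k = - (s_tau s)^-1 * (s_rho s k * (ebar i k * (V s i k - V0 s i k)))
    + s_rho s k * (V0 s i k * diff_cell i (s_psi s i) k).
  rewrite /f -mulr_sumr.
  have -> : \sum_j ebar i k * V0 s j k * diff_face j (V0 s i) k =
     ebar i k * \sum_j V0 s j k * diff_face j (V0 s i) k.
    by rewrite mulr_sumr; apply: eq_bigr => j _; rewrite mulrA.
  rewrite /e1 /e3 /e4 /ebar; move: (\sum_j _) (\sum_j _) => x y.
  by field.
have If i : I (f i) = \sum_j I (fun k =>
  s_rho s k * (ebar i k * V0 s j k * diff_face j (V0 s i) k))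
  + I (fun k => s_rho s k * ub s i k * diff_cell i (s_psi s i) k)
  - I (fun k => s_rho s k * (V s i k - V0 s i k) * diff_cell i (s_psi s i) k)
  - I (fun k => (s_rho s k - s_r s k) * ebar i k * s_Z s i k)
  - I (fun k => ebar i k * e3 i k) - I (fun k => s_rho s k * ebar i k * e1 i k)
  - I (fun k => ebar i k * e4 i k).
  by rewrite /f !IpcB !IpcD Ipc_sum.
have -> : S1 s + S2 s + X2 s + X3 s + X4 s + X5 s - S3 s + S4 s =
   \sum_i I (f i) - I (fun k => s_rho s k * e2 k) + S4 s.
  rewrite (eq_bigr _ (fun i _ => If i)) !sumrB big_split/=.
  by rewrite /S1 /S2 /X2 /X3 /X4 /X5 /S3; ring.
rewrite -Ipc_sum -IpcB /S4 -IpcD -IpcZ -IpcN -IpcB; apply: Ipc_eq => k.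
rewrite (eq_bigr _ (fun i _ => fE i k)) big_split/= -!mulr_sumr /e2.
move: (\sum_i _) (\sum_i _) => x y; rewrite /ebar.
by field.
Qed.

(** Discrete product rule: the two integrands add up to the difference quotient of [f g], whose
    integral vanishes. *)
Lemma Ipc_diff_avg N i (f g : cell d N -> R) :
  I (fun k => diff_face i f k * avg_face i g k)
  = - I (fun k => avg_face i f k * diff_face i g k).
Proof.
have E : I (fun k => f (up i k) * g (up i k) / @mesh R N) =
    I (fun k => f k * g k / @mesh R N).
  exact: (Ipc_up i (fun k => f k * g k / @mesh R N)).
apply/eqP; rewrite -addr_eq0 -IpcD; apply/eqP.
transitivity (I (fun k => f (up i k) * g (up i k) / @mesh R N - f k * g k / @mesh R N)).
  by apply: Ipc_eq => k; rewrite /diff_face /avg_face; move: (@mesh R N)^-1 => q; field.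
by rewrite IpcB E subrr.
Qed.

Lemma pressure_gradient s :
  S2 s - \sum_j I (fun k => mass_flux alpha (s_rho s) (s_u s) j k * diff_face j (phi0 s) k)
  = X6 s + X7 s + X8 s.
Proof.
rewrite /S2 /X6 /X7 /X8 mulr_sumr -sumrB -sumrN -!big_split/=; apply: eq_bigr => i _.
have -> : I (fun k => s_rho s k * ub s i k * diff_cell i (s_psi s i) k) =
  - I (fun k => diff_face i (fun l => s_rho s l * ub s i l) k * s_psi s i k).
  by rewrite Ipc_diff_face opprK.
have -> : I (fun k => diff_face i (fun l => s_rho s l * ub s i l) k * s_psi s i k) =
   I (fun k => diff_face i (fun l => s_rho s l * ub s i l) k
       * (s_psi s i k - avg_face i (phi0 s) k))
   + I (fun k => diff_face i (fun l => s_rho s l * ub s i l) k * avg_face i (phi0 s) k).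
  by rewrite -IpcD; apply: Ipc_eq => k; ring.
rewrite Ipc_diff_avg.
have -> : I (fun k => (avg_face i (fun l => s_rho s l * ub s i l) k
      - upwind (s_rho s) (s_u s) i k) * diff_face i (phi0 s) k) =
   I (fun k => avg_face i (fun l => s_rho s l * ub s i l) k * diff_face i (phi0 s) k)
   - I (fun k => upwind (s_rho s) (s_u s) i k * diff_face i (phi0 s) k).
  by rewrite -IpcB; apply: Ipc_eq => k; ring.
have -> : I (fun k => mass_flux alpha (s_rho s) (s_u s) i k * diff_face i (phi0 s) k) =
   I (fun k => upwind (s_rho s) (s_u s) i k * diff_face i (phi0 s) k)
   - h s `^ alpha * I (fun k => diff_face i (s_rho s) k * diff_face i (phi0 s) k).
  by rewrite -IpcZ -IpcB; apply: Ipc_eq => k; rewrite /mass_flux; ring.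
ring.
Qed.

Lemma convective_flux s :
  S1 s + \sum_i \sum_j I (fun k =>
     - ((s_rho s k * Num.max 0 (s_u s j k) * ebar0 i k
         + s_rho s (up j k) * Num.min 0 (s_u s j k) * ebar0 i (up j k))
        * diff_face j (V0 s i) k)) = X1 s.
Proof.
rewrite /S1 /X1 -big_split; apply: eq_bigr => i _; rewrite -big_split; apply: eq_bigr => j _.
pose f k := s_rho s k * Num.min 0 (s_u s j (dn j k)) * ebar0 i k
  * diff_face j (V0 s i) (dn j k).
have -> : I (fun k =>
     - ((s_rho s k * Num.max 0 (s_u s j k) * ebar0 i k
         + s_rho s (up j k) * Num.min 0 (s_u s j k) * ebar0 i (up j k))
        * diff_face j (V0 s i) k)) =
  - I (fun k => s_rho s k * Num.max 0 (s_u s j k) * ebar0 i k * diff_face j (V0 s i) k)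
  - I (fun k => f (up j k)).
  by rewrite -IpcN -IpcB; apply: Ipc_eq => k; rewrite /f upK; ring.
rewrite Ipc_up /= -opprD -IpcD -IpcB /f; apply: Ipc_eq => k /=; ring.
Qed.

Lemma s_r0_gt0 s k : 0 < s_r0 s k.
Proof. by have /andP[r1 _] := s_r0_itv k; apply: lt_le_trans r1. Qed.

Lemma pressure_balance s :
  S4 s - I (fun k => p (s_rho s k) * div_cell (s_W0 s) k)
  + I (fun k => (p (s_r s k) - p (s_r0 s k)) / s_tau s) = X11 s.
Proof.
rewrite /X11 -IpcZ -[RHS]IpcD /S4 -IpcB -[LHS]IpcD; apply: Ipc_eq => k.
have := pressure_excess a gamma_gt1 (s_rho s k) (s_r0 s k).
rewrite mulNr [(gamma - 1) * (_ * _)]mulrA => <-.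
move: (p (s_rho s k)) (p (s_r s k)) (p (s_r0 s k)) => x y z; ring.
Qed.

(** Summation by parts moves the average contained in [ebar] onto [G] and [D], which makes them
    comparable with differences of the face field; then [u] is split into error and test field. *)
Lemma viscous_terms s :
  - S3 s
  - mu * (\sum_i \sum_j I (fun k => diff_face j (s_u s i) k *
                  (diff_face j (s_u s i) k - diff_face j (s_W0 s i) k)))
  - (mu + lambda) * I (fun k => div_cell (s_u s) k *
                  (div_cell (s_u s) k - div_cell (s_W0 s) k))
  + mu * gradE s + (mu + lambda) * I (fun k => div_cell (@err s) k ^+ 2) = X12 s.
Proof.
have S3E : - S3 s = mu * \sum_i \sum_j I (fun k => diff_face j (@err s i) k *
       ((s_G s i j k + s_G s i j (up i k)) / 2))
    + (mu + lambda) * \sum_i I (fun k => diff_cell i (@err s i) k *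
       ((s_D s i (dn i k) + s_D s i k) / 2)).
  rewrite /S3 !mulr_sumr -big_split -sumrN; apply: eq_bigr => i _ /=.
  have -> : I (fun k => ebar i k *
     (mu * \sum_j diff_cell j (s_G s i j) k + (mu + lambda) * diff_cell i (s_D s i) k)) =
     mu * \sum_j I (fun k => ebar i k * diff_cell j (s_G s i j) k)
     + (mu + lambda) * I (fun k => ebar i k * diff_cell i (s_D s i) k).
    rewrite -Ipc_sum -!IpcZ -IpcD; apply: Ipc_eq => k.
    by rewrite -mulr_sumr; ring.
  rewrite opprD -[X in X + _ = _]mulrN -[X in _ + X = _]mulrN; congr (_ * _ + _ * _).
    rewrite -sumrN; apply: eq_bigr => j _; rewrite -Ipc_diff_face.
    under Ipc_eq do rewrite diff_ebarE mulrC.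
    by rewrite -Ipc_avg_face; apply: Ipc_eq => k; rewrite mulrC /avg_face.
  rewrite -Ipc_diff_face.
  have E k : diff_face i (@ebar s i) k = avg_face i (diff_cell i (@err s i)) k.
    by rewrite /diff_face !ebarE /avg_face /avg_cell /diff_cell upK; ring.
  under Ipc_eq do rewrite E.
  by rewrite Ipc_avg_face; apply: Ipc_eq => k; rewrite /avg_cell [X in X / 2]addrC.
have L1 : mu * \sum_i \sum_j I (fun k => diff_face j (@err s i) k *
    ((s_G s i j k + s_G s i j (up i k)) / 2 - diff_face j (s_W s i) k)) =
   mu * \sum_i \sum_j I (fun k => diff_face j (@err s i) k *
       ((s_G s i j k + s_G s i j (up i k)) / 2))
   - mu * \sum_i \sum_j I (fun k => diff_face j (@err s i) k * diff_face j (s_W s i) k).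
  rewrite -mulrBr -sumrB; congr (_ * _); apply: eq_bigr => i _.
  rewrite -sumrB; apply: eq_bigr => j _; rewrite -IpcB.
  by apply: Ipc_eq => k; rewrite mulrBr.
have L2 : (mu + lambda) * \sum_i I (fun k => diff_cell i (@err s i) k *
     ((s_D s i (dn i k) + s_D s i k) / 2 - div_cell (s_W s) k)) =
   (mu + lambda) * \sum_i I (fun k => diff_cell i (@err s i) k *
       ((s_D s i (dn i k) + s_D s i k) / 2))
   - (mu + lambda) * I (fun k => div_cell (@err s) k * div_cell (s_W s) k).
  have -> : I (fun k => div_cell (@err s) k * div_cell (s_W s) k) =
    \sum_i I (fun k => diff_cell i (@err s i) k * div_cell (s_W s) k).
    by rewrite -Ipc_sum; apply: Ipc_eq => k; rewrite -mulr_suml.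
  rewrite -mulrBr -sumrB; congr (_ * _); apply: eq_bigr => i _; rewrite -IpcB.
  by apply: Ipc_eq => k; rewrite mulrBr.
have L3 : \sum_i \sum_j I (fun k => diff_face j (s_u s i) k *
                  (diff_face j (s_u s i) k - diff_face j (s_W0 s i) k)) =
   gradE s + \sum_i \sum_j I (fun k => diff_face j (@err s i) k * diff_face j (s_W s i) k)
   + \sum_i \sum_j I (fun k => diff_face j (s_u s i) k *
     (diff_face j (s_W s i) k - diff_face j (s_W0 s i) k)).
  rewrite /gradE /grad_norm2 -!big_split; apply: eq_bigr => i _ /=.
  rewrite -!big_split; apply: eq_bigr => j _ /=; rewrite -!IpcD.
  apply: Ipc_eq => k; have -> : diff_face j (@err s i) k =
     diff_face j (s_u s i) k - diff_face j (s_W s i) k by rewrite /diff_face /err; ring.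
  ring.
have L4 : I (fun k => div_cell (s_u s) k *
                  (div_cell (s_u s) k - div_cell (s_W0 s) k)) =
   I (fun k => div_cell (@err s) k ^+ 2)
   + I (fun k => div_cell (@err s) k * div_cell (s_W s) k)
   + I (fun k => div_cell (s_u s) k * (div_cell (s_W s) k - div_cell (s_W0 s) k)).
  rewrite -!IpcD; apply: Ipc_eq => k.
  have -> : div_cell (@err s) k = div_cell (s_u s) k - div_cell (s_W s) k.
    by rewrite /div_cell -sumrB; apply: eq_bigr => i _; rewrite /diff_cell /err; ring.
  ring.
rewrite S3E /X12 L1 L2 L3 L4; ring.
Qed.

(** Adding the integral of [p(r)] at both levels completes the Bregman distances; the increment of
    this integral is the time term that [pressure_balance] needs. *)
Lemma relative_energy_step s :
  relE s - relE0 s + s_tau s * (dissipation alpha (s_rho s) (s_u s) H H'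
     + mu * gradE s + (mu + lambda) * I (fun k => div_cell (@err s) k ^+ 2))
  <= s_tau s * (X1 s + X2 s + X3 s + X4 s + X5 s + X6 s + X7 s + X8 s + X9 s + X10 s
                + X11 s + X12 s).
Proof.
have t0 := s_tau_gt0 s.
have Q := relative_energy_ineq (s_N_gt0 s) t0 (@s_rho0_gt0 s) (@s_rho_gt0 s)
  (pressure_hpot a gamma_gt1) (bregman_hpot_ge0 a_gt0 gamma_gt1) (s_W0 s)
  (s_W s) (fun k => H' (s_r0 s k)) (fun k => H' (s_r s k)) (@s_continuity s) (@s_momentum s).
have F : \sum_i \sum_j I (fun k =>
        - ((s_rho s k * Num.max 0 (s_u s j k) * (ub s i k - V0 s i k)
         + s_rho s (up j k) * Num.min 0 (s_u s j k) * (ub s i (up j k) - V0 s i (up j k)))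
        * diff_face j (V0 s i) k)
       + h s / 2 * (s_rho s k * Num.max 0 (s_u s j k)
          - s_rho s (up j k) * Num.min 0 (s_u s j k)) * diff_face j (V0 s i) k ^+ 2
       + h s `^ alpha * (avg_face j (fun l => ub s i l - V0 s i l) k
          * diff_face j (s_rho s) k * diff_face j (V0 s i) k)) =
   X1 s - S1 s + X9 s + X10 s.
  rewrite -convective_flux [S1 s + _]addrC addrK /X9 /X10 mulr_sumr -!big_split.
  apply: eq_bigr => i _ /=; rewrite mulr_sumr -!big_split; apply: eq_bigr => j _ /=.
  by rewrite !IpcD IpcZ.
have E1 : relE s = I (fun k => 2^-1 * s_rho s k * (\sum_i (ub s i k - V s i k) ^+ 2)
              + H (s_rho s k) - H' (s_r s k) * s_rho s k) + I (fun k => p (s_r s k)).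
  rewrite -IpcD; apply: Ipc_eq => k.
  by rewrite (pressure_hpot a gamma_gt1 (s_r_gt0 k)) /bregman; ring.
have E2 : relE0 s = I (fun k => 2^-1 * s_rho0 s k * (\sum_i (s_ubar0 s i k - V0 s i k) ^+ 2)
              + H (s_rho0 s k) - H' (s_r0 s k) * s_rho0 s k) + I (fun k => p (s_r0 s k)).
  rewrite -IpcD; apply: Ipc_eq => k.
  by rewrite (pressure_hpot a gamma_gt1 (s_r0_gt0 k)) /bregman; ring.
have E3 : I (fun k => p (s_r s k)) - I (fun k => p (s_r0 s k)) =
   s_tau s * I (fun k => (p (s_r s k) - p (s_r0 s k)) / s_tau s).
  rewrite -IpcB -IpcZ; apply: Ipc_eq => k; field; by rewrite gt_eqF.
have Et := time_difference s; have Ep := pressure_gradient s.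
have Eb := pressure_balance s; have Ev := viscous_terms s.
move: Q; rewrite F Et => Q.
rewrite E1 E2; move: Q E3 Ep Eb Ev.
move: (I (fun k => _ + H (s_rho s k) - _)) (I (fun k => _ + H (s_rho0 s k) - _)) => y1 y2.
move: (I (fun k => p (s_r s k))) (I (fun k => p (s_r0 s k))) => y3 y4.
move: (\sum_j I (fun k => mass_flux _ _ _ _ _ * _)) => y5.
move: (I (fun k => p (s_rho s k) * _)) (I (fun k => _ / s_tau s)) => y6 y7.
move: (S1 s) (S2 s) (S3 s) (S4 s) => z1 z2 z3 z4.
move: (mu * (\sum_i _)) ((mu + lambda) * I (fun k => div_cell (s_u s) k * _)) => v1 v2.
move: (mu * gradE s) ((mu + lambda) * I (fun k => div_cell (@err s) k ^+ 2)) => v3 v4.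
move: (dissipation _ _ _ _ _) => D Q E3 Ep Eb Ev.
have -> : X12 s = - z3 - v1 - v2 + v3 + v4 by [].
have -> : X11 s = z4 - y6 + y7 by [].
have -> : X6 s = z2 - y5 - X7 s - X8 s by lra.
lra.
Qed.
(** The sign of the face velocity selects one of the two upwind distances; in the diffusive part one
    of the two is dropped. *)
Lemma jumps_le_dissipation (b b' : R -> R) (c : R) : 0 <= c ->
  (forall x y : R, 0 < x -> 0 < y -> c * ((x - y) ^+ 2 / (1 + x + y)) <= bregman b b' x y) ->
  forall s, c * jumps s <= dissipation alpha (s_rho s) (s_u s) b b'.
Proof.
move=> c0 Hb s; rewrite /jumps /dissipation mulrDr !mulr_sumr -big_split/=.
apply: ler_sum => j _; rewrite -!IpcZ -IpcD.
apply: Ipc_le => [|k]; first exact: s_N_gt0.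
have h0 := h_gt0 s; have r0 := s_rho_gt0 k; have r1 := s_rho_gt0 (up j k).
have E1 := Hb _ _ r0 r1; have E2 := Hb _ _ r1 r0.
set q := (s_rho s (up j k) - s_rho s k) ^+ 2 / (1 + s_rho s k + s_rho s (up j k)).
have {}E1 : c * q <= bregman b b' (s_rho s k) (s_rho s (up j k)).
  by move: E1; rewrite -[(s_rho s k - _) ^+ 2]sqrrN opprB.
have {}E2 : c * q <= bregman b b' (s_rho s (up j k)) (s_rho s k).
  by move: E2; rewrite [1 + _ + _]addrAC.
have q0 : 0 <= c * q.
  by rewrite mulr_ge0// divr_ge0 ?sqr_ge0//; lra.
have ha0 := powR_ge0 (h s) alpha.
apply: lerD.
  have -> : c * (`|s_u s j k| * (s_rho s (up j k) - s_rho s k) ^+ 2 /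
      (1 + s_rho s k + s_rho s (up j k)) / h s) = `|s_u s j k| * (c * q) / h s.
    by rewrite /q; ring.
  apply: ler_wpM2r; first by rewrite invr_ge0 ltW.
  have [u0|u0] := leP 0 (s_u s j k).
    by rewrite ger0_norm// mul0r subr0; exact: ler_wpM2l.
  rewrite ltr0_norm// mul0r sub0r -mulNr; apply: ler_wpM2l => //.
  by rewrite oppr_ge0 ltW.
have -> : c * (h s `^ alpha * diff_face j (s_rho s) k ^+ 2 /
      (1 + s_rho s k + s_rho s (up j k))) = h s `^ alpha / h s ^+ 2 * (c * q).
  rewrite /q /diff_face; field; rewrite (gt_eqF h0) andbT gt_eqF//; lra.
apply: ler_wpM2l; first by rewrite divr_ge0// sqr_ge0.
by apply: le_trans E1 _; rewrite lerDl (le_trans q0).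
Qed.

(** An addition to the relative energy for [gamma > 2]. The factor [sqrt h] matches the weight of
    [jumps] in [negligible] and keeps the initial value of order [h^A]. *)
Definition entropy_total (N : nat) (rho : cell d N -> R) : R :=
  if gamma <= 2 then 0 else Num.sqrt (@mesh R N) * I (fun k => entropy (rho k)).

Lemma entropy_total_ge0 (N : nat) (rho : cell d N -> R) : (0 < N)%N ->
  (forall k, 0 < rho k) -> 0 <= entropy_total rho.
Proof.
move=> N0 r0; rewrite /entropy_total; case: ifP => // _.
rewrite mulr_ge0 ?sqrtr_ge0//; apply: Ipc_ge0 => // k.
by have /andP[] := entropy_bound (r0 k).
Qed.

(** For [gamma > 2] the internal energy bounds the density in [L^2], so the compression source of
    the entropy can be absorbed by viscosity. *)
Lemma neg_entropy_flux : 2 < gamma ->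
  negligible (fun s => Num.sqrt (h s) * I (fun k => s_rho s k * `|div_cell (s_u s) k|)).
Proof.
move=> g2.
have n1 i : negligible (fun s => I (fun k => Num.sqrt (h s) * s_rho s k
    * `|diff_cell i (@err s i) k|)).
  apply: (@neg_young 1 ler01 (fun s k => diff_cell i (@err s i) k) _
    (fun s k => Num.sqrt (h s) * s_rho s k) (1 + B)) => [s| |s k|s].
  - by apply: le_1gradE; exact: diff_cell_err_le.
  - by rewrite addr_ge0.
  - by rewrite mulr_ge0 ?sqrtr_ge0// ltW// s_rho_gt0.
  apply: (@le_trans _ _ (h s * (1 + B))); last first.
    rewrite mulrC; apply: ler_wpM2l; first by rewrite addr_ge0.
    by have := relE_ge0 s; have := mesh_le_rate s; lra.
  under Ipc_eq do rewrite exprMn sqr_sqrtr ?(ltW (h_gt0 s))//.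
  rewrite IpcZ; apply: ler_wpM2l; first exact: ltW.
  apply: (@le_trans _ _ (I (fun k => 1 + s_rho s k `^ gamma))).
    apply: Ipc_le => [|k]; first exact: s_N_gt0.
    have r0 := s_rho_gt0 k; rewrite -powR_mulrn ?(ltW r0)//.
    have [r1|r1] := leP (s_rho s k) 1.
      have P0 := powR_ge0 (s_rho s k) gamma.
      have : s_rho s k `^ 2%:R <= 1.
        by rewrite powR_mulrn ?(ltW r0)// expr_le1// ltW.
      lra.
    have : s_rho s k `^ 2%:R <= s_rho s k `^ gamma.
      by apply: ler_powR; rewrite ltW.
    lra.
  by rewrite IpcD Ipc_cst ?s_N_gt0// lerD2l s_internal.
have n2 : negligible (fun s => d%:R * B * M * Num.sqrt (h s)).
  by apply: (@neg_sqrt (d%:R * B * M)) => //; rewrite !mulr_ge0// ltW.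
apply: neg_le (negD (neg_sum n1) n2) => s.
have E : d%:R * B * M * Num.sqrt (h s) = I (fun k => d%:R * B * Num.sqrt (h s) * s_rho s k).
  by rewrite IpcZ s_mass; ring.
rewrite E -IpcZ -Ipc_sum -IpcD; apply: Ipc_le => [|k]; first exact: s_N_gt0.
have q0 : 0 <= Num.sqrt (h s) * s_rho s k by rewrite mulr_ge0 ?sqrtr_ge0// ltW// s_rho_gt0.
have U : `|div_cell (s_u s) k| <= \sum_i `|diff_cell i (@err s i) k| + d%:R * B.
  apply: le_trans (ler_norm_sum _ _ _) _.
  apply: (@le_trans _ _ (\sum_i (`|diff_cell i (@err s i) k| + B))).
    by apply: ler_sum => i _; exact: diff_cell_u_le.
  by rewrite big_split/= sumr_const card_ord mulr_natl.
have := ler_wpM2l q0 U; rewrite -mulr_sumr; lra.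
Qed.

Lemma entropy_step s : 2 < gamma ->
  I (fun k => entropy (s_rho s k)) - I (fun k => entropy (s_rho0 s k))
  + s_tau s * (4^-1 * jumps s)
  <= s_tau s * I (fun k => s_rho s k * `|div_cell (s_u s) k|).
Proof.
move=> g2; have t0 := s_tau_gt0 s.
have Q := renormalized_continuity (s_N_gt0 s) t0 entropy entropy' (@s_continuity s).
have br (x y : R) : 0 < x -> 0 < y ->
    4^-1 * ((x - y) ^+ 2 / (1 + x + y)) <= bregman entropy entropy' x y.
  by move=> x0 y0; rewrite mulrC; exact: bregman_entropy_ge.
have i4 : 0 <= 4^-1 :> R by rewrite invr_ge0.
have J := ler_wpM2l (ltW t0) (jumps_le_dissipation i4 br s).
have E : I (fun k => entropy (s_rho s k)) - I (fun k => entropy (s_rho0 s k)) <=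
   I (fun k => (s_rho s k - s_rho0 s k) * entropy' (s_rho s k)).
  rewrite -IpcB; apply: Ipc_le => [|k]; first exact: s_N_gt0.
  have b0 := br _ _ (s_rho0_gt0 k) (s_rho_gt0 k).
  have : 0 <= 4^-1 * ((s_rho0 s k - s_rho s k) ^+ 2 / (1 + s_rho0 s k + s_rho s k)).
    rewrite mulr_ge0// divr_ge0 ?sqr_ge0//.
    by have := s_rho0_gt0 k; have := s_rho_gt0 k; lra.
  move: b0; rewrite /bregman; move: (_ / _) => z b0; lra.
have F : - I (fun k => (s_rho s k * entropy' (s_rho s k) - entropy (s_rho s k))
     * div_cell (s_u s) k) <= I (fun k => s_rho s k * `|div_cell (s_u s) k|).
  rewrite -IpcN; apply: Ipc_le => [|k]; first exact: s_N_gt0.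
  have /andP[p0 p1] := entropy_flux_bound (s_rho_gt0 k).
  apply: le_trans (ler_norm _) _; rewrite normrN normrM ger0_norm//.
  exact: ler_wpM2r.
have := ler_wpM2l (ltW t0) F; move: Q J E.
rewrite !mulrDr; lra.
Qed.

Theorem one_step : exists2 C : R, 0 < C & forall s,
  relE s + entropy_total (s_rho s) - relE0 s - entropy_total (s_rho0 s)
  + s_tau s * (mu / 2 * gradE s + (mu + lambda) * I (fun k => div_cell (@err s) k ^+ 2))
  <= s_tau s * (C * (relE s + h s `^ A)).
Proof.
have nX : negligible (fun s => X1 s + X2 s + X3 s + X4 s + X5 s + X6 s + X7 s + X8 s
    + X9 s + X10 s + X11 s + X12 s).
  exact: (negD (negD (negD (negD (negD (negD (negD (negD (negD (negD (negD neg_X1 neg_X2) neg_X3) neg_X4) neg_X5) neg_X6) neg_X7) neg_X8) neg_X9) neg_X10) neg_X11) neg_X12).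
have mu2 : 0 < mu / 2 by rewrite divr_gt0.
have [g2|g2] := leP gamma 2.
  have c0 : 0 < a * (gamma - 1) by rewrite mulr_gt0// subr_gt0.
  (* Half of the viscosity is kept for the conclusion. The other entry is the coercivity constant of
     the dissipation: [a (gamma - 1)] in this case, [1/4] for the entropy in the other. *)
  pose del := Num.min (mu / 2) (a * (gamma - 1)).
  have del0 : 0 < del by rewrite /del lt_min mu2.
  have [C C0 HC] := nX del del0; exists C => // s.
  rewrite /entropy_total g2 addr0 subr0.
  have t0 := s_tau_gt0 s; have Q := relative_energy_step s.
  have X := ler_wpM2l (ltW t0) (HC s).
  have J := jumps_le_dissipation (ltW c0)
    (fun x y => @bregman_hpot_ge _ _ _ a_gt0 gamma_gt1 x y g2) s.
  have q1 : Num.sqrt (h s) * jumps s <= jumps s.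
    by rewrite ler_piMl ?jumps_ge0// -[X in _ <= X]sqrtr1 ler_sqrt.
  have d1 : del * gradE s <= mu / 2 * gradE s.
    by apply: ler_wpM2r; [exact: gradE_ge0|rewrite /del ge_min lexx].
  have d2 : del * (Num.sqrt (h s) * jumps s) <= a * (gamma - 1) * jumps s.
    apply: ler_pM => //; first exact: ltW.
      by rewrite mulr_ge0 ?sqrtr_ge0 ?jumps_ge0.
    by rewrite /del ge_min lexx orbT.
  have K : del * (gradE s + Num.sqrt (h s) * jumps s) <=
     mu / 2 * gradE s + dissipation alpha (s_rho s) (s_u s) H H' by lra.
  have := ler_wpM2l (ltW t0) K; move: Q X.
  move: (I (fun k => div_cell (@err s) k ^+ 2)) (dissipation _ _ _ _ _) => x y.
  rewrite !mulrDr; lra.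
have nX' := negD nX (neg_entropy_flux g2).
pose del := Num.min (mu / 2) 4^-1.
have del0 : 0 < del by rewrite /del lt_min mu2 invr_gt0 ltr0n.
have [C C0 HC] := nX' del del0; exists C => // s.
rewrite /entropy_total [gamma <= 2]leNgt g2/=.
have t0 := s_tau_gt0 s; have Q := relative_energy_step s.
have X := ler_wpM2l (ltW t0) (HC s).
have D0 : 0 <= dissipation alpha (s_rho s) (s_u s) H H'.
  have br (x y : R) : 0 < x -> 0 < y -> 0 * ((x - y) ^+ 2 / (1 + x + y)) <= bregman H H' x y.
    by move=> x0 y0; rewrite mul0r bregman_hpot_ge0.
  by have := jumps_le_dissipation (lexx 0) br s; rewrite mul0r.
have d1 : del * gradE s <= mu / 2 * gradE s.
  by apply: ler_wpM2r; [exact: gradE_ge0|rewrite /del ge_min lexx].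
have d2 : del * (Num.sqrt (h s) * jumps s) <= Num.sqrt (h s) * (4^-1 * jumps s).
  rewrite [X in _ <= X]mulrCA; apply: ler_wpM2r.
    by rewrite mulr_ge0 ?sqrtr_ge0 ?jumps_ge0.
  by rewrite /del ge_min lexx orbT.
have S := ler_wpM2l (sqrtr_ge0 (h s)) (entropy_step s g2).
have K : del * (gradE s + Num.sqrt (h s) * jumps s) <=
   mu / 2 * gradE s + Num.sqrt (h s) * (4^-1 * jumps s) by lra.
have := ler_wpM2l (ltW t0) K; have := mulr_ge0 (ltW t0) D0; move: Q X S.
move: (I (fun k => div_cell (@err s) k ^+ 2)) (dissipation _ _ _ _ _) => x y.
move: (I (fun k => s_rho s k * _)) (I (fun k => entropy (s_rho s k)))
  (I (fun k => entropy (s_rho0 s k))) => z e e0.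
rewrite !mulrDr; lra.
Qed.

End one_step.

(** * Lebesgue measure of boxes and averages over boxes *)

Section lebesgue_box.
Context {R : realType}.
Local Notation tup n := (n.-tuple (measurableTypeR R)).
Implicit Types n : nat.

Definition box n (a b : 'I_n -> R) : set (tup n) :=
  [set t | forall i, a i <= tnth t i <= b i].

Lemma measurable_box n (a b : 'I_n -> R) : measurable (box a b).
Proof.
have -> : box a b = \bigcap_(i in [set: 'I_n])
    ((fun t : tup n => tnth t i) @^-1` `[a i, b i]%classic).
  apply/seteqP; split => [t H i _ /=|t H i]; first by rewrite in_itv/=; exact: H.
  by have := H i I; rewrite /= in_itv.
apply: fin_bigcap_measurable => // i _; rewrite -[X in measurable X]setTI.
exact: measurable_tnth.
Qed.

Lemma preimage_tcons_box n (a b : 'I_n.+1 -> R) :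
  @tcons R n @^-1` box a b =
  `[a ord0, b ord0]%classic `*` box (a \o lift ord0) (b \o lift ord0).
Proof.
apply/seteqP; split => [[x t] H|[x t] [/= Hx Ht] i].
  split; first by have := H ord0; rewrite /= in_itv.
  by move=> i; have := H (lift ord0 i); rewrite /= tnthS.
case: (unliftP ord0 i) => [j ->|->]; first by rewrite tnthS; exact: Ht.
by move: Hx; rewrite in_itv.
Qed.

Lemma leb_box n (a b : 'I_n -> R) : (forall i, a i <= b i) ->
  leb n (box a b) = (\prod_i (b i - a i))%:E.
Proof.
elim: n a b => [|n IH] a b ab.
  rewrite big_ord0 /= diracE mem_set//; by case.
have -> : leb n.+1 (box a b) = (@lebesgue_measure R \x leb n)%E (@tcons R n @^-1` box a b).
  by [].
rewrite preimage_tcons_box product_measure1E//; last exact: measurable_box.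
rewrite IH//; last by move=> i; exact: ab.
rewrite big_ord_recl EFinM; congr (_ * _)%E.
rewrite [LHS](lebesgue_measure_itv `[a ord0, b ord0])/= lte_fin.
have := ab ord0; rewrite le_eqVlt => /predU1P[->|->].
  by rewrite ltxx subrr.
by rewrite EFinB.
Qed.

Definition translate n (s : 'I_n -> R) (t : tup n) : tup n :=
  [tuple tnth t i + s i | i < n].

Lemma measurable_translate n (s : 'I_n -> R) : measurable_fun [set: tup n] (translate s).
Proof.
apply/measurable_fun_tnthP => i.
rewrite (_ : _ \o _ = (fun t : tup n => tnth t i + s i)); last first.
  by apply/funext => t /=; rewrite tnth_mktuple.
by apply: measurable_funD => //; exact: measurable_tnth.
Qed.

Lemma lebesgue_measure_shift (c : R) (A : set (measurableTypeR R)) : measurable A ->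
  @lebesgue_measure R ((fun x : measurableTypeR R => x + c : measurableTypeR R) @^-1` A)
  = @lebesgue_measure R A.
Proof.
move=> mA; pose f (x : measurableTypeR R) : measurableTypeR R := x + c.
have mf : measurable_fun setT f by apply: measurable_funD.
apply/esym.
pose m := pushforward (@lebesgue_measure R : {measure set _ -> \bar R}) f.
apply: (@lebesgue_measure_unique R [the measure _ _ of m]) => // X [[a b] /= _ <-].
rewrite /m /pushforward.
have -> : f @^-1` `]a, b]%classic = `]a - c, b - c]%classic.
  by apply/seteqP; split => x; rewrite /f /= !in_itv/= ltrBlDr lerBrDr.
rewrite !lebesgue_measure_itv/= !lte_fin ltrD2r; case: ifP => // _.
by rewrite -!EFinB; congr EFin; lra.
Qed.

(** Induction on the product structure: the measure is determined by rectangles, on which one factor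
    is a translation of the line and the other the induction hypothesis. *)
Lemma leb_translate n (s : 'I_n -> R) (A : set (tup n)) : measurable A ->
  leb n (translate s @^-1` A) = leb n A.
Proof.
elim: n s A => [|n IH] s A mA.
  congr (leb 0 _); apply/seteqP; split => t /=;
  by rewrite [translate s t]tuple0 [t]tuple0.
pose f (x : measurableTypeR R) : measurableTypeR R := x + s ord0.
pose s' := s \o lift ord0.
pose g (z : measurableTypeR R * tup n) := (f z.1, translate s' z.2).
have mf : measurable_fun setT f by apply: measurable_funD.
have mg : measurable_fun setT g.
  apply/measurable_fun_pairP; split.
    by apply: (measurableT_comp mf); exact: measurable_fst.
  by apply: (measurableT_comp (measurable_translate s')); exact: measurable_snd.
have E : @tcons R n @^-1` (translate s @^-1` A) = g @^-1` (@tcons R n @^-1` A).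
  have key z : translate s (tcons z) = tcons (g z).
    case: z => x t; apply: eq_from_tnth => i; rewrite tnth_mktuple.
    by case: (unliftP ord0 i) => [j ->|->]//; rewrite !tnthS tnth_mktuple.
  by apply/funext => z; rewrite /preimage/= key.
rewrite /= /tuple_measure_step /pushforward E.
pose m := pushforward ((@lebesgue_measure R \x leb n)%E : {measure set _ -> \bar R}) g.
have mc : measurable (@tcons R n @^-1` A).
  by rewrite -[X in measurable X]setTI; exact: measurable_tcons.
apply/esym; apply: (@product_measure_unique _ _ _ _ _ _ _ [the measure _ _ of m]) => //.
move=> X Y mX mY.
transitivity ((@lebesgue_measure R \x leb n)%E
  ((f @^-1` X) `*` (translate s' @^-1` Y))); first by [].
rewrite product_measure1E; first by
  congr (_ * _)%E; [exact: lebesgue_measure_shift|exact: IH].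
- by rewrite -[X in measurable X]setTI; exact: mf.
- by rewrite -[X in measurable X]setTI; exact: measurable_translate.
Qed.

(* An open set of [R^m] is a countable union of rational boxes. *)
Lemma measurable_continuous_rV n m (g : tup n -> 'rV[R]_m) (phi : 'rV[R]_m -> R) :
  (forall j, measurable_fun [set: tup n] (fun t => g t 0 j)) -> continuous phi ->
  measurable_fun [set: tup n] (fun t => phi (g t)).
Proof.
move=> mg cphi.
suff mO : forall O : set 'rV[R]_m, open O -> measurable (g @^-1` O).
  apply: (measurability (@RGenOpens.G R)) => //.
    exact: RGenOpens.measurableE.
  move=> _ [_ [a [b ->]] <-]; rewrite setTI.
  rewrite (_ : _ @^-1` _ = g @^-1` (phi @^-1` `]a, b[%classic))//.
  apply: mO; apply: open_comp => // x _; exact: cphi.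
move=> O oO.
pose bx (q : nat * 'rV[rat]_m) : set 'rV[R]_m :=
  [set x | forall j, `|x 0 j - ratr (q.2 0 j)| <= q.1.+1%:R^-1].
pose F (q : nat * 'rV[rat]_m) : set (tup n) :=
  if pselect (bx q `<=` O) then g @^-1` bx q else set0.
have -> : g @^-1` O = \bigcup_q F q.
  apply/seteqP; split => [t /= Ot|t [q _]]; last first.
    by rewrite /F; case: pselect => // qO /= /qO.
  have /nbhs_ballP[e /= e0 eO] : nbhs (g t) O by exact: open_nbhs_nbhs.
  have [k ke] : exists k : nat, (k.+1%:R : R)^-1 < e / 2.
    exists (Num.truncn (2 / e)); rewrite -[X in _ < X]invf_div ltf_pV2 ?posrE ?divr_gt0// ?invr_gt0//.
    exact: truncnS_gt.
  have q j : exists q : rat, `|g t 0 j - ratr q| < (k.+1%:R : R)^-1.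
    have : g t 0 j - k.+1%:R^-1 < g t 0 j + k.+1%:R^-1.
      by rewrite ltrBlDr -addrA ltrDl addr_gt0// invr_gt0.
    move=> /rat_in_itvoo[q]; rewrite in_itv/= => /andP[q1 q2]; exists q.
    move: q1 q2; move: (ratr q : R) ((k.+1%:R : R)^-1) (g t 0 j) => x y z q1 q2.
    by rewrite ltr_norml; apply/andP; split; lra.
  have [Q HQ] := choice q.
  exists (k, \row_j Q j) => //; rewrite /F; case: pselect => [_ j|[]].
    by rewrite /= mxE ltW.
  move=> y /= Hy; apply: eO; split => // i j; rewrite ord1 -ball_normE /=.
  have := Hy j; rewrite mxE => Hj; have {}HQ := HQ j.
  have tri (x z w c : R) : c < e / 2 -> `|x - w| < c -> `|z - w| <= c -> `|x - z| < e.
    by move=> ce xw zw; have := ler_distD w x z; rewrite [`|w - _|]distrC; lra.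
  exact: tri ke HQ Hj.
apply: countable_bigcupT_measurable => [|q]; first exact: countableP.
rewrite /F; case: pselect => bO /=; last exact: measurable0.
have -> : g @^-1` bx q = \bigcap_(j in [set: 'I_m])
    ((fun t => g t 0 j) @^-1` `[ratr (q.2 0 j) - q.1.+1%:R^-1,
                               ratr (q.2 0 j) + q.1.+1%:R^-1]%classic).
  apply/seteqP; split => [t H j _ /=|t H j]; first by rewrite in_itv/= -ler_distl; exact: H.
  by have := H j I; rewrite /= in_itv/= -ler_distl.
apply: fin_bigcap_measurable => // j _; rewrite -[X in measurable X]setTI.
exact: mg.
Qed.


(** The parametrization [g] is left free so that cells ([pt_of]) and faces ([face_point]) share the
    same lemmas. *)
Definition box_avg n m (h : R) (b : 'I_n -> R) (g : tup n -> 'rV[R]_m) (phi : 'rV[R]_m -> R) : R :=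
  (h ^+ n)^-1 * \int[leb n]_(t in box b (fun i => b i + h)) phi (g t).

Definition bounded_continuous m (phi : 'rV[R]_m -> R) : Prop :=
  continuous phi /\ exists K : R, forall x, `|phi x| <= K.

Section box_avg.
Variables (n m : nat) (h : R) (b : 'I_n -> R) (g : tup n -> 'rV[R]_m).
Hypothesis h_gt0 : 0 < h.
Hypothesis mg : forall j, measurable_fun [set: tup n] (fun t => g t 0 j).
Let D := box b (fun i => b i + h).
Let mD : measurable D. Proof. exact: measurable_box. Qed.
Let leb_D : leb n D = (h ^+ n)%:E.
Proof.
rewrite leb_box; last by move=> i; rewrite lerDl ltW.
congr EFin; under eq_bigr do rewrite addrC addKr.
by rewrite prodr_const card_ord.
Qed.

Let leb_fin : (leb n D < +oo)%E. Proof. by rewrite leb_D ltry. Qed.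

Lemma box_integrable phi : bounded_continuous phi ->
  (leb n).-integrable D (EFin \o (fun t => phi (g t))).
Proof.
move=> [cphi [K HK]]; apply: measurable_bounded_integrable => //.
- by apply: (@measurable_funS _ _ _ _ setT) => //; exact: measurable_continuous_rV.
- exists K; split; first exact: num_real.
  by move=> x Kx t _ /=; apply: le_trans (HK _) _; exact: ltW.
Qed.

Lemma box_avg_fun (f : tup n -> R) (c : R) :
  (leb n).-integrable D (EFin \o f) -> (forall t, D t -> c <= f t) ->
  h ^+ n * c <= \int[leb n]_(t in D) f t.
Proof.
move=> If cf; have -> : h ^+ n * c = \int[leb n]_(t in D) c.
  by rewrite Rintegral_cst// [X in c * fine X]leb_D mulrC.
apply: le_Rintegral => //; apply: measurable_bounded_integrable => //.
by exists `|c|; split; [exact: num_real|move=> x cx t _ /=; exact: ltW].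
Qed.

Lemma box_avg_ge phi c : bounded_continuous phi ->
  (forall t, D t -> c <= phi (g t)) -> c <= box_avg h b g phi.
Proof.
move=> bp cp; rewrite /box_avg -ler_pdivrMl ?invr_gt0 ?exprn_gt0// invrK.
by apply: box_avg_fun => //; exact: box_integrable.
Qed.

Lemma box_avgB phi psi : bounded_continuous phi -> bounded_continuous psi ->
  box_avg h b g (fun x => phi x - psi x) = box_avg h b g phi - box_avg h b g psi.
Proof.
by move=> bp bq; rewrite /box_avg -mulrBr RintegralB//; exact: box_integrable.
Qed.

Lemma bounded_continuousB m' (phi psi : 'rV[R]_m' -> R) : bounded_continuous phi ->
  bounded_continuous psi -> bounded_continuous (fun x => phi x - psi x).
Proof.
move=> [c1 [K1 H1]] [c2 [K2 H2]]; split => [x|].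
  by apply: (@continuousB _ _ _ phi psi); [apply: c1|apply: c2].
exists (K1 + K2) => x; apply: le_trans (ler_normB _ _) _; exact: lerD.
Qed.

Lemma bounded_continuous_cst m' (c : R) : bounded_continuous (fun _ : 'rV[R]_m' => c).
Proof. by split; [exact: cst_continuous|exists `|c| => x]. Qed.

Lemma box_avg_norm phi c e : bounded_continuous phi ->
  (forall t, D t -> `|phi (g t) - c| <= e) -> `|box_avg h b g phi - c| <= e.
Proof.
move=> bp Hp; have bc := @bounded_continuous_cst m.
have B t : D t -> c - e <= phi (g t) /\ phi (g t) <= c + e.
  by move/Hp; rewrite ler_distl => /andP[].
rewrite ler_distl; apply/andP; split.
  by apply: box_avg_ge => // t /B[].
rewrite -subr_ge0.
have E : box_avg h b g (fun _ => c + e) = c + e.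
  by rewrite /box_avg Rintegral_cst// [X in _ * (_ * fine X)]leb_D /= mulrC mulfK// expf_neq0// gt_eqF.
rewrite -E -box_avgB//; apply: box_avg_ge => [|t /B[]]; last by rewrite subr_ge0.
exact: bounded_continuousB.
Qed.

(** Change of variables. Only the composed functions have to agree, so a translation by [h - 1] can
    be traded for one by [h] when the function is periodic. *)
Lemma box_avg_translate (s : 'I_n -> R) (g' : tup n -> 'rV[R]_m) phi psi :
  bounded_continuous psi -> (forall t, psi (g t) = phi (g' (translate s t))) ->
  (forall j, measurable_fun [set: tup n] (fun t => g' t 0 j)) ->
  bounded_continuous phi ->
  box_avg h (fun i => b i + s i) g' phi = box_avg h b g psi.
Proof.
move=> bpsi E mg' bphi; rewrite /box_avg; congr (_ * _).
pose D' := box (fun i => b i + s i) (fun i => b i + s i + h).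
have mD' : measurable D' by exact: measurable_box.
have ED : translate s @^-1` D' = D.
  apply/seteqP; split => t H i; have := H i; rewrite /= tnth_mktuple;
  by move=> /andP[H1 H2]; apply/andP; split; lra.
have mt := measurable_translate s.
pose F : tup n -> \bar R := EFin \o (fun t => phi (g' t)).
have mF : measurable_fun setT F.
  by apply/measurable_EFinP; apply: measurable_continuous_rV => //; case: bphi.
have EF : F \o translate s = EFin \o (fun t => psi (g t)).
  by apply/funext => t; rewrite /F /= E.
rewrite /Rintegral; congr fine.
rewrite (@eq_measure_integral _ _ _ D' (pushforward (leb n) (translate s))); last first.
  by move=> A mA _; rewrite /pushforward; exact/esym/leb_translate.
rewrite integral_pushforward//; last by rewrite ED EF; exact: box_integrable.
by rewrite ED EF.
Qed.

End box_avg.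

End lebesgue_box.

(** * Cell and face averages of periodic functions *)

Section projections.
Context {R : realType} {d N : nat}.
Hypothesis N_gt0 : (0 < N)%N.
Local Notation h := (@mesh R N).
Implicit Types (k : cell d N) (i j : 'I_d) (phi : 'rV[R]_d -> R).

Let h_gt0 : 0 < h. Proof. exact: mesh_gt0. Qed.

(** Common reference point with which the averages belonging to a cell are compared. *)
Definition corner k : 'rV[R]_d := \row_j ((k j)%:R * h).

Definition in_cell k (x : 'rV[R]_d) : Prop :=
  forall j, (k j)%:R * h <= x 0 j <= (k j).+1%:R * h.

Definition face_mean phi i k : R :=
  (h ^+ d.-1)^-1 * \int[leb d.-1]_(t in face_set i k) phi (face_point i k t).

(** The successor of the last cell is the first one, so the corner moves by [h - 1] there instead of
    [h]; the difference is a period. *)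
Lemma ordS_mesh (a : 'I_N) : (ordS a)%:R * h = (a.+1)%:R * h \/ (ordS a)%:R * h = (a.+1)%:R * h - 1.
Proof.
have : (a.+1 <= N)%N by exact: ltn_ord.
rewrite leq_eqVlt => /predU1P[E|E].
  right; rewrite /= E modnn mul0r /mesh mulfV ?subrr//.
  by rewrite pnatr_eq0 -lt0n.
by left; rewrite /= modn_small.
Qed.

Let up_shift j k : R := (up j k j)%:R * h - (k j)%:R * h.

Let up_coord j k i : (up j k i)%:R * h = (k i)%:R * h + (if i == j then up_shift j k else 0).
Proof.
rewrite /up_shift; case: eqP => [->|/eqP ij]; first by rewrite addrCA subrr addr0.
by rewrite ffunE (negbTE ij) addr0.
Qed.

Let periodic_up j k phi x : torus_periodic phi ->
  phi (x + up_shift j k *: unit_vec j) = phi (x + h *: unit_vec j).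
Proof.
move=> pp; rewrite /up_shift ffunE eqxx; have [->|->] := ordS_mesh (k j).
  by rewrite -mulrBl -natrB// subSnn mul1r.
rewrite -(pp (x + _) j) -addrA -[X in _ *: _ + X]scale1r -scalerDl.
by congr (phi (_ + _ *: _)); rewrite -addn1 natrD; ring.
Qed.

Lemma corner_up phi j k : torus_periodic phi -> phi (corner (up j k)) = phi (corner k + h *: unit_vec j).
Proof.
move=> pp; rewrite -(@periodic_up j k phi (corner k) pp); congr phi.
apply/rowP => i; rewrite !mxE up_coord eqxx /=.
by congr (_ + _); case: (i == j); rewrite /= ?mulr1 ?mulr0.
Qed.

Let coordS (a : nat) : a.+1%:R * h = a%:R * h + h.
Proof. by rewrite -addn1 natrD mulrDl mul1r. Qed.

Let cell_setE k : cell_set k = box (fun i => (k i)%:R * h) (fun i => (k i)%:R * h + h).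
Proof. by rewrite /cell_set /box; apply/seteqP; split => t H i; have := H i; rewrite coordS. Qed.

Let face_setE i k : face_set i k =
  box (fun l => (k (lift i l))%:R * h) (fun l => (k (lift i l))%:R * h + h).
Proof. by rewrite /face_set /box; apply/seteqP; split => t H j; have := H j; rewrite coordS. Qed.

Let proj_cellE phi k : proj_cell phi k = box_avg h (fun i => (k i)%:R * h) (@pt_of R d) phi.
Proof. by rewrite /proj_cell cell_setE. Qed.

Let face_meanE phi i k :
  face_mean phi i k = box_avg h (fun l => (k (lift i l))%:R * h) (face_point i k) phi.
Proof. by rewrite /face_mean face_setE. Qed.

Lemma measurable_pt_of j : measurable_fun setT (fun t => @pt_of R d t 0 j).
Proof.
rewrite (_ : (fun _ => _) = (fun t => tnth t j)); first exact: measurable_tnth.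
by apply/funext => t; rewrite mxE.
Qed.

Let measurable_face_point i k j :
  measurable_fun setT (fun t : d.-1.-tuple (measurableTypeR R) => face_point i k t 0 j).
Proof.
case Eu : (unlift i j) => [l|].
  rewrite (_ : (fun _ => _) = (fun t => tnth t l)); first exact: measurable_tnth.
  by apply/funext => t; rewrite mxE Eu.
rewrite (_ : (fun _ => _) = cst ((k i).+1%:R * h)); first exact: measurable_cst.
by apply/funext => t; rewrite mxE Eu.
Qed.

Let pt_in_cell k t : cell_set k t -> in_cell k (pt_of t).
Proof. by move=> H j; rewrite mxE; exact: H. Qed.

Let face_point_in_cell i k t : face_set i k t -> in_cell k (face_point i k t).
Proof.
move=> H j; rewrite mxE; case: unliftP => [l ->|->]; first exact: H.
by rewrite lexx andbT ler_pM2r// ler_nat.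
Qed.

Lemma proj_cell_near phi k c e : bounded_continuous phi ->
  (forall x, in_cell k x -> `|phi x - c| <= e) -> `|proj_cell phi k - c| <= e.
Proof.
move=> bp H; rewrite proj_cellE; apply: box_avg_norm => //; first exact: measurable_pt_of.
by move=> t tk; apply/H/pt_in_cell; rewrite cell_setE.
Qed.

Lemma face_mean_near phi i k c e : bounded_continuous phi ->
  (forall x, in_cell k x -> `|phi x - c| <= e) -> `|face_mean phi i k - c| <= e.
Proof.
move=> bp H; rewrite face_meanE; apply: box_avg_norm => //.
by move=> t tk; apply/H/face_point_in_cell; rewrite face_setE.
Qed.

Lemma proj_cellB phi psi k : bounded_continuous phi -> bounded_continuous psi ->
  proj_cell (fun x => phi x - psi x) k = proj_cell phi k - proj_cell psi k.
Proof. by move=> bp bq; rewrite !proj_cellE box_avgB//; exact: measurable_pt_of. Qed.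

Lemma face_meanB phi psi i k : bounded_continuous phi -> bounded_continuous psi ->
  face_mean (fun x => phi x - psi x) i k = face_mean phi i k - face_mean psi i k.
Proof. by move=> bp bq; rewrite !face_meanE box_avgB. Qed.

Lemma bounded_continuous_shift phi (v : 'rV[R]_d) : bounded_continuous phi ->
  bounded_continuous (fun x => phi (x + v)).
Proof.
move=> [cp [K HK]]; split; last by exists K => x; exact: HK.
have cv (x : 'rV[R]_d) : (fun z => z + v) z @[z --> x] --> x + v.
  exact: (@cvgD _ _ _ (nbhs x) _ id (cst v) x v (@cvg_id _ _) (@cvg_cst _ _ _ _ _)).
by move=> x; apply: continuous_comp; [exact: cv|exact: cp].
Qed.

(** The average over a neighbouring face is the average of a shifted function over the same face,
    also across the boundary of the unit cube. Differences of averages thereby become averages of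
    differences. *)
Lemma face_mean_up phi i j k : bounded_continuous phi -> torus_periodic phi ->
  face_mean phi i (up j k) = face_mean (fun x => phi (x + h *: unit_vec j)) i k.
Proof.
move=> bp pp; rewrite !face_meanE.
rewrite (_ : (fun l => (up j k (lift i l))%:R * h) =
   (fun l => (k (lift i l))%:R * h + if lift i l == j then up_shift j k else 0)); last first.
  by apply/funext => l; rewrite up_coord.
apply: box_avg_translate => //; first exact: bounded_continuous_shift.
move=> t; rewrite -(@periodic_up j k phi _ pp); congr phi; apply/rowP => l; rewrite !mxE eqxx /= mulr_natr.
case: unliftP => [m ->|->]; first by rewrite tnth_mktuple; case: eqP.
by rewrite !coordS up_coord addrAC; congr (_ + _ + _); case: eqP.
Qed.

(** A vanishing integral would force the function to vanish almost everywhere on a cell of measure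
    [h^d > 0]. Integrability on the cell comes from square integrability, via [|f| <= 1 + f^2]. *)
Lemma proj_cell_gt0 (phi : 'rV[R]_d -> R) k : inLp 2 phi ->
  {ae leb d, forall t, Omega t -> 0 < phi (pt_of t)} -> 0 < proj_cell phi k.
Proof.
move=> Lphi phi_gt0; rewrite /proj_cell; set D := cell_set k.
have mD : measurable D by rewrite /D cell_setE; exact: measurable_box.
have lebD : leb d D = (h ^+ d)%:E.
  rewrite /D cell_setE leb_box; last by move=> i; rewrite lerDl ltW.
  by congr EFin; under eq_bigr do rewrite addrC addKr; rewrite prodr_const card_ord.
have DO : D `<=` Omega.
  move=> t tD i; have /andP[t1 t2] := tD i; rewrite in_itv /=; apply/andP; split.
    by apply: le_trans t1; rewrite mulr_ge0// ltW.
  apply: le_trans t2 _; rewrite /mesh ler_pdivrMr ?ltr0n// mul1r ler_nat; exact: ltn_ord.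
pose f : d.-tuple (measurableTypeR R) -> R := (phi \o @pt_of R d) \_ Omega.
have fE t : D t -> f t = phi (pt_of t) by move=> tD; rewrite /f patchE mem_set//; exact: DO.
have mf : measurable_fun setT f by move: Lphi; rewrite /inLp inE => /andP[/[!inE]].
have If : (leb d).-integrable D (EFin \o f).
  have I2 := @Lfun_integrable _ _ _ (leb d) f 2 (ler1n _ 2) Lphi.
  have {}I2 : (leb d).-integrable D (fun x => (`|f x| `^ 2)%:E).
    by apply: integrableS I2.
  have I1 : (leb d).-integrable D (EFin \o (fun _ => 1)).
    have lfin : (leb d D < +oo)%E by rewrite lebD ltry.
    apply: measurable_bounded_integrable => //.
    by exists 1; split => // x x1 t _ /=; rewrite normr1 ltW.
  apply: le_integrable (integrableD mD I1 I2) => //.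
    by apply/measurable_EFinP; exact: measurable_funS mf.
  move=> t _ /=; rewrite lee_fin powR_mulrn// [X in _ <= X]ger0_norm; last by rewrite addr_ge0// sqr_ge0.
  have := sqr_ge0 (`|f t| - 1); have := sqr_ge0 `|f t|; move: `|f t| => y; lra.
have f_gt0 : {ae leb d, forall t, D t -> 0 < f t}.
  by apply: filterS phi_gt0 => t H tD; rewrite fE//; exact/H/DO.
rewrite pmulr_rgt0 ?invr_gt0 ?exprn_gt0//.
have -> : \int[leb d]_(t in D) phi (pt_of t) = \int[leb d]_(t in D) f t.
  by apply: eq_Rintegral => t; rewrite inE => tD; rewrite fE.
have mfD : measurable_fun D (EFin \o f) by apply/measurable_EFinP; exact: measurable_funS mf.
have Eabs : (\int[leb d]_(t in D) (EFin \o f) t = \int[leb d]_(t in D) `|(EFin \o f) t|)%E.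
  apply: ae_eq_integral => //; first exact: measurableT_comp.
  by apply: filterS f_gt0 => t H tD /=; rewrite gtr0_norm// H.
have := integral_fune_fin_num mD If; rewrite /Rintegral.
have I0 : (0 <= \int[leb d]_(t in D) (EFin \o f) t)%E by rewrite Eabs; exact: integral_ge0.
rewrite lt_neqAle fine_ge0// andbT => fin; apply/negP => /eqP E0.
have /ae_eq_integral_abs : (\int[leb d]_(t in D) `|(EFin \o f) t| = 0)%E.
  by rewrite -Eabs -[LHS]fineK// -E0.
move=> /(_ mD mfD) E.
have : (leb d).-negligible D.
  have : {ae leb d, forall t, ~ D t}.
    apply: filterS2 E f_gt0 => t /= H1 H2 tD; have := H1 tD; have := H2 tD.
    by move=> + [E1]; rewrite E1 ltxx.
  by apply: negligibleS => t tD /=; exact.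
move=> /negligibleP => /(_ mD) leb0; move: lebD; rewrite [LHS]leb0 => -[] /esym/eqP.
by rewrite expf_eq0 gt_eqF ?andbF.
Qed.

End projections.

(** * Calculus along lines in the space-time slab *)

Section slab.
Context {R : realType} {d : nat}.
Local Notation st := (R * 'rV[R]_d)%type.
Implicit Types (f g : st -> R) (z w v : st) (j : @dir d).

(** The regularity class provides directional derivatives, not differentiability on the product
    space; calculus is therefore carried out for functions of one variable along coordinate
    lines. *)
Lemma is_derive_line f z v s : derivable f (z + s *: v) v ->
  is_derive s 1 (fun s => f (z + s *: v)) ('D_v f (z + s *: v)).
Proof.
have E : (fun h : R => h^-1 *: ((fun s => f (z + s *: v)) (h *: 1 + s) - f (z + s *: v)))
  = (fun h : R => h^-1 *: (f (h *: v + (z + s *: v)) - f (z + s *: v))).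
  apply/funext => h; congr (_ *: (f _ - _)).
  by rewrite [h *: 1]mulr1 scalerDl addrCA.
move=> df; apply: DeriveDef; first by rewrite /derivable E.
by rewrite /derive E.
Qed.

Lemma derive_along f z v (s df : R) :
  is_derive s 1 (fun s => f (z + s *: v)) df ->
  derivable f (z + s *: v) v /\ 'D_v f (z + s *: v) = df.
Proof.
have E : (fun h : R => h^-1 *: ((fun s => f (z + s *: v)) (h *: 1 + s) - f (z + s *: v)))
  = (fun h : R => h^-1 *: (f (h *: v + (z + s *: v)) - f (z + s *: v))).
  apply/funext => h; congr (_ *: (f _ - _)).
  by rewrite [h *: 1]mulr1 scalerDl addrCA.
by move=> [H1 H2]; split; [move: H1; rewrite /derivable E|move: H2; rewrite /derive E].
Qed.

Lemma derivable_comp1 (F : R -> R) f z v (dF : R) : derivable f z v ->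
  is_derive (f z) 1 F dF ->
  derivable (fun y => F (f y)) z v /\ 'D_v (fun y => F (f y)) z = dF * 'D_v f z.
Proof.
move=> df HF; have z0 : z = z + (0 : R) *: v by rewrite scale0r addr0.
have df0 : is_derive (0 : R) 1 (fun s => f (z + s *: v)) ('D_v f (z + (0 : R) *: v)).
  by apply: is_derive_line; rewrite -z0.
have HF0 : is_derive ((fun s => f (z + s *: v)) (0 : R)) 1 F dF by rewrite -z0.
have := @derive_along (fun y => F (f y)) z v 0 _ (is_derive1_comp HF0 df0).
by rewrite -z0 mulrC.
Qed.

Lemma MVT_line f z v (eta : R) : 0 < eta ->
  (forall s, 0 < s < eta -> derivable f (z + s *: v) v) ->
  {within `[0, eta], continuous (fun s : R => f (z + s *: v))} ->
  exists2 s, 0 < s < eta & f (z + eta *: v) - f z = eta * 'D_v f (z + s *: v).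
Proof.
move=> e0 df cf; have [|s] := @MVT R (fun s => f (z + s *: v)) (fun s => 'D_v f (z + s *: v)) 0 eta e0 _ cf.
  by move=> s; rewrite in_itv /= => s0; apply: is_derive_line; exact: df.
by rewrite in_itv /= => s0; rewrite subr0 scale0r addr0 mulrC; exists s.
Qed.

Lemma MVT_line_open f z v (eta : R) : 0 < eta ->
  (forall s, 0 <= s <= eta -> derivable f (z + s *: v) v) ->
  exists2 s, 0 < s < eta & f (z + eta *: v) - f z = eta * 'D_v f (z + s *: v).
Proof.
move=> e0 df; apply: MVT_line => //.
  by move=> s /andP[s0 s1]; apply: df; rewrite !ltW.
apply: derivable_within_continuous => s; rewrite in_itv /= => s0.
by have /is_derive_line[] := df _ s0.
Qed.

Definition coord j z : R := if j is Some i then z.2 0 i else z.1.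

Lemma coord_move j k z (c : R) :
  coord k (z + c *: dir_vec j) = coord k z + (if k == j then c else 0).
Proof.
case: j => [j|]; case: k => [k|] /=; rewrite ?scaler0 ?addr0 ?[c *: 1]mulr1 ?mxE ?mulr0 ?addr0//.
rewrite eqxx /= (inj_eq (@Some_inj _)).
by case: eqP; rewrite ?mulr1 ?mulr0 ?addr0.
Qed.

Lemma ball_coord z (e : R) w : 0 < e -> (forall j, `|coord j z - coord j w| < e) -> ball z e w.
Proof.
move=> e0 H; split; first by rewrite -ball_normE /=; exact: (H None).
by split => // i j; rewrite ord1 -ball_normE /=; exact: (H (Some j)).
Qed.

Variable (T : R).
Hypothesis T_gt0 : 0 < T.

(** Relative continuity on the closed slab with distances measured coordinate by coordinate, as
    coordinate moves require. *)
Definition slab_continuous f : Prop := forall z, closed_slab T z ->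
  forall e : R, 0 < e -> exists2 del : R, 0 < del &
    forall w, closed_slab T w -> (forall j, `|coord j z - coord j w| < del) ->
    `|f z - f w| < e.

Lemma within_slab_continuous f : {within closed_slab T, continuous f} -> slab_continuous f.
Proof.
move=> /subspace_continuousP cf z zT e e0.
have /cvgrPdist_lt/(_ e e0) := cf z zT.
rewrite /prop_near1 /within /= => /nbhs_ballP[del /= del0 H].
by exists del => // w wT wz; apply: H => //; exact: ball_coord.
Qed.

Lemma open_closed z : open_slab T z -> closed_slab T z.
Proof. by rewrite /open_slab /closed_slab /= => /andP[/ltW -> /ltW ->]. Qed.

Lemma slab_continuous_x f t : slab_continuous f -> 0 <= t <= T -> continuous (fun x => f (t, x)).
Proof.
move=> cf tT; suff cx (x : 'rV[R]_d) : f (t, y) @[y --> x] --> f (t, x) by exact: cx.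
apply/(@cvgrPdist_lt _ _ _ (nbhs x)) => e e0.
have [del del0 H] := cf (t, x) tT e e0.
apply/nbhs_ballP; exists del => //= y [_ xy]; apply: H => // -[j|] /=.
  by have := xy 0 j; rewrite -ball_normE.
by rewrite subrr normr0.
Qed.

Lemma slab_continuous_line f z v (eta : R) : slab_continuous f ->
  (forall s, 0 <= s <= eta -> closed_slab T (z + s *: v)) ->
  {within `[0, eta], continuous (fun s : R => f (z + s *: v))}.
Proof.
move=> cf zT; apply/subspace_continuousP => s; rewrite /= in_itv /= => s0.
apply/cvgrPdist_lt => e e0.
have [del del0 H] := cf _ (zT _ s0) e e0.
pose K : R := 1 + \sum_j `|coord j v|.
have Kj j : `|coord j v| < K.
  rewrite /K (bigD1 j)//=; have : 0 <= \sum_(i | i != j) `|coord i v| by exact: sumr_ge0.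
  lra.
have K0 : 0 < K by apply: le_lt_trans (Kj None).
rewrite /prop_near1 /within /=; apply/nbhs_ballP; exists (del / K); first exact: divr_gt0.
move=> t; rewrite -ball_normE /= => st; rewrite in_itv /= => t0.
apply: H; first exact: zT.
move=> j; have -> : coord j (z + s *: v) - coord j (z + t *: v) = (s - t) * coord j v.
  by case: j => [j|] /=; [rewrite !mxE; ring|rewrite /GRing.scale /=; ring].
rewrite normrM; apply: (@le_lt_trans _ _ (`|s - t| * K)).
  by apply: ler_wpM2l => //; exact: ltW.
by rewrite -ltr_pdivlMr.
Qed.

(* Uniform continuity and boundedness on the part of the slab visited by the difference
   quotients based at a point of the unit cube. *)
Definition ball3 z : Prop := open_slab T z /\ forall i, 0 <= z.2 0 i <= 3.

Definition tame f : Prop :=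
  (forall e : R, 0 < e -> exists2 del : R, 0 < del & forall z w, ball3 z -> ball3 w ->
     (forall j, `|coord j z - coord j w| < del) -> `|f z - f w| <= e)
  /\ exists K : R, forall z, ball3 z -> `|f z| <= K.

(** Heine-Cantor for the continuous extension on the compact set [[0,T] x [0,3]^d]. Side 3 holds a
    base point of the unit cube, an averaging box and one further segment, each of length at most
    1. *)
Lemma extends_tame f : extends_continuously T f -> tame f.
Proof.
move=> [g /within_slab_continuous cg fg].
pose K : set st := `[0, T]%classic `*` [set x : 'rV[R]_d | forall i, `[0, 3]%classic (x ord0 i)].
have cK : compact K.
  by apply: compact_setX; [exact: segment_compact|exact: (@rV_compact R d (fun _ => `[0, 3]%classic) (fun _ => @segment_compact R 0 3))].
have KT z : K z -> closed_slab T z by move=> [/= z1 _]; move: z1; rewrite in_itv.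
have K3 z : ball3 z -> K z.
  move=> [/open_closed z1 z2]; split; first by rewrite /= in_itv.
  by move=> i /=; rewrite in_itv /=; exact: z2.
have fE z : ball3 z -> f z = g z by move=> [z1 _]; rewrite fg// inE.
have key (e : R) : 0 < e -> \forall del \near 0^'+, K `<=` [set z | K z -> forall w, K w ->
    (forall j, `|coord j z - coord j w| < del) -> `|g z - g w| <= e].
  move=> e0; apply: ((compact_near_coveringP K).1 cK) => //.
  move=> z Kz; have e2 : 0 < e / 2 by rewrite divr_gt0.
  have [rho rho0 H] := cg z (KT z Kz) _ e2.
  have rho2 : 0 < rho / 2 by rewrite divr_gt0.
  exists (ball z (rho / 2), [set del : R | del < rho / 2]) => /=.
    by split; [exact: nbhsx_ballx|exact: nbhs_right_lt].
  move=> [z' del] [/= [zz1 [_ zz2]] dr] Kz' w Kw zw.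
  have zz' k : `|coord k z - coord k z'| < rho / 2.
    move: zz1; rewrite -ball_normE /=; case: k => [k|] //= _.
    by have := zz2 0 k; rewrite -ball_normE.
  have hz' : `|g z - g z'| < e / 2.
    by apply: H => [|k]; [exact: KT|apply: lt_trans (zz' k) _; lra].
  have hw : `|g z - g w| < e / 2.
    apply: H => [|k]; first exact: KT.
    by have := ler_distD (coord k z') (coord k z) (coord k w); have := zz' k; have := zw k; lra.
  have := ler_distD (g z) (g z') (g w); rewrite [`|g z' - g z|]distrC; lra.
split => [e e0|].
  have [del /= del0 H] := key e e0.
  exists (del / 2); first by rewrite divr_gt0.
  move=> z w z3 w3 zw; rewrite !fE//.
  have d2 : ball 0 del (del / 2).
    by rewrite -ball_normE /= sub0r normrN gtr0_norm ?divr_gt0//; lra.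
  by apply: (H _ d2 _ z (K3 z z3) (K3 z z3) w (K3 w w3)) => //; rewrite divr_gt0.
have key1 : \forall B \near +oo, K `<=` [set z | K z -> `|g z| <= B].
  apply: ((compact_near_coveringP K).1 cK) => //.
  move=> z Kz; have [rho rho0 H] := cg z (KT z Kz) _ ltr01.
  exists (ball z rho, [set B : R | `|g z| + 1 < B]) => /=.
    by split; [exact: nbhsx_ballx|exact: nbhs_pinfty_gt].
  move=> [z' B] [/= [zz1 [_ zz2]] dr] Kz'.
  have : `|g z - g z'| < 1.
    apply: H; first exact: KT.
    move=> k; move: zz1; rewrite -ball_normE /=; case: k => [k|] //= _.
    by have := zz2 0 k; rewrite -ball_normE.
  have := ler_normD (g z' - g z) (g z); rewrite subrK [`|g z' - _|]distrC; lra.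
have [B [_ HB]] := key1; exists (B + 1) => z z3; rewrite fE//.
by apply: HB (K3 z z3) (K3 z z3); rewrite ltrDl.
Qed.

Lemma tameM f g : tame f -> tame g -> tame (fun z => f z * g z).
Proof.
move=> [uf [K Kf]] [ug [L Lg]].
split; last first.
  by exists (K * L) => z z3; rewrite normrM; apply: ler_pM => //; [exact: Kf|exact: Lg].
move=> e e0; have P0 : 0 < 1 + `|K| + `|L| by have := normr_ge0 K; have := normr_ge0 L; lra.
pose e' := e / (1 + `|K| + `|L|); have e'0 : 0 < e' by rewrite divr_gt0.
have [d1 d10 H1] := uf _ e'0; have [d2 d20 H2] := ug _ e'0.
exists (Num.min d1 d2); first by rewrite lt_min d10.
move=> z w z3 w3 zw.
have h1 : `|f z - f w| <= e' by apply: H1 => // k; have := zw k; rewrite lt_min => /andP[].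
have h2 : `|g z - g w| <= e' by apply: H2 => // k; have := zw k; rewrite lt_min => /andP[].
have -> : f z * g z - f w * g w = (f z - f w) * g z + f w * (g z - g w) by ring.
have hg := le_trans (Lg z z3) (ler_norm L); have hf := le_trans (Kf w w3) (ler_norm K).
apply: le_trans (ler_normD _ _) _; rewrite !normrM.
have := ler_pM (normr_ge0 _) (normr_ge0 _) h1 hg.
have := ler_pM (normr_ge0 _) (normr_ge0 _) hf h2.
have -> : e = e' + e' * `|L| + `|K| * e' by rewrite /e'; field; rewrite gt_eqF.
by move: (`|f z - f w| * _) (`|f w| * _) (e' * `|L|) (`|K| * e') e'0 => *; lra.
Qed.

Lemma tameD f g : tame f -> tame g -> tame (fun z => f z + g z).
Proof.
move=> [uf [K Kf]] [ug [L Lg]]; split; last first.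
  exists (K + L) => z z3; apply: le_trans (ler_normD _ _) _.
  by apply: lerD; [exact: Kf|exact: Lg].
move=> e e0; have e2 : 0 < e / 2 by rewrite divr_gt0.
have [d1 d10 H1] := uf _ e2; have [d2 d20 H2] := ug _ e2.
exists (Num.min d1 d2); first by rewrite lt_min d10.
move=> z w z3 w3 zw.
have h1 : `|f z - f w| <= e / 2 by apply: H1 => // k; have := zw k; rewrite lt_min => /andP[].
have h2 : `|g z - g w| <= e / 2 by apply: H2 => // k; have := zw k; rewrite lt_min => /andP[].
have -> : f z + g z - (f w + g w) = (f z - f w) + (g z - g w) by ring.
by have := ler_normD (f z - f w) (g z - g w); lra.
Qed.

Lemma tame_lipschitz (F : R -> R) (a b K : R) f : tame f ->
  (forall z, ball3 z -> a <= f z <= b) ->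
  (forall x y, a <= x <= b -> a <= y <= b -> `|F x - F y| <= K * `|x - y|) ->
  tame (fun z => F (f z)).
Proof.
move=> [uf [B Bf]] fab FK; split; last first.
  have [[z0 z03]|nz] := pselect (exists z0, ball3 z0); last first.
    by exists 0 => z z3; case: nz; exists z.
  exists (`|F (f z0)| + `|K| * (B + B)) => z z3.
  rewrite -[F (f z)](subrK (F (f z0))); apply: le_trans (ler_normD _ _) _.
  rewrite addrC lerD2l; apply: le_trans (FK _ _ (fab _ z3) (fab _ z03)) _.
  apply: (@le_trans _ _ (`|K| * `|f z - f z0|)); first by apply: ler_wpM2r => //; exact: ler_norm.
  apply: ler_wpM2l => //; apply: le_trans (ler_normB _ _) _.
  by apply: lerD; exact: Bf.
move=> e e0; have P0 : 0 < 1 + `|K| by have := normr_ge0 K; lra.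
have [del d0 H] := uf _ (divr_gt0 e0 P0).
exists del => // z w z3 w3 zw; apply: le_trans (FK _ _ (fab _ z3) (fab _ w3)) _.
apply: (@le_trans _ _ ((1 + `|K|) * (e / (1 + `|K|)))); last by rewrite mulrC divfK// gt_eqF.
apply: (@le_trans _ _ ((1 + `|K|) * `|f z - f w|)).
  by apply: ler_wpM2r => //; have := ler_norm K; lra.
by apply: ler_wpM2l; [exact: ltW|exact: H].
Qed.

End slab.

Ltac norm_split H := move: (H); rewrite ler_norml => /andP[? ?].
Ltac norm_lra := rewrite ler_norml; apply/andP; split; lra.

(** * Difference estimates up to the ends of the time interval *)

Section differences.
Context {R : realType} {d : nat}.
Local Notation st := (R * 'rV[R]_d)%type.
Implicit Types (f g : st -> R) (z w : st) (j k : @dir d) (x y : 'rV[R]_d).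

(** The sum norm is adapted to joining two points by coordinate moves. *)
Definition dist1 x y : R := \sum_i `|x 0 i - y 0 i|.

Lemma space_lipschitz (F : 'rV[R]_d -> R) (K : R) :
  (forall x i (c : R), `|F (x + c *: unit_vec i) - F x| <= K * `|c|) ->
  forall x y, `|F x - F y| <= K * dist1 x y.
Proof.
move=> HF x y.
rewrite /dist1; have {1}-> : x = y + \sum_i (x 0 i - y 0 i) *: unit_vec i.
  rewrite -{1}(subrK y x) addrC; congr (_ + _).
  by rewrite {1}[x - y]row_sum_delta; apply: eq_bigr => i _; rewrite !mxE.
elim: (index_enum 'I_d) => [|i s IH]; first by rewrite !big_nil addr0 subrr normr0 mulr0.
rewrite !big_cons mulrDr [_ *: _ + _]addrC addrA.
set u := y + _ in IH *.
rewrite -(subrK (F u) (F (u + _))) -addrA; apply: le_trans (ler_normD _ _) _.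
exact: lerD.
Qed.

Lemma move_time (t s : R) x : (t, x) + s *: (dir_vec None) = (t + s, x).
Proof. by rewrite /= -[s *: _]/(s *: 1, s *: 0) scaler0 [s *: 1]mulr1; congr pair => /=; rewrite addr0. Qed.

Lemma move_space (t s : R) x i : (t, x) + s *: (dir_vec (Some i)) = (t, x + s *: unit_vec i).
Proof. by rewrite /= -[s *: _]/(s *: 0, s *: unit_vec i) scaler0; congr pair => /=; rewrite addr0. Qed.

Variable T : R.
Hypothesis T_gt0 : 0 < T.

Lemma slab_approx (t e : R) : 0 <= t <= T -> 0 < e -> exists2 s, 0 < s < T & `|s - t| <= e.
Proof.
move=> /andP[t0 tT] e0; pose c := Num.min (e / 2) (T / 2).
have c0 : 0 < c by rewrite lt_min !divr_gt0.
have ce : c <= e / 2 by rewrite ge_min lexx.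
have cT : c <= T / 2 by rewrite ge_min lexx orbT.
have [h|h] := leP t (T / 2).
  exists (t + c / 2); first by apply/andP; split; lra.
  by rewrite addrC addKr gtr0_norm; lra.
exists (t - c / 2); first by apply/andP; split; lra.
by rewrite addrC addKr normrN gtr0_norm; lra.
Qed.

Lemma space_move_open f i (K : R) t x (c : R) : 0 < t < T ->
  (forall z, open_slab T z -> derivable f z (dir_vec (Some i))) ->
  (forall z, open_slab T z -> `|dx i f z| <= K) ->
  `|f (t, x + c *: unit_vec i) - f (t, x)| <= K * `|c|.
Proof.
move=> tT df fK.
have key y (s : R) : 0 < s -> `|f (t, y + s *: unit_vec i) - f (t, y)| <= K * `|s|.
  move=> s0.
  have [|u _] := @MVT_line_open _ _ f (t, y) (dir_vec (Some i)) s s0.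
    by move=> u _; apply: df; rewrite move_space.
  rewrite !move_space => ->; rewrite normrM mulrC; apply: ler_wpM2r => //.
  exact: fK.
have [c0|c0|->] := ltgtP c 0.
- have Nc0 : 0 < - c by rewrite oppr_gt0.
  have := key (x + c *: unit_vec i) _ Nc0.
  by rewrite scaleNr addrK distrC normrN.
- exact: key.
- by rewrite scale0r addr0 subrr normr0 mulr0.
Qed.

Lemma time_move_open f (K : R) t t' x : 0 < t < T -> 0 < t' < T ->
  (forall z, open_slab T z -> derivable f z (dir_vec None)) ->
  (forall z, open_slab T z -> `|dt f z| <= K) ->
  `|f (t, x) - f (t', x)| <= K * `|t - t'|.
Proof.
move=> tT tT' df fK; wlog tt : t t' tT tT' / t' < t => [H|].
  have [E|E|->] := ltgtP t t'; last by rewrite !subrr normr0 mulr0.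
    by rewrite distrC [X in _ * X]distrC; exact: H.
  exact: H.
have [||u /andP[u0 u1]] := @MVT_line_open _ _ f (t', x) (dir_vec None) (t - t').
- by rewrite subr_gt0.
- move=> u /andP[u0 u1]; apply: df; rewrite move_time /open_slab /=.
  by move: tT tT' => /andP[? ?] /andP[? ?]; apply/andP; split; lra.
- rewrite !move_time subrKC => ->; rewrite normrM mulrC; apply: ler_wpM2r => //.
  apply: fK; move: tT tT' => /andP[? ?] /andP[? ?].
  by rewrite /open_slab /=; apply/andP; split; lra.
Qed.

Lemma time_lipschitz f (K : R) t t' x : slab_continuous T f ->
  0 <= t <= T -> 0 <= t' <= T ->
  (forall z, open_slab T z -> derivable f z (dir_vec None)) ->
  (forall z, open_slab T z -> `|dt f z| <= K) ->
  `|f (t, x) - f (t', x)| <= K * `|t - t'|.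
Proof.
move=> cf tT tT' df fK; wlog tt : t t' tT tT' / t' < t => [H|].
  have [E|E|->] := ltgtP t t'; last by rewrite !subrr normr0 mulr0.
    by rewrite distrC [X in _ * X]distrC; exact: H.
  exact: H.
move: tT tT' => /andP[t0 t1] /andP[t2 t3].
have [| | |u /andP[u0 u1]] := @MVT_line _ _ f (t', x) (dir_vec None) (t - t').
- by rewrite subr_gt0.
- move=> u /andP[u0 u1]; apply: df; rewrite move_time /open_slab /=.
  by apply/andP; split; lra.
- apply: (slab_continuous_line cf) => s /andP[s0 s1]; rewrite move_time /closed_slab /=.
  by apply/andP; split; lra.
- rewrite !move_time subrKC => ->; rewrite normrM mulrC; apply: ler_wpM2r => //.
  by apply: fK; rewrite /open_slab /=; apply/andP; split; lra.
Qed.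

(* The bounds on [f] available for the density and the velocity components. *)
Definition smooth_bound f (K : R) : Prop :=
  [/\ slab_continuous T f,
      forall j z, open_slab T z -> derivable f z (dir_vec j) /\ `|dpart j f z| <= K
    & forall i z, open_slab T z ->
        derivable (dx i f) z (dir_vec None) /\ `|dt (dx i f) z| <= K].

Definition hessian_bound f (K : R) : Prop :=
  forall i l z, open_slab T z ->
    derivable (dx i f) z (dir_vec (Some l)) /\ `|dx l (dx i f) z| <= K.

Section closed_slab.
Variables (f : st -> R) (K : R).
Hypotheses (K_ge0 : 0 <= K) (fK : smooth_bound f K).

Lemma closed_time t t' x : 0 <= t <= T -> 0 <= t' <= T ->
  `|f (t, x) - f (t', x)| <= K * `|t - t'|.
Proof.
move=> tT tT'; case: fK => cf df _.
by apply: time_lipschitz => // z zT; have [] := df None z zT.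
Qed.

(* Inequalities between values at boundary times follow from those at interior times. *)
Lemma closed_space t x y : 0 <= t <= T -> `|f (t, x) - f (t, y)| <= K * dist1 x y.
Proof.
move=> tT; case: (fK) => _ df _.
apply: (@space_lipschitz (fun x => f (t, x))) => u i c.
apply/ler_addgt0Pr => e e0.
have P0 : 0 < 2 * K + 1 by have := K_ge0; lra.
have [s sT st] := slab_approx tT (divr_gt0 e0 P0).
have sT' : 0 <= s <= T by case/andP: sT => /ltW -> /ltW ->.
have h1 := closed_time (u + c *: unit_vec i) tT sT'.
have h2 := closed_time u sT' tT.
have h3 : `|f (s, u + c *: unit_vec i) - f (s, u)| <= K * `|c|.
  by apply: space_move_open => // z zT; have [] := df (Some i) z zT.
have se : 2 * K * `|s - t| <= e.
  have := ler_wpM2l (ltW P0) st; rewrite mulrC [_ * (e / _)]mulrC divfK ?gt_eqF// => h4.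
  by have := normr_ge0 (s - t); lra.
have hK := mulr_ge0 K_ge0 (normr_ge0 (s - t)).
rewrite [`|t - s|]distrC in h1.
norm_split h1; norm_split h2; norm_split h3; norm_lra.
Qed.

(** The spatial derivative of [f(s, .) - f(s', .)] is a time increment of a spatial derivative,
    hence bounded by the mixed derivative. *)
Lemma closed_mixed t t' x y : 0 <= t <= T -> 0 <= t' <= T ->
  `|f (t, x) - f (t', x) - (f (t, y) - f (t', y))| <= K * `|t - t'| * dist1 x y.
Proof.
move=> tT tT'; case: (fK) => _ df ddf.
apply: (@space_lipschitz (fun x => f (t, x) - f (t', x))) => u i c.
apply/ler_addgt0Pr => e e0.
(* The tolerance pays for four replacements of a time by an interior one and for the change of
   [|t - t'|] into [|s - s'|]. *)
have P0 : 0 < 4 * K + 2 * K * `|c| + 1.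
  by have := K_ge0; have := mulr_ge0 K_ge0 (normr_ge0 c); lra.
have [s sT st] := slab_approx tT (divr_gt0 e0 P0).
have [s' sT' st'] := slab_approx tT' (divr_gt0 e0 P0).
have cs : 0 <= s <= T by case/andP: sT => /ltW -> /ltW ->.
have cs' : 0 <= s' <= T by case/andP: sT' => /ltW -> /ltW ->.
have h1 := closed_time (u + c *: unit_vec i) tT cs.
have h2 := closed_time u cs tT.
have h3 := closed_time (u + c *: unit_vec i) cs' tT'.
have h4 := closed_time u tT' cs'.
have h5 : `|f (s, u + c *: unit_vec i) - f (s', u + c *: unit_vec i)
    - (f (s, u) - f (s', u))| <= K * `|s - s'| * `|c|.
  pose g z := f (s, z.2) - f (s', z.2).
  have dg z : open_slab T z -> derivable g z (dir_vec (Some i)) /\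
     dx i g z = dx i f (s, z.2) - dx i f (s', z.2).
    move=> zT.
    have D t0 : 0 < t0 < T -> is_derive (0 : R) 1
        (fun a : R => f ((t0, z.2) + a *: dir_vec (Some i))) (dx i f (t0, z.2)).
      move=> t0T; have := @is_derive_line _ _ f (t0, z.2) (dir_vec (Some i)) 0.
      by rewrite scale0r addr0; apply; have [] := df (Some i) (t0, z.2) t0T.
    have := @derive_along _ _ g z (dir_vec (Some i)) 0 (dx i f (s, z.2) - dx i f (s', z.2)).
    rewrite scale0r addr0; apply.
    have -> : (fun a : R => g (z + a *: dir_vec (Some i))) =
      (fun a => f ((s, z.2) + a *: dir_vec (Some i))) \-
      (fun a => f ((s', z.2) + a *: dir_vec (Some i))).
      by apply/funext => a; case: (z) => z1 z2 /=; rewrite /g !move_space.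
    by apply: is_deriveB; exact: D.
  apply: (@space_move_open g i (K * `|s - s'|) s u c) => // z zT; first by have [] := dg z zT.
  have [_ ->] := dg z zT.
  by apply: time_move_open => // w wT; have [] := ddf i w wT.
have ss : `|s - s'| <= `|t - t'| + (`|s - t| + `|s' - t'|).
  have -> : s - s' = (s - t) + (t - t') - (s' - t') by ring.
  apply: le_trans (ler_normB _ _) _.
  by have := ler_normD (s - t) (t - t'); lra.
have h6 := ler_wpM2r (normr_ge0 c) (ler_wpM2l K_ge0 ss).
have es : (4 * K + 2 * K * `|c| + 1) * (e / (4 * K + 2 * K * `|c| + 1)) = e.
  by rewrite mulrC divfK ?gt_eqF.
set q := e / _ in st st' es.
have q0 : 0 <= q by rewrite divr_ge0// ltW.
have h7 : 2 * K * `|s - t| + 2 * K * `|s' - t'| + K * (`|s - t| + `|s' - t'|) * `|c| <= e.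
  have a1 := ler_wpM2l K_ge0 st; have a2 := ler_wpM2l K_ge0 st'.
  have a3 := ler_wpM2r (normr_ge0 c) a1; have a4 := ler_wpM2r (normr_ge0 c) a2.
  have := mulr_ge0 K_ge0 q0; have := mulr_ge0 (mulr_ge0 K_ge0 q0) (normr_ge0 c); lra.
rewrite [`|t - s|]distrC in h1; rewrite [`|t' - s'|]distrC in h4.
norm_split h1; norm_split h2; norm_split h3; norm_split h4; norm_split h5; norm_lra.
Qed.

End closed_slab.

End differences.

(** * Means by midpoint sums *)

Section averages.
Context {R : realType} {d : nat}.
Local Notation st := (R * 'rV[R]_d)%type.
Implicit Types (f g : st -> R) (z w : st) (j k : @dir d) (x y : 'rV[R]_d) (s : seq (@dir d)).

Section second_order.
Variables (T : R) (f : st -> R) (K : R).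
Hypotheses (T_gt0 : 0 < T) (K_ge0 : 0 <= K) (fK : smooth_bound T f K) (hK : hessian_bound T f K).

Let approx (t b : R) : 0 <= t <= T -> 0 <= b -> forall e : R, 0 < e ->
  exists2 s, 0 < s < T & b * `|s - t| <= e.
Proof.
move=> tT b0 e e0; have P0 : 0 < b + 1 by lra.
have [s sT st] := slab_approx T_gt0 tT (divr_gt0 e0 P0); exists s => //.
have := ler_wpM2l (ltW P0) st; rewrite mulrC [_ * (e / _)]mulrC divfK ?gt_eqF// => h4.
by have := normr_ge0 (s - t); lra.
Qed.

Lemma closed_second (t : R) x (j l : 'I_d) (a b : R) : 0 <= t <= T ->
  `|f (t, x + a *: unit_vec j + b *: unit_vec l) - f (t, x + b *: unit_vec l)
    - (f (t, x + a *: unit_vec j) - f (t, x))| <= K * `|a| * `|b|.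
Proof.
move=> tT; apply/ler_addgt0Pr => e e0.
have [|s sT st] := @approx t (4 * K) tT _ e e0; first by rewrite mulr_ge0.
have cs : 0 <= s <= T by case/andP: sT => /ltW -> /ltW ->.
case: (fK) => _ df _.
pose g z := f (z.1, z.2 + a *: unit_vec j) - f z.
have dg z : open_slab T z -> derivable g z (dir_vec (Some l)) /\
   dx l g z = dx l f (z.1, z.2 + a *: unit_vec j) - dx l f z.
  case: z => z1 z2 zT.
  have D y : is_derive (0 : R) 1
      (fun b : R => f ((z1, y) + b *: dir_vec (Some l))) (dx l f (z1, y)).
    have := @is_derive_line _ _ f (z1, y) (dir_vec (Some l)) 0.
    by rewrite scale0r addr0; apply; have [] := df (Some l) (z1, y) zT.
  have := @derive_along _ _ g (z1, z2) (dir_vec (Some l)) 0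
    (dx l f (z1, z2 + a *: unit_vec j) - dx l f (z1, z2)).
  rewrite scale0r addr0; apply.
  have -> : (fun c : R => g ((z1, z2) + c *: dir_vec (Some l))) =
    (fun c => f ((z1, z2 + a *: unit_vec j) + c *: dir_vec (Some l))) \-
    (fun c => f ((z1, z2) + c *: dir_vec (Some l))).
    by apply/funext => c; rewrite [in RHS]/= !move_space /g /= addrAC.
  by apply: is_deriveB; exact: D.
have h5 : `|g (s, x + b *: unit_vec l) - g (s, x)| <= K * `|a| * `|b|.
  apply: (@space_move_open _ _ T g l) => // z zT; first by have [] := dg z zT.
  have [_ ->] := dg z zT; case: z zT => z1 z2 zT.
  by apply: (@space_move_open _ _ T (dx l f) j) => // w wT; have [] := hK l j wT.
rewrite /g /= [x + _ + _]addrAC in h5.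
have h y := closed_time fK y tT cs.
have h1 := h (x + a *: unit_vec j + b *: unit_vec l).
have h2 := h (x + b *: unit_vec l).
have h3 := h (x + a *: unit_vec j); have h4 := h x.
rewrite [`|t - s|]distrC in h1 h2 h3 h4.
norm_split h1; norm_split h2; norm_split h3; norm_split h4; norm_split h5; norm_lra.
Qed.

Lemma open_gradient_lipschitz i z w : open_slab T z -> open_slab T w ->
  `|dx i f z - dx i f w| <= K * (`|z.1 - w.1| + dist1 z.2 w.2).
Proof.
case: z => t x; case: w => t' y tT tT' /=; case: (fK) => _ df ddf.
have h1 : `|dx i f (t, x) - dx i f (t, y)| <= K * dist1 x y.
  apply: (@space_lipschitz _ _ (fun x => dx i f (t, x))) => u l c.
  by apply: (@space_move_open _ _ T (dx i f) l) => // z zT; have [] := hK i l zT.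
have h2 : `|dx i f (t, y) - dx i f (t', y)| <= K * `|t - t'|.
  by apply: (@time_move_open _ _ T (dx i f)) => // z zT; have [] := ddf i z zT.
norm_split h1; norm_split h2; norm_lra.
Qed.

Lemma closed_gradient (t : R) x (i : 'I_d) (h : R) w : 0 <= t <= T -> open_slab T w -> 0 < h ->
  `|f (t, x + h *: unit_vec i) - f (t, x) - h * dx i f w|
  <= h * (K * (`|t - w.1| + dist1 x w.2 + h)).
Proof.
move=> tT wT h0; apply/ler_addgt0Pr => e e0.
have [|s sT st] := @approx t (2 * K + h * K) tT _ e e0.
  by have := mulr_ge0 (ltW h0) K_ge0; have := K_ge0; lra.
have cs : 0 <= s <= T by case/andP: sT => /ltW -> /ltW ->.
case: (fK) => _ df _.
have [|u /andP[u0 uh]] := @MVT_line_open _ _ f (s, x) (dir_vec (Some i)) h h0.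
  by move=> u _; rewrite move_space; have [] := df (Some i) (s, x + u *: unit_vec i) sT.
rewrite !move_space => E.
have h1 := closed_time fK (x + h *: unit_vec i) tT cs.
have h2 := closed_time fK x tT cs.
have h3 := open_gradient_lipschitz i (z := (s, x)) sT wT.
have h4 : `|dx i f (s, x + u *: unit_vec i) - dx i f (s, x)| <= K * h.
  apply: (@le_trans _ _ (K * `|u|)); last by apply: ler_wpM2l => //; rewrite gtr0_norm// ltW.
  by apply: (@space_move_open _ _ T (dx i f) i) => // z zT; have [] := hK i i zT.
have h5 : `|s - w.1| <= `|t - w.1| + `|s - t|.
  by rewrite -[s - w.1](subrKA t) addrC; exact: ler_normD.
rewrite [`|t - s|]distrC in h1 h2.
have h6 : `|h * 'D_(dir_vec (Some i)) f (s, x + u *: unit_vec i) - h * dx i f w|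
    <= h * (K * (`|t - w.1| + `|s - t| + dist1 x w.2 + h)).
  rewrite -mulrBr normrM gtr0_norm//; apply: ler_wpM2l; first exact: ltW.
  have h7 := ler_wpM2l K_ge0 h5; move: h3 h4 => /= h3 h4; rewrite /dx /= in h3 h4 *.
  norm_split h3; norm_split h4; norm_lra.
rewrite -E in h6.
norm_split h1; norm_split h2; norm_split h6; norm_lra.
Qed.

End second_order.

(** The mean value theorem gives the derivative at some point of the segment; uniform continuity
    moves it to the midpoint, uniformly over all admissible segments. *)
Lemma tame_quotient (T : R) f j : (forall z, open_slab T z -> derivable f z (dir_vec j)) ->
  tame T (dpart j f) -> forall e : R, 0 < e -> exists2 del : R, 0 < del &
  forall (eta : R) z, 0 < eta < del -> (forall s : R, 0 < s < eta -> ball3 T (z + s *: dir_vec j)) ->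
    {within `[0, eta], continuous (fun s : R => f (z + s *: dir_vec j))} ->
    `|f (z + eta *: dir_vec j) - f z - eta * dpart j f (z + (eta / 2) *: dir_vec j)| <= e * eta.
Proof.
move=> df [uf _] e e0; have [del d0 H] := uf e e0; exists del => // eta z /andP[n0 n1] z3 cz.
have [|s /andP[s0 s1] ->] := MVT_line n0 _ cz; first by move=> s /z3[zT _]; exact: df.
have -> w : 'D_(dir_vec j) f w = dpart j f w by case: j {df uf H z3 cz}.
rewrite -mulrBr normrM gtr0_norm// mulrC; apply: ler_wpM2r; first exact: ltW.
apply: H => [||k]; [by apply: z3; lra|by apply: z3; lra|].
rewrite !coord_move; case: eqP => _; last by rewrite subrr normr0.
by rewrite opprD addrACA subrr add0r ltr_norml; apply/andP; split; lra.
Qed.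

(* Midpoint rule with [m] nodes for the mean over a segment of length [b] in direction [j]. *)
Definition seg_avg (m : nat) (b : R) j f z : R :=
  m%:R^-1 * \sum_(l < m) f (z + (b * (l%:R + 2^-1) / m%:R) *: dir_vec j).

(** Continuity is demanded separately on closed subsegments because a segment in time may start or
    end on the boundary of the slab, where no derivative is available. *)
Definition good_line (T : R) f j (b : R) z : Prop :=
  (forall s : R, 0 < s < b -> ball3 T (z + s *: dir_vec j)) /\
  forall c eta : R, 0 <= c -> 0 < eta -> c + eta <= b ->
    {within `[0, eta], continuous (fun s : R => f (z + c *: dir_vec j + s *: dir_vec j))}.

(** Telescoping over the nodes: the error of the midpoint sum vanishes as the number of nodes grows,
    with no regularity beyond uniform continuity of the derivative. *)
Lemma seg_avg_derive (T : R) f j (b : R) : 0 < b ->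
  (forall z, open_slab T z -> derivable f z (dir_vec j)) ->
  tame T (dpart j f) -> forall e : R, 0 < e -> exists m0 : nat, forall m, (m0 < m)%N ->
  forall z, good_line T f j b z ->
    `|seg_avg m b j (dpart j f) z - (f (z + b *: dir_vec j) - f z) / b| <= e.
Proof.
move=> b0 df tf e e0; have [del d0 H] := tame_quotient df tf e0.
exists (Num.truncn (b / del)) => m m0 z [z3 cz].
have mgt : (0 < m)%N by apply: leq_ltn_trans m0.
have M0 : 0 < m%:R :> R by rewrite ltr0n.
pose eta := b / m%:R.
have n0 : 0 < eta by rewrite divr_gt0.
have nd : eta < del.
  rewrite /eta ltr_pdivrMr// mulrC -ltr_pdivrMr//.
  apply: lt_le_trans (truncnS_gt _) _; by rewrite ler_nat.
have mE : m%:R * eta = b by rewrite /eta mulrC divfK// gt_eqF.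
pose P (l : nat) := f (z + (l%:R * eta) *: dir_vec j).
have -> : f (z + b *: dir_vec j) - f z = \sum_(l < m) (P l.+1 - P l).
  rewrite -(big_mkord xpredT (fun l => P l.+1 - P l)) telescope_sumr//.
  by rewrite /P mE mul0r scale0r addr0.
have -> : seg_avg m b j (dpart j f) z =
    (\sum_(l < m) eta * dpart j f (z + (l%:R * eta + eta / 2) *: dir_vec j)) / b.
  rewrite /seg_avg -mulr_sumr mulrAC; congr (_ * _).
    by rewrite /eta; field; rewrite !gt_eqF.
  apply: eq_bigr => l _; congr (dpart j f (z + _ *: _)).
  by rewrite /eta; field; rewrite gt_eqF.
rewrite -mulrBl normrM [`|b^-1|]gtr0_norm ?invr_gt0// ler_pdivrMr// -sumrB.
apply: le_trans (ler_norm_sum _ _ _) _.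
have -> : e * b = \sum_(l < m) e * eta.
  by rewrite sumr_const card_ord -mulr_natr -mulrA [eta * _]mulrC mE.
apply: ler_sum => l _; rewrite distrC.
have lm : l.+1%:R * eta <= b by rewrite -mE; apply: ler_wpM2r; [exact: ltW|rewrite ler_nat].
have l0 : 0 <= l%:R * eta by rewrite mulr_ge0// ltW.
have lS : l.+1%:R * eta = l%:R * eta + eta by rewrite -addn1 natrD mulrDl mul1r.
have := H eta (z + (l%:R * eta) *: dir_vec j).
rewrite n0 nd => /(_ isT) h; rewrite /P lS !scalerDl !addrA; apply: h.
  move=> s /andP[s0 s1]; rewrite -addrA -scalerDl; apply: z3; apply/andP; split.
    by apply: lt_le_trans s0 _; rewrite lerDr.
  by apply: lt_le_trans lm; rewrite lS ltrD2l.
by apply: cz => //; rewrite -lS.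
Qed.

Section iterated.
Variables (m : nat) (b : @dir d -> R).
Hypotheses (m_gt0 : (0 < m)%N) (b_gt0 : forall j, 0 < b j).
Local Notation S j := (seg_avg m (b j) j).

Fixpoint box_mean s f : st -> R := if s is j :: s' then S j (box_mean s' f) else f.

(** A set containing all nodes of [box_mean]: an open box in the directions of [s], with the other
    coordinates fixed. *)
Fixpoint hull s z w : Prop :=
  if s is j :: s' then exists2 c : R, 0 < c < b j & hull s' (z + c *: dir_vec j) w else w = z.

Let M0 : 0 < m%:R :> R. Proof. by rewrite ltr0n. Qed.

Let node j (l : 'I_m) : 0 < b j * (l%:R + 2^-1) / m%:R < b j.
Proof.
have l0 : 0 <= l%:R :> R by [].
have l1 : l%:R + 1 <= m%:R :> R by rewrite natr1 ler_nat.
apply/andP; split; first by rewrite divr_gt0// mulr_gt0//; lra.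
by rewrite ltr_pdivrMr// ltr_pM2l//; lra.
Qed.

Let seg_avg_norm j f z (c e : R) :
  (forall u, 0 < u < b j -> `|f (z + u *: dir_vec j) - c| <= e) -> `|S j f z - c| <= e.
Proof.
move=> H; have -> : c = m%:R^-1 * \sum_(l < m) c.
  by rewrite sumr_const card_ord -[c *+ m]mulr_natl mulKf// gt_eqF.
rewrite /seg_avg -mulrBr -sumrB normrM gtr0_norm ?invr_gt0// ler_pdivrMl//.
apply: le_trans (ler_norm_sum _ _ _) _.
have -> : m%:R * e = \sum_(l < m) e by rewrite sumr_const card_ord mulr_natl.
apply: ler_sum => l _.
exact/H/node.
Qed.

Lemma box_mean_near s f z (c e : R) :
  (forall w, hull s z w -> `|f w - c| <= e) -> `|box_mean s f z - c| <= e.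
Proof.
elim: s z => [|j s IH] z H /=; first exact: H.
apply: seg_avg_norm => u ub; apply: IH => w zw; apply: H; by exists u.
Qed.

Lemma box_meanD s f g z :
  box_mean s (fun z => f z + g z) z = box_mean s f z + box_mean s g z.
Proof.
elim: s z => [//|j s IH] z /=; rewrite /seg_avg -mulrDr -big_split /=.
by congr (_ * _); apply: eq_bigr => l _; exact: IH.
Qed.

Lemma box_meanZ s (c : R) f z : box_mean s (fun z => c * f z) z = c * box_mean s f z.
Proof.
elim: s z => [//|j s IH] z /=; rewrite /seg_avg [RHS]mulrCA; congr (_ * _).
by rewrite mulr_sumr; apply: eq_bigr => l _; exact: IH.
Qed.

Lemma box_meanB s f g z :
  box_mean s (fun z => f z - g z) z = box_mean s f z - box_mean s g z.
Proof.
rewrite (_ : (fun z => f z - g z) = (fun z => f z + -1 * g z)) ?box_meanD ?box_meanZ ?mulN1r//.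
by apply/funext => w; rewrite mulN1r.
Qed.

Lemma box_mean_sum s (J : finType) (F : J -> st -> R) z :
  box_mean s (fun z => \sum_i F i z) z = \sum_i box_mean s (F i) z.
Proof.
elim: (index_enum J) => [|i r IH].
  transitivity (box_mean s (fun _ => 0 * 0) z); last by rewrite box_meanZ mul0r big_nil.
  by congr box_mean; apply/funext => w; rewrite big_nil mul0r.
rewrite big_cons -IH -box_meanD; congr box_mean; apply/funext => w.
by rewrite big_cons.
Qed.

Lemma eq_box_mean s f g z : (forall w, hull s z w -> f w = g w) ->
  box_mean s f z = box_mean s g z.
Proof.
move=> H; apply/eqP; rewrite -subr_eq0 -box_meanB -normr_le0 -[box_mean _ _ _]subr0.
by apply: box_mean_near => w /H ->; rewrite subrr subr0 normr0.
Qed.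

Lemma box_mean_shift s f z v : box_mean s (fun w => f (w + v)) z = box_mean s f (z + v).
Proof.
elim: s z => [//|j s IH] z /=; congr (_ * _); apply: eq_bigr => l _.
by rewrite IH addrAC.
Qed.

Lemma seg_avgC j k f z : S j (S k f) z = S k (S j f) z.
Proof.
have E j' k' : S j' (S k' f) z = m%:R^-1 * (m%:R^-1 * \sum_(l < m) \sum_(l' < m)
    f (z + (b j' * (l%:R + 2^-1) / m%:R) *: dir_vec j'
         + (b k' * (l'%:R + 2^-1) / m%:R) *: dir_vec k')).
  by rewrite /seg_avg; congr (_ * _); rewrite mulr_sumr.
rewrite !E exchange_big /=; do 2!congr (_ * _).
by apply: eq_bigr => l _; apply: eq_bigr => l' _; rewrite addrAC.
Qed.

Lemma box_mean_seg s j f z : S j (box_mean s f) z = box_mean s (S j f) z.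
Proof.
elim: s z => [//|k s IH] z /=; rewrite seg_avgC.
by rewrite /seg_avg; congr (_ * _); apply: eq_bigr => l _; exact: IH.
Qed.

(** Means in different directions commute, so the direction in which a derivative is to be
    integrated can be made the innermost one. *)
Lemma box_mean_rem s j f z : j \in s -> box_mean s f z = box_mean (rem j s) (S j f) z.
Proof.
elim: s z => [//|k s IH] z; rewrite inE /=; case: (eqVneq k j) => [-> _|kj].
  exact: box_mean_seg.
move=> /= js; rewrite /seg_avg; congr (_ * _).
by apply: eq_bigr => l _; exact: IH.
Qed.

Lemma hull_coord s z w : uniq s -> hull s z w -> forall j,
  if j \in s then is_true (coord j z < coord j w < coord j z + b j) else coord j w = coord j z.
Proof.
elim: s z => [|k s IH] z /=; first by move=> _ ->.
move=> /andP[ks us] [c /andP[c0 c1] /(IH _ us) H] j.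
have := H j; rewrite coord_move inE; case: (eqVneq j k) => [->|jk] /=; last by rewrite addr0.
by rewrite (negbTE ks) => ->; rewrite ltrDl ltrD2l c0 c1.
Qed.

End iterated.

End averages.

(** * Bounds for functions of the density *)

Section functions_of_density.
Context {R : realType}.
Implicit Types (x y e : R).

Definition lipschitz_on (a b K : R) (F : R -> R) : Prop :=
  forall x y, a <= x <= b -> a <= y <= b -> `|F x - F y| <= K * `|x - y|.

Variables (lo up : R).
Hypothesis lo_gt0 : 0 < lo.

(** The sum of the two end values covers both signs of the exponent. *)
Lemma powR_itv e x : lo <= x <= up -> 0 <= x `^ e <= lo `^ e + up `^ e.
Proof.
move=> /andP[lx xu]; rewrite powR_ge0 /=.
have x0 : 0 < x by exact: lt_le_trans lx.
have u0 : 0 < up by exact: lt_le_trans xu.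
have p1 := powR_ge0 lo e; have p2 := powR_ge0 up e.
have [e0|e0] := leP 0 e.
  have : x `^ e <= up `^ e by apply: ge0_ler_powR => //; rewrite nnegrE ltW.
  lra.
have : x `^ e <= lo `^ e.
  rewrite -[e]opprK !(powRN _ (- e)) lef_pV2 ?posrE ?powR_gt0//.
  by apply: ge0_ler_powR => //; rewrite ?nnegrE ?oppr_ge0 ?(ltW e0) ?(ltW x0) ?(ltW lo_gt0).
lra.
Qed.

Lemma MVT_pos (F dF : R -> R) x y : (forall x, 0 < x -> is_derive x 1 F (dF x)) ->
  0 < x -> x < y -> exists2 c, x < c < y & F y - F x = dF c * (y - x).
Proof.
move=> HF x0 xy; have [||c] := @MVT R F dF x y xy.
- by move=> c; rewrite in_itv /= => /andP[xc cy]; apply: HF; exact: lt_trans xc.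
- apply: derivable_within_continuous => c; rewrite in_itv /= => /andP[xc cy].
  by have [] : is_derive c 1 F (dF c) by apply: HF; exact: lt_le_trans xc.
- by rewrite in_itv /= => ci E; exists c.
Qed.

Lemma mvt_lipschitz (F dF : R -> R) (K : R) :
  (forall x, 0 < x -> is_derive x 1 F (dF x)) ->
  (forall x, lo <= x <= up -> `|dF x| <= K) ->
  lipschitz_on lo up K F.
Proof.
move=> HF HK x y xi yi; wlog xy : x y xi yi / x < y => [H|].
  have [E|E|->] := ltgtP x y; last by rewrite !subrr normr0 mulr0.
    exact: H.
  by rewrite distrC [X in _ * X]distrC; exact: H.
move: xi yi => /andP[x1 x2] /andP[y1 y2].
have [c /andP[xc cy] E] := MVT_pos HF (lt_le_trans lo_gt0 x1) xy.
rewrite distrC E normrM [`|x - y|]distrC; apply: ler_wpM2r => //.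
by apply: HK; apply/andP; split; lra.
Qed.

Lemma powR_lipschitz e : lipschitz_on lo up
  (`|e| * (lo `^ (e - 1) + up `^ (e - 1))) (fun x => x `^ e).
Proof.
apply: (mvt_lipschitz (dF := fun x => e * x `^ (e - 1))) => x xi.
have /andP[p1 p2] := powR_itv (e - 1) xi.
by rewrite normrM [`|x `^ _|]ger0_norm//; apply: ler_wpM2l.
Qed.

(** The mean value theorem is applied to both increments; the two derivatives are compared at
    intermediate points, each within one increment of its end point. Time increments of nonlinear
    functions of cell averages thus become accurate to order [tau h]. *)
Lemma quadrilateral (F dF : R -> R) (K : R) x x' y y' :
  (forall x, 0 < x -> is_derive x 1 F (dF x)) ->
  (forall x, lo <= x <= up -> `|dF x| <= K) -> lipschitz_on lo up K dF ->
  lo <= x <= up -> lo <= x' <= up -> lo <= y <= up -> lo <= y' <= up ->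
  `|F x - F x' - (F y - F y')| <= K * `|x - x' - (y - y')|
     + K * (`|x - x'| + `|x' - y'| + `|y - y'|) * `|y - y'|.
Proof.
move=> HF HK LF xi xi' yi yi'.
have mv u v : lo <= u <= up -> lo <= v <= up -> exists2 c,
    (lo <= c <= up) /\ `|c - v| <= `|u - v| & F u - F v = dF c * (u - v).
  move=> ui vi; have [E|E|->] := ltgtP u v; last first.
  - by exists v; rewrite ?subrr ?mulr0 ?normr0.
  - move: ui vi => /andP[u1 u2] /andP[v1 v2].
    have [c /andP[uc cv] Ec] := MVT_pos HF (lt_le_trans lo_gt0 v1) E.
    exists c => //; split; first by apply/andP; split; lra.
    by rewrite !gtr0_norm ?subr_gt0//; lra.
  - move: ui vi => /andP[u1 u2] /andP[v1 v2].
    have [c /andP[uc cv] Ec] := MVT_pos HF (lt_le_trans lo_gt0 u1) E.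
    exists c; last by rewrite -opprB Ec; ring.
    split; first by apply/andP; split; lra.
    by rewrite !ltr0_norm ?subr_lt0//; lra.
have [c [ci cx] ->] := mv x x' xi xi'; have [c' [ci' cy] ->] := mv y y' yi yi'.
have -> : dF c * (x - x') - dF c' * (y - y') =
  dF c * (x - x' - (y - y')) + (dF c - dF c') * (y - y') by ring.
apply: le_trans (ler_normD _ _) _; rewrite !normrM; apply: lerD.
  by apply: ler_wpM2r => //; exact: HK.
apply: ler_wpM2r => //; apply: le_trans (LF _ _ ci ci') _.
have K0 : 0 <= K by apply: le_trans (HK x xi).
apply: ler_wpM2l => //.
norm_split cx; norm_split cy.
move: (ler_norm (x' - y')) (ler_norm (y' - x')); rewrite [`|y' - x'|]distrC => ? ?.
by norm_lra.
Qed.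

Variables (a gamma : R).
Hypotheses (a_gt0 : 0 < a) (gamma_gt1 : 1 < gamma).
Local Notation p := (pressure a gamma).
Local Notation H' := (hpot' a gamma).
Definition dpressure x := a * gamma * x `^ (gamma - 1).
Definition dhpot' x := a * gamma * x `^ (gamma - 2).

Lemma is_derive_pressure x : 0 < x -> is_derive x 1 p (dpressure x).
Proof.
move=> x0; rewrite /dpressure -mulrA.
exact: (is_derive_eq (is_deriveZ a (is_derive1_powR gamma x0)) erefl).
Qed.

Lemma is_derive_hpot' x : 0 < x -> is_derive x 1 H' (dhpot' x).
Proof.
move=> x0.
have h1 := is_deriveZ gamma (is_derive1_powR (gamma - 1) x0).
have h2 := is_deriveB h1 (is_derive_cst (1 : R) x (1 : R)).
have h3 := is_deriveZ (a / (gamma - 1)) h2.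
have g1 : gamma - 1 != 0 by rewrite subr_eq0 gt_eqF.
apply: (is_derive_eq h3); rewrite /dhpot' /GRing.scale /= subr0.
rewrite (_ : gamma - 1 - 1 = gamma - 2); last by ring.
by field.
Qed.

Record density_bound (K : R) : Prop := {
  bound_p : forall x, lo <= x <= up -> `|p x| <= K;
  bound_dp : forall x, lo <= x <= up -> `|dpressure x| <= K;
  bound_dH : forall x, lo <= x <= up -> `|dhpot' x| <= K;
  lip_p : lipschitz_on lo up K p;
  lip_dp : lipschitz_on lo up K dpressure;
  lip_H : lipschitz_on lo up K H';
  lip_dH : lipschitz_on lo up K dhpot';
  bound_xdp : forall x, lo <= x <= up -> `|dpressure x * x - p x| <= K;
  lip_xdp : lipschitz_on lo up K (fun x => dpressure x * x - p x)
}.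

Lemma density_boundP : exists2 K, 1 <= K & density_bound K.
Proof.
pose M e := lo `^ e + up `^ e.
have M0 e : 0 <= M e by rewrite addr_ge0 ?powR_ge0.
have B (c e : R) x : lo <= x <= up -> `|c * x `^ e| <= `|c| * M e.
  by move=> /(powR_itv e)/andP[p0 p1]; rewrite normrM [`|x `^ _|]ger0_norm//; apply: ler_wpM2l.
have L (c e : R) : lipschitz_on lo up (`|c| * (`|e| * M (e - 1))) (fun x => c * x `^ e).
  move=> x y xi yi; rewrite -mulrBr normrM -mulrA; apply: ler_wpM2l => //.
  exact: powR_lipschitz.
have x0 x : lo <= x <= up -> 0 < x by move=> /andP[lx _]; exact: lt_le_trans lx.
have E x : lo <= x <= up -> dpressure x * x - p x = (a * gamma - a) * x `^ gamma.
  move=> /x0 xp; rewrite /dpressure /pressure -mulrA [_ * x]mulrC powR_predr//; ring.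
pose K1 := `|a| * M gamma; pose K2 := `|a * gamma| * M (gamma - 1).
pose K3 := `|a * gamma| * M (gamma - 2).
pose K4 := `|a * gamma| * (`|gamma - 1| * M (gamma - 1 - 1)).
pose K5 := `|a * gamma| * (`|gamma - 2| * M (gamma - 2 - 1)).
pose K6 := `|a * gamma - a| * M gamma.
pose K7 := `|a * gamma - a| * (`|gamma| * M (gamma - 1)).
have nn : [/\ 0 <= K1, 0 <= K2, 0 <= K3, 0 <= K4 & 0 <= K5] by split; rewrite !mulr_ge0.
have nn' : 0 <= K6 /\ 0 <= K7 by split; rewrite !mulr_ge0.
case: nn nn' => k1 k2 k3 k4 k5 [k6 k7].
pose K := 1 + K1 + K2 + K3 + K4 + K5 + K6 + K7.
have up_ k : k <= K -> forall z : R, k * `|z| <= K * `|z| by move=> kK z; apply: ler_wpM2r.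
have b_dp x : lo <= x <= up -> `|dpressure x| <= K2 by exact: B.
have b_dH x : lo <= x <= up -> `|dhpot' x| <= K3 by exact: B.
have cK1 : K1 <= K by rewrite /K; lra.
have cK2 : K2 <= K by rewrite /K; lra.
have cK3 : K3 <= K by rewrite /K; lra.
have cK4 : K4 <= K by rewrite /K; lra.
have cK5 : K5 <= K by rewrite /K; lra.
have cK6 : K6 <= K by rewrite /K; lra.
have cK7 : K7 <= K by rewrite /K; lra.
exists K; first by rewrite /K; lra.
split.
- by move=> x xi; apply: le_trans cK1; exact: B.
- by move=> x xi; apply: le_trans cK2; exact: b_dp.
- by move=> x xi; apply: le_trans cK3; exact: b_dH.
- move=> x y xi yi; apply: le_trans (up_ _ cK2 _).
  exact: (mvt_lipschitz is_derive_pressure b_dp).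
- move=> x y xi yi; apply: le_trans (up_ _ cK4 _); exact: L.
- move=> x y xi yi; apply: le_trans (up_ _ cK3 _).
  exact: (mvt_lipschitz is_derive_hpot' b_dH).
- move=> x y xi yi; apply: le_trans (up_ _ cK5 _); exact: L.
- by move=> x xi; rewrite E//; apply: le_trans cK6; exact: B.
- move=> x y xi yi; rewrite !E//; apply: le_trans (up_ _ cK7 _); exact: L.
Qed.

End functions_of_density.

Section distance.
Context {R : realType} {d : nat}.
Implicit Types x y : 'rV[R]_d.

Lemma dist1_ge0 x y : 0 <= dist1 x y.
Proof. by apply: sumr_ge0 => i _. Qed.

Lemma dist1C x y : dist1 x y = dist1 y x.
Proof. by apply: eq_bigr => i _; rewrite distrC. Qed.

Lemma dist1_triangle y x z : dist1 x z <= dist1 x y + dist1 y z.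
Proof. by rewrite -big_split; apply: ler_sum => i _; exact: ler_distD. Qed.

Lemma dist1_move x i (c : R) : dist1 (x + c *: unit_vec i) x = `|c|.
Proof.
rewrite /dist1 (bigD1 i)//= big1 ?addr0 => [|l li].
  by rewrite !mxE !eqxx /= mulr1 addrAC subrr add0r.
by rewrite !mxE eqxx /= (negbTE li) mulr0 addr0 subrr normr0.
Qed.

Lemma dist1_le x y (c : R) : (forall i, `|x 0 i - y 0 i| <= c) -> dist1 x y <= d%:R * c.
Proof.
move=> H; have -> : d%:R * c = \sum_(i < d) c by rewrite sumr_const card_ord mulr_natl.
by apply: ler_sum => i _.
Qed.

Lemma tame_eq (T : R) (f g : R * 'rV[R]_d -> R) : (forall z, open_slab T z -> f z = g z) ->
  tame T g -> tame T f.
Proof.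
move=> E [ug [K HK]]; split => [e /ug[del d0 H]|].
  by exists del => // z w z3 w3; rewrite !E; [exact: H|case: w3|case: z3].
by exists K => z z3; rewrite E; [exact: HK|case: z3].
Qed.

End distance.

Lemma finite_threshold (J : finType) (P : J -> nat -> Prop) :
  (forall i, exists m0 : nat, forall m, (m0 < m)%N -> P i m) ->
  exists m0 : nat, forall m, (m0 < m)%N -> forall i, P i m.
Proof.
move=> /choice[f Hf]; exists (\max_i f i)%N => m mf i; apply: Hf.
by apply: leq_ltn_trans mf; exact: leq_bigmax.
Qed.


(* The smooth solution, sampled on the grid, solves the Navier-Stokes system up to [O(h)]
   when the remaining fields are replaced by suitable averages. *)
Record consistent {R : realType} {d N : nat} (a gamma mu lambda rlow rup B tau : R)
    (r0 r1 : cell d N -> R) (W0 W1 psi : 'I_d -> cell d N -> R)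
    (G : 'I_d -> 'I_d -> cell d N -> R) (DD Z : 'I_d -> cell d N -> R) : Prop := {
  c_r0 : forall k, rlow <= r0 k <= rup;
  c_r1 : forall k, rlow <= r1 k <= rup;
  c_W0 : forall i k, `|W0 i k| <= B;
  c_W1 : forall i k, `|W1 i k| <= B;
  c_WB : forall i k, `|W1 i k - W0 i k| <= B * tau;
  c_dW0 : forall i j k, `|diff_face j (W0 i) k| <= B;
  c_dW1 : forall i j k, `|diff_face j (W1 i) k| <= B;
  c_dWB : forall i j k, `|diff_face j (W1 i) k - diff_face j (W0 i) k| <= B * tau;
  c_ddW0 : forall i j l k, `|diff_face l (diff_face j (W0 i)) k| <= B;
  c_ddW1 : forall i j l k, `|diff_face l (diff_face j (W1 i)) k| <= B;
  c_phiB : forall k, `|hpot' a gamma (r1 k) - hpot' a gamma (r0 k)| <= B * tau;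
  c_dphi : forall j k, `|diff_face j (fun l => hpot' a gamma (r0 l)) k| <= B;
  c_pB : forall k, `|pressure a gamma (r1 k) - pressure a gamma (r0 k)| <= B * tau;
  c_Z : forall i k, `|Z i k| <= B;
  c_velocity : forall i k,
    `|(mean W1 i k - mean W0 i k) / tau
      + \sum_j mean W0 j k * diff_face j (mean W0 i) k
      + diff_cell i (psi i) k - Z i k| <= B * @mesh R N;
  c_stress : forall i k,
    `|r1 k * Z i k - mu * \sum_j diff_cell j (G i j) k
      - (mu + lambda) * diff_cell i (DD i) k| <= B * @mesh R N;
  c_psi : forall i k,
    `|psi i k - avg_face i (fun l => hpot' a gamma (r0 l)) k| <= B * @mesh R N;
  c_G : forall i j k, `|G i j k - diff_face j (W0 i) k| <= B * @mesh R N;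
  c_D : forall i k, `|DD i k - div_cell W0 k| <= B * @mesh R N;
  c_transport : forall k,
    `|(hpot' a gamma (r1 k) - hpot' a gamma (r0 k)) / tau
      + \sum_i mean W0 i k * diff_cell i (psi i) k
      + a * gamma * r0 k `^ (gamma - 1) * div_cell W0 k| <= B * @mesh R N;
  c_pressure :
    `|integral_pc (fun k => (pressure a gamma (r1 k) - pressure a gamma (r0 k)) / tau
      + (a * gamma * r0 k `^ (gamma - 1) * r0 k - pressure a gamma (r0 k)) * div_cell W0 k)|
     <= B * @mesh R N
}.

(** * Consistency of the sampled strong solution *)

Section consistency.
Context {R : realType} {d : nat}.
Local Notation st := (R * 'rV[R]_d)%type.
Variables (T a gamma mu lambda rlow rup K KF : R) (r : st -> R) (u : 'I_d -> st -> R).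
Hypotheses (T_gt0 : 0 < T) (a_gt0 : 0 < a) (gamma_gt1 : 1 < gamma) (rlow_gt0 : 0 < rlow)
  (mu_gt0 : 0 < mu) (K_ge1 : 1 <= K) (KF_ge1 : 1 <= KF)
  (HF : density_bound rlow rup a gamma KF).
Hypotheses (hr : smooth_bound T r K) (hu : forall i, smooth_bound T (u i) K)
  (hh : forall i, hessian_bound T (u i) K)
  (u_le : forall i z, closed_slab T z -> `|u i z| <= K)
  (r_itv : forall z, closed_slab T z -> rlow <= r z <= rup)
  (per_r : forall t, 0 <= t <= T -> torus_periodic (fun x => r (t, x)))
  (per_u : forall i t, 0 <= t <= T -> torus_periodic (fun x => u i (t, x)))
  (tame_r : tame T r) (tame_u : forall i, tame T (u i))
  (tame_dr : forall j, tame T (dpart j r))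
  (tame_du : forall j i, tame T (dpart j (u i)))
  (tame_ddu : forall l j i, tame T (dx l (dx j (u i)))).
Local Notation p := (pressure a gamma).
Local Notation H' := (hpot' a gamma).
Local Notation dp := (dpressure a gamma).
Local Notation dH := (dhpot' a gamma).

(** The divergence of the stress with the mixed derivatives in the order in which they arise; their
    exchange is performed later, on averages. *)
Definition visc (i : 'I_d) (z : st) : R :=
  mu * \sum_j dx j (dx j (u i)) z + mu * \sum_j dx j (dx i (u j)) z
  + lambda * \sum_j dx i (dx j (u j)) z.

Hypotheses
  (eq_cont : forall z, open_slab T z ->
     dt r z + \sum_j u j z * dx j r z + r z * \sum_j dx j (u j) z = 0)
  (eq_mom : forall i z, open_slab T z ->
     r z * (dt (u i) z + \sum_j u j z * dx j (u i) z) + dp (r z) * dx i r z = visc i z).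

Let D : R := d%:R.
Let D_ge0 : 0 <= D. Proof. exact: ler0n. Qed.
Let K_gt0 : 0 < K. Proof. exact: lt_le_trans K_ge1. Qed.
Let K_ge0 : 0 <= K. Proof. exact: ltW. Qed.
Let KF_gt0 : 0 < KF. Proof. exact: lt_le_trans KF_ge1. Qed.
Let KF_ge0 : 0 <= KF. Proof. exact: ltW. Qed.

Lemma r_gt0 z : closed_slab T z -> 0 < r z.
Proof. by move=> /r_itv/andP[r1 _]; exact: lt_le_trans r1. Qed.

Lemma compose_derive (F dF : R -> R) j z : (forall x : R, 0 < x -> is_derive x 1 F (dF x)) ->
  open_slab T z -> derivable (fun y => F (r y)) z (dir_vec j) /\
    dpart j (fun y => F (r y)) z = dF (r z) * dpart j r z.
Proof.
move=> HFd zT; case: hr => _ dr _; have [drj _] := dr j z zT.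
have := derivable_comp1 drj (HFd _ (r_gt0 (open_closed zT))).
by case: j drj.
Qed.

Let compose_tame (F : R -> R) : lipschitz_on rlow rup KF F -> tame T (fun z => F (r z)).
Proof.
move=> LF; apply: tame_lipschitz tame_r _ LF => z [zT _].
exact/r_itv/open_closed.
Qed.

Let compose_dtame (F dF : R -> R) j : (forall x : R, 0 < x -> is_derive x 1 F (dF x)) ->
  lipschitz_on rlow rup KF dF -> tame T (dpart j (fun y => F (r y))).
Proof.
move=> HFd LF; apply: (@tame_eq _ _ _ _ (fun z => dF (r z) * dpart j r z)) => [z zT|].
  by have [] := compose_derive j HFd zT.
by apply: tameM => //; exact: compose_tame.
Qed.

Let HpD (x : R) : 0 < x -> is_derive x 1 p (dp x). Proof. exact: is_derive_pressure. Qed.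
Let HHD (x : R) : 0 < x -> is_derive x 1 H' (dH x). Proof. exact: is_derive_hpot'. Qed.

Let phi z := H' (r z).
(** Flux of the pressure equation [dt p + div (p u) + (r p' - p) div u = 0]; its divergence
    disappears on integration over the torus. *)
Let flux j z := p (r z) * u j z.

Let flux_derive j z : open_slab T z -> derivable (flux j) z (dir_vec (Some j)) /\
  dx j (flux j) z = dp (r z) * dx j r z * u j z + p (r z) * dx j (u j) z.
Proof.
move=> zT; have [d1 e1] := compose_derive (Some j) HpD zT.
have [_ /(_ (Some j) z zT)[d2 _] _] := hu j.
split; first exact: derivableM.
have e1' : 'D_(dir_vec (Some j)) (fun y => p (r y)) z = dp (r z) * dx j r z by [].
by apply: etrans (deriveM d1 d2) _; rewrite e1' addrC; congr (_ + _); exact: mulrC.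
Qed.

Let flux_tame j : tame T (dx j (flux j)).
Proof.
apply: (@tame_eq _ _ _ _
  (fun z => dp (r z) * dx j r z * u j z + p (r z) * dx j (u j) z)) => [z zT|].
  by have [] := flux_derive j zT.
have t1 := compose_tame (lip_dp HF); have t2 := compose_tame (lip_p HF).
exact: (tameD (tameM (tameM t1 (tame_dr (Some j))) (tame_u j)) (tameM t2 (tame_du (Some j) j))).
Qed.

Section one_level.
Variables (N : nat) (tau t0 : R).
Hypotheses (N_gt0 : (0 < N)%N) (tau_gt0 : 0 < tau) (tau_le : tau <= K * @mesh R N)
  (t0_ge0 : 0 <= t0) (t1_le : t0 + tau <= T).
Local Notation h := (@mesh R N).
Local Notation cl := (cell d N).
Implicit Types (k : cl) (i j l : 'I_d) (s : seq (option 'I_d)) (z w : st) (tt : R).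

Let h_gt0 : 0 < h. Proof. exact: mesh_gt0. Qed.
Let h_le1 : h <= 1. Proof. exact: mesh_le1. Qed.
Let h_ge0 : 0 <= h. Proof. exact: ltW. Qed.
Let t0T : 0 <= t0 <= T. Proof. by rewrite t0_ge0 /=; apply: le_trans t1_le; rewrite lerDl ltW. Qed.
Let t1T : 0 <= t0 + tau <= T. Proof. by rewrite t1_le addr_ge0// ltW. Qed.

Definition W tt i k : R := face_mean (fun x => u i (tt, x)) i k.
Definition rr tt k : R := proj_cell (fun x => r (tt, x)) k.

Let bc_u tt i : 0 <= tt <= T -> bounded_continuous (fun x => u i (tt, x)).
Proof.
move=> tT; have [cu _ _] := hu i; split; first exact: slab_continuous_x cu tT.
by exists K => x; exact: u_le.
Qed.

Let bc_r tt : 0 <= tt <= T -> bounded_continuous (fun x => r (tt, x)).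
Proof.
move=> tT; have [cr _ _] := hr; split; first exact: slab_continuous_x cr tT.
exists rup => x; have := @r_itv (tt, x) tT; have := @r_gt0 (tt, x) tT.
by move=> /ltW r0 /andP[_ r1]; rewrite ger0_norm.
Qed.

Let in_cell_dist k (x : 'rV[R]_d) : in_cell k x -> dist1 x (corner k) <= D * h.
Proof.
move=> kx; apply: dist1_le => i; have := kx i; rewrite mxE => /andP[x1 x2].
rewrite ger0_norm ?subr_ge0// lerBlDr; apply: le_trans x2 _.
by rewrite -addn1 natrD mulrDl mul1r addrC.
Qed.

Lemma W_near tt i k : 0 <= tt <= T -> `|W tt i k - u i (tt, corner k)| <= K * (D * h).
Proof.
move=> tT; apply: face_mean_near => //; first exact: bc_u.
move=> x /in_cell_dist kx; apply: le_trans (closed_space T_gt0 K_ge0 (hu i) _ _ tT) _.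
exact: ler_wpM2l.
Qed.

Lemma r_near tt k : 0 <= tt <= T -> `|rr tt k - r (tt, corner k)| <= K * (D * h).
Proof.
move=> tT; apply: proj_cell_near => //; first exact: bc_r.
move=> x /in_cell_dist kx; apply: le_trans (closed_space T_gt0 K_ge0 hr _ _ tT) _.
exact: ler_wpM2l.
Qed.

Lemma W_time tt i k c (e : R) : 0 <= tt <= T ->
  (forall x, in_cell k x -> `|u i (t0 + tau, x) - u i (tt, x) - c| <= e) ->
  `|W (t0 + tau) i k - W tt i k - c| <= e.
Proof.
move=> tT H; rewrite /W -face_meanB//; [|exact: bc_u|exact: bc_u].
by apply: face_mean_near => //; apply: bounded_continuousB; exact: bc_u.
Qed.

Lemma r_time k c (e : R) :
  (forall x, in_cell k x -> `|r (t0 + tau, x) - r (t0, x) - c| <= e) ->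
  `|rr (t0 + tau) k - rr t0 k - c| <= e.
Proof.
move=> H; rewrite /rr -proj_cellB//; [|exact: bc_r|exact: bc_r].
by apply: proj_cell_near => //; apply: bounded_continuousB; exact: bc_r.
Qed.

Lemma rr_itv tt k : 0 <= tt <= T -> rlow <= rr tt k <= rup.
Proof.
move=> tT; have : `|rr tt k - (rlow + rup) / 2| <= (rup - rlow) / 2.
  apply: proj_cell_near => //; first exact: bc_r.
  by move=> x _; have := @r_itv (tt, x) tT => /andP[? ?]; norm_lra.
by rewrite ler_norml => /andP[? ?]; apply/andP; split; lra.
Qed.

Lemma W_le tt i k : 0 <= tt <= T -> `|W tt i k| <= K.
Proof.
move=> tT; rewrite -[W _ _ _]subr0; apply: face_mean_near => //; first exact: bc_u.
by move=> x _; rewrite subr0; exact: u_le.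
Qed.

Let per_shift i tt (v : 'rV[R]_d) : 0 <= tt <= T -> torus_periodic (fun x => u i (tt, x + v)).
Proof. by move=> tT x l; rewrite addrAC; exact: (per_u i tT). Qed.

Lemma W_up tt i j k : 0 <= tt <= T ->
  W tt i (up j k) = face_mean (fun x => u i (tt, x + h *: unit_vec j)) i k.
Proof. by move=> tT; rewrite /W face_mean_up//; [exact: bc_u|exact: per_u]. Qed.

Lemma W_dn tt i l k : 0 <= tt <= T ->
  W tt i (dn l k) = face_mean (fun x => u i (tt, x - h *: unit_vec l)) i k.
Proof.
move=> tT; rewrite -{2}(dnK l k) face_mean_up//.
- by congr face_mean; apply/funext => x; rewrite addrK.
- exact: (bounded_continuous_shift (- _) (bc_u i tT)).
- exact: per_shift.
Qed.

Lemma W_up_dn tt i j l k : 0 <= tt <= T ->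
  W tt i (up j (dn l k)) = face_mean (fun x => u i (tt, x - h *: unit_vec l + h *: unit_vec j)) i k.
Proof.
move=> tT; rewrite up_dnC W_dn// face_mean_up//.
- by congr face_mean; apply/funext => x; rewrite addrAC.
- exact: (bounded_continuous_shift (- _) (bc_u i tT)).
- exact: per_shift.
Qed.

Let bc_s tt i (v : 'rV[R]_d) : 0 <= tt <= T -> bounded_continuous (fun x => u i (tt, x + v)).
Proof. by move=> tT; exact: (bounded_continuous_shift v (bc_u i tT)). Qed.

Lemma W_diff tt i j k : 0 <= tt <= T -> `|W tt i (up j k) - W tt i k| <= K * h.
Proof.
move=> tT; rewrite W_up// /W -face_meanB//; [|exact: bc_s|exact: bc_u].
rewrite -[face_mean _ _ _]subr0; apply: face_mean_near => //.
  by apply: bounded_continuousB; [exact: bc_s|exact: bc_u].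
move=> x _; rewrite subr0; apply: le_trans (closed_space T_gt0 K_ge0 (hu i) _ _ tT) _.
by rewrite dist1_move gtr0_norm.
Qed.

Lemma W_mixed i j k :
  `|W (t0 + tau) i (up j k) - W (t0 + tau) i k - (W t0 i (up j k) - W t0 i k)| <= K * tau * h.
Proof.
have E : W (t0 + tau) i (up j k) - W (t0 + tau) i k - (W t0 i (up j k) - W t0 i k) =
  (W (t0 + tau) i (up j k) - W t0 i (up j k)) - (W (t0 + tau) i k - W t0 i k) by ring.
have b1 := bounded_continuousB (bc_s i (h *: unit_vec j) t1T) (bc_s i (h *: unit_vec j) t0T).
have b2 := bounded_continuousB (bc_u i t1T) (bc_u i t0T).
rewrite E !W_up// /W -!face_meanB//; try exact: bc_s; try exact: bc_u.
rewrite -[face_mean _ _ _]subr0; apply: face_mean_near => //.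
  exact: bounded_continuousB.
move=> x _; rewrite subr0.
apply: le_trans (closed_mixed T_gt0 K_ge0 (hu i) _ _ t1T t0T) _.
by rewrite dist1_move [t0 + tau]addrC addrK !gtr0_norm.
Qed.

Lemma W_second tt i j l k : 0 <= tt <= T ->
  `|W tt i (up j (up l k)) - W tt i (up l k) - (W tt i (up j k) - W tt i k)| <= K * h * h.
Proof.
move=> tT; rewrite [W _ _ (up j (up l k))]/W face_mean_up//; [|exact: bc_u|exact: per_u].
rewrite face_mean_up//; [|exact: bc_s|exact: per_shift].
have b1 := bounded_continuousB (bc_s i (h *: unit_vec l + h *: unit_vec j) tT)
  (bc_s i (h *: unit_vec l) tT).
have b2 := bounded_continuousB (bc_s i (h *: unit_vec j) tT) (bc_u i tT).
have b3 : bounded_continuous (fun x => u i (tt, x + h *: unit_vec l + h *: unit_vec j)).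
  have := bc_s i (h *: unit_vec l + h *: unit_vec j) tT.
  by rewrite (_ : (fun _ => _) = (fun x => u i (tt, x + h *: unit_vec l + h *: unit_vec j)))//;
    apply/funext => x; rewrite addrA.
have b4 := bounded_continuousB b3 (bc_s i (h *: unit_vec l) tT).
rewrite !W_up// /W -!face_meanB//; try exact: bc_s; try exact: bc_u.
rewrite -[face_mean _ _ _]subr0; apply: face_mean_near => //.
  exact: bounded_continuousB.
move=> x _; rewrite subr0 [x + _ + _]addrAC.
apply: le_trans (closed_second T_gt0 K_ge0 (hu i) (hh i) x j l h h tT) _.
by rewrite gtr0_norm.
Qed.

Let c8 : R := K * (K + 2 * D + 3).

(** The extra [h] admits the averaging boxes based at a neighbouring corner, as used for face
    averages. *)
Definition near_cell k w : Prop :=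
  [/\ closed_slab T w, `|w.1 - t0| <= K * h & dist1 w.2 (corner k) <= D * h + h].

(** Both the face of [k] and that of [dn l k] are treated, since a cell mean involves the two
    opposite faces of the cell. *)
Lemma W_gradient i j l k w : open_slab T w -> near_cell k w ->
  `|W t0 i (up j (dn l k)) - W t0 i (dn l k) - h * dx j (u i) w| <= h * (c8 * h) /\
  `|W t0 i (up j k) - W t0 i k - h * dx j (u i) w| <= h * (c8 * h).
Proof.
move=> wT [_ w1 w2].
have key (v x : 'rV[R]_d) : in_cell k x -> dist1 (x + v) x <= h ->
    `|u i (t0, x + v + h *: unit_vec j) - u i (t0, x + v) - h * dx j (u i) w| <= h * (c8 * h).
  move=> /in_cell_dist kx vh.
  apply: le_trans (closed_gradient T_gt0 K_ge0 (hu i) (hh i) (x + v) j t0T wT h_gt0) _.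
  apply: ler_wpM2l => //; rewrite /c8 -mulrA; apply: ler_wpM2l => //.
  have e1 := dist1_triangle x (x + v) w.2.
  have e2 := dist1_triangle (corner k) x w.2; rewrite [dist1 (corner k) _]dist1C in e2.
  by rewrite distrC; lra.
split.
  rewrite W_up_dn// W_dn// -face_meanB//; [| |exact: bc_s]; last first.
    have := bc_s i (- (h *: unit_vec l) + h *: unit_vec j) t0T.
    by rewrite (_ : (fun _ => _) = (fun x => u i (t0, x - h *: unit_vec l + h *: unit_vec j)))//;
      apply/funext => x; rewrite addrA.
  apply: face_mean_near => // [|x kx].
    apply: bounded_continuousB; last exact: bc_s.
    have := bc_s i (- (h *: unit_vec l) + h *: unit_vec j) t0T.
    by rewrite (_ : (fun _ => _) = (fun x => u i (t0, x - h *: unit_vec l + h *: unit_vec j)))//;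
      apply/funext => x; rewrite addrA.
  by apply: key => //; rewrite -scaleNr dist1_move normrN gtr0_norm.
rewrite W_up// /W -face_meanB//; [|exact: bc_s|exact: bc_u].
apply: face_mean_near => // [|x kx].
  by apply: bounded_continuousB; [exact: bc_s|exact: bc_u].
have := key 0 x kx; rewrite !addr0; apply.
by rewrite -[X in dist1 X _]addr0 -(scale0r (unit_vec j)) dist1_move normr0.
Qed.

Lemma mean_W_near i k : `|mean (W t0) i k - u i (t0, corner k)| <= K * (D + 1) * h.
Proof.
rewrite /mean /avg_cell.
have h1 := W_near i k t0T; have h2 := W_near i (dn i k) t0T.
have h3 := closed_space T_gt0 K_ge0 (hu i) (corner (dn i k) + h *: unit_vec i) (corner (dn i k)) t0T.
rewrite -(@corner_up _ _ _ N_gt0 (fun x => u i (t0, x)) i (dn i k) (per_u i t0T)) dnK in h3.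
rewrite dist1_move [`|h|]gtr0_norm// in h3.
have hK : 0 <= K * h by rewrite mulr_ge0.
norm_split h1; norm_split h2; norm_split h3; norm_lra.
Qed.

Let b (j : @dir d) : R := if j is Some _ then h else tau.
Let b_gt0 (j : @dir d) : 0 < b j. Proof. by case: j. Qed.
Let tauK : tau <= K * h := tau_le.

Definition base z : Prop := [/\ 0 <= z.1, z.1 + tau <= T & forall i, 0 <= z.2 0 i <= 1].

(** The tolerance [h^2] still leaves [O(h)] after a further division by [h], as happens for second
    differences. *)
Definition quot (m : nat) (f : st -> R) (j : @dir d) : Prop :=
  forall z, good_line T f j (b j) z ->
    `|seg_avg m (b j) j (dpart j f) z - (f (z + b j *: dir_vec j) - f z) / b j| <= h ^+ 2.

Lemma hull_base s z w : uniq s -> base z -> hull b s z w ->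
  [/\ closed_slab T w, `|w.1 - z.1| <= K * h, dist1 w.2 z.2 <= D * h,
      (forall i, 0 <= w.2 0 i <= 2) & None \in s -> open_slab T w].
Proof.
move=> us [z1 zT z2] /(hull_coord us) H.
have Hi i : z.2 0 i <= w.2 0 i <= z.2 0 i + h.
  have := H (Some i); case: ifP => _ /=; last by move=> ->; rewrite lexx lerDl.
  by move=> /andP[/ltW -> /ltW ->].
have Ht := H None; rewrite /= in Ht.
have {}Ht : z.1 <= w.1 <= z.1 + tau /\ (None \in s -> z.1 < w.1 < z.1 + tau).
  move: Ht; case: ifP => _; last by move=> ->; rewrite lexx lerDl ltW.
  by move=> /[dup] /andP[/ltW -> /ltW ->].
case: Ht => /andP[w1 w2] wo; split.
- by rewrite /closed_slab /=; apply/andP; split; lra.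
- by rewrite ger0_norm ?subr_ge0//; have := tauK; lra.
- apply: dist1_le => i; have /andP[h1 h2] := Hi i.
  by rewrite ger0_norm ?subr_ge0//; lra.
- move=> i; have /andP[h1 h2] := Hi i; have /andP[h3 h4] := z2 i.
  by move: h_le1 => ?; apply/andP; split; lra.
- by move=> /wo /andP[h1 h2]; rewrite /open_slab /=; apply/andP; split; lra.
Qed.

(** Spatial derivatives exist in the open slab only, so a spatial segment must start at a point
    already moved inside by the mean in time; a segment in time needs only continuity at its
    ends. *)
Lemma base_good f (j : @dir d) s z w : uniq s -> j \notin s -> (j != None -> None \in s) ->
  (forall z, open_slab T z -> derivable f z (dir_vec j)) ->
  (j = None -> slab_continuous T f) -> base z -> hull b s z w -> good_line T f j (b j) w.
Proof.
move=> us js Ns df cf zb zw; have [cw _ _ w2 ow] := hull_base us zb zw.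
have jw : coord j w = coord j z by have := hull_coord us zw j; rewrite (negbTE js).
have b3 c : 0 <= c <= b j -> (j = None -> 0 < c < b j) -> ball3 T (w + c *: dir_vec j).
  move=> /andP[c0 cb] cN; split.
    rewrite /open_slab /=; have := coord_move j None w c; rewrite /= => ->.
    case: (j) Ns jw cb cN => [i /(_ isT)/ow wo _ _ _|_ jw _ /(_ erefl)/andP[c1 c2]] /=.
      by rewrite addr0.
    case: zb => z1 z3 _; rewrite /= in jw c2; rewrite jw.
    by apply/andP; split; [apply: lt_le_trans c1 _; rewrite lerDr|
      apply: lt_le_trans z3; rewrite ltrD2l].
  move=> i; have := coord_move j (Some i) w c; rewrite /= => ->.
  have /andP[w3 w4] := w2 i.
  case: eqP => [E|_]; last by rewrite addr0; apply/andP; split; lra.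
  have cb1 : c <= 1 by apply: le_trans cb _; rewrite -E.
  by apply/andP; split; lra.
split=> [c /andP[c0 cb]|c eta c0 e0 ce].
  by apply: b3 => [|_]; rewrite ?c0 ?cb// !ltW.
case Ej : j => [i|].
  apply: derivable_within_continuous => s' ; rewrite in_itv /= => /andP[s0 s1].
  have : derivable f (w + c *: dir_vec (Some i) + s' *: dir_vec (Some i)) (dir_vec (Some i)).
    rewrite -addrA -scalerDl -Ej; apply: df.
    have H3 : ball3 T (w + (c + s') *: dir_vec j); last by case: H3.
    apply: b3; last by rewrite Ej.
    by rewrite addr_ge0//=; apply: le_trans ce; rewrite lerD2l.
  by move=> /is_derive_line[].
apply: slab_continuous_line; first exact: cf.
move=> s' /andP[s0 s1]; rewrite -addrA -scalerDl.
have := coord_move None None w (c + s'); rewrite eqxx /closed_slab /= => ->.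
case: zb => z1 z3 _; move: jw ce; rewrite Ej /b /= => -> ce.
by apply/andP; split; lra.
Qed.

Section nodes.
Variable m : nat.
Hypothesis m_gt0 : (0 < m)%N.
Local Notation BM s f z := (box_mean m b s f z).
Local Notation all := (enum {: option 'I_d}).
Local Notation al j := (rem j all).
Local Notation z0 k := (t0, corner k).

Let allP (j : option 'I_d) : j \in all. Proof. exact: mem_enum. Qed.
Let all_uniq : uniq all. Proof. exact: enum_uniq. Qed.
Let al_uniq (j : option 'I_d) : uniq (al j). Proof. exact: rem_uniq. Qed.
Let alP (j l : option 'I_d) : (l \in al j) = (l != j).
Proof. by rewrite mem_rem_uniq// inE allP andbT. Qed.

Lemma mean_quot s f (j : @dir d) z : quot m f j -> uniq s -> j \notin s ->
  (j != None -> None \in s) ->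
  (forall z, open_slab T z -> derivable f z (dir_vec j)) ->
  (j = None -> slab_continuous T f) -> base z ->
  `|BM s (seg_avg m (b j) j (dpart j f)) z
    - (BM s f (z + b j *: dir_vec j) - BM s f z) / b j| <= h ^+ 2.
Proof.
move=> q us js Ns df cf zb.
have -> : (BM s f (z + b j *: dir_vec j) - BM s f z) / b j =
    BM s (fun w => (b j)^-1 * (f (w + b j *: dir_vec j) - f w)) z.
  by rewrite box_meanZ box_meanB box_mean_shift mulrC.
rewrite -box_meanB -[X in `|X|]subr0; apply: box_mean_near => // w zw.
by rewrite subr0 [_^-1 * _]mulrC; apply: q; exact: base_good zb zw.
Qed.

(** Gauss theorem on a space-time cell: with direction [j] innermost, only means over the two faces
    orthogonal to [j] remain. *)
Lemma mean_derive f (j : @dir d) z : quot m f j ->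
  (forall z, open_slab T z -> derivable f z (dir_vec j)) ->
  (j = None -> slab_continuous T f) -> base z ->
  `|BM all (dpart j f) z - (BM (al j) f (z + b j *: dir_vec j) - BM (al j) f z) / b j| <= h ^+ 2.
Proof.
move=> q df cf zb; rewrite (box_mean_rem _ _ _ _ (allP j)).
by apply: mean_quot => //; rewrite ?alP ?eqxx//; case: (j).
Qed.

Let corner_itv k i : 0 <= (corner k : 'rV[R]_d) 0 i <= 1 - h.
Proof.
rewrite mxE mulr_ge0//= lerBrDr; have : (k i).+1%:R * h <= 1.
  by rewrite /mesh ler_pdivrMr ?ltr0n// mul1r ler_nat; exact: ltn_ord.
by rewrite -addn1 natrD mulrDl mul1r.
Qed.

Lemma base_shift k i : base (t0, corner k + h *: unit_vec i).
Proof.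
split => //= l; have /andP[c0 c1] := corner_itv k l; rewrite !mxE eqxx /= in c0 c1 *.
by case: (l == i); rewrite ?mulr1 ?mulr0; have := h_gt0 => ?; apply/andP; split; lra.
Qed.

Lemma base_corner k : base (z0 k).
Proof.
split => //= l; have /andP[c0 c1] := corner_itv k l; rewrite c0 /=.
by apply: le_trans c1 _; rewrite gerBl.
Qed.

Lemma hull_near s k w : uniq s -> hull b s (z0 k) w ->
  near_cell k w /\ (None \in s -> open_slab T w).
Proof.
move=> us zw; have [cw w1 w2 _ ow] := hull_base us (base_corner k) zw.
by split => //; split => //; apply: le_trans w2 _; rewrite lerDl.
Qed.

Lemma hull_near_shift s k i w : uniq s -> hull b s (t0, corner k + h *: unit_vec i) w ->
  near_cell k w /\ (None \in s -> open_slab T w).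
Proof.
move=> us zw; have [cw w1 w2 _ ow] := hull_base us (base_shift k i) zw.
split => //; split => //.
apply: le_trans (dist1_triangle (corner k + h *: unit_vec i) _ _) _.
by apply: lerD => //; rewrite dist1_move gtr0_norm.
Qed.

Let c1 : R := K * (K + D + 1).

Lemma near_val (f : st -> R) k w : smooth_bound T f K -> near_cell k w ->
  `|f w - f (z0 k)| <= c1 * h.
Proof.
case: w => t x fb [wT /= w1 w2].
have h1 := closed_time fb x wT t0T.
have h2 := closed_space T_gt0 K_ge0 fb x (corner k) t0T.
have h3 := ler_wpM2l K_ge0 w1; have h4 := ler_wpM2l K_ge0 w2.
rewrite /c1; norm_split h1; norm_split h2; norm_lra.
Qed.

Let cq : R := KF * K * D + KF * (K * K + K * D + K * K) * K.

(** Applied twice, to point values and to cell averages, with the increment at the corner as common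
    reference. *)
Let time_quad (F dF : R -> R) k (X1 X0 : R) : (forall x : R, 0 < x -> is_derive x 1 F (dF x)) ->
  (forall x, rlow <= x <= rup -> `|dF x| <= KF) -> lipschitz_on rlow rup KF dF ->
  rlow <= X1 <= rup -> rlow <= X0 <= rup ->
  `|X1 - X0 - (r (t0 + tau, corner k) - r (z0 k))| <= K * tau * (D * h) ->
  `|X1 - X0| <= K * tau -> `|X0 - r (z0 k)| <= K * (D * h) ->
  `|F X1 - F X0 - (F (r (t0 + tau, corner k)) - F (r (z0 k)))| <= cq * tau * h.
Proof.
move=> HFd Hd Ld i1 i0 h1 h2 h3.
have j1 := @r_itv (t0 + tau, corner k) t1T; have j0 := @r_itv (z0 k) t0T.
have h4 := closed_time hr (corner k) t1T t0T; rewrite [_ - t0]addrC addKr [`|tau|]gtr0_norm// in h4.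
apply: le_trans (quadrilateral rlow_gt0 HFd Hd Ld i1 i0 j1 j0) _.
have t2 := ler_wpM2l K_ge0 tauK.
have -> : cq * tau * h = KF * (K * tau * (D * h))
    + KF * (K * (K * h) + K * (D * h) + K * (K * h)) * (K * tau) by rewrite /cq; ring.
apply: lerD; first by apply: ler_wpM2l.
apply: ler_pM => //; first by rewrite mulr_ge0// !addr_ge0.
by apply: ler_wpM2l => //; lra.
Qed.

Let move_t (t : R) (x : 'rV[R]_d) : (t, x) + b None *: dir_vec None = (t + tau, x).
Proof. exact: move_time. Qed.

Let move_x (t : R) (x : 'rV[R]_d) i : (t, x) + b (Some i) *: dir_vec (Some i) = (t, x + h *: unit_vec i).
Proof. exact: move_space. Qed.

Let h2_le : h ^+ 2 <= h. Proof. by rewrite expr2 ler_piMl. Qed.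

Let div_le (X c e : R) : 0 < c -> `|X| <= e * c -> `|X / c| <= e.
Proof.
move=> c0 Xe; rewrite normrM; have -> : `|c^-1| = c^-1 by rewrite gtr0_norm ?invr_gt0.
by rewrite ler_pdivrMr.
Qed.

Let div_near (A G B c e e' : R) : 0 < c -> `|A - G| <= e * c -> `|B - G / c| <= e' ->
  `|A / c - B| <= e + e'.
Proof.
move=> c0 h1 h2; have -> : A / c - B = (A - G) / c - (B - G / c) by field; rewrite gt_eqF.
apply: le_trans (ler_normB _ _) _; apply: lerD => //.
by rewrite normrM [`|c^-1|]gtr0_norm ?invr_gt0// ler_pdivrMr.
Qed.

Let tri (A G c e e' E : R) : `|G - c| <= e -> `|A - c| <= e' -> e + e' <= E -> `|A - G| <= E.
Proof. by move=> N1 N2 eE; norm_split N1; norm_split N2; norm_lra. Qed.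

Let mean_tri (A1 A0 B1 B0 c c' e e' : R) : `|A1 - A0 - c| <= e -> `|B1 - B0 - c'| <= e ->
  `|c - c'| <= e' -> 0 <= e' -> `|(A1 + B1) / 2 - (A0 + B0) / 2 - c| <= e + e'.
Proof.
by move=> N2 N3 N4 e0; norm_split N2; norm_split N3; norm_split N4; norm_lra.
Qed.

Let dist_near k s w : uniq s -> hull b s (z0 k) w -> dist1 w.2 (corner k) <= D * h.
Proof. by move=> us zw; have [] := hull_base us (base_corner k) zw. Qed.

Let time_hull k w : hull b (al None) (z0 k) w -> w.1 = t0.
Proof. by move=> zw; have := hull_coord (al_uniq None) zw None; rewrite alP eqxx. Qed.

(** No second time derivative is involved: the increment of the averages and the mean of the time
    derivative are both compared with the increment at the corner, by means of mixed space-time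
    differences. *)
Lemma time_density (F dF : R -> R) k : (forall x : R, 0 < x -> is_derive x 1 F (dF x)) ->
  (forall x, rlow <= x <= rup -> `|dF x| <= KF) -> lipschitz_on rlow rup KF dF ->
  slab_continuous T (fun z => F (r z)) -> quot m (fun z => F (r z)) None ->
  `|(F (rr (t0 + tau) k) - F (rr t0 k)) / tau - BM all (dt (fun z => F (r z))) (z0 k)|
  <= (2 * cq + 1) * h.
Proof.
move=> HFd Hd Ld cF q; set f := fun z => F (r z).
have df z : open_slab T z -> derivable f z (dir_vec None).
  by move=> zT; have [] := compose_derive None HFd zT.
have Q := mean_derive q df (fun _ => cF) (base_corner k).
rewrite -box_mean_shift -box_meanB in Q.
have N1 : `|BM (al None) (fun w => f (w + b None *: dir_vec None) - f w) (z0 k)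
    - (f (t0 + tau, corner k) - f (z0 k))| <= cq * tau * h.
  apply: box_mean_near => // w zw; have wx := dist_near (al_uniq None) zw.
  have wt := time_hull zw; case: w zw wx wt => t x zw /= wx ->; rewrite move_t.
  apply: (time_quad HFd Hd Ld); [exact: r_itv|exact: r_itv| | |].
  - apply: le_trans (closed_mixed T_gt0 K_ge0 hr _ _ t1T t0T) _.
    rewrite [_ - t0]addrC addKr [`|tau|]gtr0_norm//.
    by apply: ler_wpM2l => //; rewrite mulr_ge0// ltW.
  - apply: le_trans (closed_time hr _ t1T t0T) _.
    by rewrite [_ - t0]addrC addKr [`|tau|]gtr0_norm.
  - apply: le_trans (closed_space T_gt0 K_ge0 hr _ _ t0T) _; exact: ler_wpM2l.
have N2 : `|F (rr (t0 + tau) k) - F (rr t0 k) - (f (t0 + tau, corner k) - f (z0 k))| <= cq * tau * h.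
  apply: (time_quad HFd Hd Ld); [exact: rr_itv|exact: rr_itv| | |exact: r_near].
  - apply: r_time => x /in_cell_dist kx.
    apply: le_trans (closed_mixed T_gt0 K_ge0 hr _ _ t1T t0T) _.
    rewrite [_ - t0]addrC addKr [`|tau|]gtr0_norm//.
    by apply: ler_wpM2l => //; rewrite mulr_ge0// ltW.
  - rewrite -[_ - _]subr0; apply: r_time => x _; rewrite subr0.
    apply: le_trans (closed_time hr _ t1T t0T) _.
    by rewrite [_ - t0]addrC addKr [`|tau|]gtr0_norm.
rewrite (_ : (2 * cq + 1) * h = 2 * cq * h + h); last by ring.
apply: le_trans (_ : _ <= 2 * cq * h + h ^+ 2) _; last by rewrite lerD2l.
apply: div_near Q => //; apply: (tri N1 N2).
by rewrite le_eqVlt; apply/orP; left; apply/eqP; rewrite /b; ring.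
Qed.

Let cv : R := K * (2 * D + 1) + 1.

Lemma time_velocity i k : quot m (u i) None ->
  `|(mean (W (t0 + tau)) i k - mean (W t0) i k) / tau - BM all (dt (u i)) (z0 k)| <= cv * h.
Proof.
move=> q; have [cf df _] := hu i.
have Q := mean_derive q (fun z zT => (df None z zT).1) (fun _ => cf) (base_corner k).
rewrite -box_mean_shift -box_meanB in Q.
have mix x y : dist1 x y <= D * h ->
    `|u i (t0 + tau, x) - u i (t0, x) - (u i (t0 + tau, y) - u i (t0, y))| <= K * D * h * tau.
  move=> xy; apply: le_trans (closed_mixed T_gt0 K_ge0 (hu i) _ _ t1T t0T) _.
  rewrite [_ - t0]addrC addKr [`|tau|]gtr0_norm//.
  have := ler_wpM2l (mulr_ge0 K_ge0 (ltW tau_gt0)) xy; lra.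
have N1 : `|BM (al None) (fun w => u i (w + b None *: dir_vec None) - u i w) (z0 k)
    - (u i (t0 + tau, corner k) - u i (z0 k))| <= K * D * h * tau.
  apply: box_mean_near => // w zw; have wx := dist_near (al_uniq None) zw.
  by have wt := time_hull zw; case: w zw wx wt => t x zw /= wx ->; rewrite move_t; exact: mix.
have N2 := W_time t0T (fun x kx => mix x (corner k) (in_cell_dist kx)).
have N3 := W_time t0T (fun x kx => mix x (corner (dn i k)) (in_cell_dist kx)).
have N4 := closed_mixed T_gt0 K_ge0 (hu i) (corner (dn i k) + h *: unit_vec i)
  (corner (dn i k)) t1T t0T.
(* The left face belongs to the cell [dn i k], whose corner moved by [h] is, up to a period, the
   corner of [k]. *)
have cp t : 0 <= t <= T -> u i (t, corner (dn i k) + h *: unit_vec i) = u i (t, corner k).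
  move=> tT; have := @corner_up _ _ _ N_gt0 (fun x => u i (t, x)) i (dn i k) (per_u i tT).
  by rewrite dnK => ->.
rewrite !cp// dist1_move [`|h|]gtr0_norm// [_ - t0]addrC addKr [`|tau|]gtr0_norm// in N4.
rewrite (_ : cv * h = K * (2 * D + 1) * h + h); last by rewrite /cv; ring.
apply: le_trans (_ : _ <= K * (2 * D + 1) * h + h ^+ 2) _; last by rewrite lerD2l.
have P0 : 0 <= K * tau * h by rewrite !mulr_ge0// ltW.
have N5 : `|mean (W (t0 + tau)) i k - mean (W t0) i k - (u i (t0 + tau, corner k) - u i (z0 k))|
    <= K * D * h * tau + K * tau * h.
  exact: (mean_tri N2 N3 N4 P0).
apply: div_near Q => //; apply: (tri N1 N5).
by rewrite le_eqVlt; apply/orP; left; apply/eqP; rewrite /b; ring.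
Qed.

(** In a product the slowly varying factor is frozen at a constant, while the derivative stays under
    the mean, where it is a difference quotient. *)
Let prod_near (g f : st -> R) k (c e M : R) : 0 <= e ->
  (forall w, open_slab T w -> near_cell k w -> `|g w - c| <= e /\ `|f w| <= M) ->
  `|BM all (fun w => g w * f w) (z0 k) - c * BM all f (z0 k)| <= e * M.
Proof.
move=> e0 H; rewrite -box_meanZ -box_meanB -[X in `|X|]subr0; apply: box_mean_near => // w zw.
have [nw /(_ (allP None)) ow] := hull_near all_uniq zw.
have [h1 h2] := H w ow nw; rewrite subr0 -mulrBl normrM.
exact: (ler_pM (normr_ge0 _) (normr_ge0 _) h1 h2).
Qed.

Let open_bm (f : st -> R) k (M : R) : (forall w, open_slab T w -> near_cell k w -> `|f w| <= M) ->
  `|BM all f (z0 k)| <= M.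
Proof.
move=> H; rewrite -[X in `|X|]subr0; apply: box_mean_near => // w zw; rewrite subr0.
by have [nw /(_ (allP None)) ow] := hull_near all_uniq zw; exact: H.
Qed.

Let open_eq (f g : st -> R) k : (forall w, open_slab T w -> f w = g w) ->
  BM all f (z0 k) = BM all g (z0 k).
Proof.
move=> H; apply: eq_box_mean => // w zw.
by have [_ /(_ (allP None)) ow] := hull_near all_uniq zw; exact: H.
Qed.

Let dx_periodic (f : st -> R) i t : torus_periodic (fun x => f (t, x)) ->
  torus_periodic (fun x => dx i f (t, x)).
Proof.
move=> pf x l; pose v : st := (0, unit_vec i).
have pf' y : f (t, y + unit_vec l) = f (t, y) := pf y l.
have E0 c y : c *: v + (t, y) = (t, y + c *: unit_vec i) by rewrite addrC; exact: move_space.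
have E : (fun c : R => c^-1 *: (f (c *: v + (t, x + unit_vec l)) - f (t, x + unit_vec l))) =
    (fun c : R => c^-1 *: (f (c *: v + (t, x)) - f (t, x))).
  by apply/funext => c; rewrite !E0 addrAC !pf'.
by rewrite /dx /derive E.
Qed.

(** Mean over the right face of the cell and over the time step: every direction except [i], based
    at the shifted corner. These means are the fields [psi], [G] and, summed, [DD] of the
    consistency record. *)
Definition face_avg_of (f : st -> R) i k : R := BM (al (Some i)) f (t0, corner k + h *: unit_vec i).

Let mean_periodic (f : st -> R) s : uniq s -> None \in s ->
  (forall t, 0 < t < T -> torus_periodic (fun x => f (t, x))) ->
  torus_periodic (fun x => BM s f (t0, x)).
Proof.
move=> us sN pf x l /=; rewrite (_ : (t0, x + unit_vec l) = (t0, x) + (0, unit_vec l)); last first.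
  by congr pair; rewrite /= addr0.
rewrite -box_mean_shift; apply: eq_box_mean => // w zw.
have := hull_coord us zw None; rewrite sN /= => /andP[w1 w2].
case: w zw w1 w2 => t y zw /= w1 w2; rewrite -[_ + _]/(t + 0, y + unit_vec l) addr0.
apply: pf; apply/andP; split; first exact: le_lt_trans w1.
exact: lt_le_trans w2 t1_le.
Qed.

Lemma cell_quot (f : st -> R) i k : quot m f (Some i) ->
  (forall z, open_slab T z -> derivable f z (dir_vec (Some i))) ->
  (forall t, 0 < t < T -> torus_periodic (fun x => f (t, x))) ->
  `|diff_cell i (face_avg_of f i) k - BM all (dx i f) (z0 k)| <= h ^+ 2.
Proof.
move=> q df pf; have Q : `|_| <= _ := mean_derive q df (fun E => ltac:(discriminate E)) (base_corner k).
rewrite move_x in Q; rewrite distrC /diff_cell /face_avg_of.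
have pm : torus_periodic (fun x => BM (al (Some i)) f (t0, x)).
  by apply: mean_periodic => //; rewrite alP.
by rewrite -(@corner_up _ _ _ N_gt0 (fun x => BM (al (Some i)) f (t0, x)) i (dn i k) pm) dnK.
Qed.

Let schwarz_real (A B1 B0 q11 q10 q01 q00 : R) : `|A - (B1 - B0) / h| <= h ^+ 2 ->
  `|B1 - (q11 - q10) / h| <= h ^+ 2 -> `|B0 - (q01 - q00) / h| <= h ^+ 2 ->
  `|A - (q11 - q10 - (q01 - q00)) / h / h| <= 3 * h.
Proof.
move=> Q1 Q3 Q2.
have P : `|(B1 - B0) / h - (q11 - q10 - (q01 - q00)) / h / h| <= 2 * h.
  have -> : (B1 - B0) / h - (q11 - q10 - (q01 - q00)) / h / h =
    ((B1 - (q11 - q10) / h) - (B0 - (q01 - q00) / h)) / h by field; rewrite gt_eqF.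
  apply: div_le => //; apply: le_trans (ler_normB _ _) _.
  by apply: le_trans (lerD Q3 Q2) _; rewrite expr2; lra.
have -> : A - (q11 - q10 - (q01 - q00)) / h / h =
  (A - (B1 - B0) / h) + ((B1 - B0) / h - (q11 - q10 - (q01 - q00)) / h / h) by ring.
apply: le_trans (ler_normD _ _) _; apply: le_trans (lerD Q1 P) _.
by have := h2_le; lra.
Qed.

Let schwarz_swap (A A' x1 x2 x3 x4 : R) :
  `|A - (x1 - x2 - (x3 - x4)) / h / h| <= 3 * h ->
  `|A' - (x1 - x3 - (x2 - x4)) / h / h| <= 3 * h -> `|A - A'| <= 6 * h.
Proof.
rewrite (_ : x1 - x3 - (x2 - x4) = x1 - x2 - (x3 - x4)); last by ring.
move=> S1 S2; rewrite distrC in S1; move: S1 S2; move: (_ / h / h) => q S1 S2; norm_split S1; norm_split S2; norm_lra.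
Qed.

Let schwarz_half (f : st -> R) i j k : i != j -> quot m (dx i f) (Some j) -> quot m f (Some i) ->
  (forall z, open_slab T z -> derivable f z (dir_vec (Some i))) ->
  (forall z, open_slab T z -> derivable (dx i f) z (dir_vec (Some j))) ->
  forall s, s = rem (Some i) (al (Some j)) ->
  `|BM all (dx j (dx i f)) (z0 k) -
    (BM s f (t0, corner k + h *: unit_vec j + h *: unit_vec i)
     - BM s f (t0, corner k + h *: unit_vec j)
     - (BM s f (t0, corner k + h *: unit_vec i) - BM s f (z0 k))) / h / h| <= 3 * h.
Proof.
move=> ij q1 q2 d2 d1 s Es.
have ji : (Some i != Some j :> option 'I_d) by rewrite (inj_eq (@Some_inj _)).
have us : uniq s by rewrite Es; apply: rem_uniq.
have is' : Some i \notin s by rewrite Es mem_rem_uniq// inE eqxx.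
have Ns : None \in s by rewrite Es mem_rem_uniq// inE alP.
have iN (P : Prop) : Some i = None :> option 'I_d -> P by [].
have jN (P : Prop) : Some j = None :> option 'I_d -> P by [].
have Q1 := mean_derive q1 d1 (jN _) (base_corner k); rewrite move_x in Q1.
have Q2 := mean_quot q2 us is' (fun _ => Ns) d2 (iN _) (base_corner k).
have Q3 := mean_quot q2 us is' (fun _ => Ns) d2 (iN _) (base_shift k j).
have ia : Some i \in al (Some j) by rewrite alP.
have Eb z : BM s (seg_avg m (b (Some i)) (Some i) (dpart (Some i) f)) z = BM (al (Some j)) (dx i f) z.
  by rewrite Es -(box_mean_rem _ _ _ _ ia).
rewrite Eb !move_x in Q2; rewrite Eb !move_x in Q3.
exact: (schwarz_real Q1 Q3 Q2).
Qed.

(** Both means are, up to [O(h)], the same double difference of the mean over the remaining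
    directions, in which the order of [i] and [j] is immaterial. *)
Lemma schwarz_mean (f : st -> R) i j k :
  (forall l, quot m f (Some l)) -> (forall l l', quot m (dx l f) (Some l')) ->
  (forall l z, open_slab T z -> derivable f z (dir_vec (Some l))) ->
  (forall l l' z, open_slab T z -> derivable (dx l f) z (dir_vec (Some l'))) ->
  `|BM all (dx j (dx i f)) (z0 k) - BM all (dx i (dx j f)) (z0 k)| <= 6 * h.
Proof.
move=> q1 q2 d1 d2; have [->|ij] := eqVneq i j.
  by rewrite subrr normr0 mulr_ge0.
have ji : j != i by rewrite eq_sym.
have S1 := @schwarz_half f i j k ij (q2 i j) (q1 i) (d1 i) (d2 i j) _ erefl.
have S2 := @schwarz_half f j i k ji (q2 j i) (q1 j) (d1 j) (d2 j i) _ erefl.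
have E : rem (Some j) (al (Some i)) = rem (Some i) (al (Some j)).
  rewrite (rem_filter _ (al_uniq (Some i))) (rem_filter _ (al_uniq (Some j))).
  rewrite !(rem_filter _ all_uniq); elim: (all) => [//|l s IH] /=.
  by case: ifP => /= e1; case: ifP => /= e2; rewrite ?e1 ?e2 /= IH.
rewrite /= E [corner k + h *: unit_vec i + _]addrAC in S2; rewrite /= in S1.
exact: (schwarz_swap S1 S2).
Qed.

Let cm : R := K * (D + 1).
Let Cz : R := (2 * mu + `|lambda|) * D * K / rlow.

Hypotheses (q_phi : forall j : @dir d, quot m phi j) (q_p : quot m (fun z => p (r z)) None)
  (q_u : forall i (j : @dir d), quot m (u i) j)
  (q_du : forall i l l', quot m (dx l (u i)) (Some l')) (q_f : forall j, quot m (flux j) (Some j)).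

Let compose_continuous (F : R -> R) : lipschitz_on rlow rup KF F ->
  slab_continuous T (fun z => F (r z)).
Proof.
move=> LF z zT e e0; have [cr _ _] := hr.
have [del d0 Hd] := cr z zT _ (divr_gt0 e0 KF_gt0).
exists del => // w wT zw; apply: le_lt_trans (LF _ _ (r_itv zT) (r_itv wT)) _.
by rewrite mulrC -ltr_pdivlMr//; exact: Hd.
Qed.

Let u_deriv i (j : @dir d) z : open_slab T z -> derivable (u i) z (dir_vec j).
Proof. by move=> zT; have [_ du _] := hu i; have [] := du j z zT. Qed.

Let du_le i l z : open_slab T z -> `|dx l (u i) z| <= K.
Proof. by move=> zT; have [_ du _] := hu i; have [] := du (Some l) z zT. Qed.

Let dr_le l z : open_slab T z -> `|dx l r z| <= K.
Proof. by move=> zT; have [_ dr _] := hr; have [] := dr (Some l) z zT. Qed.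

Let dphi i z : open_slab T z -> derivable phi z (dir_vec (Some i)) /\ dx i phi z = dH (r z) * dx i r z.
Proof. exact: (compose_derive (Some i) HHD). Qed.

Let dphi_le i z : open_slab T z -> `|dx i phi z| <= KF * K.
Proof.
move=> zT; have [_ ->] := dphi i zT; rewrite normrM; apply: ler_pM => //; last exact: dr_le.
exact/(bound_dH HF)/r_itv/open_closed.
Qed.

Let u_near i k w : near_cell k w -> `|u i w - mean (W t0) i k| <= (c1 + cm) * h.
Proof.
move=> nw; have h1 := near_val (hu i) nw; have h2 := mean_W_near i k.
rewrite mulrDl -/cm in h2 *; norm_split h1; norm_split h2; norm_lra.
Qed.

Let r0_near k w : near_cell k w -> `|r w - rr t0 k| <= (c1 + K * D) * h.
Proof.
move=> nw; have h1 := near_val hr nw; have h2 := r_near k t0T.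
rewrite mulrDl -mulrA; norm_split h1; norm_split h2; norm_lra.
Qed.

Let mean_W_le i k : `|mean (W t0) i k| <= K.
Proof.
have h1 := W_le i k t0T; have h2 := W_le i (dn i k) t0T.
by rewrite /mean /avg_cell; norm_split h1; norm_split h2; norm_lra.
Qed.

Let grad_div (X y e : R) : `|X - h * y| <= h * e -> `|y - X / h| <= e.
Proof.
move=> H; have -> : y - X / h = - ((X - h * y) / h) by field; rewrite gt_eqF.
by rewrite normrN; apply: div_le => //; rewrite [e * h]mulrC.
Qed.

Let W_grad1 i j k w : open_slab T w -> near_cell k w ->
  `|dx j (u i) w - diff_face j (W t0 i) k| <= c8 * h.
Proof. by move=> ow nw; have [_ H2] := W_gradient i j j ow nw; exact: grad_div. Qed.

Let W_grad2 i j l k w : open_slab T w -> near_cell k w ->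
  `|dx j (u i) w - diff_face j (W t0 i) (dn l k)| <= c8 * h.
Proof. by move=> ow nw; have [H2 _] := W_gradient i j l ow nw; exact: grad_div. Qed.

Let W_grad3 i j k w : open_slab T w -> near_cell k w ->
  `|dx j (u i) w - diff_face j (mean (W t0) i) k| <= c8 * h.
Proof.
move=> ow nw; have h1 := W_grad1 i j ow nw; have h2 := W_grad2 i j i ow nw.
have -> : diff_face j (mean (W t0) i) k =
    (diff_face j (W t0 i) k + diff_face j (W t0 i) (dn i k)) / 2.
  by rewrite /diff_face /mean /avg_cell up_dnC; field; rewrite gt_eqF.
by norm_split h1; norm_split h2; norm_lra.
Qed.

Let div_grad k w : open_slab T w -> near_cell k w ->
  `|\sum_j dx j (u j) w - div_cell (W t0) k| <= D * c8 * h.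
Proof.
move=> ow nw; rewrite /div_cell -sumrB; apply: le_trans (ler_norm_sum _ _ _) _.
have -> : D * c8 * h = \sum_(j < d) c8 * h by rewrite sumr_const card_ord -mulrA mulr_natl.
apply: ler_sum => j _; have := W_grad2 j j j ow nw.
by rewrite /diff_face /diff_cell dnK.
Qed.

Let div_le_DK w : open_slab T w -> `|\sum_j dx j (u j) w| <= D * K.
Proof.
move=> ow; apply: le_trans (ler_norm_sum _ _ _) _.
have -> : D * K = \sum_(j < d) K by rewrite sumr_const card_ord mulr_natl.
by apply: ler_sum => j _; exact: du_le.
Qed.

Let sum_const (c : R) : \sum_(j < d) c = D * c. Proof. by rewrite sumr_const card_ord mulr_natl. Qed.

Let prod_diff (x y x' y' e1 e2 M1 M2 : R) : `|x - x'| <= e1 -> `|y| <= M1 -> `|y - y'| <= e2 ->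
  `|x'| <= M2 -> `|x * y - x' * y'| <= e1 * M1 + M2 * e2.
Proof.
move=> h1 h2 h3 h4; have -> : x * y - x' * y' = (x - x') * y + x' * (y - y') by ring.
apply: le_trans (ler_normD _ _) _; rewrite !normrM; apply: lerD.
  exact: (ler_pM (normr_ge0 _) (normr_ge0 _) h1 h2).
exact: (ler_pM (normr_ge0 _) (normr_ge0 _) h4 h3).
Qed.

Let open_near (f : st -> R) k (c e : R) :
  (forall w, open_slab T w -> near_cell k w -> `|f w - c| <= e) -> `|BM all f (z0 k) - c| <= e.
Proof.
move=> Hf; apply: box_mean_near => // w zw.
by have [nw /(_ (allP None)) ow] := hull_near all_uniq zw; exact: Hf.
Qed.

Let face_near (f : st -> R) i k (c e : R) :
  (forall w, open_slab T w -> near_cell k w -> `|f w - c| <= e) -> `|face_avg_of f i k - c| <= e.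
Proof.
move=> Hf; apply: box_mean_near => // w zw.
have [nw ow] := hull_near_shift (al_uniq (Some i)) zw.
by apply: Hf => //; apply: ow; rewrite alP.
Qed.

Let tri4 (q1 q2 q3 q4 e1 e2 e3 : R) : `|q1 - q3| <= e1 -> `|q2 - q4| <= e2 -> `|q4 - q3| <= e3 ->
  `|q1 - q2| <= e1 + e2 + e3.
Proof. by move=> n2 n3 n4; norm_split n2; norm_split n3; norm_split n4; norm_lra. Qed.

Let tri5 (q1 q2 q3 q4 e1 e2 e3 : R) : `|q1 - q4| <= e1 -> `|q3 - q4| <= e2 -> `|q2 - q3| <= e3 ->
  `|q1 - q2| <= e1 + e2 + e3.
Proof. by move=> n1 n2 n3; norm_split n1; norm_split n2; norm_split n3; norm_lra. Qed.

Let avg2 (x y z e : R) : `|x - y| <= e -> `|x - z| <= e -> `|x - (y + z) / 2| <= e.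
Proof. by move=> n2 n3; norm_split n2; norm_split n3; norm_lra. Qed.

Let mu_abs (x e : R) : `|x| <= e -> `|mu * x| <= mu * e.
Proof.
move=> xe; have mu0 : 0 <= mu by exact: ltW.
by rewrite normrM (ger0_norm mu0); exact: ler_wpM2l.
Qed.

Let dp_dH (x : R) : 0 < x -> dp x = dH x * x.
Proof.
move=> x0; rewrite /dpressure /dhpot' -[RHS]mulrA; congr (_ * _).
have := powR_predr (gamma - 1) x0; rewrite (_ : gamma - 1 - 1 = gamma - 2); last by ring.
by rewrite mulrC => ->.
Qed.

Let cpsi : R := KF * (c1 + K * D + K).

Lemma psi_bound i k :
  `|face_avg_of phi i k - avg_face i (fun l : cl => H' (rr t0 l)) k| <= cpsi * h.
Proof.
apply: face_near => w ow nw.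
have rw := r_itv (open_closed ow).
have h1 := lip_H HF rw (rr_itv k t0T); have h2 := lip_H HF rw (rr_itv (up i k) t0T).
have n1 := r0_near nw; have n2 := near_val hr nw; have n3 := r_near (up i k) t0T.
have cu := @corner_up _ _ _ N_gt0 (fun x => r (t0, x)) i k (per_r t0T); rewrite /= in cu.
rewrite cu in n3.
have n4 := closed_space T_gt0 K_ge0 hr (corner k + h *: unit_vec i) (corner k) t0T.
rewrite dist1_move [`|h|]gtr0_norm// in n4.
have n5 : `|r w - rr t0 (up i k)| <= (c1 + K * D + K) * h.
  by rewrite (_ : (c1 + K * D + K) * h = c1 * h + K * (D * h) + K * h);
    [exact: (tri4 n2 n3 n4)|ring].
have n6 : `|r w - rr t0 k| <= (c1 + K * D + K) * h.
  by apply: le_trans n1 _; apply: ler_wpM2r => //; rewrite lerDl.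
have h3 := le_trans h1 (ler_wpM2l KF_ge0 n6); have h4 := le_trans h2 (ler_wpM2l KF_ge0 n5).
rewrite (_ : cpsi * h = KF * ((c1 + K * D + K) * h)); last by rewrite /cpsi; ring.
exact: (avg2 h3 h4).
Qed.

Lemma G_bound i j k : `|face_avg_of (dx j (u i)) j k - diff_face j (W t0 i) k| <= c8 * h.
Proof. by apply: face_near => w ow nw; exact: W_grad1. Qed.

Lemma D_bound i k :
  `|\sum_l face_avg_of (dx l (u l)) i k - div_cell (W t0) k| <= D * c8 * h.
Proof.
rewrite /div_cell -sumrB; apply: le_trans (ler_norm_sum _ _ _) _.
rewrite -mulrA -sum_const; apply: ler_sum => j _; apply: face_near => w ow nw.
by have := W_grad2 j j j ow nw; rewrite /diff_face /diff_cell dnK.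
Qed.

(** Viscous force per unit mass. Division of the momentum equation by [r] turns the pressure
    gradient into the gradient of [phi = H'(r)]. *)
Definition force i z : R := visc i z / r z.

Let ddu_le i l j w : open_slab T w -> `|dx l (dx j (u i)) w| <= K.
Proof. by move=> ow; have [] := hh i j l ow. Qed.

Let visc_le i w : open_slab T w -> `|visc i w| <= (2 * mu + `|lambda|) * D * K.
Proof.
move=> ow; have S (F : 'I_d -> R) : (forall j, `|F j| <= K) -> `|\sum_j F j| <= D * K.
  move=> FK; apply: le_trans (ler_norm_sum _ _ _) _; rewrite -sum_const.
  by apply: ler_sum => j _; exact: FK.
have s1 := S (fun j => dx j (dx j (u i)) w) (fun j => ddu_le i j j ow).
have s2 := S (fun j => dx j (dx i (u j)) w) (fun j => ddu_le j j i ow).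
have s3 := S (fun j => dx i (dx j (u j)) w) (fun j => ddu_le j i j ow).
rewrite /visc; have -> : (2 * mu + `|lambda|) * D * K =
  mu * (D * K) + mu * (D * K) + `|lambda| * (D * K) by ring.
apply: le_trans (ler_normD _ _) _; apply: lerD; last by rewrite normrM; apply: ler_wpM2l.
by apply: le_trans (ler_normD _ _) _; apply: lerD; exact: mu_abs.
Qed.

Let force_le i w : open_slab T w -> `|force i w| <= Cz.
Proof.
move=> ow; have /andP[r1 _] := r_itv (open_closed ow); have r0 := r_gt0 (open_closed ow).
rewrite /force normrM /Cz [`|(r w)^-1|]gtr0_norm ?invr_gt0//.
apply: ler_pM => //; first by rewrite invr_ge0 ltW.
  exact: visc_le.
by rewrite lef_pV2 ?posrE.
Qed.

Lemma Z_bound i k : `|BM all (force i) (z0 k)| <= Cz.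
Proof. by apply: open_bm => w ow _; exact: force_le. Qed.

Let sum3 (x1 x2 x3 y1 y2 y3 e1 e2 e3 : R) : `|x1 - y1| <= e1 -> `|x2 - y2| <= e2 ->
  `|x3 - y3| <= e3 -> `|x1 + x2 + x3 - (y1 + y2 + y3)| <= e1 + e2 + e3.
Proof.
by move=> h1 h2 h3; norm_split h1; norm_split h2; norm_split h3; norm_lra.
Qed.

Let phi_per i k : `|diff_cell i (face_avg_of phi i) k - BM all (dx i phi) (z0 k)| <= h.
Proof.
apply: le_trans h2_le; apply: cell_quot => //; first by move=> z zT; have [] := dphi i zT.
by move=> t /andP[/ltW t1 /ltW t2] x l; rewrite /phi (per_r (t := t))// t1 t2.
Qed.

Let Cvel : R := cv + D * ((c1 + cm) * K + K * c8) + 1.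

(** The momentum equation divided by [r] and averaged over the space-time cell: time derivative and
    pressure gradient become difference quotients, and the convective product is replaced by its
    discrete counterpart, whose factors vary by [O(h)]. *)
Lemma velocity_bound i k :
  `|(mean (W (t0 + tau)) i k - mean (W t0) i k) / tau
    + \sum_j mean (W t0) j k * diff_face j (mean (W t0) i) k
    + diff_cell i (face_avg_of phi i) k - BM all (force i) (z0 k)| <= Cvel * h.
Proof.
have E : BM all (force i) (z0 k) = BM all (dt (u i)) (z0 k)
    + \sum_j BM all (fun w => u j w * dx j (u i) w) (z0 k) + BM all (dx i phi) (z0 k).
  rewrite -box_mean_sum -!box_meanD; apply: open_eq => w ow.
  have [_ ->] := dphi i ow; have r0 := r_gt0 (open_closed ow).
  have := eq_mom i ow; rewrite /force => <-.
  have rn : r w != 0 by rewrite gt_eqF.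
  by rewrite (dp_dH r0) mulrDl [r w * _]mulrC (mulfK rn) mulrAC (mulfK rn).
have h1 := time_velocity k (@q_u i None).
have h2 : `|\sum_j mean (W t0) j k * diff_face j (mean (W t0) i) k
    - \sum_j BM all (fun w => u j w * dx j (u i) w) (z0 k)| <= D * ((c1 + cm) * K + K * c8) * h.
  rewrite -sumrB; apply: le_trans (ler_norm_sum _ _ _) _; rewrite -mulrA -sum_const.
  apply: ler_sum => j _; rewrite distrC; apply: open_near => w ow nw.
  have := prod_diff (u_near j nw) (du_le i j ow) (W_grad3 i j ow nw) (mean_W_le j k).
  by move=> H0; apply: le_trans H0 _; rewrite le_eqVlt; apply/orP; left; apply/eqP; ring.
have h3 := phi_per i k.
rewrite E; apply: le_trans (sum3 h1 h2 h3) _.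
by rewrite /Cvel le_eqVlt; apply/orP; left; apply/eqP; ring.
Qed.

Let density_grad (F : R -> R) k w : lipschitz_on rlow rup KF F ->
  (forall x, rlow <= x <= rup -> `|F x| <= KF) -> open_slab T w -> near_cell k w ->
  `|F (r w) * \sum_j dx j (u j) w - F (rr t0 k) * div_cell (W t0) k|
  <= (KF * (c1 + K * D) * (D * K) + KF * (D * c8)) * h.
Proof.
move=> LF FK ow nw; have rw := r_itv (open_closed ow).
have h1 := le_trans (LF _ _ rw (rr_itv k t0T)) (ler_wpM2l KF_ge0 (r0_near nw)).
have := prod_diff h1 (div_le_DK ow) (div_grad ow nw) (FK _ (rr_itv k t0T)).
by move=> H0; apply: le_trans H0 _; rewrite le_eqVlt; apply/orP; left; apply/eqP; ring.
Qed.

Let Cd : R := KF * (c1 + K * D) * (D * K) + KF * (D * c8).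
Let Ctr : R := (2 * cq + 1) + D * (K + (c1 + cm) * (KF * K)) + Cd.

(** The continuity equation multiplied by [H''(r) = p'(r)/r], averaged in the same way. *)
Lemma transport_bound k :
  `|(H' (rr (t0 + tau) k) - H' (rr t0 k)) / tau
    + \sum_i mean (W t0) i k * diff_cell i (face_avg_of phi i) k
    + dp (rr t0 k) * div_cell (W t0) k| <= Ctr * h.
Proof.
have E : BM all (dt phi) (z0 k) + \sum_i BM all (fun w => u i w * dx i phi w) (z0 k)
    + BM all (fun w => dp (r w) * \sum_j dx j (u j) w) (z0 k) = 0.
  rewrite -box_mean_sum -!box_meanD (@open_eq _ (fun _ => 0 * 0)) ?box_meanZ ?mul0r// => w ow.
  have r0 := r_gt0 (open_closed ow).
  have [_ e1] := compose_derive None HHD ow.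
  have e2 : \sum_i u i w * dx i phi w = dH (r w) * \sum_i u i w * dx i r w.
    by rewrite mulr_sumr; apply: eq_bigr => i _; have [_ ->] := dphi i ow; ring.
  have e3 := dp_dH r0.
  have -> : dt phi w = dH (r w) * dt r w by exact: e1.
  by rewrite e2 e3 -mulrA -!mulrDr (eq_cont ow) !mulr0.
have h1 : `|(H' (rr (t0 + tau) k) - H' (rr t0 k)) / tau - BM all (dt phi) (z0 k)|
    <= (2 * cq + 1) * h := time_density k HHD (bound_dH HF) (lip_dH HF) (compose_continuous (lip_H HF)) (@q_phi None).
have h2 : `|\sum_i mean (W t0) i k * diff_cell i (face_avg_of phi i) k
    - \sum_i BM all (fun w => u i w * dx i phi w) (z0 k)| <= D * (K + (c1 + cm) * (KF * K)) * h.
  rewrite -sumrB; apply: le_trans (ler_norm_sum _ _ _) _; rewrite -mulrA -sum_const.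
  apply: ler_sum => i _.
  have e0 : 0 <= (c1 + cm) * h by rewrite mulr_ge0// addr_ge0// mulr_ge0// ?addr_ge0.
  have n1 := @prod_near (u i) (dx i phi) k (mean (W t0) i k) ((c1 + cm) * h) (KF * K) e0
    (fun w ow nw => conj (u_near i nw) (dphi_le i ow)).
  have n2 := ler_pM (normr_ge0 _) (normr_ge0 _) (mean_W_le i k) (phi_per i k).
  rewrite -normrM mulrBr in n2.
  move: n1 n2; move: (BM all (fun w => _) _) (_ * BM all _ _) (_ * diff_cell _ _ _) => x1 x2 x3 n1 n2.
  by norm_split n1; norm_split n2; norm_lra.
have h3 : `|dp (rr t0 k) * div_cell (W t0) k
    - BM all (fun w => dp (r w) * \sum_j dx j (u j) w) (z0 k)| <= Cd * h.
  by rewrite distrC; apply: open_near => w ow nw; exact: density_grad (lip_dp HF) (bound_dp HF) ow nw.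
have Hs := sum3 h1 h2 h3; rewrite E subr0 in Hs; apply: le_trans Hs _.
by rewrite /Ctr le_eqVlt; apply/orP; left; apply/eqP; ring.
Qed.

Let press_real (x y z x1 x2 x3 : R) :
  x * x1 + (x * x2 + y * x3) + (x * z - y) * x3 = x * (x1 + x2 + z * x3).
Proof. by ring. Qed.

Let Cp : R := (2 * cq + 1) + D + Cd.

Lemma pressure_bound :
  `|integral_pc (fun k : cl => (p (rr (t0 + tau) k) - p (rr t0 k)) / tau
      + (dp (rr t0 k) * rr t0 k - p (rr t0 k)) * div_cell (W t0) k)| <= Cp * h.
Proof.
(* The discrete divergence of the averaged flux has integral zero; adding it makes the integrand
   small cell by cell. *)
pose g (k : cl) := (p (rr (t0 + tau) k) - p (rr t0 k)) / tau
  + \sum_j diff_cell j (face_avg_of (flux j) j) k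
  + (dp (rr t0 k) * rr t0 k - p (rr t0 k)) * div_cell (W t0) k.
have gE : integral_pc (fun k : cl => (p (rr (t0 + tau) k) - p (rr t0 k)) / tau
      + (dp (rr t0 k) * rr t0 k - p (rr t0 k)) * div_cell (W t0) k) = integral_pc g.
  rewrite [RHS](_ : _ = integral_pc (fun k : cl => (p (rr (t0 + tau) k) - p (rr t0 k)) / tau
      + (dp (rr t0 k) * rr t0 k - p (rr t0 k)) * div_cell (W t0) k)
      + \sum_j integral_pc (diff_cell j (face_avg_of (flux j) j))).
    rewrite big1 ?addr0// => j _.
    have -> : integral_pc (diff_cell j (face_avg_of (flux j) j)) =
        integral_pc (fun k : cl => diff_cell j (face_avg_of (flux j) j) k * (fun=> 1) k).
      by congr (_ * _); apply: eq_bigr => k _; rewrite mulr1.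
    rewrite Ipc_diff_cell// /integral_pc big1 ?mulr0 ?oppr0// => k _.
    by rewrite /diff_face subrr mul0r mulr0.
  rewrite -Ipc_sum -IpcD; congr (_ * _); apply: eq_bigr => k _; rewrite /g.
  by rewrite addrAC.
rewrite gE; apply: le_trans (Ipc_norm _ _) _ => //.
rewrite -[X in _ <= X](@Ipc_cst R d N N_gt0 (Cp * h)); apply: Ipc_le => // k.
have E : BM all (dt (fun z => p (r z))) (z0 k) + \sum_j BM all (dx j (flux j)) (z0 k)
    + BM all (fun w => (dp (r w) * r w - p (r w)) * \sum_j dx j (u j) w) (z0 k) = 0.
  rewrite -box_mean_sum -!box_meanD (@open_eq _ (fun _ => 0 * 0)) ?box_meanZ ?mul0r// => w ow.
  have [_ e1] := compose_derive None HpD ow.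
  have -> : dt (fun z => p (r z)) w = dp (r w) * dt r w by exact: e1.
  have -> : \sum_j dx j (flux j) w = dp (r w) * (\sum_j u j w * dx j r w)
      + p (r w) * \sum_j dx j (u j) w.
    by rewrite !mulr_sumr -big_split; apply: eq_bigr => j _ /=; have [_ ->] := flux_derive j ow; ring.
  by rewrite press_real (eq_cont ow) !mulr0.
have h1 := time_density k HpD (bound_dp HF) (lip_dp HF) (compose_continuous (lip_p HF)) q_p.
have h2 : `|\sum_j diff_cell j (face_avg_of (flux j) j) k
    - \sum_j BM all (dx j (flux j)) (z0 k)| <= D * h.
  rewrite -sumrB; apply: le_trans (ler_norm_sum _ _ _) _; rewrite -sum_const.
  apply: ler_sum => j _; apply: le_trans h2_le; apply: cell_quot => //.
    by move=> z zT; have [] := flux_derive j zT.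
  move=> t /andP[/ltW t1 /ltW t2] x l; have tT : 0 <= t <= T by rewrite t1 t2.
  by rewrite /flux (per_r tT) (per_u j tT).
have h3 : `|(dp (rr t0 k) * rr t0 k - p (rr t0 k)) * div_cell (W t0) k
    - BM all (fun w => (dp (r w) * r w - p (r w)) * \sum_j dx j (u j) w) (z0 k)| <= Cd * h.
  rewrite distrC; apply: open_near => w ow nw.
  exact: (density_grad (lip_xdp HF) (bound_xdp HF) ow nw).
have Hs := sum3 h1 h2 h3; rewrite E subr0 in Hs; apply: le_trans Hs _.
by rewrite /Cp le_eqVlt; apply/orP; left; apply/eqP; ring.
Qed.

Let bm3 (x1 x2 x3 : R) (f1 f2 f3 : st -> R) z :
  BM all (fun z => x1 * f1 z + x2 * f2 z + x3 * f3 z) z =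
  x1 * BM all f1 z + x2 * BM all f2 z + x3 * BM all f3 z.
Proof.
rewrite -!box_meanZ -(box_meanD _ _ _ (fun z => x1 * f1 z) (fun z => x2 * f2 z)).
by rewrite -(box_meanD _ _ _ (fun z => x1 * f1 z + x2 * f2 z) (fun z => x3 * f3 z)).
Qed.

Let Cst : R := (K * K + K * D + c1) * Cz + mu * D * 7 + `|mu + lambda| * D.

(** Exchanging the averaged mixed derivatives brings the divergence of the stress into the form
    [mu Delta u + (mu + lambda) grad div u] discretized by the scheme. *)
Lemma stress_bound i k :
  `|rr (t0 + tau) k * BM all (force i) (z0 k)
    - mu * \sum_j diff_cell j (face_avg_of (dx j (u i)) j) k
    - (mu + lambda) * diff_cell i (fun k : cl => \sum_l face_avg_of (dx l (u l)) i k) k| <= Cst * h.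
Proof.
have E : BM all (visc i) (z0 k) = mu * \sum_j BM all (dx j (dx j (u i))) (z0 k)
    + mu * \sum_j BM all (dx j (dx i (u j))) (z0 k)
    + lambda * \sum_j BM all (dx i (dx j (u j))) (z0 k).
  apply: etrans (bm3 mu mu lambda (fun z => \sum_j dx j (dx j (u i)) z)
    (fun z => \sum_j dx j (dx i (u j)) z) (fun z => \sum_j dx i (dx j (u j)) z) (z0 k)) _.
  by congr (_ * _ + _ * _ + _ * _); exact: box_mean_sum.
have h1 : `|rr (t0 + tau) k * BM all (force i) (z0 k) - BM all (visc i) (z0 k)|
    <= (K * K + K * D + c1) * Cz * h.
  have c0 : 0 <= (K * K + K * D + c1) * h.
    by rewrite mulr_ge0// !addr_ge0// mulr_ge0// !addr_ge0.
  have -> : BM all (visc i) (z0 k) = BM all (fun w => r w * force i w) (z0 k).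
    by apply: open_eq => w ow; rewrite /force mulrC divfK// gt_eqF// r_gt0//; exact: open_closed.
  rewrite distrC (_ : (K * K + K * D + c1) * Cz * h = (K * K + K * D + c1) * h * Cz); last by ring.
  apply: (@prod_near r (force i) k _ _ Cz c0) => w ow nw; split; last exact: force_le.
  have n1 := near_val hr nw; have n2 := r_near k t0T.
  have n3 : `|rr (t0 + tau) k - rr t0 k| <= K * (K * h).
    rewrite -[_ - _]subr0; apply: r_time => x _; rewrite subr0.
    apply: le_trans (closed_time hr _ t1T t0T) _.
    by rewrite [_ - t0]addrC addKr [`|tau|]gtr0_norm//; apply: ler_wpM2l.
  rewrite (_ : (K * K + K * D + c1) * h = c1 * h + K * (D * h) + K * (K * h)); last by ring.
  exact: (tri5 n1 n2 n3).
have du_der (i' l l' : 'I_d) z : open_slab T z -> derivable (dx l (u i')) z (dir_vec (Some l')).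
  by move=> zT; have [] := hh i' l l' zT.
have du_per (i' l : 'I_d) t : 0 < t < T -> torus_periodic (fun x => dx l (u i') (t, x)).
  by move=> /andP[/ltW t1 /ltW t2]; apply: dx_periodic; apply: per_u; rewrite t1 t2.
have cqd (i' l l' : 'I_d) :
    `|diff_cell l' (face_avg_of (dx l (u i')) l') k - BM all (dx l' (dx l (u i'))) (z0 k)| <= h.
  apply: le_trans h2_le; apply: cell_quot => //; first exact: du_der.
  by move=> t tT; exact: du_per.
have h2 : `|\sum_j diff_cell j (face_avg_of (dx j (u i)) j) k
    - \sum_j BM all (dx j (dx j (u i))) (z0 k)| <= D * h.
  rewrite -sumrB; apply: le_trans (ler_norm_sum _ _ _) _; rewrite -sum_const.
  by apply: ler_sum => j _; exact: cqd.
have h3 : `|\sum_j BM all (dx j (dx i (u j))) (z0 k) - \sum_j BM all (dx i (dx j (u j))) (z0 k)|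
    <= D * (6 * h).
  rewrite -sumrB; apply: le_trans (ler_norm_sum _ _ _) _; rewrite -sum_const.
  apply: ler_sum => j _; apply: schwarz_mean => [l|l l'|l z zT|l l' z zT] //.
    exact: u_deriv.
  exact: du_der.
have h4 : `|diff_cell i (fun k : cl => \sum_l face_avg_of (dx l (u l)) i k) k
    - \sum_j BM all (dx i (dx j (u j))) (z0 k)| <= D * h.
  have -> : diff_cell i (fun k : cl => \sum_l face_avg_of (dx l (u l)) i k) k =
      \sum_l diff_cell i (face_avg_of (dx l (u l)) i) k.
    by rewrite /diff_cell -mulr_suml -sumrB.
  rewrite -sumrB; apply: le_trans (ler_norm_sum _ _ _) _; rewrite -sum_const.
  by apply: ler_sum => j _; exact: cqd.
rewrite E in h1.
have real5 (X a1 a2 b1 b2 b3 e1 e2 e3 e4 : R) :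
    `|X - (mu * b1 + mu * b2 + lambda * b3)| <= e1 -> `|a1 - b1| <= e2 -> `|b2 - b3| <= e3 ->
    `|a2 - b3| <= e4 ->
    `|X - mu * a1 - (mu + lambda) * a2| <= e1 + mu * e2 + mu * e3 + `|mu + lambda| * e4.
  move=> g1 g2 g3 g4.
  have -> : X - mu * a1 - (mu + lambda) * a2 = (X - (mu * b1 + mu * b2 + lambda * b3))
    - mu * (a1 - b1) + mu * (b2 - b3) - (mu + lambda) * (a2 - b3) by ring.
  apply: le_trans (ler_normB _ _) _; apply: lerD; last by rewrite normrM; apply: ler_wpM2l.
  apply: le_trans (ler_normD _ _) _; apply: lerD; last first.
    by apply: mu_abs.
  apply: le_trans (ler_normB _ _) _; apply: lerD => //.
  by apply: mu_abs.
apply: le_trans (real5 _ _ _ _ _ _ _ _ _ _ h1 h2 h3 h4) _.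
by rewrite /Cst le_eqVlt; apply/orP; left; apply/eqP; ring.
Qed.

Let consts : seq R := [:: K; KF * K; KF * (2 * (K * D) + K); Cz; Cvel; Cst; cpsi; c8; D * c8; Ctr; Cp].

(** Built from [K], [KF], [rlow], the viscosities and [d] only: neither the grid, nor the time step,
    nor the number of nodes enters. *)
Definition consistency_constant : R := 1 + \sum_(c <- consts) `|c|.

Let leB n : (n < 11)%N -> nth 0 consts n <= consistency_constant.
Proof.
move=> n11; apply: le_trans (ler_norm _) _; rewrite /consistency_constant (big_nth 0) big_mkord.
rewrite (bigD1 (Ordinal (n11 : (n < size consts)%N)))//= addrCA lerDl addr_ge0//.
by apply: sumr_ge0.
Qed.

Let r_step k : `|rr (t0 + tau) k - rr t0 k| <= K * tau.
Proof.
rewrite -[_ - _]subr0; apply: r_time => x _; rewrite subr0.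
apply: le_trans (closed_time hr _ t1T t0T) _.
by rewrite [_ - t0]addrC addKr [`|tau|]gtr0_norm.
Qed.

Let dd_bound tt i j l k : 0 <= tt <= T -> `|diff_face l (diff_face j (W tt i)) k| <= K.
Proof.
move=> tT; rewrite /diff_face -mulrBl; apply: div_le => //; apply: div_le => //.
rewrite mulrC mulrA [h * K]mulrC -[K * h * h]mulrA mulrA; exact: W_second.
Qed.

Let d_bound tt i j k : 0 <= tt <= T -> `|diff_face j (W tt i) k| <= K.
Proof. by move=> tT; apply: div_le => //; exact: W_diff. Qed.

Lemma consistent_nodes (B : R) : consistency_constant <= B ->
  consistent a gamma mu lambda rlow rup B tau (rr t0) (rr (t0 + tau)) (W t0) (W (t0 + tau))
    (face_avg_of phi) (fun i j => face_avg_of (dx j (u i)) j)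
    (fun i k => \sum_l face_avg_of (dx l (u l)) i k) (fun i k => BM all (force i) (z0 k)).
Proof.
move=> cB; have le n (n11 : (n < 11)%N) : nth 0 consts n <= B := le_trans (leB n11) cB.
have leh n (n11 : (n < 11)%N) : nth 0 consts n * h <= B * h by apply: ler_wpM2r => //; exact: le.
have tau0 : 0 <= tau by exact: ltW.
have let_ n (n11 : (n < 11)%N) : nth 0 consts n * tau <= B * tau by apply: ler_wpM2r => //; exact: le.
split.
- by move=> k; exact: rr_itv.
- by move=> k; exact: rr_itv.
- by move=> i k; apply: le_trans (W_le i k t0T) (le 0%N isT).
- by move=> i k; apply: le_trans (W_le i k t1T) (le 0%N isT).
- move=> i k; apply: le_trans (let_ 0%N isT).
  rewrite -[_ - _]subr0; apply: W_time => // x _; rewrite subr0.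
  apply: le_trans (closed_time (hu i) _ t1T t0T) _.
  by rewrite [_ - t0]addrC addKr [`|tau|]gtr0_norm.
- by move=> i j k; apply: le_trans (d_bound i j k t0T) (le 0%N isT).
- by move=> i j k; apply: le_trans (d_bound i j k t1T) (le 0%N isT).
- move=> i j k; apply: le_trans (let_ 0%N isT); rewrite /diff_face -mulrBl.
  by apply: div_le => //; exact: W_mixed.
- by move=> i j l k; apply: le_trans (dd_bound i j l k t0T) (le 0%N isT).
- by move=> i j l k; apply: le_trans (dd_bound i j l k t1T) (le 0%N isT).
- move=> k; apply: le_trans (let_ 1%N isT).
  apply: le_trans (lip_H HF (rr_itv k t1T) (rr_itv k t0T)) _.
  by rewrite /= -mulrA; apply: ler_wpM2l.
- move=> j k; apply: le_trans (le 2%N isT); apply: div_le => //=.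
  apply: le_trans (lip_H HF (rr_itv _ t0T) (rr_itv k t0T)) _.
  rewrite -mulrA; apply: ler_wpM2l => //.
  have n1 := r_near k t0T; have n2 := r_near (up j k) t0T.
  have cu := @corner_up _ _ _ N_gt0 (fun x => r (t0, x)) j k (per_r t0T); rewrite /= in cu.
  rewrite cu in n2.
  have n4 := closed_space T_gt0 K_ge0 hr (corner k + h *: unit_vec j) (corner k) t0T.
  rewrite dist1_move [`|h|]gtr0_norm// in n4; rewrite distrC in n1.
  have -> : rr t0 (up j k) - rr t0 k = (rr t0 (up j k) - r (t0, corner k + h *: unit_vec j))
    + (r (t0, corner k + h *: unit_vec j) - r (z0 k)) + (r (z0 k) - rr t0 k) by ring.
  apply: le_trans (ler_normD _ _) _; apply: le_trans (lerD (ler_normD _ _) (lexx _)) _.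
  apply: le_trans (lerD (lerD n2 n4) n1) _.
  by rewrite le_eqVlt; apply/orP; left; apply/eqP; ring.
- move=> k; apply: le_trans (let_ 1%N isT).
  apply: le_trans (lip_p HF (rr_itv k t1T) (rr_itv k t0T)) _.
  by rewrite /= -mulrA; apply: ler_wpM2l.
- by move=> i k; apply: le_trans (Z_bound i k) (le 3%N isT).
- by move=> i k; apply: le_trans (velocity_bound i k) (leh 4%N isT).
- by move=> i k; apply: le_trans (stress_bound i k) (leh 5%N isT).
- by move=> i k; apply: le_trans (psi_bound i k) (leh 6%N isT).
- by move=> i j k; apply: le_trans (G_bound i j k) (leh 7%N isT).
- by move=> i k; apply: le_trans (D_bound i k) (leh 8%N isT).
- by move=> k; apply: le_trans (transport_bound k) (leh 9%N isT).
- by apply: le_trans pressure_bound (leh 10%N isT).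
Qed.

End nodes.

Let quot_eventually f (j : @dir d) : (forall z, open_slab T z -> derivable f z (dir_vec j)) ->
  tame T (dpart j f) -> exists m0 : nat, forall m, (m0 < m)%N -> quot m f j.
Proof.
move=> df tf; have h20 : 0 < h ^+ 2 by rewrite exprn_gt0.
have [m0 H0] := seg_avg_derive (b_gt0 j) df tf h20.
by exists m0 => m mm z zg; exact: H0.
Qed.

(** The number of nodes is taken beyond finitely many thresholds. It may depend on the solution and
    on the grid because no constant depends on it. *)
Lemma consistent_step (B : R) : consistency_constant <= B -> exists psi G DD Z,
  consistent a gamma mu lambda rlow rup B tau (rr t0) (rr (t0 + tau)) (W t0) (W (t0 + tau))
    psi G DD Z.
Proof.
move=> cB.
have [m1 E1] := @finite_threshold (option 'I_d) (fun (j : option 'I_d) m => quot m phi j) (fun j : option 'I_d =>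
  quot_eventually (fun z zT => (compose_derive j HHD zT).1) (compose_dtame j HHD (lip_dH HF))).
have [m2 E2] := quot_eventually (fun z zT => (compose_derive None HpD zT).1)
  (compose_dtame None HpD (lip_dp HF)).
have [m3 E3] := @finite_threshold ('I_d * option 'I_d)%type (fun ij m => quot m (u ij.1) ij.2)
  (fun ij => quot_eventually (fun z zT => (let: And3 _ H1 _ := hu ij.1 in H1 ij.2 z zT).1)
    (tame_du ij.2 ij.1)).
have [m4 E4] := @finite_threshold ('I_d * ('I_d * 'I_d))%type
  (fun x m => quot m (dx x.2.1 (u x.1)) (Some x.2.2))
  (fun x => quot_eventually (fun z zT => (hh x.1 x.2.1 x.2.2 zT).1) (tame_ddu x.2.2 x.2.1 x.1)).
have [m5 E5] := @finite_threshold 'I_d (fun j m => quot m (flux j) (Some j)) (fun j =>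
  quot_eventually (fun z zT => (flux_derive j zT).1) (flux_tame j)).
pose m := (m1 + m2 + m3 + m4 + m5).+1.
have l1 : (m1 < m)%N by rewrite ltnS -!addnA leq_addr.
have l2 : (m2 < m)%N by rewrite ltnS [(m1 + _)%N]addnC -!addnA leq_addr.
have l3 : (m3 < m)%N by rewrite ltnS [(_ + m3)%N]addnC -!addnA leq_addr.
have l4 : (m4 < m)%N by rewrite ltnS [(_ + m4)%N]addnC -!addnA leq_addr.
have l5 : (m5 < m)%N by rewrite ltnS leq_addl.
exists (face_avg_of m phi), (fun i j => face_avg_of m (dx j (u i)) j),
  (fun i k => \sum_l face_avg_of m (dx l (u l)) i k),
  (fun i k => box_mean m b (enum {: option 'I_d}) (force i) (t0, corner k)).
apply: consistent_nodes => //.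
- by move=> j; exact: E1.
- exact: E2.
- by move=> i j; exact: (E3 _ l3 (i, j)).
- by move=> i l l'; exact: (E4 _ l4 (i, (l, l'))).
- by move=> j; exact: E5.
Qed.

End one_level.

End consistency.

(** * Pointwise bounds from the essential supremum, and the equations in nonconservative form *)

Section strong_solutions.
Context {R : realType} {d : nat}.
Local Notation st := (R * 'rV[R]_d)%type.
Local Notation tup n := (n.-tuple (measurableTypeR R)).
Variable T : R.
Hypothesis T_gt0 : 0 < T.
Implicit Types (f g : st -> R) (z w : st).

Definition slab_periodic f : Prop := forall z l, open_slab T z -> f (z + (0, unit_vec l)) = f z.

Lemma open_slab_nbhs z : open_slab T z -> \near z, open_slab T z.
Proof.
move=> /andP[z0 zT]; apply/nbhs_ballP; exists (Num.min z.1 (T - z.1)) => /=.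
  by rewrite lt_min z0 subr_gt0.
move=> w [+ _]; rewrite -ball_normE /= lt_min => /andP[h1 h2].
have := ler_norm (z.1 - w.1); have := ler_norm (w.1 - z.1); rewrite [`|w.1 - _|]distrC.
by move=> h3 h4; rewrite /open_slab /=; apply/andP; split; lra.
Qed.

Lemma dpart_periodic f (j : @dir d) : slab_periodic f -> slab_periodic (dpart j f).
Proof.
move=> pf z l zT; pose v : st := (0, unit_vec l); pose fs w := f (w + v).
have E : dpart j f (z + v) = dpart j fs z.
  have E0 (e : st) : (fun c : R => c^-1 *: (f (c *: e + (z + v)) - f (z + v))) =
      (fun c : R => c^-1 *: (fs (c *: e + z) - fs z)).
    by apply/funext => c; rewrite /fs addrA.
  by case: j => [j|] /=; rewrite /dx /dt /derive E0.
rewrite -/v E; have nE : \near z, fs z = f z.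
  by apply: filterS (open_slab_nbhs zT) => w wT; exact: pf.
by case: j {E} => [j|] /=; rewrite /dx /dt; exact: near_eq_derive.
Qed.

Lemma torus_periodic_int (F : 'rV[R]_d -> R) : torus_periodic F ->
  forall (n : 'I_d -> int) x, F (x + \sum_i (n i)%:~R *: unit_vec i) = F x.
Proof.
move=> pF n; have one i (m : int) x : F (x + m%:~R *: unit_vec i) = F x.
  case: m => m.
    elim: m x => [|m IH] x; first by rewrite scale0r addr0.
    have -> : (m.+1%:~R : R) = m%:~R + 1 by rewrite -addn1 PoszD intrD.
    by rewrite scalerDl scale1r addrA pF; exact: IH.
  rewrite NegzE; elim: m x => [|m IH] x.
    by rewrite mulrN1z scaleN1r -(pF (x - unit_vec i) i) subrK.
  rewrite -(pF _ i) -addrA (_ : _ + unit_vec i = (- (m.+1%:Z))%:~R *: unit_vec i).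
    exact: IH.
  rewrite -[X in _ + X]scale1r -scalerDl; congr (_ *: _).
  by rewrite !mulrNz -[m.+2]addn1 PoszD intrD opprD subrK.
elim: (index_enum _) => [|i s IH] x; first by rewrite big_nil addr0.
by rewrite big_cons addrA IH one.
Qed.

(** A point violating the bound, moved into the unit cube by periodicity, would have next to it a
    box of positive measure inside the domain on which [f] exceeds its essential supremum. *)
Lemma Linfty_bound f g (Bf : R) : (forall z, ball3 T z -> 0 <= f z <= Bf) -> tame T g ->
  (forall z, open_slab T z -> `|g z| <= f z) -> slab_periodic g ->
  forall z, open_slab T z -> `|g z| <= Linfty_norm T f.
Proof.
move=> fB [ug _] gf pg.
pose mu : {measure set _ -> \bar R} := (@lebesgue_measure R \x leb d)%E.
pose D : set (measurableTypeR R * tup d) := `]0, T[ `*` Omega.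
pose F : measurableTypeR R * tup d -> \bar R :=
  EFin \o ((fun s => f (s.1, pt_of s.2)) \_ D).
pose Qb (t eta : R) (x : 'I_d -> R) : set (measurableTypeR R * tup d) :=
  `[t, t + eta]%classic `*` box x (fun i => x i + eta).
have box_pos (t eta : R) (x : 'I_d -> R) : 0 < eta -> (0 < mu (Qb t eta x))%E.
  move=> e0; have mb := measurable_box x (fun i => x i + eta).
  pose It : set (measurableTypeR R) := `[t, t + eta]%classic.
  rewrite (_ : mu _ = @lebesgue_measure R It * leb d (box x (fun i => (x i + eta)%R)))%E;
    last exact: product_measure1E.
  have m1 : @lebesgue_measure R It = eta%:E.
    rewrite /It; by rewrite lebesgue_measure_itv /= lte_fin ltrDl e0 -EFinB addrAC subrr add0r.
  have m2 : leb d (box x (fun i => x i + eta)) = (eta ^+ d)%:E.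
    rewrite leb_box; last by move=> i; rewrite lerDl ltW.
    by congr EFin; under eq_bigr do rewrite addrC addKr; rewrite prodr_const card_ord.
  by rewrite [X in (X * _)%E]m1 [X in (_ * X)%E]m2 -EFinM lte_fin mulr_gt0// exprn_gt0.
have muT : (0 < mu setT)%E.
  apply: lt_le_trans (box_pos 0 1 (fun=> 0) ltr01) _.
  apply: le_measure; rewrite ?inE//.
  by apply: measurableX => //; exact: measurable_box.
have LE : Linfty_norm T f = fine (ess_sup mu (abse \o F)).
  by rewrite /Linfty_norm unlock /= -/mu muT.
have D3 s : D s -> ball3 T (s.1, pt_of s.2).
  move=> [/= s1 s2]; split; first by rewrite /open_slab /=; move: s1; rewrite in_itv.
  by move=> i /=; rewrite mxE; have := s2 i; rewrite in_itv /= => /andP[-> h]; lra.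
(* Boundedness of [f] keeps the essential supremum finite; an infinite one would be sent to 0 by
   [fine] and the bound would be lost. *)
have Bf0 : 0 <= Num.max 0 Bf by rewrite le_max lexx.
have FB s : ((abse \o F) s <= (Num.max 0 Bf)%:E)%E.
  rewrite /F /= patchE; case: ifPn => [|_]; last by rewrite normr0 lee_fin.
  rewrite inE => /D3/fB/andP[f0 f1]; rewrite lee_fin ger0_norm// le_max f1 orbT.
  done.
have sup_le : (ess_sup mu (abse \o F) <= (Num.max 0 Bf)%:E)%E.
  by apply/ess_supP; apply: nearW => s; exact: FB.
have sup_ge : (0 <= ess_sup mu (abse \o F))%E.
  by apply: ess_sup_gee => //; apply: nearW => s /=; rewrite lee_fin.
have Lfin : ess_sup mu (abse \o F) \is a fin_num.
  by rewrite ge0_fin_numE//; apply: le_lt_trans sup_le (ltry _).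
set L := Linfty_norm T f.
have ae : {ae mu, forall s, (abse \o F) s <= L%:E}%E.
  by rewrite /L LE fineK//; exact: ess_sup_ge.
move=> z zT; rewrite leNgt; apply/negP => Lg.
pose n i : int := - Num.floor (z.2 0 i).
pose y := z.2 + \sum_i (n i)%:~R *: unit_vec i.
have yE i : y 0 i = z.2 0 i - (Num.floor (z.2 0 i))%:~R.
  rewrite /y mxE; congr (_ + _); rewrite summxE (bigD1 i)//= big1 ?addr0.
    by rewrite !mxE !eqxx mulr1 /n mulrNz.
  by move=> l li; rewrite !mxE eqxx /= eq_sym (negbTE li) mulr0.
have y01 i : 0 <= y 0 i < 1.
  rewrite yE subr_ge0 ge_floor /=; have := lt_succ_floor (z.2 0 i); rewrite intrD; lra.
have gy : g (z.1, y) = g z.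
  have pz : torus_periodic (fun x => g (z.1, x)).
    by move=> x l; have := pg (z.1, x) l zT; rewrite /= -[_ + (0, _)]/(z.1 + 0, x + unit_vec l) addr0.
  by rewrite (torus_periodic_int pz n z.2); case: (z).
have y3 : ball3 T (z.1, y).
  by split => // i /=; have /andP[h1 h2] := y01 i; apply/andP; split; lra.
pose e := (`|g z| - L) / 2.
have e0 : 0 < e by rewrite divr_gt0// subr_gt0.
have [del del0 Hd] := ug e e0.
move: (zT) => /andP[z0 z1].
(* The side of the box stays below the modulus of uniform continuity, ends before time [T] and
   remains in the unit cube, which is possible because the fractional parts are less than 1. *)
pose bnd := \big[Num.min/Num.min (del / 2) ((T - z.1) / 2)]_i (1 - y 0 i).
pose eta := bnd.
have eta0 : 0 < eta.
  rewrite /eta /bnd; elim/big_ind: _ => [|u v u0 v0|i _].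
  - by rewrite lt_min !divr_gt0// subr_gt0.
  - by rewrite lt_min u0.
  - by rewrite subr_gt0; have /andP[] := y01 i.
have eta1 : eta <= Num.min (del / 2) ((T - z.1) / 2).
  rewrite /eta /bnd; elim: (index_enum _) => [|i s IH]; first by rewrite big_nil.
  by rewrite big_cons ge_min IH orbT.
have eta2 i : eta <= 1 - y 0 i.
  by rewrite /eta /bnd (bigD1 i)//= ge_min lexx.
move: eta1; rewrite le_min => /andP[eta1 eta3].
pose Q := Qb z.1 eta (fun i => y 0 i).
have mQ : measurable Q by apply: measurableX => //; exact: measurable_box.
have QD s : Q s -> D s.
  move=> [/= s1 s2]; split.
    by move: s1; rewrite /= !in_itv /= => /andP[? ?]; apply/andP; split; lra.
  move=> i; rewrite in_itv /=; have /andP[h1 h2] := s2 i; have /andP[h3 h4] := y01 i.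
  by have := eta2 i => h5; apply/andP; split; lra.
have Qbad s : Q s -> ~ ((abse \o F) s <= L%:E)%E.
  move=> Qs; rewrite /F /= patchE mem_set; last exact: QD.
  have s3 := D3 s (QD s Qs); rewrite lee_fin => fL.
  have h1 : `|g (z.1, y) - g (s.1, pt_of s.2)| <= e.
    apply: Hd => // -[i|] /=; case: (Qs) => /= s1 s2.
      have /andP[h1 h2] := s2 i; rewrite [pt_of s.2 0 i]mxE ltr_norml.
      move: h1 h2 eta1 del0 eta0; clear; cbv beta; move: (y 0 i) (tnth s.2 i) eta => x1 x2 x3 h1 h2 h3 h4 h5.
      by apply/andP; split; lra.
    by move: s1; rewrite in_itv /= => /andP[h1 h2]; rewrite ltr_norml; apply/andP; split; lra.
  have h2 := gf _ s3.1; have h3 := ler_norm (f (s.1, pt_of s.2)).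
  have := ler_distD (g (s.1, pt_of s.2)) (g (z.1, y)) 0; rewrite !subr0 gy in h1 *.
  by rewrite /e in h1; lra.
have : mu.-negligible Q by apply: negligibleS ae => s Qs /=; exact: Qbad.
move=> /negligibleP => /(_ mQ) Q0.
by have := box_pos z.1 eta (fun i => y 0 i) eta0; rewrite [mu _]Q0 ltxx.
Qed.

Section bounds.
Variables (a gamma mu lambda : R) (r : st -> R) (U : st -> 'rV[R]_d).
Hypothesis sol : strong_solution T a gamma mu lambda r U.
Local Notation u i := (component U i).

Let Cr : C2 T r. Proof. by case: sol => -[]. Qed.
Let Cu i : C2 T (u i). Proof. by case: sol => -[]. Qed.

Let C2_tame f : C2 T f -> tame T f.
Proof. by case=> cf _ _; apply: extends_tame; exists f. Qed.

Let C2_tame1 f (j : @dir d) : C2 T f -> tame T (dpart j f).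
Proof. by case=> _ /(_ j)[_ /extends_tame]. Qed.

Let C2_tame2 f (j k : @dir d) : C2 T f -> tame T (dpart k (dpart j f)).
Proof. by case=> _ _ /(_ j k)[_ /extends_tame]. Qed.

Let tame_sum (J : finType) (F : J -> st -> R) : (forall i, tame T (F i)) ->
  tame T (fun z => \sum_i F i z).
Proof.
move=> tF; elim: (index_enum J) => [|i s IH].
  split=> [e e0|]; first by exists 1 => // z w _ _ _; rewrite !big_nil subrr normr0 ltW.
  by exists 0 => z _; rewrite big_nil normr0.
apply: (@tame_eq _ _ _ _ (fun z => F i z + \sum_(i <- s) F i z)) => [z _|].
  by rewrite big_cons.
exact: tameD.
Qed.

Let tame_sq f : tame T f -> tame T (fun z => f z ^+ 2).
Proof. by move=> tf; exact: tameM. Qed.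

Let length_sq z := \sum_i (dx i r z) ^+ 2 + (dt r z) ^+ 2 + \sum_i (dt (dx i r) z) ^+ 2
    + (dt (dt r) z) ^+ 2
    + \sum_i (u i z) ^+ 2 + \sum_i \sum_j (dx j (u i) z) ^+ 2
    + \sum_i \sum_j \sum_k (dx k (dx j (u i)) z) ^+ 2
    + \sum_i (dt (u i) z) ^+ 2
    + \sum_i \sum_j (dt (dx j (u i)) z) ^+ 2.

Let length_tame : tame T length_sq.
Proof.
rewrite /length_sq; repeat apply: tameD; repeat (apply: tame_sum => ?); apply: tame_sq.
- exact: (C2_tame1 (Some _) Cr).
- exact: (C2_tame1 None Cr).
- exact: (C2_tame2 (Some _) None Cr).
- exact: (C2_tame2 None None Cr).
- exact: C2_tame.
- exact: (C2_tame1 (Some _) (Cu _)).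
- exact: (C2_tame2 (Some _) (Some _) (Cu _)).
- exact: (C2_tame1 None (Cu _)).
- exact: (C2_tame2 (Some _) None (Cu _)).
Qed.

Let length_bound : exists Bf : R, forall z, ball3 T z -> 0 <= solution_length r U z <= Bf.
Proof.
have [_ [K HK]] := length_tame; exists (Num.sqrt K) => z z3; rewrite sqrtr_ge0 /=.
by apply: ler_wsqrtr; apply: le_trans (HK z z3); exact: ler_norm.
Qed.

Let norm_le g : tame T g -> slab_periodic g -> (forall z, g z ^+ 2 <= length_sq z) ->
  forall z, open_slab T z -> `|g z| <= solution_norm T r U.
Proof.
move=> tg pg gl; have [Bf HB] := length_bound.
apply: (Linfty_bound HB tg _ pg) => z zT.
by rewrite -sqrtr_sqr; apply: ler_wsqrtr; exact: gl.
Qed.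

Let per_r : slab_periodic r.
Proof.
case: sol => _ [pr _] _ _ [t x] l /andP[/= t0 t1].
by rewrite -[_ + _]/(t + 0, x + unit_vec l) addr0; apply: pr; rewrite !ltW.
Qed.

Let per_u i : slab_periodic (u i).
Proof.
case: sol => _ [_ pU] _ _ [t x] l /andP[/= t0 t1].
rewrite -[_ + _]/(t + 0, x + unit_vec l) addr0 /component pU//; by rewrite !ltW.
Qed.

Let sum_ge (J : finType) (F : J -> R) i : (forall j, 0 <= F j) -> F i <= \sum_j F j.
Proof. by move=> F0; rewrite (bigD1 i)//= lerDl; apply: sumr_ge0 => j _. Qed.

Let nn1 (J : finType) (F : J -> R) : 0 <= \sum_j F j ^+ 2.
Proof. by apply: sumr_ge0 => j _; exact: sqr_ge0. Qed.
Let nn2 (J : finType) (F : J -> J -> R) : 0 <= \sum_i \sum_j F i j ^+ 2.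
Proof. by apply: sumr_ge0 => j _; exact: nn1. Qed.
Let nn3 (J : finType) (F : J -> J -> J -> R) : 0 <= \sum_i \sum_j \sum_k F i j k ^+ 2.
Proof. by apply: sumr_ge0 => j _; exact: nn2. Qed.

Let parts z : [/\ 0 <= \sum_i (dx i r z) ^+ 2, 0 <= (dt r z) ^+ 2, 0 <= \sum_i (dt (dx i r) z) ^+ 2
    & 0 <= (dt (dt r) z) ^+ 2] /\
  [/\ 0 <= \sum_i (u i z) ^+ 2, 0 <= \sum_i \sum_j (dx j (u i) z) ^+ 2,
    0 <= \sum_i \sum_j \sum_k (dx k (dx j (u i)) z) ^+ 2, 0 <= \sum_i (dt (u i) z) ^+ 2
    & 0 <= \sum_i \sum_j (dt (dx j (u i)) z) ^+ 2].
Proof. by split; split; rewrite ?sqr_ge0// ?nn1 ?nn2 ?nn3. Qed.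

Local Notation L := (solution_norm T r U).

Let nine (x1 x2 x3 x4 x5 x6 x7 x8 x9 : R) : [/\ 0 <= x1, 0 <= x2, 0 <= x3 & 0 <= x4] ->
  [/\ 0 <= x5, 0 <= x6, 0 <= x7, 0 <= x8 & 0 <= x9] ->
  let s := x1 + x2 + x3 + x4 + x5 + x6 + x7 + x8 + x9 in
  ([/\ x1 <= s, x2 <= s, x3 <= s & x4 <= s] /\
   [/\ x5 <= s, x6 <= s, x7 <= s, x8 <= s & x9 <= s])%R : Prop.
Proof. by move=> [? ? ? ?] [? ? ? ? ?] s; split; split; rewrite /s; lra. Qed.

Let groups z := nine (parts z).1 (parts z).2.

Lemma norm_dr (j : @dir d) z : open_slab T z -> `|dpart j r z| <= L.
Proof.
apply: norm_le; [exact: C2_tame1|exact: dpart_periodic|move=> w; have [[l1 l2 l3 l4] [l5 l6 l7 l8 l9]] := groups w].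
case: j => [i|] /=; last exact: l2.
exact: le_trans (sum_ge i (fun j => sqr_ge0 (dx j r w))) l1.
Qed.

Lemma norm_ddr i z : open_slab T z -> `|dt (dx i r) z| <= L.
Proof.
apply: norm_le; [exact: (C2_tame2 (Some i) None)| |move=> w; have [[l1 l2 l3 l4] [l5 l6 l7 l8 l9]] := groups w].
  by apply: (@dpart_periodic _ None); apply: (@dpart_periodic _ (Some i)).
exact: le_trans (sum_ge i (fun j => sqr_ge0 (dt (dx j r) w))) l3.
Qed.

Lemma norm_u i z : open_slab T z -> `|u i z| <= L.
Proof.
apply: norm_le; [exact: C2_tame|exact: per_u|move=> w; have [[l1 l2 l3 l4] [l5 l6 l7 l8 l9]] := groups w].
exact: le_trans (sum_ge i (fun j => sqr_ge0 (u j w))) l5.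
Qed.

Lemma norm_du i (j : @dir d) z : open_slab T z -> `|dpart j (u i) z| <= L.
Proof.
apply: norm_le; [exact: C2_tame1|exact: dpart_periodic|move=> w; have [[l1 l2 l3 l4] [l5 l6 l7 l8 l9]] := groups w].
case: j => [j|] /=; last exact: le_trans (sum_ge i (fun j => sqr_ge0 (dt (u j) w))) l8.
apply: le_trans (sum_ge j (fun l => sqr_ge0 (dx l (u i) w))) _.
exact: le_trans (@sum_ge _ (fun i => \sum_j dx j (u i) w ^+ 2) i (fun _ => nn1 _)) l6.
Qed.

Lemma norm_dtdu i j z : open_slab T z -> `|dt (dx j (u i)) z| <= L.
Proof.
apply: norm_le; [exact: (C2_tame2 (Some j) None)| |move=> w; have [[l1 l2 l3 l4] [l5 l6 l7 l8 l9]] := groups w].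
  by apply: (@dpart_periodic _ None); apply: (@dpart_periodic _ (Some j)).
apply: le_trans (sum_ge j (fun l => sqr_ge0 (dt (dx l (u i)) w))) _.
exact: le_trans (@sum_ge _ (fun i => \sum_j dt (dx j (u i)) w ^+ 2) i (fun _ => nn1 _)) l9.
Qed.

Lemma norm_ddu i j l z : open_slab T z -> `|dx l (dx j (u i)) z| <= L.
Proof.
apply: norm_le; [exact: (C2_tame2 (Some j) (Some l))| |move=> w; have [[l1 l2 l3 l4] [l5 l6 l7 l8 l9]] := groups w].
  by apply: (@dpart_periodic _ (Some l)); apply: (@dpart_periodic _ (Some j)).
apply: le_trans (sum_ge l (fun l => sqr_ge0 (dx l (dx j (u i)) w))) _.
apply: le_trans (@sum_ge _ (fun j => \sum_k dx k (dx j (u i)) w ^+ 2) j (fun _ => nn1 _)) _.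
exact: le_trans (@sum_ge _ (fun i => \sum_j \sum_k dx k (dx j (u i)) w ^+ 2) i (fun _ => nn2 _)) l7.
Qed.


Let sm f : C2 T f -> forall (j : @dir d) z, open_slab T z -> derivable f z (dir_vec j).
Proof. by case=> _ H1 _ j z zT; have [Hd _] := H1 j; exact: Hd. Qed.

Let sm2 f : C2 T f -> forall (j k : @dir d) z, open_slab T z -> derivable (dpart j f) z (dir_vec k).
Proof. by case=> _ _ H1 j k z zT; have [Hd _] := H1 j k; exact: Hd. Qed.

Let dM (f g : st -> R) z v : derivable f z v -> derivable g z v ->
  'D_v (fun y => f y * g y) z = f z * 'D_v g z + g z * 'D_v f z.
Proof. by move=> h1 h2; exact: (deriveM h1 h2). Qed.

Lemma solution_continuity z : open_slab T z ->
  dt r z + \sum_j u j z * dx j r z + r z * \sum_j dx j (u j) z = 0.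
Proof.
move=> zT; case: sol => _ _ ce _; have := ce z zT.
have -> : \sum_j dx j (fun y => r y * u j y) z =
    \sum_j u j z * dx j r z + r z * \sum_j dx j (u j) z.
  rewrite mulr_sumr -big_split; apply: eq_bigr => j _ /=.
  rewrite addrC; refine (dM (@sm _ Cr (Some j) z zT) (@sm _ (Cu j) (Some j) z zT)).
by rewrite addrA.
Qed.

(** Conservative momentum equation minus the velocity times the continuity equation. *)
Lemma solution_momentum i z : open_slab T z -> 0 < r z ->
  r z * (dt (u i) z + \sum_j u j z * dx j (u i) z) + dpressure a gamma (r z) * dx i r z
  = visc mu lambda (fun i => u i) i z.
Proof.
move=> zT r0; have CE := solution_continuity zT; case: sol => _ _ _ me; have := me z i zT.
have E1 : dt (fun y => r y * u i y) z = r z * dt (u i) z + u i z * dt r z.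
  refine (dM (@sm _ Cr None z zT) (@sm _ (Cu i) None z zT)).
have E2 j : dx j (fun y => r y * u i y * u j y) z =
    r z * u i z * dx j (u j) z + u j z * (r z * dx j (u i) z + u i z * dx j r z).
  have d1 := derivableM (@sm _ Cr (Some j) z zT) (@sm _ (Cu i) (Some j) z zT).
  apply: (etrans (dM d1 (@sm _ (Cu j) (Some j) z zT))); congr (_ + _ * _).
  refine (dM (@sm _ Cr (Some j) z zT) (@sm _ (Cu i) (Some j) z zT)).
have E3 : dx i (fun y => pressure a gamma (r y)) z = dpressure a gamma (r z) * dx i r z.
  by have [_] := derivable_comp1 (@sm _ Cr (Some i) z zT) (is_derive_pressure a gamma r0).
have E4 j : dx j (stress mu lambda U i j) z =
    mu * (dx j (dx j (u i)) z + dx j (dx i (u j)) z)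
    + lambda * (\sum_k dx j (dx k (u k)) z) * (i == j)%:R.
  have s1 (k l : 'I_d) : is_derive z (dir_vec (Some j)) (dx k (u l)) (dx j (dx k (u l)) z).
    by apply: DeriveDef => //; exact: (@sm2 _ (Cu l) (Some k) (Some j) z zT).
  have s2 := is_deriveZ mu (is_deriveD (s1 j i) (s1 i j)).
  have s3 : is_derive z (dir_vec (Some j)) (\sum_k (dx k (u k) : st -> R)) (\sum_k dx j (dx k (u k)) z).
    have s4 k : is_derive z (dir_vec (Some j)) (dx k (u k) : st -> R) (dx j (dx k (u k)) z) := s1 k k.
    move: s4; clear; move: (fun k => dx k (u k)) (fun k => dx j (dx k (u k)) z) => f df s4.
    first [timeout 20 exact: (is_derive_sum s4) | timeout 20 by apply: (@is_derive_sum _ _ _ d f) => k; exact: s4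
      | timeout 20 exact: is_derive_sum].
  have s4 := is_deriveD s2 (is_deriveZ (lambda * (i == j)%:R) s3).
  have [_] := s4; set f := (X in 'D__ X _) => s5.
  have fE : f = stress mu lambda U i j.
    apply/funext => w.
    change (mu * (dx j (u i) w + dx i (u j) w)
      + (lambda * (i == j)%:R) * ((\sum_k (dx k (u k) : st -> R)) w) = stress mu lambda U i j w).
    by rewrite fct_sumE /stress [X in _ + X]mulrAC.
  rewrite -fE; apply: (etrans s5); clear.
  change (mu * (dx j (dx j (u i)) z + dx j (dx i (u j)) z)
    + (lambda * (i == j)%:R) * (\sum_k dx j (dx k (u k)) z) =
    mu * (dx j (dx j (u i)) z + dx j (dx i (u j)) z)
    + lambda * (\sum_k dx j (dx k (u k)) z) * (i == j)%:R).
  by rewrite [X in _ + X = _]mulrAC.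
rewrite E1 E3 (eq_bigr _ (fun j _ => E2 j)) (eq_bigr _ (fun j _ => E4 j)) => ME.
have S4 : \sum_j (mu * (dx j (dx j (u i)) z + dx j (dx i (u j)) z)
    + lambda * (\sum_k dx j (dx k (u k)) z) * (i == j)%:R) = visc mu lambda (fun i => u i) i z.
  rewrite big_split /= -mulr_sumr big_split /= mulrDr /visc; congr (_ + _).
  have sel (F : 'I_d -> R) : \sum_j F j * (i == j)%:R = F i.
    rewrite (bigD1 i)//= eqxx mulr1 big1 ?addr0// => j ji.
    by rewrite eq_sym (negbTE ji) mulr0.
  exact: (sel (fun j => lambda * (\sum_k dx j (dx k (u k)) z))).
have S2 : \sum_j (r z * u i z * dx j (u j) z + u j z * (r z * dx j (u i) z + u i z * dx j r z))
    = r z * u i z * \sum_j dx j (u j) z + r z * \sum_j u j z * dx j (u i) z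
      + u i z * \sum_j u j z * dx j r z.
  rewrite !mulr_sumr -!big_split; apply: eq_bigr => j _ /=; ring.
rewrite -S4 -ME S2; move: CE.
move: (dt r z) (\sum_j u j z * dx j r z) (\sum_j dx j (u j) z) (\sum_j u j z * dx j (u i) z).
move=> x1 x2 x3 x4 CE.
have -> : r z * dt (u i) z + u i z * x1 + (r z * u i z * x3 + r z * x4 + u i z * x2)
  = r z * (dt (u i) z + x4) + u i z * (x1 + x2 + r z * x3) by ring.
by rewrite CE mulr0 addr0.
Qed.

End bounds.

End strong_solutions.

(** * Identification of the Helmholtz potential *)

Section Helmholtz_potential.
Context {R : realType} (a gamma : R).
Hypotheses (a_gt0 : 0 < a) (gamma_gt1 : 1 < gamma).
Local Notation p := (pressure a gamma).
Local Notation H := (hpot a gamma).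
Local Notation H' := (hpot' a gamma).

(** An antiderivative of [p(z)/z^2]. *)
Let F (x : R) : R := a / (gamma - 1) * x `^ (gamma - 1).

Let dF (x : R) : 0 < x -> is_derive x 1 F (a * x `^ (gamma - 2)).
Proof.
move=> x0; have g1 : gamma - 1 != 0 by rewrite subr_eq0 gt_eqF.
apply: (is_derive_eq (is_deriveZ (a / (gamma - 1)) (is_derive1_powR (gamma - 1) x0))).
rewrite /GRing.scale /= (_ : gamma - 1 - 1 = gamma - 2); last by ring.
by field.
Qed.

Let integral_pressure (x y : R) : 0 < x -> x <= y ->
  \int[lebesgue_measure]_(z in `[x, y]) (p z / z ^+ 2) = F y - F x.
Proof.
move=> x0; rewrite le_eqVlt => /predU1P[<-|xy].
  by rewrite set_itv1 Rintegral_set1 subrr.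
have -> : \int[lebesgue_measure]_(z in `[x, y]) (p z / z ^+ 2) =
    \int[lebesgue_measure]_(z in `[x, y]) (a * z `^ (gamma - 2)).
  apply: eq_Rintegral => z; rewrite inE /= in_itv /= => /andP[xz _].
  have z0 : 0 < z by exact: lt_le_trans xz.
  rewrite /pressure -mulrA; congr (_ * _).
  rewrite -(powR_predr gamma z0) -(powR_predr (gamma - 1) z0).
  rewrite (_ : gamma - 1 - 1 = gamma - 2); last by ring.
  by rewrite expr2; field; rewrite gt_eqF.
have d1 (z : R) : 0 < z -> is_derive z 1 (fun z => a * z `^ (gamma - 2)) (a * ((gamma - 2) * z `^ (gamma - 2 - 1))).
  by move=> z0; exact: (is_deriveZ a (is_derive1_powR (gamma - 2) z0)).
have cF (z : R) : 0 < z -> F t @[t --> z] --> F z.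
  by move=> /dF[dz _]; apply: differentiable_continuous; exact/derivable1_diffP.
rewrite /Rintegral (@continuous_FTC2 R _ F x y xy).
- by rewrite -EFinB.
- apply: derivable_within_continuous => z; rewrite in_itv /= => /andP[xz _].
  by have [] := d1 z (lt_le_trans x0 xz).
- split.
  + move=> z; rewrite in_itv /= => /andP[xz _].
    by have [] := dF (lt_trans x0 xz).
  + exact/cvg_at_right_filter/cF.
  + exact/cvg_at_left_filter/cF/(lt_trans x0).
- move=> z; rewrite in_itv /= => /andP[xz _].
  by rewrite derive1E; have [_ ->] := dF (lt_trans x0 xz).
Qed.

Lemma Helmholtz_hpot (x : R) : 0 < x -> Helmholtz a gamma x = H x.
Proof.
move=> x0; have F1 : F 1 = a / (gamma - 1) by rewrite /F powR1 mulr1.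
have E : x * (F x - F 1) = H x.
  by rewrite F1 /F /hpot mulrBr mulrCA (powR_predr gamma x0); ring.
rewrite /Helmholtz; case: leP => x1; first by rewrite integral_pressure.
by rewrite integral_pressure ?ltW// opprB.
Qed.

(** The closed form is known at positive arguments, and these form a neighbourhood of [x]. *)
Lemma derive1_Helmholtz (x : R) : 0 < x -> derive1 (Helmholtz a gamma) x = H' x.
Proof.
move=> x0; rewrite derive1E.
have -> : 'D_1 (Helmholtz a gamma) x = 'D_1 H x.
  apply: near_eq_derive; near=> y; apply: Helmholtz_hpot.
  by near: y; exact: lt_nbhsr.
have d := is_deriveZ (a / (gamma - 1)) (is_deriveB (is_derive1_powR gamma x0) (is_derive_id x (1 : R))).
by have [_ ->] := d.
Unshelve. all: by end_near. Qed.

Lemma rel_energy_density_bregman (x y : R) : 0 < x -> 0 < y ->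
  rel_energy_density a gamma x y = bregman H H' x y.
Proof. by move=> x0 y0; rewrite /rel_energy_density derive1_Helmholtz// !Helmholtz_hpot// /bregman; ring. Qed.

Lemma bregman_pressure (x y : R) : 0 < y -> bregman H H' x y = H x + p y - H' y * x.
Proof. by move=> y0; rewrite /bregman (pressure_hpot a gamma_gt1 y0); ring. Qed.

End Helmholtz_potential.

(** * Discrete Gronwall inequality and a priori bounds *)

(** Implicit version: for [C tau <= 1/2] one has [1/(1 - C tau) <= 1 + 2 C tau], and powers of the
    latter are bounded by an exponential. The accumulated dissipation is part of the induction
    quantity. *)
Lemma discrete_gronwall {R : realType} (C delta tau T : R) (Nt : nat) (Phi D : nat -> R) :
  0 <= C -> 0 <= delta -> 0 < tau -> C * tau <= 2^-1 -> Nt%:R * tau <= T ->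
  (forall n, 0 <= Phi n) ->
  (forall n, (n < Nt)%N -> Phi n.+1 + D n.+1 <= Phi n + tau * (C * (Phi n.+1 + delta))) ->
  (forall n, 0 <= D n) ->
  forall n, (n <= Nt)%N ->
    Phi n + \sum_(1 <= k < n.+1) D k <= expR (2 * C * T) * (Phi 0%N + delta).
Proof.
move=> C0 d0 t0 Ct NT P0 step D0.
pose q := 1 + 2 * C * tau.
have Ct0 : 0 <= C * tau by rewrite mulr_ge0// ltW.
have q1 : 1 <= q by rewrite /q; lra.
have key n : (n <= Nt)%N -> Phi n + \sum_(1 <= k < n.+1) D k + delta <= q ^+ n * (Phi 0%N + delta).
  elim: n => [|n IH] nN; first by rewrite big_nil addr0 expr0 mul1r.
  have := IH (ltnW nN); have := step n nN.
  rewrite [\sum_(1 <= k < n.+2) _]big_nat_recr//=.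
  have S0 : 0 <= \sum_(1 <= k < n.+1) D k by apply: sumr_ge0.
  move: (\sum_(1 <= k < n.+1) D k) S0 (D0 n.+1) => S S0 Dn h1 h2.
  pose Y := Phi n.+1 + (S + D n.+1) + delta; pose X := Phi n + S + delta.
  have XY : Y * (1 - C * tau) <= X.
    have := mulr_ge0 Ct0 (addr_ge0 S0 Dn); rewrite /X /Y; lra.
  have YX : Y <= q * X.
    have Y0 : 0 <= Y by rewrite /Y; have := P0 n.+1; lra.
    apply: le_trans (_ : Y * ((1 - C * tau) * q) <= _).
      rewrite ler_peMr//; rewrite /q; have := mulr_ge0 Ct0 (_ : 0 <= 1 - 2 * (C * tau)); lra.
    by rewrite mulrA mulrC; apply: ler_wpM2l => //; lra.
  rewrite -/Y; apply: le_trans YX _; rewrite exprS -mulrA; apply: ler_wpM2l; first lra.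
  exact: h2.
move=> n nN; apply: le_trans (_ : q ^+ n * (Phi 0%N + delta) <= _).
  by have := key n nN; lra.
apply: ler_wpM2r; first exact: addr_ge0.
apply: (@le_trans _ _ (expR (2 * C * tau) ^+ n)).
  by apply: lerXn2r; rewrite ?nnegrE ?expR_ge0 ?expR_ge1Dx//; lra.
rewrite -expRM_natl ler_expR.
have nT : n%:R * tau <= T.
  by apply: le_trans NT; apply: ler_wpM2r; [exact: ltW|rewrite ler_nat].
by move: (n%:R : R) nT => y nT; have := ler_wpM2l C0 nT; lra.
Qed.

Section energy_estimate.
Context {R : realType} {d N : nat}.
Variables (a gamma mu lambda alpha tau : R).
Hypotheses (a_gt0 : 0 < a) (gamma_gt1 : 1 < gamma) (mu_gt0 : 0 < mu)
  (mulambda_ge0 : 0 <= mu + lambda) (N_gt0 : (0 < N)%N) (tau_gt0 : 0 < tau).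
Local Notation cell := (cell d N).
Local Notation I := (@integral_pc R d N).
Variables (rho0 rho : cell -> R) (ubar0 u : 'I_d -> cell -> R).
Hypotheses (rho0_gt0 : forall k, 0 < rho0 k) (rho_gt0 : forall k, 0 < rho k).
Hypothesis ceq : continuity_eq alpha tau rho0 rho u.
Hypothesis meq : momentum_eq a gamma mu lambda alpha tau rho0 ubar0 rho u.
Local Notation H := (hpot a gamma).
Local Notation H' := (hpot' a gamma).

Lemma mass_step : I rho = I rho0.
Proof.
have := continuity_weak tau_gt0 (fun=> 1) ceq.
rewrite [X in _ * X]big1 => [|j _]; last first.
  by rewrite /integral_pc big1 ?mulr0// => k _; rewrite /diff_face subrr mul0r mulr0.
rewrite mulr0 => E; apply/eqP; rewrite -subr_eq0 -IpcB -E; apply/eqP.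
by apply: Ipc_eq => k; rewrite mulr1.
Qed.

(** The relative energy inequality with zero test fields, for which the right-hand side vanishes. *)
Lemma energy_step :
  I (fun k => 2^-1 * rho k * (\sum_i mean u i k ^+ 2) + H (rho k))
  <= I (fun k => 2^-1 * rho0 k * (\sum_i ubar0 i k ^+ 2) + H (rho0 k)).
Proof.
pose Z : 'I_d -> cell -> R := fun _ _ => 0; pose z : cell -> R := fun _ => 0.
have bg (x y : R) (x0 : 0 < x) (y0 : 0 < y) := bregman_hpot_ge0 a_gt0 gamma_gt1 x0 y0.
have Q := relative_energy_ineq N_gt0 tau_gt0 rho0_gt0 rho_gt0
  (fun x x0 => pressure_hpot a gamma_gt1 x0) bg Z Z z z ceq meq.
have h0 : 0 < @mesh R N := mesh_gt0 N_gt0.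
have I0 (f : cell -> R) : (forall k, f k = 0) -> I f = 0.
  by move=> f0; rewrite /integral_pc big1 ?mulr0.
have mZ i k : mean Z i k = 0 by rewrite /mean /avg_cell /Z addr0 mul0r.
have dZ i j k : diff_face j (Z i) k = 0 by rewrite /diff_face subrr mul0r.
have dmZ i j k : diff_face j (mean Z i) k = 0 by rewrite /diff_face !mZ subrr mul0r.
have divZ k : div_cell Z k = 0.
  by rewrite /div_cell big1// => i _; rewrite /diff_cell subrr mul0r.
have dz j k : diff_face j z k = 0 by rewrite /diff_face subrr mul0r.
move: Q; set A := (X in X - _ + _ <= _); set B := (X in _ - X + _ <= _).
set rhs := (X in _ <= X); set V := (X in _ + tau * X <= _).
have AE : A = I (fun k => 2^-1 * rho k * (\sum_i mean u i k ^+ 2) + H (rho k)).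
  apply: Ipc_eq => k; rewrite mul0r subr0; congr (_ * _ + _).
  by apply: eq_bigr => i _; rewrite mZ subr0.
have BE : B = I (fun k => 2^-1 * rho0 k * (\sum_i ubar0 i k ^+ 2) + H (rho0 k)).
  apply: Ipc_eq => k; rewrite mul0r subr0; congr (_ * _ + _).
  by apply: eq_bigr => i _; rewrite mZ subr0.
have rhs0 : rhs = 0.
  transitivity (- 0 - 0 + tau * (0 - 0 - 0 : R)); last by ring.
  rewrite /rhs; congr (- _ - _ + tau * (_ - _ - _)).
  - by apply: I0 => k; rewrite big1 ?mulr0// => i _; rewrite !mZ subrr mulr0.
  - by apply: I0 => k; rewrite subrr mulr0.
  - rewrite big1// => i _; rewrite big1// => j _; apply: I0 => k.
    by rewrite dmZ expr0n !mulr0 oppr0 !addr0.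
  - by rewrite big1// => j _; apply: I0 => k; rewrite dz mulr0.
  - by apply: I0 => k; rewrite divZ mulr0.
have V0 : 0 <= V.
  rewrite /V; apply: addr_ge0; [apply: addr_ge0|].
  - apply: sumr_ge0 => j _; apply: Ipc_ge0 => // k.
    have b1 := bg _ _ (rho_gt0 k) (rho_gt0 (up j k)).
    have b2 := bg _ _ (rho_gt0 (up j k)) (rho_gt0 k).
    have mx : 0 <= Num.max 0 (u j k) by rewrite le_max lexx.
    have mn : Num.min 0 (u j k) <= 0 by rewrite ge_min lexx.
    apply: addr_ge0.
      apply: divr_ge0; last exact: ltW.
      by rewrite subr_ge0; apply: (@le_trans _ _ 0); [exact: mulr_le0_ge0|exact: mulr_ge0].
    apply: mulr_ge0; last exact: addr_ge0.
    by apply: divr_ge0; rewrite ?powR_ge0 ?exprn_ge0// ltW.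
  - apply: mulr_ge0; first exact: ltW.
    apply: sumr_ge0 => i _; apply: sumr_ge0 => j _; apply: Ipc_ge0 => // k.
    by rewrite dZ subr0 -expr2 sqr_ge0.
  - by apply: mulr_ge0 => //; apply: Ipc_ge0 => // k; rewrite divZ subr0 -expr2 sqr_ge0.
rewrite rhs0 AE BE; have := mulr_ge0 (ltW tau_gt0) V0; lra.
Qed.

End energy_estimate.

(** * Initial relative energy: projected against exact data *)

Section initial_energy.
Context {R : realType} {d N : nat}.
Variables (a gamma rlow rup KF e : R).
Hypotheses (a_gt0 : 0 < a) (gamma_gt1 : 1 < gamma) (rlow_gt0 : 0 < rlow) (N_gt0 : (0 < N)%N)
  (HF : density_bound rlow rup a gamma KF) (e_ge0 : 0 <= e) (KF_ge0 : 0 <= KF).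
Local Notation cell := (cell d N).
Local Notation p := (pressure a gamma).
Local Notation H := (hpot a gamma).
Local Notation H' := (hpot' a gamma).
Variables (rho : cell -> R) (ub : 'I_d -> cell -> R) (rf : 'rV[R]_d -> R)
  (Uf : 'rV[R]_d -> 'rV[R]_d) (rh : cell -> R) (V : 'I_d -> cell -> R).
Hypotheses (rho_gt0 : forall k, 0 < rho k) (rf_bc : bounded_continuous rf)
  (Uf_bc : forall i, bounded_continuous (fun x => Uf x 0 i))
  (rf_itv : forall x, rlow <= rf x <= rup) (rh_itv : forall k, rlow <= rh k <= rup)
  (rf_near : forall k x, in_cell k x -> `|rf x - rh k| <= e)
  (Uf_near : forall i k x, in_cell k x -> `|Uf x 0 i - V i k| <= e).

Let phi k (x : 'rV[R]_d) : R := 2^-1 * rho k * (\sum_i (ub i k - Uf x 0 i) ^+ 2)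
  + rel_energy_density a gamma (rho k) (rf x).

Let bcD (f g : 'rV[R]_d -> R) : bounded_continuous f -> bounded_continuous g ->
  bounded_continuous (fun x => f x + g x).
Proof.
move=> bf bg; have b0 := @bounded_continuous_cst R d 0.
have := bounded_continuousB bf (bounded_continuousB b0 bg).
by rewrite (_ : (fun x => f x - (0 - g x)) = (fun x => f x + g x))//;
  apply/funext => x; rewrite sub0r opprK.
Qed.

Let bcM (f g : 'rV[R]_d -> R) : bounded_continuous f -> bounded_continuous g ->
  bounded_continuous (fun x => f x * g x).
Proof.
move=> [cf [K1 H1]] [cg [K2 H2]]; split => [x|].
  by apply: (@continuousM _ _ f g); [apply: cf|apply: cg].
by exists (K1 * K2) => x; rewrite normrM; apply: ler_pM.
Qed.

Let bc_lip (F : R -> R) : lipschitz_on rlow rup KF F -> bounded_continuous (fun x => F (rf x)).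
Proof.
move=> LF; case: rf_bc => cr [K HK]; split.
  suff cx (x : 'rV[R]_d) : F (rf y) @[y --> x] --> F (rf x) by exact: cx.
  apply/(@cvgrPdist_lt _ _ _ (nbhs x)) => q q0.
  have P0 : 0 < KF + 1 by rewrite ltr_wpDl.
  have := @cvgrPdist_lt _ _ _ (nbhs x) _ rf (rf x); case=> /(_ (cr x)) + _.
  move=> /(_ _ (divr_gt0 q0 P0)); apply: filterS => y hy.
  apply: le_lt_trans (LF _ _ (rf_itv x) (rf_itv y)) _.
  apply: (@le_lt_trans _ _ ((KF + 1) * `|rf x - rf y|)).
    by apply: ler_wpM2r => //; rewrite lerDl.
  by rewrite mulrC -ltr_pdivlMr.
exists (`|F (rf 0)| + KF * (K + K)) => x.
rewrite -[F (rf x)](subrK (F (rf 0))) addrC; apply: le_trans (ler_normD _ _) _.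
rewrite lerD2l; apply: le_trans (LF _ _ (rf_itv x) (rf_itv 0)) _.
apply: ler_wpM2l => //; apply: le_trans (ler_normB _ _) _; exact: lerD.
Qed.

Let bc_sum (F : 'I_d -> 'rV[R]_d -> R) : (forall i, bounded_continuous (F i)) ->
  bounded_continuous (fun x => \sum_i F i x).
Proof.
move=> bF; elim: (index_enum _) => [|i s IH].
  rewrite (_ : (fun x => _) = (fun=> 0)); first exact: bounded_continuous_cst.
  by apply/funext => x; rewrite big_nil.
rewrite (_ : (fun x => _) = (fun x => F i x + \sum_(i <- s) F i x)); first exact: bcD.
by apply/funext => x; rewrite big_cons.
Qed.

Let rf_gt0 x : 0 < rf x. Proof. by have /andP[r1 _] := rf_itv x; exact: lt_le_trans r1. Qed.
Let rh_gt0 k : 0 < rh k. Proof. by have /andP[r1 _] := rh_itv k; exact: lt_le_trans r1. Qed.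

Let phiE k x : phi k x = 2^-1 * rho k * (\sum_i (ub i k - Uf x 0 i) ^+ 2)
  + (H (rho k) + p (rf x) - H' (rf x) * rho k).
Proof. by rewrite /phi rel_energy_density_bregman// bregman_pressure. Qed.

Let phi_bc k : bounded_continuous (phi k).
Proof.
have c (q : R) := @bounded_continuous_cst R d q.
rewrite (_ : phi k = (fun x => 2^-1 * rho k * (\sum_i (ub i k - Uf x 0 i) * (ub i k - Uf x 0 i))
  + (H (rho k) + p (rf x) - H' (rf x) * rho k))); last first.
  by apply/funext => x; rewrite phiE.
apply: bcD; first apply: bcM => //.
  by apply: bc_sum => i; apply: bcM; apply: bounded_continuousB => //; exact: Uf_bc.
apply: bounded_continuousB; last by apply: bcM => //; exact: bc_lip (lip_H HF).
by apply: bcD => //; exact: bc_lip (lip_p HF).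
Qed.

Let proj_cell_ge (f : 'rV[R]_d -> R) (k : cell) c : bounded_continuous f ->
  (forall x, in_cell k x -> c <= f x) -> c <= proj_cell f k.
Proof.
move=> bf fc; have [_ [K HK]] := bf.
(* A one-sided bound obtained from the two-sided one: on the cell [f] lies between [c] and
   [K + |c|], an interval described by midpoint and half-length. *)
have : `|proj_cell f k - (c + (K + `|c|)) / 2| <= (K + `|c| - c) / 2.
  apply: proj_cell_near => // x kx; have h1 := fc x kx; have h2 := HK x.
  by have h3 := normr_ge0 c; norm_split h2; norm_lra.
by move=> hh; norm_split hh; lra.
Qed.

Let initE : rel_energy_init a gamma rho ub rf Uf = integral_pc (fun k => proj_cell (phi k) k).
Proof.
have h0 : 0 < @mesh R N ^+ d by rewrite exprn_gt0// mesh_gt0.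
rewrite /integral_pc mulr_sumr; apply: eq_bigr => k _.
by rewrite /proj_cell mulVKf// gt_eqF.
Qed.

Lemma rel_energy_init_ge0 : 0 <= rel_energy_init a gamma rho ub rf Uf.
Proof.
rewrite initE; apply: Ipc_ge0 => // k; apply: proj_cell_ge => // x _.
rewrite /phi rel_energy_density_bregman//; apply: addr_ge0; last exact: bregman_hpot_ge0.
apply: mulr_ge0; first by rewrite mulr_ge0// ltW.
by apply: sumr_ge0 => i _; exact: sqr_ge0.
Qed.

(** The factor 2 comes from splitting the velocity error at the exact data. The density part depends
    on [r] through [H'(r)] and [p(r)] and so changes linearly in [e]; [E1] turns the quadratic
    velocity error into [E1 e]. *)
Lemma rel_energy_init_compare (E1 : R) : e <= E1 ->
  rel_energy a gamma rho ub rh V <= 2 * rel_energy_init a gamma rho ub rf Uf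
    + (d%:R * E1 + 4 * KF) * (1 + integral_pc rho) * e.
Proof.
move=> e1; rewrite initE.
have -> : (d%:R * E1 + 4 * KF) * (1 + integral_pc rho) * e =
    integral_pc (fun k => (d%:R * E1 + 4 * KF) * e * (1 + rho k)).
  by rewrite IpcZ IpcD (@Ipc_cst R d N N_gt0 1); ring.
rewrite -IpcZ -IpcD; apply: Ipc_le => // k.
pose q := 2^-1 * rho k * (\sum_i (ub i k - V i k) ^+ 2) + rel_energy_density a gamma (rho k) (rh k).
suff : (q - (d%:R * E1 + 4 * KF) * e * (1 + rho k)) / 2 <= proj_cell (phi k) k by rewrite /q; lra.
apply: proj_cell_ge => // x kx; rewrite phiE /q rel_energy_density_bregman//.
have b0 := bregman_hpot_ge0 a_gt0 gamma_gt1 (rho_gt0 k) (rh_gt0 k).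
have r0 := rho_gt0 k.
have s1 : \sum_i (ub i k - V i k) ^+ 2 <= 2 * (\sum_i (ub i k - Uf x 0 i) ^+ 2) + 2 * (d%:R * E1 * e).
  have -> : d%:R * E1 * e = \sum_(i < d) E1 * e by rewrite -mulrA; rewrite sumr_const card_ord mulr_natl.
  rewrite !mulr_sumr -big_split; apply: ler_sum => i _ /=.
  have h1 := Uf_near i kx.
  have h2 : (Uf x 0 i - V i k) ^+ 2 <= E1 * e.
    rewrite -real_normK ?num_real// expr2; apply: ler_pM => //; exact: le_trans e1.
  move: h2; move: (ub i k) (Uf x 0 i) (V i k) => q1 q2 q3 h2.
  have := sqr_ge0 ((q1 - q2) - (q2 - q3)).
  have -> : q1 - q3 = (q1 - q2) + (q2 - q3) by ring.
  move: h2; move: (q1 - q2) (q2 - q3) => y1 y2; rewrite sqrrB sqrrD; lra.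
have l1 := le_trans (lip_p HF (rf_itv x) (rh_itv k)) (ler_wpM2l KF_ge0 (rf_near kx)).
have l2 := le_trans (lip_H HF (rf_itv x) (rh_itv k)) (ler_wpM2l KF_ge0 (rf_near kx)).
have s2 := ler_wpM2l (ltW r0) s1.
have Eb := bregman_pressure a gamma_gt1 (rho k) (rh_gt0 k); rewrite Eb in b0 *.
have l3 : `|(H' (rf x) - H' (rh k)) * rho k| <= KF * e * rho k.
  by rewrite normrM [`|rho k|]gtr0_norm//; apply: ler_wpM2r => //; exact: ltW.
have P1 : 0 <= KF * e by exact: mulr_ge0.
have P2 := mulr_ge0 P1 (ltW r0).
have P3 : 0 <= d%:R * E1 * e by rewrite !mulr_ge0//; exact: le_trans e1.
have P4 := mulr_ge0 P3 (ltW r0).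
rewrite mulrBl in l3.
move: s2 b0 l1 l3 P1 P2 P3 P4; move: (\sum_i _) (\sum_i _) (H (rho k)) (p (rf x)) (p (rh k)).
move: (H' (rf x) * rho k) (H' (rh k) * rho k) => y1 y2 y3 y4 y5 y6 y7 s2 b0 l1 l3 P1 P2 P3 P4.
norm_split l1; norm_split l3; lra.
Qed.

End initial_energy.

Lemma step_rearrange (R : realFieldType) (x1 x2 x3 x4 x5 x6 : R) :
  x1 + x3 - x2 - x4 + x5 <= x6 -> x1 + x3 + x5 <= x2 + x4 + x6.
Proof. lra. Qed.

Lemma step_extend (R : realFieldType) (r1 s1 D r0 s0 X Y S P Z : R) :
  r1 + s1 + D <= r0 + s0 + X -> X <= Y -> (r0 + s0) + S <= P + Z ->
  (r1 + s1) + (S + D) <= P + (Z + Y).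
Proof. lra. Qed.

Lemma absorb_rate (R : realFieldType) (K q e : R) : 0 <= K -> 1 <= q * e ->
  K + e <= (K * q + 1) * e.
Proof. by move=> K0 /(ler_wpM2l K0); rewrite mulr1; lra. Qed.

Lemma total_bound (R : realFieldType) (P i e c s X Y z : R) :
  P <= 2 * i + (c + s) * e -> 0 <= i -> 0 <= e -> 0 <= c * i -> 0 <= s * i ->
  0 <= Y * (e + i) -> 0 <= X * i -> z <= X * e -> P + z <= (Y + 2 + c + s + X) * (e + i).
Proof. lra. Qed.

(** * The estimate with constants depending on numbers only *)

(** Functions, grids and discrete solutions are quantified inside, so a constant chosen for these
    numbers cannot depend on anything else. The energy enters as an upper bound, which allows it to
    be replaced by an integer level. *)
Definition uniform_bound (R : realType) (d : nat) (T a gamma mu lambda alpha c2 M En rlow rup ns c : R)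
    : Prop :=
  forall (r : R * 'rV[R]_d -> R) (U : R * 'rV[R]_d -> 'rV[R]_d),
  strong_solution T a gamma mu lambda r U ->
  (forall z, closed_slab T z -> rlow <= r z <= rup) -> solution_norm T r U = ns ->
  forall (N Nt : nat) (rho : nat -> cell d N -> R) (u0 : 'rV[R]_d -> 'rV[R]_d)
    (u : nat -> 'I_d -> cell d N -> R), (0 < N)%N -> (0 < Nt)%N ->
    let tau := T / Nt%:R in
    let A := Num.min ((2 * gamma - d%:R) / gamma) 2^-1 in
    let ubar := cell_velocity u0 u in
    let rh n := proj_cell (fun x => r (n%:R * tau, x)) in
    let Uh n := proj_face (fun x => U (n%:R * tau, x)) in
    let RE n := rel_energy a gamma (rho n) (ubar n) (rh n) (mean (Uh n)) in
    let err n := fun i k => u n i k - Uh n i k in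
    let init := rel_energy_init a gamma (rho 0%N) (ubar 0%N) (fun x => r (0, x)) (fun x => U (0, x)) in
    tau <= c2 * @mesh R N -> (forall k, 0 < rho 0%N k) ->
    (forall n, (n < Nt)%N -> continuity_eq alpha tau (rho n) (rho n.+1) (u n.+1) /\
      momentum_eq a gamma mu lambda alpha tau (rho n) (ubar n) (rho n.+1) (u n.+1)) ->
    integral_pc (rho 0%N) = M -> energy a gamma (rho 0%N) (ubar 0%N) <= En ->
    0 <= init /\
    \big[Num.max/RE 0%N]_(n < Nt.+1) RE n
    + tau * (\sum_(1 <= n < Nt.+1) mu / 2 * grad_norm2 (err n))
    + tau * (\sum_(1 <= n < Nt.+1) (mu + lambda) * integral_pc (fun k => div_cell (err n) k ^+ 2))
    <= c * (@mesh R N `^ A + init).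

Section uniform_estimate.
Context {R : realType} {d : nat}.
Variables (T a gamma mu lambda alpha c2 M En rlow rup ns : R).
Hypotheses (T_gt0 : 0 < T) (a_gt0 : 0 < a) (gamma_gt1 : 1 < gamma) (gammad : d%:R / 2 <= gamma)
  (mu_gt0 : 0 < mu) (mulambda_ge0 : 0 <= mu + lambda) (alpha_gt1 : 1 < alpha) (c2_gt0 : 0 < c2)
  (M_gt0 : 0 < M) (rlow_gt0 : 0 < rlow).
Local Notation A := (Num.min ((2 * gamma - d%:R) / gamma) 2^-1 : R).
Local Notation st := (R * 'rV[R]_d)%type.
Local Notation H := (hpot a gamma).
Local Notation H' := (hpot' a gamma).

(** [K] majorizes the norm of the strong solution and the ratio of [tau] to [h]; [Bk] and [Bi] bound
    the kinetic and the internal energy in terms of [En] and [M]. *)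
Let K : R := 1 + `|ns| + c2.
Let am : R := a / (gamma - 1).
Let Bk : R := 2 * (En + am * M).
Let Bi : R := En / am + M.

Let am_gt0 : 0 < am. Proof. by rewrite divr_gt0// subr_gt0. Qed.
Let K_ge1 : 1 <= K. Proof. by rewrite /K -addrA lerDl addr_ge0// ltW. Qed.
Let K_ge0 : 0 <= K. Proof. exact: le_trans K_ge1. Qed.
Let ns_le : ns <= K. Proof. by rewrite /K; have := ler_norm ns; have := c2_gt0; lra. Qed.
Let c2_le : c2 <= K. Proof. by rewrite /K; have := normr_ge0 ns; lra. Qed.

(** The potential is negative for small densities, but not below [- am rho], so the mass
    compensates. *)
Lemma energy_bounds (N : nat) (rho : cell d N -> R) (v : 'I_d -> cell d N -> R) : (0 < N)%N ->
  (forall k, 0 < rho k) -> integral_pc rho = M ->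
  integral_pc (fun k => 2^-1 * rho k * (\sum_i v i k ^+ 2) + H (rho k)) <= En ->
  integral_pc (fun k => rho k * \sum_i v i k ^+ 2) <= Bk /\
  integral_pc (fun k => rho k `^ gamma) <= Bi.
Proof.
move=> N0 r0 rM; rewrite IpcD.
have -> : integral_pc (fun k => 2^-1 * rho k * (\sum_i v i k ^+ 2)) =
    2^-1 * integral_pc (fun k => rho k * \sum_i v i k ^+ 2).
  by rewrite -IpcZ; apply: Ipc_eq => k; rewrite mulrA.
have -> : integral_pc (fun k => H (rho k)) = am * (integral_pc (fun k => rho k `^ gamma) - M).
  by rewrite -rM -IpcB -IpcZ; exact: Ipc_eq.
have k0 : 0 <= integral_pc (fun k => rho k * \sum_i v i k ^+ 2).
  apply: Ipc_ge0 => // k; apply: mulr_ge0; first exact: ltW.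
  by apply: sumr_ge0 => i _; exact: sqr_ge0.
have i0 : 0 <= integral_pc (fun k => rho k `^ gamma).
  by apply: Ipc_ge0 => // k; exact: powR_ge0.
move: k0 i0; move: (integral_pc _) (integral_pc _) => y x k0 i0 E.
have ax := mulr_ge0 (ltW am_gt0) i0; have ay := mulr_ge0 (ltW am_gt0) k0.
split; first by rewrite /Bk; lra.
rewrite /Bi -lerBlDr ler_pdivlMr// mulrC; lra.
Qed.

Variables (KF : R).
Hypotheses (KF_ge1 : 1 <= KF) (HF : density_bound rlow rup a gamma KF).
Let KF_ge0 : 0 <= KF. Proof. exact: le_trans KF_ge1. Qed.

Let B : R := 1 + `|@consistency_constant R d mu lambda rlow K KF| + K + `|Bk| + `|Bi|.
Let B_ge1 : 1 <= B.
Proof.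
rewrite /B; have := normr_ge0 (@consistency_constant R d mu lambda rlow K KF).
by have := normr_ge0 Bk; have := normr_ge0 Bi; have := K_ge0; lra.
Qed.
Let cons_le : @consistency_constant R d mu lambda rlow K KF <= B.
Proof.
rewrite /B; have := ler_norm (@consistency_constant R d mu lambda rlow K KF).
by have := normr_ge0 Bk; have := normr_ge0 Bi; have := K_ge0; lra.
Qed.
Let K_le : K <= B.
Proof.
rewrite /B; have := normr_ge0 (@consistency_constant R d mu lambda rlow K KF).
by have := normr_ge0 Bk; have := normr_ge0 Bi; have := K_ge0; lra.
Qed.
Let Bk_le : Bk <= B.
Proof.
rewrite /B; have := normr_ge0 (@consistency_constant R d mu lambda rlow K KF).
by have := ler_norm Bk; have := normr_ge0 Bi; have := K_ge0; lra.
Qed.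
Let Bi_le : Bi <= B.
Proof.
rewrite /B; have := normr_ge0 (@consistency_constant R d mu lambda rlow K KF).
by have := normr_ge0 Bk; have := ler_norm Bi; have := K_ge0; lra.
Qed.

Let Hm : R := `|H' rlow| + KF * `|rup - rlow|.
(** [Kb] bounds the relative energy a priori, for use with large steps; [Ci] and [Cs] account for
    the initial projection error and the initial entropy. *)
Let Kb : R := B + d%:R * K ^+ 2 * M + am * B + KF + Hm * M.
Let E1 : R := K * (2 * d%:R + 1).
Let Ci : R := (d%:R * E1 + 4 * KF) * (1 + M) * E1.
Let Cs : R := 2 + 2 * B.

Lemma relative_energy_bound (N : nat) (rho rh : cell d N -> R) (v V : 'I_d -> cell d N -> R) :
  (0 < N)%N -> (forall k, 0 < rho k) -> integral_pc rho = M ->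
  integral_pc (fun k => rho k * \sum_i v i k ^+ 2) <= B ->
  integral_pc (fun k => rho k `^ gamma) <= B ->
  (forall k, rlow <= rh k <= rup) -> (forall i k, `|V i k| <= K) ->
  rel_energy a gamma rho v rh V <= Kb.
Proof.
move=> N0 r0 rM kB iB rhi VK.
apply: (@le_trans _ _ (integral_pc (fun k => rho k * (\sum_i v i k ^+ 2)
    + d%:R * K ^+ 2 * rho k + am * rho k `^ gamma + KF + Hm * rho k))).
  apply: Ipc_le => // k; have rk := r0 k; have /andP[l1 l2] := rhi k.
  have rh0 : 0 < rh k by exact: lt_le_trans l1.
  rewrite rel_energy_density_bregman// bregman_pressure//.
  have s1 : \sum_i (v i k - V i k) ^+ 2 <= 2 * (\sum_i v i k ^+ 2) + 2 * (d%:R * K ^+ 2).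
    have -> : d%:R * K ^+ 2 = \sum_(i < d) K ^+ 2 by rewrite sumr_const card_ord mulr_natl.
    rewrite !mulr_sumr -big_split; apply: ler_sum => i _ /=.
    have h2 : V i k ^+ 2 <= K ^+ 2.
      by rewrite -real_normK ?num_real//; apply: lerXn2r => //; rewrite nnegrE.
    have := sqr_ge0 (v i k + V i k); rewrite sqrrB sqrrD; move: h2; lra.
  have s2 := ler_wpM2l (ltW rk) s1.
  have ri : rlow <= rlow <= rup by rewrite lexx; exact: le_trans l1 l2.
  have l3 := lip_H HF (rhi k) ri.
  have l4 : `|rh k - rlow| <= `|rup - rlow|.
    by rewrite !ger0_norm ?subr_ge0//; [lra|exact: le_trans l1 l2].
  have l5 := le_trans l3 (ler_wpM2l KF_ge0 l4).
  have l6 : - H' (rh k) <= Hm.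
    rewrite /Hm; have := ler_norm (- H' rlow); rewrite normrN.
    by norm_split l5; lra.
  have l7 := ler_wpM2r (ltW rk) l6.
  have l8 := le_trans (ler_norm _) (bound_p HF (rhi k)).
  have l9 : H (rho k) <= am * rho k `^ gamma.
    by rewrite /hpot -/am mulrBr gerBl mulr_ge0// ltW.
  move: s2 l7 l8 l9; rewrite mulNr.
  move: (H (rho k)) (am * _) (pressure _ _ _) (H' (rh k) * rho k) (Hm * _) => y1 y2 y3 y4 y5.
  move: (\sum_i (v i k - V i k) ^+ 2) (\sum_i v i k ^+ 2) => y6 y7; lra.
rewrite !IpcD !IpcZ (@Ipc_cst R d N N0 KF) rM /Kb.
have := ler_wpM2l (ltW am_gt0) iB; lra.
Qed.

Lemma entropy_total_le (N : nat) (rho : cell d N -> R) : (0 < N)%N -> (forall k, 0 < rho k) ->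
  integral_pc (fun k => rho k `^ gamma) <= B ->
  entropy_total gamma rho <= Cs * @mesh R N `^ A.
Proof.
move=> N0 r0 iB; have h0 := mesh_gt0 N0 : 0 < @mesh R N; have h1 := mesh_le1 N0 : @mesh R N <= 1.
have p0 : 0 <= @mesh R N `^ A by exact: powR_ge0.
have Cs0 : 0 <= Cs by rewrite /Cs; have := B_ge1; lra.
rewrite /entropy_total; case: ifPn => [_|]; first exact: mulr_ge0.
rewrite -ltNge => g2.
have sA : Num.sqrt (@mesh R N) <= @mesh R N `^ A.
  rewrite -powR12_sqrt ?(ltW h0)//; apply: ger_powR; rewrite ?h0 ?h1//.
  by rewrite ge_min lexx orbT.
rewrite mulrC; apply: ler_pM; rewrite ?sqrtr_ge0//.
  by apply: Ipc_ge0 => // k; have /andP[] := entropy_bound (r0 k).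
apply: (@le_trans _ _ (integral_pc (fun k => 2 + 2 * rho k `^ gamma))).
  apply: Ipc_le => // k; have rk := r0 k; have /andP[_ e1] := entropy_bound rk.
  have e2 := le_1D_powR gamma_gt1 rk.
  have e3 : rho k ^+ 2 <= 1 + rho k `^ gamma.
    have [l1|l1] := leP (rho k) 1.
      have q1 : rho k ^+ 2 <= 1 by rewrite exprn_ile1// ltW.
      by have := powR_ge0 (rho k) gamma; lra.
    have q2 : rho k `^ 2 <= rho k `^ gamma by apply: ler_powR; exact: ltW.
    by rewrite powR_mulrn ?(ltW rk)// in q2; lra.
  lra.
by rewrite IpcD IpcZ (@Ipc_cst R d N N0 2) /Cs; lra.
Qed.

Section data.
Variables (r : st -> R) (U : st -> 'rV[R]_d).
Hypotheses (sol : strong_solution T a gamma mu lambda r U)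
  (r_itv : forall z, closed_slab T z -> rlow <= r z <= rup)
  (norm_ns : solution_norm T r U = ns).
Local Notation u := (fun i => component U i).

Let Cr : C2 T r. Proof. by case: sol => -[]. Qed.
Let Cu i : C2 T (component U i). Proof. by case: sol => -[]. Qed.

Let leK (x : R) : x <= solution_norm T r U -> x <= K.
Proof. by rewrite norm_ns => h; exact: le_trans ns_le. Qed.

Let hr : smooth_bound T r K.
Proof.
split; first by case: Cr => cf _ _; exact: within_slab_continuous.
- move=> j z zT; split; first by case: Cr => _ /(_ j)[dr _] _; exact: dr.
  by apply: leK; exact: (norm_dr sol j zT).
- move=> i z zT; split; first by case: Cr => _ _ /(_ (Some i) None)[dr _]; exact: dr.
  by apply: leK; exact: (norm_ddr sol i zT).
Qed.

Let hu i : smooth_bound T (component U i) K.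
Proof.
split; first by case: (Cu i) => cf _ _; exact: within_slab_continuous.
- move=> j z zT; split; first by case: (Cu i) => _ /(_ j)[dr _] _; exact: dr.
  by apply: leK; exact: (norm_du sol i j zT).
- move=> l z zT; split; first by case: (Cu i) => _ _ /(_ (Some l) None)[dr _]; exact: dr.
  by apply: leK; exact: (norm_dtdu sol i l zT).
Qed.

Let hh i : hessian_bound T (component U i) K.
Proof.
move=> j l z zT; split; first by case: (Cu i) => _ _ /(_ (Some j) (Some l))[dr _]; exact: dr.
by apply: leK; exact: (norm_ddu sol i j l zT).
Qed.

Let u_le i z : closed_slab T z -> `|component U i z| <= K.
Proof.
case: z => t x tT; apply/ler_addgt0Pr => e e0.
have K0 : 0 < K by exact: lt_le_trans K_ge1.
have [s sT st'] := slab_approx T_gt0 tT (divr_gt0 e0 K0).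
have cs : 0 <= s <= T by case/andP: sT => /ltW -> /ltW ->.
have h1 := closed_time (hu i) x tT cs; rewrite [`|t - s|]distrC in h1.
have h2 : `|component U i (s, x)| <= K by apply: leK; exact: (norm_u sol i (z := (s, x)) sT).
have h3 := ler_wpM2l (ltW K0) st'; rewrite [K * (e / K)]mulrC divfK ?gt_eqF// in h3.
by norm_split h1; norm_split h2; norm_lra.
Qed.

Let per_r t : 0 <= t <= T -> torus_periodic (fun x => r (t, x)).
Proof. by case: sol => _ [pr _] _ _; exact: pr. Qed.

Let per_u i t : 0 <= t <= T -> torus_periodic (fun x => component U i (t, x)).
Proof. by case: sol => _ [_ pU] _ _ tT x l; rewrite /component (pU t tT). Qed.

Let consistent_data (N : nat) (tau t0 : R) : (0 < N)%N -> 0 < tau -> tau <= c2 * @mesh R N ->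
  0 <= t0 -> t0 + tau <= T -> exists psi G DD Z,
  consistent a gamma mu lambda rlow rup B tau (@rr R d r N t0) (rr r (t0 + tau)) (W u t0)
    (W u (t0 + tau)) psi G DD Z.
Proof.
move=> N0 tau0 tauh t00 t1T.
have tauK : tau <= K * @mesh R N.
  by apply: le_trans tauh _; apply: ler_wpM2r => //; rewrite ltW// mesh_gt0.
have t2 (f : st -> R) : C2 T f -> tame T f by case=> cf _ _; apply: extends_tame; exists f.
have t3 (f : st -> R) (j : @dir d) : C2 T f -> tame T (dpart j f).
  by case=> _ /(_ j)[_ /extends_tame].
have t4 (f : st -> R) (j k : @dir d) : C2 T f -> tame T (dpart k (dpart j f)).
  by case=> _ _ /(_ j k)[_ /extends_tame].
have rpos z : open_slab T z -> 0 < r z.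
  by move=> zT; have /andP[l1 _] := r_itv (open_closed zT); exact: lt_le_trans l1.
exact: (consistent_step T_gt0 gamma_gt1 rlow_gt0 mu_gt0 K_ge1 KF_ge1 HF hr hu hh u_le r_itv per_r
  per_u (t2 _ Cr) (fun i => t2 _ (Cu i)) (fun j => t3 _ j Cr) (fun j i => t3 _ j (Cu i))
  (fun l j i => t4 _ (Some j) (Some l) (Cu i)) (solution_continuity sol)
  (fun i z zT => solution_momentum sol i zT (rpos z zT)) N0 tau0 tauK t00 t1T cons_le).
Qed.

Section scheme.
Variables (C : R) (N Nt : nat) (rho : nat -> cell d N -> R) (v : nat -> 'I_d -> cell d N -> R)
  (ub0 : 'I_d -> cell d N -> R).
Hypotheses (C_gt0 : 0 < C)
  (HC : forall s : step d a gamma mu lambda alpha M B rlow rup,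
    relE s + entropy_total gamma (s_rho (s:=s)) - relE0 s - entropy_total gamma (s_rho0 (s:=s))
    + s_tau s * (mu / 2 * gradE s + (mu + lambda) * integral_pc (fun k => div_cell (@err _ _ _ _ _ _ _ _ _ _ _ s) k ^+ 2))
    <= s_tau s * (C * (relE s + @mesh R (s_N s) `^ A)))
  (N_gt0 : (0 < N)%N) (Nt_gt0 : (0 < Nt)%N).
Let tau : R := T / Nt%:R.
Let cv n : 'I_d -> cell d N -> R := if n is 0%N then ub0 else mean (v n).
Local Notation h := (@mesh R N).
Hypotheses (tau_le : tau <= c2 * h) (rho0_gt0 : forall k, 0 < rho 0%N k)
  (scheme : forall n, (n < Nt)%N -> continuity_eq alpha tau (rho n) (rho n.+1) (v n.+1) /\
     momentum_eq a gamma mu lambda alpha tau (rho n) (cv n) (rho n.+1) (v n.+1))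
  (massM : integral_pc (rho 0%N) = M) (energyE : energy a gamma (rho 0%N) ub0 <= En).

Let tau_gt0 : 0 < tau. Proof. by rewrite divr_gt0// ltr0n. Qed.
Let h_gt0 : 0 < h. Proof. exact: mesh_gt0. Qed.
Let h_le1 : h <= 1. Proof. exact: mesh_le1. Qed.

(** Positivity, mass and energy propagate together, since the energy estimate of each step needs
    positive densities at both levels. *)
Let state n : (n <= Nt)%N -> [/\ forall k, 0 < rho n k, integral_pc (rho n) = M
  & integral_pc (fun k => 2^-1 * rho n k * (\sum_i cv n i k ^+ 2) + H (rho n k)) <= En].
Proof.
elim: n => [_|n IH nN].
  split => //; apply: le_trans energyE; rewrite le_eqVlt; apply/orP; left; apply/eqP.
  by apply: Ipc_eq => k; rewrite Helmholtz_hpot.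
have [r0 rM rE] := IH (ltnW nN); have [ce me] := scheme nN.
have r1 := density_gt0 N_gt0 tau_gt0 ce r0.
split => //; first by rewrite (mass_step tau_gt0 ce).
exact: le_trans (energy_step a_gt0 gamma_gt1 mu_gt0 mulambda_ge0 N_gt0 tau_gt0 r0 r1 ce me) rE.
Qed.

Let time n : (n <= Nt)%N -> 0 <= n%:R * tau <= T.
Proof.
move=> nN; rewrite mulr_ge0 ?(ltW tau_gt0)//= /tau mulrCA ger_pMr//.
by rewrite ler_pdivrMr ?ltr0n// mul1r ler_nat.
Qed.

Let rh n : cell d N -> R := rr r (n%:R * tau).
Let Uh n : 'I_d -> cell d N -> R := W u (n%:R * tau).
Let RE n : R := rel_energy a gamma (rho n) (cv n) (rh n) (mean (Uh n)).
Let er n i k : R := v n i k - Uh n i k.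
Let Dn n : R := tau * (mu / 2 * grad_norm2 (er n)
  + (mu + lambda) * integral_pc (fun k => div_cell (er n) k ^+ 2)).
Let init : R := rel_energy_init a gamma (rho 0%N) ub0 (fun x => r (0, x)) (fun x => U (0, x)).

Let rh_itv n : (n <= Nt)%N -> forall k, rlow <= rh n k <= rup.
Proof. by move=> /time tT k; exact: (rr_itv rlow_gt0 hr r_itv N_gt0 k tT). Qed.

Let Uh_le n i k : (n <= Nt)%N -> `|mean (Uh n) i k| <= K.
Proof.
move=> /time tT; have h1 := W_le hu u_le N_gt0 i k tT; have h2 := W_le hu u_le N_gt0 i (dn i k) tT.
rewrite /mean /avg_cell /Uh; move: h1 h2; move: (W _ _ _ _) (W _ _ _ _) => x y h1 h2.
by norm_split h1; norm_split h2; norm_lra.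
Qed.

Let kin n : (n < Nt)%N -> integral_pc (fun k => rho n.+1 k * \sum_i mean (v n.+1) i k ^+ 2) <= B /\
  integral_pc (fun k => rho n.+1 k `^ gamma) <= B.
Proof.
move=> nN; have [r0 rM rE] := state nN; have [k1 k2] := energy_bounds N_gt0 r0 rM rE.
by split; [exact: le_trans k1 Bk_le|exact: le_trans k2 Bi_le].
Qed.

Let RE_bregman n : (n <= Nt)%N -> RE n = integral_pc (fun k =>
  2^-1 * rho n k * (\sum_i (cv n i k - mean (Uh n) i k) ^+ 2) + bregman H H' (rho n k) (rh n k)).
Proof.
move=> nN; have [r0 _ _] := state nN; apply: Ipc_eq => k; rewrite rel_energy_density_bregman//.
by have /andP[l1 _] := rh_itv nN k; exact: lt_le_trans l1.
Qed.

Let step_ineq n : (n < Nt)%N -> RE n.+1 + entropy_total gamma (rho n.+1) + Dn n.+1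
  <= RE n + entropy_total gamma (rho n) + tau * (C * (RE n.+1 + h `^ A)).
Proof.
move=> nN; have [r0 rM0 _] := state (ltnW nN); have [r1 rM1 _] := state nN.
have [ce me] := scheme nN; have [k1 k2] := kin nN.
have /andP[t00 _] := time (ltnW nN); have /andP[_ t1T] := time nN.
have Et : n.+1%:R * tau = n%:R * tau + tau by rewrite -addn1 natrD mulrDl mul1r.
rewrite Et in t1T.
have [psi [G [DD [Z Hc]]]] := consistent_data N_gt0 tau_gt0 tau_le t00 t1T.
rewrite -Et in Hc.
have tauB : tau <= B * h.
  apply: le_trans tau_le _; apply: ler_wpM2r; first exact: ltW.
  exact: le_trans c2_le K_le.
pose s : step d a gamma mu lambda alpha M B rlow rup := @Step R d a gamma mu lambda alpha M B rlow rup
  N tau (rho n) (rho n.+1) (cv n) (v n.+1) _ _ _ _ psi G DD Z N_gt0 tau_gt0 tauB r0 r1 rM1 k1 k2 ce me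
  (c_r0 Hc) (c_r1 Hc) (c_W0 Hc) (c_W1 Hc) (c_WB Hc) (c_dW0 Hc) (c_dW1 Hc) (c_dWB Hc) (c_ddW0 Hc)
  (c_ddW1 Hc) (c_phiB Hc) (c_dphi Hc) (c_pB Hc) (c_Z Hc) (c_velocity Hc) (c_stress Hc) (c_psi Hc)
  (c_G Hc) (c_D Hc) (c_transport Hc) (c_pressure Hc).
have e1 : relE s = RE n.+1 by rewrite RE_bregman.
have e0 : relE0 s = RE n by rewrite RE_bregman// ltnW.
have Q : relE s + entropy_total gamma (rho n.+1) - relE0 s - entropy_total gamma (rho n) + Dn n.+1
    <= tau * (C * (relE s + h `^ A)) := HC s.
move: Q; move: (relE s) e1 (relE0 s) e0 => x -> y ->.
exact: step_rearrange.
Qed.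

Let RE_ge0 n : (n <= Nt)%N -> 0 <= RE n.
Proof.
move=> nN; have [r0 _ _] := state nN; rewrite RE_bregman//; apply: Ipc_ge0 => // k.
have rh0 : 0 < rh n k by have /andP[l1 _] := rh_itv nN k; exact: lt_le_trans l1.
apply: addr_ge0; last exact: bregman_hpot_ge0.
apply: mulr_ge0; first by rewrite mulr_ge0// ltW.
by apply: sumr_ge0 => i _; exact: sqr_ge0.
Qed.

Let Dn_ge0 n : 0 <= Dn n.
Proof.
rewrite /Dn; apply: mulr_ge0; first exact: ltW.
apply: addr_ge0; apply: mulr_ge0 => //; first by rewrite divr_ge0// ltW.
  apply: sumr_ge0 => i _; apply: sumr_ge0 => j _.
  by apply: Ipc_ge0 => // k; exact: sqr_ge0.
by apply: Ipc_ge0 => // k; exact: sqr_ge0.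
Qed.

Let rate_ge0 : 0 <= h `^ A. Proof. exact: powR_ge0. Qed.
Let mesh_rate : h <= h `^ A.
Proof.
rewrite -{1}(powRr1 (ltW h_gt0)); apply: ger_powR; rewrite ?h_gt0 ?h_le1//.
by rewrite ge_min; apply/orP; right; lra.
Qed.

Let zero_T : 0 <= (0 : R) <= T. Proof. by rewrite lexx ltW. Qed.

Let bc_r0 : bounded_continuous (fun x => r (0, x)).
Proof.
have [cr _ _] := hr; split; first exact: slab_continuous_x cr zero_T.
exists rup => x; have /andP[l1 l2] := @r_itv (0, x) zero_T.
by rewrite ger0_norm//; exact: le_trans (ltW rlow_gt0) l1.
Qed.

Let bc_U0 i : bounded_continuous (fun x => U (0, x) 0 i).
Proof.
have [cr _ _] := hu i; split; first exact: (slab_continuous_x cr zero_T).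
by exists K => x; exact: (@u_le i (0, x) zero_T).
Qed.

Let init_ge0 : 0 <= init.
Proof.
exact: (rel_energy_init_ge0 a_gt0 gamma_gt1 rlow_gt0 N_gt0 HF KF_ge0 ub0 rho0_gt0 bc_r0 bc_U0
  (fun x => @r_itv (0, x) zero_T)).
Qed.

Let RE0_le : RE 0%N <= 2 * init + Ci * h.
Proof.
have d0 : 0 <= d%:R :> R by [].
have E10 : 0 <= E1 by rewrite /E1 mulr_ge0//; lra.
have tT1 : 0 + tau <= T by have /andP[_] := time Nt_gt0; rewrite mul1r add0r.
have cellD (k : cell d N) x : in_cell k x -> dist1 x (corner k) <= d%:R * h.
  move=> kx.
  have Q i : `|x 0 i - corner k 0 i| <= h.
    have := kx i; rewrite [corner k 0 i]mxE => /andP[x1 x2].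
    rewrite ger0_norm ?subr_ge0//.
    by rewrite lerBlDr; apply: le_trans x2 _; rewrite -addn1 natrD mulrDl mul1r addrC.
  exact: dist1_le Q.
have n1 (k : cell d N) x : in_cell k x -> `|r (0, x) - rh 0%N k| <= E1 * h.
  move=> kx; have h1 := closed_space T_gt0 K_ge0 hr x (corner k) zero_T.
  have h2 := @r_near R d T rlow rup K r T_gt0 rlow_gt0 K_ge1 hr r_itv N N_gt0 0 k zero_T.
  have h3 := ler_wpM2l K_ge0 (cellD k x kx).
  have hK := mulr_ge0 K_ge0 (ltW h_gt0).
  rewrite /rh mul0r /E1; move: h1 h2 h3; move: (r (0, x)) (rr r 0 k) (r (0, corner k)) => x1 x2 x3.
  by move=> h1 h2 h3; norm_split h1; norm_split h2; norm_lra.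
have n2 i (k : cell d N) x : in_cell k x -> `|U (0, x) 0 i - mean (Uh 0%N) i k| <= E1 * h.
  move=> kx; have h1 := closed_space T_gt0 K_ge0 (hu i) x (corner k) zero_T.
  have h2 := mean_W_near T_gt0 K_ge1 hu u_le per_u N_gt0 tau_gt0 (lexx 0) tT1 i k.
  have h3 := ler_wpM2l K_ge0 (cellD k x kx).
  rewrite /Uh mul0r /E1; move: h1 h2 h3; rewrite /component.
  move: (U (0, x) 0 i) (mean _ _ _) (U (0, corner k) 0 i) => x1 x2 x3.
  by move=> h1 h2 h3; norm_split h1; norm_split h2; norm_lra.
have := rel_energy_init_compare a_gt0 gamma_gt1 rlow_gt0 N_gt0 HF (mulr_ge0 E10 (ltW h_gt0)) KF_ge0
  ub0 rho0_gt0 bc_r0 bc_U0 (fun x => @r_itv (0, x) zero_T) (rh_itv (leq0n Nt)) n1 n2 (E1 := E1).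
move=> /(_ _); rewrite massM => Q; apply: le_trans (Q _) _; first by rewrite ler_piMr.
by rewrite /Ci -[X in _ <= _ + X]mulrA; exact: lexx.
Qed.

Let Phi n : R := RE n + entropy_total gamma (rho n).

Let Phi0_le : Phi 0%N <= 2 * init + (Ci + Cs) * h `^ A.
Proof.
have [r0 rM rE] := state (leq0n Nt); have [_ k2] := energy_bounds N_gt0 r0 rM rE.
have s0 := entropy_total_le N_gt0 r0 (le_trans k2 Bi_le).
have Ci0 : 0 <= Ci.
  have d0 : 0 <= d%:R :> R by [].
  have E10 : 0 <= E1 by rewrite /E1 mulr_ge0//; lra.
  by rewrite /Ci; apply: mulr_ge0 => //; apply: mulr_ge0; rewrite ?addr_ge0 ?mulr_ge0// ltW.
have := RE0_le; have := ler_wpM2l Ci0 mesh_rate; rewrite /Phi; lra.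
Qed.

Let Kb_ge0 : 0 <= Kb.
Proof.
have B0 : 0 <= B by exact: le_trans B_ge1.
have Hm0 : 0 <= Hm by rewrite /Hm addr_ge0// mulr_ge0.
have m1 : 0 <= d%:R * K ^+ 2 * M by rewrite mulr_ge0 ?mulr_ge0 ?sqr_ge0// ltW.
have m2 := mulr_ge0 (ltW am_gt0) B0; have m3 := mulr_ge0 Hm0 (ltW M_gt0); have m4 := KF_ge0.
by rewrite /Kb; lra.
Qed.

Let q_ge0 : 0 <= 2 * C * c2.
Proof. exact: mulr_ge0 (mulr_ge0 (ler0n R 2) (ltW C_gt0)) (ltW c2_gt0). Qed.
Let X_ge0 : 0 <= T * C * (Kb * (2 * C * c2) + 1).
Proof.
exact: mulr_ge0 (mulr_ge0 (ltW T_gt0) (ltW C_gt0)) (addr_ge0 (mulr_ge0 Kb_ge0 q_ge0) ler01).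
Qed.

(** The factor 2 pays separately for the supremum and for the dissipation. The exponential covers
    small time steps, the last summand large ones. *)
Definition bound_constant : R := 2 * (expR (2 * C * T) * (3 + Ci + Cs) + 2 + Ci + Cs
  + T * C * (Kb * (2 * C * c2) + 1)).

Let partial n : (n <= Nt)%N -> Phi n + \sum_(1 <= k < n.+1) Dn k
  <= bound_constant / 2 * (h `^ A + init).
Proof.
move=> nN; have B0 : 0 <= B by exact: le_trans B_ge1.
have Cs0 : 0 <= Cs by rewrite /Cs; lra.
have E10 : 0 <= E1 by rewrite /E1 mulr_ge0// addr_ge0// mulr_ge0.
have Ci0 : 0 <= Ci.
  by rewrite /Ci; apply: mulr_ge0 => //; apply: mulr_ge0; rewrite ?addr_ge0 ?mulr_ge0// ltW.
have P0 := Phi0_le; have i0 := init_ge0; have d0 := rate_ge0.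
have e0 : 0 <= expR (2 * C * T) by exact: expR_ge0.
have X0 := X_ge0.
have Phi_ge0 m : (m <= Nt)%N -> 0 <= Phi m.
  move=> mN; have [r0 _ _] := state mN.
  by rewrite /Phi addr_ge0 ?RE_ge0 ?entropy_total_ge0.
have NT : Nt%:R * tau = T by rewrite /tau mulrC divfK// pnatr_eq0 -lt0n.
have BE : bound_constant / 2 = expR (2 * C * T) * (3 + Ci + Cs) + 2 + Ci + Cs
    + T * C * (Kb * (2 * C * c2) + 1).
  by rewrite [LHS]mulrC /bound_constant mulKf ?pnatr_eq0.
rewrite BE.
have [Ct|Ct] := leP (C * tau) 2^-1.
  (* Nonnegativity is available up to level [Nt]; beyond it the sequence is continued by zero. *)
  pose Ph m := if (m <= Nt)%N then Phi m else 0.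
  have Ph0 m : 0 <= Ph m by rewrite /Ph; case: ifP => // /Phi_ge0.
  have st m : (m < Nt)%N -> Ph m.+1 + Dn m.+1 <= Ph m + tau * (C * (Ph m.+1 + h `^ A)).
    move=> mN; rewrite /Ph mN (ltnW mN); have q := step_ineq mN.
    have [r0 _ _] := state mN; have s0 := entropy_total_ge0 gamma N_gt0 r0.
    have : tau * (C * (RE m.+1 + h `^ A)) <= tau * (C * (Phi m.+1 + h `^ A)).
      apply: ler_wpM2l; first exact: ltW.
      apply: ler_wpM2l; first exact: ltW.
      by rewrite lerD2r /Phi lerDl.
    by move=> q2; apply: le_trans q _; rewrite /Phi lerD2l; exact: q2.
  have := discrete_gronwall (ltW C_gt0) d0 tau_gt0 Ct (_ : Nt%:R * tau <= T) Ph0 st Dn_ge0 nN.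
  rewrite NT lexx /Ph nN leq0n => /(_ isT) Q; apply: le_trans Q _.
  apply: (@le_trans _ _ (expR (2 * C * T) * ((3 + Ci + Cs) * (h `^ A + init)))).
    apply: ler_wpM2l => //; move: P0 i0 d0 Ci0 Cs0 (mulr_ge0 Ci0 i0) (mulr_ge0 Cs0 i0).
    by move: (Phi 0%N) (Ci) (Cs) (init) (h `^ A) => x1 x2 x3 x4 x5 *; lra.
  rewrite mulrA; apply: ler_wpM2r; first exact: addr_ge0.
  by move: X0 Ci0 Cs0; move: (Ci) (Cs) (T * C * _) (expR _ * _) => x1 x2 x3 x4 *; lra.
(* From [C tau > 1/2] and [tau <= c2 h]. The a priori bound [Kb] then costs at most
   [Kb (2 C c2) h^A], and the step inequalities are summed directly. *)
have h1 : 1 <= 2 * C * c2 * h.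
  have := ler_wpM2l (ltW C_gt0) tau_le; lra.
have h2 : 1 <= 2 * C * c2 * h `^ A.
  by apply: le_trans h1 _; apply: (ler_wpM2l q_ge0); exact: mesh_rate.
have key m : (m <= Nt)%N -> Phi m + \sum_(1 <= k < m.+1) Dn k
    <= Phi 0%N + m%:R * tau * (C * (Kb + h `^ A)).
  elim: m => [_|m IH mN]; first by rewrite big_nil addr0 !mul0r addr0.
  have q1 := IH (ltnW mN); have q2 := step_ineq mN; rewrite [\sum_(1 <= k < m.+2) _]big_nat_recr//=.
  have [r0 rM _] := state mN; have [k1 k2] := kin mN.
  have rb : RE m.+1 <= Kb.
    apply: (relative_energy_bound N_gt0 r0 rM k1 k2 (rh_itv mN)) => i k; exact: Uh_le.
  have q3 : tau * (C * (RE m.+1 + h `^ A)) <= tau * (C * (Kb + h `^ A)).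
    apply: ler_wpM2l; first exact: ltW.
    apply: ler_wpM2l; first exact: ltW.
    by rewrite lerD2r.
  have -> : m.+1%:R * tau = m%:R * tau + tau by rewrite -addn1 natrD mulrDl mul1r.
  rewrite [X in _ <= _ + X]mulrDl; exact: step_extend q2 q3 q1.
apply: le_trans (key n nN) _.
have nT : n%:R * tau * (C * (Kb + h `^ A)) <= T * C * ((Kb * (2 * C * c2) + 1) * h `^ A).
  have /andP[t1 t2] := time nN; rewrite -[T * C * _]mulrA.
  apply: (ler_pM t1 _ t2); first exact: mulr_ge0 (ltW C_gt0) (addr_ge0 Kb_ge0 d0).
  by apply: ler_wpM2l; [exact: ltW|exact: absorb_rate Kb_ge0 h2].
have m1 := mulr_ge0 Ci0 i0; have m2 := mulr_ge0 Cs0 i0.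
have m3 : 0 <= expR (2 * C * T) * (3 + Ci + Cs) * (h `^ A + init).
  by apply: mulr_ge0; [apply: mulr_ge0 => //|exact: addr_ge0]; lra.
have m4 := mulr_ge0 X0 i0.
rewrite [X in _ <= X]mulrA in nT.
exact: total_bound P0 i0 d0 m1 m2 m3 m4 nT.
Qed.

Lemma scheme_estimate :
  \big[Num.max/RE 0%N]_(n < Nt.+1) RE n
  + tau * (\sum_(1 <= n < Nt.+1) mu / 2 * grad_norm2 (er n))
  + tau * (\sum_(1 <= n < Nt.+1) (mu + lambda) * integral_pc (fun k => div_cell (er n) k ^+ 2))
  <= bound_constant * (h `^ A + init).
Proof.
have -> : bound_constant * (h `^ A + init) = bound_constant / 2 * (h `^ A + init)
    + bound_constant / 2 * (h `^ A + init) by field.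
rewrite -addrA; apply: lerD.
  have RB n : (n <= Nt)%N -> RE n <= bound_constant / 2 * (h `^ A + init).
    move=> nN; apply: le_trans (partial nN); have [r0 _ _] := state nN.
    have s0 := entropy_total_ge0 gamma N_gt0 r0.
    have : 0 <= \sum_(1 <= k < n.+1) Dn k by apply: sumr_ge0 => k _; exact: Dn_ge0.
    rewrite /Phi; lra.
  elim/big_ind: _ => [|x y hx hy|n _]; first exact: RB.
    by rewrite ge_max hx.
  by apply: RB; rewrite -ltnS.
apply: le_trans (partial (leqnn Nt)).
have -> : \sum_(1 <= k < Nt.+1) Dn k = tau * (\sum_(1 <= n < Nt.+1) mu / 2 * grad_norm2 (er n))
  + tau * (\sum_(1 <= n < Nt.+1) (mu + lambda) * integral_pc (fun k => div_cell (er n) k ^+ 2)).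
  by rewrite -mulrDr -big_split mulr_sumr.
have [r0 _ _] := state (leqnn Nt).
by rewrite lerDr /Phi addr_ge0 ?RE_ge0 ?entropy_total_ge0.
Qed.

Lemma bound_constant_gt0 : 0 < bound_constant.
Proof.
have B0 : 0 <= B by exact: le_trans B_ge1.
have E10 : 0 <= E1 by rewrite /E1 mulr_ge0// addr_ge0// mulr_ge0.
have Ci0 : 0 <= Ci.
  by rewrite /Ci; apply: mulr_ge0 => //; apply: mulr_ge0; rewrite ?addr_ge0 ?mulr_ge0// ltW.
have Cs0 : 0 <= Cs by rewrite /Cs; lra.
have X0 := X_ge0.
have e0 : 0 <= expR (2 * C * T) * (3 + Ci + Cs) by apply: mulr_ge0; [exact: expR_ge0|lra].
rewrite /bound_constant; lra.
Qed.

Lemma scheme_init_ge0 : 0 <= init. Proof. exact: init_ge0. Qed.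

End scheme.

End data.

Lemma uniform_bound_exists : exists2 c : R, 0 < c &
  @uniform_bound R d T a gamma mu lambda alpha c2 M En rlow rup ns c.
Proof.
have [C C0 HC] := one_step rup a_gt0 gamma_gt1 gammad mu_gt0 mulambda_ge0 alpha_gt1 M_gt0 B_ge1
  rlow_gt0.
exists (bound_constant C); first exact: bound_constant_gt0.
move=> r U sol ritv nn N Nt rho u0 u N0 Nt0 tau A' ubar rh Uh RE err init tl r0 sc mM eE; split.
  by eapply scheme_init_ge0; try eassumption.
exact: (@scheme_estimate r U sol ritv nn C N Nt rho u (ubar 0%N) C0 HC N0 Nt0 tl r0 sc mM eE).
Qed.

End uniform_estimate.

(** * The constant as a function of mass, energy and norms *)

Section monotone_sums.
Variables (R : realType) (F : nat -> R).
Hypothesis F_ge0 : forall k, 0 <= F k.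

Lemma le_sum_ord n m : (n <= m)%N -> \sum_(k < n) F k <= \sum_(k < m) F k.
Proof.
move=> nm; rewrite -(subnKC nm); elim: (m - n)%N => [|j IH]; first by rewrite addn0.
by rewrite addnS big_ord_recr/=; apply: le_trans IH _; rewrite lerDl.
Qed.

Lemma le_term_sum_ord n k : (k < n)%N -> F k <= \sum_(k < n) F k.
Proof. by move=> kn; rewrite (bigD1 (Ordinal kn))//= lerDl; apply: sumr_ge0 => j _. Qed.

End monotone_sums.

Lemma mass_gt0 (R : realType) (d N : nat) (rho : cell d N -> R) : (0 < N)%N ->
  (forall k, 0 < rho k) -> 0 < mass rho.
Proof.
move=> N0 r0; rewrite /mass /integral_pc; apply: mulr_gt0; first exact: exprn_gt0 (mesh_gt0 N0).
rewrite (bigD1 ([ffun=> Ordinal N0] : cell d N))//=; apply: ltr_pwDl => //.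
by apply: sumr_ge0 => k _; exact: ltW.
Qed.

Theorem theorem2p11 (R : realType) (d : nat) (T a gamma mu lambda alpha c1 c2 : R)
    (hd : d = 2%N \/ d = 3%N) (hT : 0 < T) (ha : 0 < a)
    (hgamma : 1 < gamma) (hgammad : d%:R / 2 <= gamma)
    (hmu : 0 < mu) (hmulambda : 0 <= mu + lambda)
    (halpha : 1 < alpha) (halpha2 : gamma < 2 -> alpha < 2 * gamma - d%:R / 3)
    (hc1 : 0 < c1) (hc2 : 0 < c2) :
  exists C : R -> R -> R -> R -> R -> R -> R,
    (forall M E rlow rup np ns, 0 < C M E rlow rup np ns) /\
    (forall M E E' rlow rup np ns,
       E <= E' -> C M E rlow rup np ns <= C M E' rlow rup np ns) /\
    forall (rho0 : 'rV[R]_d -> R) (u0 : 'rV[R]_d -> 'rV[R]_d)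
      (r : R * 'rV[R]_d -> R) (U : R * 'rV[R]_d -> 'rV[R]_d) (rlow rup : R),
      torus_periodic rho0 -> torus_periodic u0 ->
      {ae leb d, forall t, Omega t -> 0 < rho0 (pt_of t)} ->
      inLp gamma rho0 -> inLp 2 rho0 ->
      (forall i, inW12 (fun x => u0 x 0 i)) ->
      strong_solution T a gamma mu lambda r U ->
      0 < rlow ->
      (forall z, closed_slab T z -> rlow <= r z <= rup) ->
    forall (N Nt : nat) (rho : nat -> cell d N -> R)
      (u : nat -> 'I_d -> cell d N -> R),
      (0 < N)%N -> (0 < Nt)%N ->
      let h := N%:R^-1 : R in
      let tau := T / Nt%:R in
      c1 * h <= tau <= c2 * h ->
      MAC_solution a gamma mu lambda alpha T Nt rho0 u0 rho u ->
      let rh n := proj_cell (fun x => r (n%:R * tau, x)) in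
      let Uh n := proj_face (fun x => U (n%:R * tau, x)) in
      let ubar := cell_velocity u0 u in
      let RE n := rel_energy a gamma (rho n) (ubar n) (rh n) (mean (Uh n)) in
      let err n := fun i k => u n i k - Uh n i k in
      let c := C (mass (rho 0%N)) (energy a gamma (rho 0%N) (ubar 0%N)) rlow rup
                 (C1_norm (derive1 (pressure a gamma)) rlow rup)
                 (solution_norm T r U) in
      let A := Num.min ((2 * gamma - d%:R) / gamma) 2^-1 in
      \big[Num.max/RE 0%N]_(n < Nt.+1) RE n
      + tau * (\sum_(1 <= n < Nt.+1) mu / 2 * grad_norm2 (err n))
      + tau * (\sum_(1 <= n < Nt.+1)
                 (mu + lambda) * integral_pc (fun k => div_cell (err n) k ^+ 2))
      <= c * (h `^ A + Num.sqrt tau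
              + rel_energy_init a gamma (rho 0%N) (ubar 0%N)
                  (fun x => r (0, x)) (fun x => U (0, x))).
Proof.
(* Positivity of [M] and [rlow] is a premise inside [P], so that the choice function is defined and
   positive for all real arguments. *)
pose P (p : R * R * R * R * R) c := 0 < c /\ (0 < p.1.1.1.1 -> 0 < p.1.1.2 ->
  @uniform_bound R d T a gamma mu lambda alpha c2 p.1.1.1.1 p.1.1.1.2 p.1.1.2 p.1.2 p.2 c).
have /boolp.choice[f Hf] : forall p, exists c, P p c.
  move=> [[[[M En] rlow] rup] ns].
  have [M0|M0] := ltP 0 M; last first.
    by exists 1; split => //=; rewrite ltNge M0.
  have [l0|l0] := ltP 0 rlow; last first.
    by exists 1; split => //= _; rewrite ltNge l0.
  have [KF KF1 HF] := density_boundP rup l0 a hgamma.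
  have [c c0 Hc] := uniform_bound_exists En ns hT ha hgamma hgammad hmu hmulambda halpha hc2 M0 l0
    KF1 HF.
  by exists c; split.
pose F M rlow rup ns (k : nat) := f (M, k%:R, rlow, rup, ns).
have F0 M rlow rup ns k : 0 <= F M rlow rup ns k by apply: ltW; have [] := Hf (M, k%:R, rlow, rup, ns).
(* The energy may be negative because the potential is; truncation is applied to its positive
   part. *)
pose t (E : R) := Num.truncn (Num.max E 0).
have tP E : (t E)%:R <= Num.max E 0 < (t E).+1%:R by apply: truncn_itv; rewrite le_max lexx orbT.
(* The levels run from 0 to [t E + 1]. The last one is at least [E], so its constant applies to the
   given data and is one of the summands. *)
pose C M E rlow rup (np ns : R) := \sum_(k < (t E).+2) F M rlow rup ns k.
have C0 M E rlow rup np ns : 0 < C M E rlow rup np ns.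
  rewrite /C big_ord_recl; apply: ltr_pwDl; last by apply: sumr_ge0 => k _; exact: F0.
  by have [] := Hf (M, 0, rlow, rup, ns).
exists C; split => //; split.
  move=> M E E' rlow rup np ns EE; apply: le_sum_ord => [k|]; first exact: F0.
  have /andP[t1 _] := tP E; have /andP[_ t2] := tP E'.
  rewrite !ltnS -ltnS -(ltr_nat R); apply: le_lt_trans t2; apply: le_trans t1 _.
  by rewrite ge_max !le_max EE lexx orbT.
move=> rho0 u0 r U rlow rup _ _ rho0_pos _ rho0_L2 _ sol rlow0 ritv N Nt rho u N0 Nt0 h tau
  /andP[_ tauh] [rhoE scheme]; cbv zeta.
pose ubar := cell_velocity u0 u; pose A := Num.min ((2 * gamma - d%:R) / gamma) 2^-1.
have r0 k : 0 < rho 0%N k by rewrite rhoE; apply: proj_cell_gt0.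
have M0 : 0 < mass (rho 0%N) by exact: mass_gt0.
pose M := mass (rho 0%N); pose E := energy a gamma (rho 0%N) (ubar 0%N).
pose k := (t E).+1.
pose c := C M E rlow rup (C1_norm (derive1 (pressure a gamma)) rlow rup) (solution_norm T r U).
have Ek : E <= k%:R.
  have /andP[_ /ltW] := tP E; apply: le_trans; by rewrite le_max lexx.
have [_ /(_ M0 rlow0)] := Hf (M, k%:R, rlow, rup, solution_norm T r U).
move=> /(_ r U sol ritv erefl N Nt rho u0 u N0 Nt0 tauh r0 scheme erefl Ek).
pose init := rel_energy_init a gamma (rho 0%N) (ubar 0%N) (fun x => r (0, x)) (fun x => U (0, x)).
move=> [i0 est].
have h0 : 0 <= h `^ A by exact: powR_ge0.
have Fc : F M rlow rup (solution_norm T r U) k <= c.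
  by apply: (@le_term_sum_ord R (F M rlow rup (solution_norm T r U))); [exact: F0|].
apply: (le_trans est); apply: (@le_trans _ _ (c * (h `^ A + init))).
  by apply: ler_wpM2r Fc; exact: addr_ge0.
apply: (@ler_wpM2l _ c); first by apply: ltW; exact: C0.
by rewrite lerD2r lerDl sqrtr_ge0.
Qed.
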